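(* Let $p$ be a prime number and let $d$ be a non-negative integer. There is a number $N(p,d)$, depending only on $p$ and $d$, such that, as $G$ ranges over all $d$-generated finite $p$-groups of nilpotency class smaller than $p$, the mod $p$ cohomology algebras $H^*(G;\mathbb{F}_p)$ fall into at most $N(p,d)$ isomorphism classes of graded $\mathbb{F}_p$-algebras.
   Context: A group is $d$-generated if it can be generated by $d$ elements. $H^*(G;\mathbb{F}_p)$ denotes the mod $p$ group cohomology algebra of $G$ with its cup product. *)

(* Defs.v *)
From HB Require Import structures.
From mathcomp Require Import all_boot all_order all_algebra all_fingroup all_solvable.
Set Implicit Arguments. Unset Strict Implicit. Unset Printing Implicit Defensive.
Import GRing.Theory.
Local Open Scope ring_scope.

Section Cochains.
Variables (p : nat) (gT : finGroupType).

Definition cochain (n : nat) := {ffun {ffun 'I_n -> gT} -> ('F_p)^o}.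

Definition tget n (x : {ffun 'I_n.+1 -> gT}) (k : nat) : gT :=
  if (k < n.+1)%N then x (inord k) else 1%g.

Definition face_first n (x : {ffun 'I_n.+1 -> gT}) : {ffun 'I_n -> gT} :=
  [ffun j : 'I_n => tget x j.+1].
Definition face_last n (x : {ffun 'I_n.+1 -> gT}) : {ffun 'I_n -> gT} :=
  [ffun j : 'I_n => tget x j].
Definition face_merge n (i : nat) (x : {ffun 'I_n.+1 -> gT}) : {ffun 'I_n -> gT} :=
  [ffun j : 'I_n => if (j < i)%N then tget x j
                    else if j == i :> nat then (tget x i * tget x i.+1)%g
                    else tget x j.+1].

Definition cobound n (f : cochain n) : cochain n.+1 :=
  [ffun x => f (face_first x)
             + \sum_(i < n) (-1) ^+ i.+1 * f (face_merge i x)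
             + (-1) ^+ n.+1 * f (face_last x)].

Definition is_cocycle n (f : cochain n) : Prop := cobound f = 0.

Definition is_coboundary (n : nat) : cochain n -> Prop :=
  match n return cochain n -> Prop with
  | 0 => fun f => f = 0
  | k.+1 => fun f => exists g : cochain k, f = cobound g
  end.

Definition cup m n (f : cochain m) (g : cochain n) : cochain (m + n) :=
  [ffun x : {ffun 'I_(m + n) -> gT} =>
     f [ffun i : 'I_m => x (lshift n i)] * g [ffun j : 'I_n => x (rshift m j)]].

End Cochains.

(* H^*(G;F_p) ~= H^*(K;F_p) as graded F_p-algebras: a family of F_p-linear
   maps on cochains inducing, in each degree, a well-defined bijection
   H^n(G) -> H^n(K) (cocycles to cocycles, coboundaries to coboundaries,
   injective and surjective modulo coboundaries), compatible with cup products.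
   (Every graded algebra isomorphism of the quotients lifts to such a family.) *)
Definition cohom_iso (p : nat) (gT hT : finGroupType) : Prop :=
  exists phi : forall n, {linear cochain p gT n -> cochain p hT n},
    (forall n (f : cochain p gT n), is_cocycle f -> is_cocycle (phi n f)) /\
    (forall n (f : cochain p gT n), is_coboundary f -> is_coboundary (phi n f)) /\
    (forall n (f : cochain p gT n), is_cocycle f ->
        is_coboundary (phi n f) -> is_coboundary f) /\
    (forall n (h : cochain p hT n), is_cocycle h ->
        exists2 f : cochain p gT n, is_cocycle f & is_coboundary (h - phi n f)) /\
    (forall m n (f : cochain p gT m) (g : cochain p gT n),
        is_cocycle f -> is_cocycle g ->
        is_coboundary (phi (m + n)%N (cup f g) - cup (phi m f) (phi n g))).

Definition d_generated (d : nat) (gT : finGroupType) : Prop :=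
  exists X : {set gT}, (#|X| <= d)%N /\ <<X>>%g = [set: gT].

(* Main.v *)
Require Import Defs.
From HB Require Import structures.
From mathcomp Require Import all_boot all_order all_algebra all_fingroup all_solvable.
From mathcomp Require Import boolp functions ring zify.
Set Implicit Arguments. Unset Strict Implicit. Unset Printing Implicit Defensive.
Import GRing.Theory.
Local Open Scope ring_scope.

(* By induction on r, the finite groups with a central series of at most r
   cyclic p-power factors realize finitely many mod p cohomology rings, and each
   of these rings is Noetherian; a d-generated p-group of class c has such a
   series with r <= d + d^2 + ... + d^c, from left-normed commutators.

   Let C be central and cyclic in G, with quotient Q.  The carry cochain in
   C^2(G) restricts to the polynomial generator y of H^*(C) and its coboundary is
   inflated from a class t_0 of Q; Steenrod powers give cochains restricting to
   y^(p^a) with inflated coboundaries t_a.  Since H^*(Q) is Noetherian, t_a is a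
   combination of t_0, ..., t_(a-1) for some a, and Koenig's lemma bounds a
   uniformly over the finitely many possible sequences t.  Correcting the a-th
   cochain gives a cocycle z of G that restricts to y^N, N = p^a.

   Filtering C^*(G) by the degree along C, multiplication by z shifts the
   filtration by 2N, and the five lemma makes H^*(G) free over k[z] on the
   cohomology M of the part of filtration < 2N.  M is an iterated extension of 2N
   shifted copies of H^*(Q), each extension being determined by one class (the
   differential) and by the values on generators of a finitely generated ideal.
   So M is Noetherian and takes finitely many values up to isomorphism, and
   then the ring H^*(G) is determined by the products of the generators of M. *)

(** * Finite classification of graded modules *)

(** The orders of the groups are unbounded, so an inductive step cannot retain Q: an extension is
    remembered through C, G, Q and an identification of H^*(Q) with a fixed graded ring R, and each
    further invariant is coded by an element of a finite homogeneous part of one reference object.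
    Two strictness requirements dictate the models. Transgressions must be cochains of G whose
    coboundary is literally inflated from Q; this is why the Steenrod operations come from an
    explicit natural system of higher diagonals, obtained by coning at the first vertex. The
    filtered complex must carry commuting actions of cocycles of Q and of z; cochains on the join of
    Q and G have both, one in each variable. A power of y rarely lifts to G at once. Passing to p-th
    powers helps because, by Kudo's argument, the coboundary of the power depends on the
    transgression alone. M is not a subring: products of its generators leave it. The even degree of
    z makes z commute with everything up to coboundaries, so these finitely many products determine
    all the others. A class smaller than p bounds the length of the series by d + ... + d^(p-1). *)

Section FiniteColoring.
Variable O : Type.
Implicit Types (P : O -> Prop) (E : O -> O -> Prop).

(* E need not be an equivalence: its finitely many classes are given by a coloring. *)
Definition fincol P E := exists (F : finType) (c : O -> F),
  forall x y, P x -> P y -> c x = c y -> E x y.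

Lemma fincol_sub P P' E E' : (forall x, P' x -> P x) ->
  (forall x y, P' x -> P' y -> E x y -> E' x y) -> fincol P E -> fincol P' E'.
Proof.
move=> hP hE [F [c h]]; exists F, c => x y px py e.
by apply: hE => //; apply: h => //; apply: hP.
Qed.

Lemma fincol_triv P E : (forall x y, P x -> P y -> E x y) -> fincol P E.
Proof. by move=> h; exists unit, (fun=> tt) => x y px py _; exact: h. Qed.

(** The new colour is a dependent pair: the value of [c] and the colour inside its fibre, whose
    palette may vary with the fibre. *)
Lemma fincol_sigma P E (F : finType) (c : O -> F) :
  (forall f, fincol (fun y => P y /\ c y = f) E) -> fincol P E.
Proof.
move=> h; pose G f := sval (cid (h f)).
pose d f : O -> G f := sval (cid (svalP (cid (h f)))).
have hd f : forall x y, P x /\ c x = f -> P y /\ c y = f -> d f x = d f y -> E x y.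
  exact: svalP (cid (svalP (cid (h f)))).
exists {f : F & G f}, (fun x => Tagged G (d (c x) x)) => x y px py e.
have ec : c x = c y := congr1 tag e.
have H f : c x = f -> Tagged G (d (c x) x) = Tagged G (d f x) by move=> <-.
move: e; rewrite (H _ ec) => /eqP; rewrite eq_Tagged /= => /eqP.
exact: hd.
Qed.

(** One member x0 is picked in each colour class for [E] and the rest of the class is compared with
    it, so that isomorphisms out of a single reference object become available. *)
Lemma fincol_refine P E E' : fincol P E ->
  (forall x0, P x0 -> fincol (fun y => P y /\ E x0 y) E') -> fincol P E'.
Proof.
move=> [F [c h]] h'; apply: (@fincol_sigma _ _ F c) => f.
case: (pselect (exists x, P x /\ c x = f)) => [[x [px cx]]|ne].
  apply: fincol_sub (h' x px) => // y [py cy]; split=> //.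
  by apply: h => //; rewrite cx.
by apply: fincol_triv => x y hx; case: ne; exists x.
Qed.

(** The code w is a choice inside a reference object, such as the preimage of a differential or of a
    product; the injection [e] on [D] says that finitely many codes occur. *)
Lemma fincol_code P E (I : Type) (F : finType) (e : I -> F) (D : I -> Prop)
    (rel : O -> I -> Prop) :
  (forall w w', D w -> D w' -> e w = e w' -> w = w') ->
  (forall y, P y -> exists2 w, D w & rel y w) ->
  (forall w, D w -> fincol (fun y => P y /\ rel y w) E) -> fincol P E.
Proof.
move=> einj hw h.
case: (pselect (exists i : I, True)) => [[i0 _]|ne]; last first.
  by apply: fincol_triv => x y /hw[w]; case: ne; exists w.
have [w hww] : {w : O -> I & forall y, P y -> D (w y) /\ rel y (w y)}.
  apply: (@choice O I (fun y v => P y -> D v /\ rel y v)) => y.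
  case: (pselect (P y)) => [/hw [v Dv rv]|np]; first by exists v.
  by exists i0.
apply: (@fincol_sigma _ _ F (e \o w)) => f.
case: (pselect (exists x, P x /\ e (w x) = f)) => [[x [px cx]]|ne]; last first.
  by apply: fincol_triv => x y hx; case: ne; exists x.
have [Dx rx] := hww _ px.
apply: fincol_sub (h _ Dx) => // y [py cy]; split=> //.
have [Dy ry] := hww _ py.
by rewrite (einj _ _ Dx Dy (etrans cx (esym cy))).
Qed.

End FiniteColoring.

(* A graded group, presented in each degree as the quotient gZ / gB of a finite
   group of cocycles. *)
Record gm := Gm {
  gV :> zmodType;
  gZ : nat -> gV -> Prop;
  gB : nat -> gV -> Prop;
  gZB : forall n x y, gZ n x -> gZ n y -> gZ n (x - y);
  gB0 : forall n, gB n 0;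
  gBB : forall n x y, gB n x -> gB n y -> gB n (x - y);
  gBZ : forall n x, gB n x -> gZ n x;
  gfin : forall n, exists (F : finType) (e : gV -> F),
    forall x y, gZ n x -> gZ n y -> e x = e y -> x = y
}.
Arguments gZ : clear implicits.
Arguments gB : clear implicits.

Section GmTheory.
Variable M : gm.
Implicit Types (n : nat) (x y : M).

Lemma gZ0 n : gZ M n 0. Proof. by apply: gBZ; exact: gB0. Qed.
Lemma gZN n x : gZ M n x -> gZ M n (- x).
Proof. by move=> h; rewrite -sub0r; apply: gZB (gZ0 n) h. Qed.
Lemma gBN n x : gB M n x -> gB M n (- x).
Proof. by move=> h; rewrite -sub0r; apply: gBB (gB0 M n) h. Qed.
Lemma gZD n x y : gZ M n x -> gZ M n y -> gZ M n (x + y).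
Proof. by move=> hx hy; rewrite -[y]opprK; apply: gZB hx (gZN hy). Qed.
Lemma gBD n x y : gB M n x -> gB M n y -> gB M n (x + y).
Proof. by move=> hx hy; rewrite -[y]opprK; apply: gBB hx (gBN hy). Qed.
Lemma gBxx n x : gB M n (x - x). Proof. by rewrite subrr; exact: gB0. Qed.
Lemma gBC n x y : gB M n (x - y) -> gB M n (y - x).
Proof. by move/gBN; rewrite opprB. Qed.
Lemma gBT n x y z : gB M n (x - y) -> gB M n (y - z) -> gB M n (x - z).
Proof. by move=> h1 h2; have := gBD h1 h2; rewrite addrA subrK. Qed.
Lemma gB_iff n x y : gB M n (x - y) -> gB M n x <-> gB M n y.
Proof.
move=> h; split=> h'; first by have := gBB h' h; rewrite opprB addrC subrK.
by have := gBD h h'; rewrite subrK.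
Qed.
Lemma gZ_eqv n x y : gB M n (x - y) -> gZ M n x -> gZ M n y.
Proof. by move=> /gBZ h hx; have := gZB hx h; rewrite opprB addrC subrK. Qed.
End GmTheory.

(* Isomorphisms of the quotients gZ / gB, as relations between representatives:
   no choice of maps is needed to compose, invert or restrict them. *)
Record giso (M M' : gm) (rho : nat -> M -> M' -> Prop) : Prop := Giso {
  gi_Z : forall n x y, rho n x y -> gZ M n x /\ gZ M' n y;
  gi_tot : forall n x, gZ M n x -> exists y, rho n x y;
  gi_sur : forall n y, gZ M' n y -> exists x, rho n x y;
  gi_sub : forall n x y x' y', rho n x y -> rho n x' y' -> rho n (x - x') (y - y');
  gi_B : forall n x y, rho n x y -> (gB M n x <-> gB M' n y);
  gi_BB : forall n x y, gB M n x -> gB M' n y -> rho n x y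
}.

Section GisoTheory.
Variables (M M' : gm) (rho : nat -> M -> M' -> Prop).
Hypothesis gr : giso rho.

Lemma gi_0 n : rho n 0 0.
Proof. by apply: (gi_BB gr); exact: gB0. Qed.
Lemma gi_opp n x y : rho n x y -> rho n (- x) (- y).
Proof. by move=> h; rewrite -sub0r -[- y]sub0r; apply: (gi_sub gr) (gi_0 n) h. Qed.
Lemma gi_add n x y x' y' : rho n x y -> rho n x' y' -> rho n (x + x') (y + y').
Proof. by move=> h h'; rewrite -[x']opprK -[y']opprK; apply: (gi_sub gr) h (gi_opp h'). Qed.
Lemma gi_sat n x y x' y' : rho n x y -> gB M n (x' - x) -> gB M' n (y' - y) -> rho n x' y'.
Proof.
move=> h bx by_; rewrite -[x'](subrK x) -[y'](subrK y).
by apply: gi_add => //; apply: (gi_BB gr).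
Qed.
Lemma gi_uniq n x y y' : rho n x y -> rho n x y' -> gB M' n (y - y').
Proof.
by move=> h h'; apply/(gi_B gr (gi_sub gr h h')); exact: gBxx.
Qed.

Definition gsym n (y : M') (x : M) := rho n x y.
Lemma giso_sym : giso gsym.
Proof.
split; rewrite /gsym.
- by move=> n x y /(gi_Z gr) [].
- by move=> n x /(gi_sur gr).
- by move=> n x /(gi_tot gr).
- by move=> n x y x' y'; exact: (gi_sub gr).
- by move=> n x y /(gi_B gr) [].
- by move=> n x y bx by_; exact: (gi_BB gr).
Qed.
End GisoTheory.

Lemma subr_swap (V : zmodType) (x x' y y' : V) : x - x' - (y - y') = x - y - (x' - y').
Proof. by rewrite !opprB addrACA [y' - _]addrC [- x' + _]addrC addrACA [- x' + _]addrC. Qed.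

Lemma giso_id (M : gm) :
  giso (fun n (x y : M) => [/\ gZ M n x, gZ M n y & gB M n (x - y)]).
Proof.
split.
- by move=> n x y [].
- by move=> n x hx; exists x; split=> //; exact: gBxx.
- by move=> n x hx; exists x; split=> //; exact: gBxx.
- move=> n x y x' y' [hx hy b] [hx' hy' b']; split; try exact: gZB.
  by rewrite subr_swap; exact: gBB.
- by move=> n x y [_ _ b]; exact: gB_iff.
- by move=> n x y bx by_; split; [exact: gBZ | exact: gBZ | exact: gBB].
Qed.

Definition gcomp (M1 M2 M3 : gm) (r : nat -> M1 -> M2 -> Prop) (s : nat -> M2 -> M3 -> Prop) n x z :=
  exists2 y, r n x y & s n y z.

Lemma giso_comp (M1 M2 M3 : gm) (r : nat -> M1 -> M2 -> Prop) (s : nat -> M2 -> M3 -> Prop) :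
  giso r -> giso s -> giso (gcomp r s).
Proof.
move=> hr hs; split.
- by move=> n x z [y /(gi_Z hr)[hx _] /(gi_Z hs)[_ hz]].
- move=> n x hx; have [y ry] := gi_tot hr hx.
  by have [z sz] := gi_tot hs (proj2 (gi_Z hr ry)); exists z, y.
- move=> n z hz; have [y sy] := gi_sur hs hz.
  by have [x rx] := gi_sur hr (proj1 (gi_Z hs sy)); exists x, y.
- move=> n x z x' z' [y ry sy] [y' ry' sy']; exists (y - y').
    exact: (gi_sub hr).
  exact: (gi_sub hs).
- by move=> n x z [y /(gi_B hr) -> /(gi_B hs)].
- move=> n x z bx bz; exists 0; first by apply: (gi_BB hr) => //; exact: gB0.
  by apply: (gi_BB hs) => //; exact: gB0.
Qed.

(** Modelled on cochain algebras: bilinearity and associativity are strict, graded commutativity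
    holds up to [gB]. The unit laws concern cocycles because a function on lists that is nonzero on
    the empty list is not fixed by the unit cochain. *)
Record grg := Grg {
  gR :> gm;
  rmul : gR -> gR -> gR;
  rone : gR;
  rmulBl : forall a b c, rmul (a - b) c = rmul a c - rmul b c;
  rmulBr : forall a b c, rmul a (b - c) = rmul a b - rmul a c;
  rmulA : forall a b c, rmul a (rmul b c) = rmul (rmul a b) c;
  rmulZ : forall m n a b, gZ gR m a -> gZ gR n b -> gZ gR (m + n)%N (rmul a b);
  rmulBZ : forall m n a b, gB gR m a -> gZ gR n b -> gB gR (m + n)%N (rmul a b);
  rmulZB : forall m n a b, gZ gR m a -> gB gR n b -> gB gR (m + n)%N (rmul a b);
  roneZ : gZ gR 0 rone;
  rmul1 : forall n a, gZ gR n a -> rmul rone a = a;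
  rmulr1 : forall n a, gZ gR n a -> rmul a rone = a;
  rmulC : forall m n a b, gZ gR m a -> gZ gR n b ->
    gB gR (m + n)%N (if odd m && odd n then rmul a b + rmul b a else rmul a b - rmul b a)
}.

(* The module axioms hold modulo gB only. *)
Record gmd (R : grg) := Gmd {
  gM :> gm;
  act : nat -> R -> gM -> gM;
  actZ : forall m n r u, gZ R m r -> gZ gM n u -> gZ gM (m + n)%N (act m r u);
  actB : forall m n r u, gZ R m r -> gB gM n u -> gB gM (m + n)%N (act m r u);
  actRB : forall m n r u, gB R m r -> gZ gM n u -> gB gM (m + n)%N (act m r u);
  actBl : forall m n r r' u, gZ R m r -> gZ R m r' -> gZ gM n u ->
    gB gM (m + n)%N (act m (r - r') u - (act m r u - act m r' u));
  actBr : forall m n r u u', gZ R m r -> gZ gM n u -> gZ gM n u' ->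
    gB gM (m + n)%N (act m r (u - u') - (act m r u - act m r u'));
  actA : forall m m' n r r' u, gZ R m r -> gZ R m' r' -> gZ gM n u ->
    gB gM (m + m' + n)%N (act (m + m')%N (rmul r r') u - act m r (act m' r' u));
  act1 : forall n u, gZ gM n u -> gB gM n (act 0 (rone R) u - u)
}.
Arguments act {R} g.

Section Modules.
Variable R : grg.

Lemma rmulBxx m n (a b c d : R) : gZ R m a -> gZ R m b -> gZ R n c -> gZ R n d ->
  gB R m (a - b) -> gB R n (c - d) -> gB R (m + n)%N (rmul a c - rmul b d).
Proof.
move=> ha hb hc hd hab hcd; apply: (gBT (y := rmul b c)).
  by rewrite -rmulBl; exact: rmulBZ.
by rewrite -rmulBr; exact: rmulZB.
Qed.

Definition glin (M M' : gmd R) (rho : nat -> M -> M' -> Prop) :=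
  forall m n r x y, gZ R m r -> rho n x y -> rho (m + n)%N (act M m r x) (act M' m r y).

Definition miso (M M' : gmd R) := exists2 rho : nat -> M -> M' -> Prop, giso rho & glin rho.

Section OneModule.
Variable M : gmd R.
Implicit Types (l : seq (nat * M)) (U : nat -> M -> Prop).

Lemma act_eqv m n r (u v : M) : gZ R m r -> gZ M n u -> gZ M n v -> gB M n (u - v) ->
  gB M (m + n)%N (act M m r u - act M m r v).
Proof.
by move=> hr hu hv b; apply/(gB_iff (gBC (actBr hr hu hv)))/actB.
Qed.

Lemma actD m n r (u v : M) : gZ R m r -> gZ M n u -> gZ M n v ->
  gB M (m + n)%N (act M m r (u + v) - (act M m r u + act M m r v)).
Proof.
move=> hr hu hv; have := gBN (actBr hr (gZD hu hv) hv); rewrite addrK opprB.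
by rewrite opprD addrA addrAC.
Qed.

(** Terms are added one at a time and a generator may recur, which makes closure under sums and
    multiples a direct induction; [gspan_cons] later collects the coefficient of one generator. *)
Inductive gspan l : nat -> M -> Prop :=
| gs0 n b : gB M n b -> gspan l n b
| gsa m d r u x : (d, u) \in l -> gZ R m r -> gspan l (m + d)%N x ->
    gspan l (m + d)%N (act M m r u + x).

End OneModule.
End Modules.

Section GmEquiv.
Variable M : gm.
Implicit Types (x y z t : M).

Lemma gB_add n x x' y y' : gB M n (x - x') -> gB M n (y - y') ->
  gB M n (x + y - (x' + y')).
Proof. by move=> h h'; rewrite opprD addrACA; exact: gBD. Qed.
Lemma gB_sub n x x' y y' : gB M n (x - x') -> gB M n (y - y') ->
  gB M n (x - y - (x' - y')).
Proof. by move=> h h'; rewrite subr_swap; exact: gBB. Qed.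
End GmEquiv.

Section ModuleTheory.
Variable R : grg.

Section One.
Variable M : gmd R.
Implicit Types (l : seq (nat * M)) (U : nat -> M -> Prop).

Lemma act_r0 m n (u : M) : gZ M n u -> gB M (m + n)%N (act M m 0 u).
Proof. by move=> hu; apply: actRB hu; exact: gB0. Qed.

Lemma actDl m n r r' (u : M) : gZ R m r -> gZ R m r' -> gZ M n u ->
  gB M (m + n)%N (act M m (r + r') u - (act M m r u + act M m r' u)).
Proof.
move=> hr hr' hu; have := gBN (actBl (gZD hr hr') hr' hu); rewrite addrK opprB.
by rewrite opprD addrA addrAC.
Qed.

Lemma act_opp m n r (u : M) : gZ R m r -> gZ M n u ->
  gB M (m + n)%N (act M m (- r) u - - act M m r u).
Proof.
move=> hr hu; have := actBl (gZ0 R m) hr hu; rewrite sub0r => h.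
apply: gBT h _; rewrite opprK subrK; exact: act_r0.
Qed.

Lemma gspan_eqv l n x x' : gB M n (x' - x) -> gspan l n x -> gspan l n x'.
Proof.
move=> b h; elim: h x' b => {n x} [n c bc|m d r u x hl hr _ IH] x' b.
  by apply: gs0; rewrite -[x'](subrK c); exact: gBD.
rewrite -[x'](subrK (act M m r u)) addrC; apply: gsa => //.
by apply: IH; rewrite -addrA -opprD.
Qed.

Lemma gspan_Z l n x : (forall d u, (d, u) \in l -> gZ M d u) -> gspan l n x -> gZ M n x.
Proof.
move=> hl; elim=> {n x} [n b|m d r u x hu hr _ IH]; first exact: gBZ.
by apply: gZD => //; apply: actZ => //; exact: hl.
Qed.

Lemma gspan_add l n x y : gspan l n x -> gspan l n y -> gspan l n (x + y).
Proof.
move=> h; elim: h y => {n x} [n c bc|m d r u x hl hr _ IH] y hy.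
  by apply: gspan_eqv hy; rewrite addrK.
by rewrite -addrA; apply: gsa => //; exact: IH.
Qed.

Lemma gspan_mem l d u : gZ M d u -> (d, u) \in l -> gspan l d u.
Proof.
move=> hu hl; apply: (gspan_eqv (x := act M 0 (rone R) u + 0)).
  by rewrite addr0; apply: gBC; exact: act1.
by apply: (gsa (m := 0%N)) => //; [exact: roneZ | apply: gs0; exact: gB0].
Qed.

Lemma gspan_act l m r n x : (forall d u, (d, u) \in l -> gZ M d u) ->
  gZ R m r -> gspan l n x -> gspan l (m + n)%N (act M m r x).
Proof.
move=> hl hr; elim=> {n x} [n b hb|m' d r' u x hu hr' hx IH].
  by apply: gs0; exact: actB.
have hux := gspan_Z hl hx; have hzu := hl _ _ hu.
apply: (gspan_eqv (x := act M (m + m')%N (rmul r r') u + act M m r x)).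
  apply: gBT (actD hr (actZ hr' hzu) hux) _.
  apply: gB_add (gBxx _ _); apply: gBC; rewrite addnA; exact: actA.
by rewrite addnA in IH *; apply: gsa => //; exact: rmulZ.
Qed.

Lemma gspan_opp l n x : (forall d u, (d, u) \in l -> gZ M d u) ->
  gspan l n x -> gspan l n (- x).
Proof.
move=> hl; elim=> {n x} [n b hb|m' d r' u x hu hr' hx IH].
  by apply: gs0; exact: gBN.
apply: (gspan_eqv (x := act M m' (- r') u + - x)).
  rewrite opprD; apply: gB_add (gBxx _ _); apply: gBC; apply: act_opp => //; exact: hl.
by apply: gsa => //; exact: gZN.
Qed.

Lemma gspan_mono l l' n x : {subset l <= l'} -> gspan l n x -> gspan l' n x.
Proof.
move=> hl; elim=> {n x} [n b hb|m' d r' u x hu hr' hx IH]; first exact: gs0.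
by apply: gsa => //; exact: hl.
Qed.

Record subm U : Prop := Subm {
  subZ : forall n x, U n x -> gZ M n x;
  subB : forall n x, gB M n x -> U n x;
  sub_sub : forall n x y, U n x -> U n y -> U n (x - y);
  sub_act : forall m n r x, gZ R m r -> U n x -> U (m + n)%N (act M m r x)
}.

Section Sub.
Variable U : nat -> M -> Prop.
Hypothesis hU : subm U.

Lemma sub_opp n x : U n x -> U n (- x).
Proof.
by move=> h; rewrite -sub0r; apply: (sub_sub hU) => //; apply: (subB hU); exact: gB0.
Qed.
Lemma sub_add n x y : U n x -> U n y -> U n (x + y).
Proof. by move=> h h'; rewrite -[y]opprK; apply: (sub_sub hU) h (sub_opp h'). Qed.
Lemma sub_eqv n x y : gB M n (x - y) -> U n x -> U n y.
Proof.
move=> /(subB hU) b h; rewrite -[y]opprK -[- y](addKr x) opprD opprK.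
by apply: (sub_sub hU).
Qed.
Lemma sub_gspan l n x : (forall d u, (d, u) \in l -> U d u) -> gspan l n x -> U n x.
Proof.
move=> hl; elim=> {n x} [n b|m d r u x hu hr _ IH]; first exact: (subB hU).
by apply: sub_add => //; apply: (sub_act hU) => //; exact: hl.
Qed.

Lemma subgm_fin n : exists (F : finType) (e : M -> F),
    forall x y, U n x -> U n y -> e x = e y -> x = y.
Proof.
have [F [e he]] := gfin M n; exists F, e => x y /(subZ hU) hx /(subZ hU); exact: he.
Qed.

Definition subgm : gm :=
  @Gm M U (@gB M) (sub_sub hU) (@gB0 M) (@gBB M) (subB hU) subgm_fin.

Definition subgmd : gmd R.
Proof.
apply: (@Gmd R subgm (@act R M)) => /=.
- exact: (sub_act hU).
- exact: actB.
- by move=> m n r u hr /(subZ hU); exact: actRB.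
- by move=> m n r r' u hr hr' /(subZ hU); exact: actBl.
- by move=> m n r u u' hr /(subZ hU) h /(subZ hU); exact: actBr.
- by move=> m m' n r r' u hr hr' /(subZ hU); exact: actA.
- by move=> n u /(subZ hU); exact: act1.
Defined.
End Sub.

Definition noeth := forall U, subm U -> exists l : seq (nat * M),
  (forall d u, (d, u) \in l -> U d u) /\ (forall n x, U n x -> gspan l n x).
End One.

Definition reg : gmd R.
Proof.
apply: (@Gmd R R (fun _ r u => rmul r u)).
- by move=> *; exact: rmulZ.
- by move=> *; exact: rmulZB.
- by move=> *; exact: rmulBZ.
- by move=> m n r r' u *; rewrite rmulBl; exact: gBxx.
- by move=> m n r u u' *; rewrite rmulBr; exact: gBxx.
- by move=> m m' n r r' u *; rewrite rmulA; exact: gBxx.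
- by move=> n u hu; rewrite (rmul1 hu); exact: gBxx.
Defined.

Lemma rmulr0 (r : R) : rmul r 0 = 0.
Proof. by have := rmulBr r 0 0; rewrite !subrr. Qed.

(* Isomorphism classes stay finite in number when a submodule is enlarged by one
   generator kap whose relation ideal I is the same in all members of the family:
   an isomorphism extends as soon as it matches the finitely many r kap, with r
   among generators of I. *)
Section Cyclic.
Variables (O : Type) (P : O -> Prop) (M : O -> gmd R).
Variables (U U' : forall y, nat -> M y -> Prop).
Variables (hU : forall y, subm (U (y := y))) (hU' : forall y, subm (U' (y := y))).
Variables (kap : forall y, M y) (d : nat) (I : nat -> R -> Prop).
Hypothesis noethR : noeth reg.
Hypothesis sUU' : forall y n u, P y -> U n u -> U' (y := y) n u.
Hypothesis kapU : forall y, P y -> U' d (kap y).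
Hypothesis gen : forall y n u, P y -> U' (y := y) n u -> U n u \/
  exists m r, [/\ n = (m + d)%N, gZ R m r & U n (u - act (M y) m r (kap y))].
Hypothesis hI : forall y m r, P y -> gZ R m r -> U (m + d)%N (act (M y) m r (kap y)) <-> I m r.

Let iso y z := miso (subgmd (hU y)) (subgmd (hU z)).
Let iso' y z := miso (subgmd (hU' y)) (subgmd (hU' z)).

Let kZ x (px : P x) : gZ (M x) d (kap x) := subZ (hU' x) (kapU px).

(** Indexing by the total degree n, with value 0 below d, avoids carrying a decomposition n = m + d.
    Accordingly [okr] uses the truncated n - d and forces r = 0 when n < d. *)
Definition ak x n r : M x := if (d <= n)%N then act (M x) (n - d) r (kap x) else 0.
Definition okr n (r : R) := gZ R (n - d) r /\ ((n < d)%N -> r = 0).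

Lemma ak_sub x n r r' : P x -> okr n r -> okr n r' ->
  gB (M x) n (ak x n (r - r') - (ak x n r - ak x n r')).
Proof.
move=> px [hr _] [hr' _]; rewrite /ak; case: leqP => h; last by rewrite !subr0; exact: gB0.
by have := actBl hr hr' (kZ px); rewrite subnK.
Qed.

Lemma ak_act x m n r0 r : P x -> gZ R m r0 -> okr n r ->
  gB (M x) (m + n)%N (act (M x) m r0 (ak x n r) - ak x (m + n)%N (rmul r0 r)).
Proof.
move=> px h0 [hr hn]; rewrite /ak; case: (leqP d n) => h.
  rewrite (leq_trans h (leq_addl _ _)) -addnBA //; apply: gBC.
  by have := actA h0 hr (kZ px); rewrite -addnA subnK.
rewrite hn // rmulr0; apply: gBB; first by apply: actB => //; exact: gB0.
case: ifP => h'; last exact: gB0.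
by have := act_r0 (m + n - d) (kZ px); rewrite subnK.
Qed.

Lemma ak_U' x n r : P x -> okr n r -> U' n (ak x n r).
Proof.
move=> px [hr _]; rewrite /ak; case: leqP => h; last by apply: (subB (hU' x)); exact: gB0.
by have := sub_act (hU' x) hr (kapU px); rewrite subnK.
Qed.

Lemma okr_sub n r r' : okr n r -> okr n r' -> okr n (r - r').
Proof.
move=> [h h0] [h' h0']; split; first exact: gZB.
by move=> hn; rewrite h0 // h0' // subrr.
Qed.

Lemma okr0 n : okr n 0. Proof. by split=> //; exact: gZ0. Qed.

Lemma okr_mul m n r0 r : gZ R m r0 -> okr n r -> okr (m + n)%N (rmul r0 r).
Proof.
move=> h0 [hr hn]; split.
  case: (leqP d n) => h; first by rewrite -addnBA //; exact: rmulZ.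
  by rewrite hn // rmulr0; exact: gZ0.
by move=> h; rewrite hn ?rmulr0 // (leq_ltn_trans (leq_addl _ _) h).
Qed.

Lemma gen_ak x n u : P x -> U' n u -> exists2 r, okr n r & U n (u - ak x n r).
Proof.
move=> px hu; case: (gen px hu) => [h|[m [r [-> hr h]]]].
  exists 0; first exact: okr0.
  apply: (sub_eqv (hU x) (x := u - 0)); last by rewrite subr0.
  apply: gB_sub (gBxx _ _) _; rewrite sub0r; apply: gBN.
  rewrite /ak; case: ifP => hn; last exact: gB0.
  by have := act_r0 (n - d) (kZ px); rewrite subnK.
exists r; last by rewrite /ak leq_addl addnK.
by split; [rewrite addnK | rewrite ltnNge leq_addl].
Qed.

Section Extend.
Variables (y z : O) (Rr : nat -> M y -> M z -> Prop) (lI : seq (nat * R)).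
Hypotheses (py : P y) (pz : P z).
Hypothesis Ri : giso (M := subgmd (hU y)) (M' := subgmd (hU z)) Rr.
Hypothesis Rl : glin (M := subgmd (hU y)) (M' := subgmd (hU z)) Rr.
Hypothesis lIZ : forall e r, (e, r) \in lI -> gZ R e r.
Hypothesis lI_span : forall m r, gZ R m r -> I m r -> gspan (M := reg) lI m r.
Hypothesis lI_rel : forall e r, (e, r) \in lI ->
  Rr (e + d)%N (act (M y) e r (kap y)) (act (M z) e r (kap z)).

(** Graph of the linear extension of [Rr] that sends [kap y] to [kap z]. It is well defined modulo
    boundaries because both relation ideals equal [I] and [Rr] matches the multiples of [kap] by
    [I]. *)
Definition ext n (a : M y) (b : M z) :=
  exists2 r, okr n r & Rr n (a - ak y n r) (b - ak z n r).

Let RBB n (a : M y) (b : M z) : gB (M y) n a -> gB (M z) n b -> Rr n a b := @gi_BB _ _ _ Ri n a b.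
Let Rsat n (a a' : M y) (b b' : M z) : Rr n a b ->
  gB (M y) n (a' - a) -> gB (M z) n (b' - b) -> Rr n a' b' := @gi_sat _ _ _ Ri n a b a' b'.
Let RZ n (a : M y) (b : M z) : Rr n a b -> U n a /\ U n b := @gi_Z _ _ _ Ri n a b.
Let Rsub n (a a' : M y) (b b' : M z) : Rr n a b -> Rr n a' b' -> Rr n (a - a') (b - b') :=
  @gi_sub _ _ _ Ri n a b a' b'.
Let Radd n (a a' : M y) (b b' : M z) : Rr n a b -> Rr n a' b' -> Rr n (a + a') (b + b') :=
  @gi_add _ _ _ Ri n a b a' b'.

Lemma ideal_rel m r : gZ R m r -> I m r ->
  Rr (m + d)%N (act (M y) m r (kap y)) (act (M z) m r (kap z)).
Proof.
move=> hr /(lI_span hr) h; elim: h {hr} => {m r} [m b hb|m e r u x hl hr hx IH].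
  by apply: RBB; apply: actRB => //; exact: kZ.
have hxZ : gZ R (m + e)%N x by apply: (gspan_Z (M := reg)) hx.
have hu := lIZ hl; have hru : gZ R (m + e)%N (rmul r u) by exact: rmulZ.
have h := Rl hr (lI_rel hl); rewrite addnA in h.
apply: (Rsat (Radd h IH)).
  apply: gBT (actDl hru hxZ (kZ py)) _; apply: gB_add (gBxx _ _); exact: actA (kZ py).
apply: gBT (actDl hru hxZ (kZ pz)) _; apply: gB_add (gBxx _ _); exact: actA (kZ pz).
Qed.

(** If r kap lies in U on one side then r belongs to [I], so it lies in U on the other side too, and
    [ideal_rel] matches the two multiples. This is what makes [ext] respect boundaries. *)
Lemma ext_U n r a b : okr n r -> Rr n (a - ak y n r) (b - ak z n r) ->
  U n (ak y n r) \/ U n (ak z n r) -> Rr n a b.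
Proof.
move=> hr h hor.
suff h' : Rr n (ak y n r) (ak z n r) by have := Radd h h'; rewrite !subrK.
move: hor; rewrite /ak; case: (leqP d n) => hn; last by move=> _; apply: RBB; exact: gB0.
have [hrZ _] := hr; have := ideal_rel hrZ; have := hI py hrZ; have := hI pz hrZ.
by rewrite subnK // => e1 e2 h' [/e2|/e1] /h'.
Qed.

Lemma ext_giso : giso (M := subgmd (hU' y)) (M' := subgmd (hU' z)) ext.
Proof.
split.
- move=> n a b [r hr /RZ [ha hb]]; split => /=.
    by rewrite -(subrK (ak y n r) a); apply: (sub_add (hU' y)); [exact: sUU' | exact: ak_U'].
  by rewrite -(subrK (ak z n r) b); apply: (sub_add (hU' z)); [exact: sUU' | exact: ak_U'].
- move=> n a /= ha; have [r hr h] := gen_ak py ha.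
  have [b hb] := gi_tot Ri h; exists (b + ak z n r), r => //.
  by rewrite addrK.
- move=> n b /= hb; have [r hr h] := gen_ak pz hb.
  have [a ha] := gi_sur Ri h; exists (a + ak y n r), r => //.
  by rewrite addrK.
- move=> n a b a' b' [r hr h] [r' hr' h']; exists (r - r'); first exact: okr_sub.
  apply: (Rsat (Rsub h h')).
    rewrite [X in gB _ _ (_ - X)]subr_swap; apply: gB_sub (gBxx _ _) _; exact: ak_sub.
  rewrite [X in gB _ _ (_ - X)]subr_swap; apply: gB_sub (gBxx _ _) _; exact: ak_sub.
- move=> n a b [r hr h] /=; have [ha hb] := RZ h.
  split=> hB.
    have hu : U n (ak y n r).
      have := sub_sub (hU y) (subB (hU y) hB) ha; by rewrite opprB addrC subrK.
    by apply/(gi_B Ri (ext_U hr h (or_introl hu))).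
  have hu : U n (ak z n r).
    have := sub_sub (hU z) (subB (hU z) hB) hb; by rewrite opprB addrC subrK.
  by apply/(gi_B Ri (ext_U hr h (or_intror hu))).
- move=> n a b /= ba bb; exists 0; first exact: okr0.
  have k0 x : P x -> gB (M x) n (ak x n 0).
    move=> px; rewrite /ak; case: ifP => hn; last exact: gB0.
    by have := act_r0 (n - d) (kZ px); rewrite subnK.
  by apply: RBB; apply: gBB => //; exact: k0.
Qed.

Lemma ext_glin : glin (M := subgmd (hU' y)) (M' := subgmd (hU' z)) ext.
Proof.
move=> m n r0 a b h0 [r hr h]; exists (rmul r0 r); first exact: okr_mul.
have [ha hb] := RZ h.
have haZ x c : P x -> U n (c - ak x n r) -> gZ (M x) n c.
  move=> px /(subZ (hU x)) hc; rewrite -(subrK (ak x n r) c); apply: gZD => //.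
  exact: (subZ (hU' x) (ak_U' px hr)).
have key x c : P x -> U n (c - ak x n r) -> gB (M x) (m + n)%N
    (act (M x) m r0 c - ak x (m + n)%N (rmul r0 r) - act (M x) m r0 (c - ak x n r)).
  move=> px hc; apply: gBC; apply: gBT (actBr h0 (haZ _ _ px hc) (subZ (hU' x) (ak_U' px hr))) _.
  by apply: gB_sub (gBxx _ _) _; exact: ak_act.
by apply: (Rsat (Rl h0 h)); exact: key.
Qed.
End Extend.

Lemma cyclic_fincol : fincol P iso -> fincol P iso'.
Proof.
case: (pselect (exists y, P y)) => [[y0 py0]|ne]; last first.
  by move=> _; apply: fincol_triv => x y px; case: ne; exists x.
(* [I] is known through its description in the members of the family; reading it in one member y0
   shows that it is an ideal, hence finitely generated. *)
have [lI [lIZ lIs]] : exists l : seq (nat * R),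
    (forall e r, (e, r) \in l -> gZ R e r /\ I e r) /\
    (forall m r, gZ R m r -> I m r -> gspan (M := reg) l m r).
  have [|l [h1 h2]] := noethR (U := fun n (r : R) => gZ R n r /\ I n r).
    have IB n r : gB R n r -> I n r.
      move=> h; apply/(hI py0 (gBZ h)); apply: (subB (hU y0)).
      by apply: actRB h _; exact: kZ.
    split.
    - by move=> n x [].
    - by move=> n x hx; split; [exact: gBZ | exact: IB].
    - move=> n r r' [hr ir] [hr' ir']; split; first exact: gZB.
      apply/(hI py0 (gZB hr hr')).
      move/(hI py0 hr): ir => ir; move/(hI py0 hr'): ir' => ir'.
      exact: (sub_eqv (hU y0) (gBC (actBl hr hr' (kZ py0)))) (sub_sub (hU y0) ir ir').
    - move=> m n r r' hr [hr' ir']; split; first exact: rmulZ.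
      apply/(hI py0 (rmulZ hr hr')); move/(hI py0 hr'): ir' => ir'.
      apply: (sub_eqv (hU y0) (gBC (actA hr hr' (kZ py0)))).
      by rewrite -addnA; exact: (sub_act (hU y0)).
  by exists l; split=> // m r hr ir; apply: h2.
move=> fc; apply: (fincol_refine fc) => x0 px0.
have [rho hrho] : {rho : forall y, nat -> M x0 -> M y -> Prop & forall y, iso x0 y ->
    giso (M := subgmd (hU x0)) (M' := subgmd (hU y)) (rho y) /\
    glin (M := subgmd (hU x0)) (M' := subgmd (hU y)) (rho y)}.
  have ch y : exists rho : nat -> M x0 -> M y -> Prop, iso x0 y ->
    giso (M := subgmd (hU x0)) (M' := subgmd (hU y)) rho /\
    glin (M := subgmd (hU x0)) (M' := subgmd (hU y)) rho.
    case: (pselect (iso x0 y)) => [[rho h1 h2]|ne]; first by exists rho.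
    by exists (fun _ _ _ => False).
  exists (fun y => sval (cid (ch y))) => y; exact: (svalP (cid (ch y))).
pose rel (W : seq (nat * R * M x0)) y := forall e r w, (e, r, w) \in W ->
  rho y (e + d)%N w (act (M y) e r (kap y)).
suff H (l : seq (nat * R)) W : {subset l <= lI} ->
    (forall e r, (e, r) \in lI -> (e, r) \in l \/ exists w, (e, r, w) \in W) ->
    fincol (fun y => (P y /\ iso x0 y) /\ rel W y) iso'.
  have := H lI [::] (fun _ h => h) (fun e r h => or_introl h).
  by apply: fincol_sub => // y h; split.
elim: l W => [|[e r] l IH] W hl hW.
  apply: fincol_triv => y z [[py iy] ry] [[pz iz] rz].
  have [gy ly] := hrho _ iy; have [gz lz] := hrho _ iz.
  pose Rr := gcomp (gsym (M := subgmd (hU x0)) (M' := subgmd (hU y)) (rho y)) (rho z).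
  have Ri : giso (M := subgmd (hU y)) (M' := subgmd (hU z)) Rr.
    by apply: giso_comp gz; exact: giso_sym.
  have Rl : glin (M := subgmd (hU y)) (M' := subgmd (hU z)) Rr.
    move=> m n r a b hr [c ra rb]; exists (act (M x0) m r c); first exact: ly.
    exact: lz.
  have relI e r : (e, r) \in lI -> Rr (e + d)%N (act (M y) e r (kap y)) (act (M z) e r (kap z)).
    by move=> /hW [//|[w hw]]; exists w; [exact: ry | exact: rz].
  have lZ e r : (e, r) \in lI -> gZ R e r by move=> /lIZ [].
  exists (ext Rr); first exact: (ext_giso py pz Ri Rl lZ lIs relI).
  exact: (ext_glin py pz Ri Rl).
have hin : (e, r) \in lI by apply: hl; rewrite mem_head.
have [erZ erI] := lIZ _ _ hin.
have [F [en hen]] := gfin (subgmd (hU x0)) (e + d)%N.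
apply: (@fincol_code _ _ _ (M x0) F en (fun w => U (e + d)%N w)
   (fun y w => rho y (e + d)%N w (act (M y) e r (kap y)))).
- by move=> w w' hw hw'; exact: hen.
- move=> y [[py iy] _]; have [gy _] := hrho _ iy.
  have [w hw] : exists w, rho y (e + d)%N w (act (M y) e r (kap y)).
    by apply: (gi_sur gy); apply/(hI py erZ).
  by exists w => //; case: (gi_Z gy hw).
move=> w hw.
have h1 : {subset l <= lI} by move=> x hx; apply: hl; rewrite inE hx orbT.
have h2 e' r' : (e', r') \in lI -> (e', r') \in l \/ exists w', (e', r', w') \in (e, r, w) :: W.
  move=> /hW; rewrite inE => -[/orP[/eqP[-> ->]|h]|[w' hw']].
  + by right; exists w; rewrite mem_head.
  + by left.
  + by right; exists w'; rewrite inE hw' orbT.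
apply: (fincol_sub _ _ (IH _ h1 h2)) => // y [[[py iy] ry] rw].
split=> // e' r' w'; rewrite inE => /orP[/eqP [-> -> ->] //|].
exact: ry.
Qed.

End Cyclic.
End ModuleTheory.

(** * Extensions of modules by a shifted copy of the ring *)

Section Triangle.
Variable R : grg.

(* An exact triangle M' -> M -> R[-e] -> M'[1]: [lifts m r u] says that the
   class of u maps to the class of r, and del represents the image of 1. *)
Record triangle (e : nat) := Triangle {
  tM' : gmd R;
  tM : gmd R;
  tj : tM' -> tM;
  lifts : nat -> R -> tM -> Prop;
  del : tM';
  tjB : forall a b, tj (a - b) = tj a - tj b;
  tjZ : forall n u, gZ tM' n u -> gZ tM n (tj u);
  tj_act : forall m n r u, gZ R m r -> gZ tM' n u ->
    gB tM (m + n)%N (tj (act tM' m r u) - act tM m r (tj u));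
  liftsZ : forall m r u, lifts m r u -> gZ R m r /\ gZ tM (m + e)%N u;
  lifts_ex : forall n u, gZ tM n u ->
    (exists m r, n = (m + e)%N /\ lifts m r u) \/
    (exists2 u', gZ tM' n u' & gB tM n (u - tj u'));
  lifts_sub : forall m r u r' u', lifts m r u -> lifts m r' u' -> lifts m (r - r') (u - u');
  lifts_act : forall m m' r r' u, gZ R m' r' -> lifts m r u ->
    lifts (m' + m)%N (rmul r' r) (act tM m' r' u);
  lifts_B : forall m r u, lifts m r u ->
    gB R m r <-> exists2 u', gZ tM' (m + e)%N u' & gB tM (m + e)%N (u - tj u');
  lifts_BB : forall m r u, gB R m r -> gB tM (m + e)%N u -> lifts m r u;
  lifts_tj : forall m u, gZ tM' (m + e)%N u -> lifts m 0 (tj u);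
  delZ : gZ tM' e.+1 del;
  lifts_del : forall m r, gZ R m r ->
    (exists u, lifts m r u) <-> gB tM' (m + e.+1)%N (act tM' m r del);
  tj_B : forall n u, gZ tM' n u -> gB tM n (tj u) <->
    gB tM' n u \/ exists m r, [/\ n = (m + e.+1)%N, gZ R m r & gB tM' n (u - act tM' m r del)]
}.

Section One.
Variables (e : nat) (t : triangle e).
Implicit Types (u v : tM t) (l : seq (nat * R)).

Definition low n u := exists2 u', gZ (tM' t) n u' & gB (tM t) n (u - tj u').

Lemma tj0 : tj (0 : tM' t) = 0.
Proof. by have := @tjB _ t 0 0; rewrite !subrr. Qed.

Lemma tjD (a b : tM' t) : tj (a + b) = tj a + tj b.
Proof.
by rewrite -[b]opprK tjB -[in LHS](sub0r b) tjB tj0 sub0r !opprK.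
Qed.

Lemma low_Z n u : low n u -> gZ (tM t) n u.
Proof. by case=> u' hu' b; apply: gZ_eqv (gBC b) (tjZ hu'). Qed.

Lemma tjBB n (u : tM' t) : gB (tM' t) n u -> gB (tM t) n (tj u).
Proof. by move=> b; apply/(tj_B (gBZ b)); left. Qed.

Lemma subm_low : subm low.
Proof.
split.
- exact: low_Z.
- by move=> n u b; exists 0; rewrite ?tj0 ?subr0 //; exact: gZ0.
- move=> n u v [u' hu bu] [v' hv bv]; exists (u' - v'); first exact: gZB.
  by rewrite tjB; exact: gB_sub.
- move=> m n r u hr [u' hu bu]; exists (act (tM' t) m r u'); first exact: actZ.
  apply: gBT (gBC (tj_act hr hu)); apply: act_eqv => //; last exact: tjZ.
  exact: gZ_eqv (gBC bu) (tjZ hu).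
Qed.

(** Preimage in M of the ideal generated by [l]. It is the image of M' for empty [l] and all of M
    when [l] generates the annihilator of [del], so M is reached by adjoining one generator at a
    time. *)
Definition upto l n u := low n u \/
  exists m r, [/\ n = (m + e)%N, lifts m r u & gspan (M := reg R) l m r].

Lemma lifts_low m u : low (m + e)%N u -> lifts m 0 u.
Proof.
case=> u' hu' b; have h := lifts_BB (gB0 R m) b.
by have := lifts_sub h (lifts_sub (lifts_BB (gB0 R m) (gB0 _ _)) (lifts_tj hu')); rewrite !subr0 sub0r opprK subrK.
Qed.

Lemma lifts_uniq m r r' u : lifts m r u -> lifts m r' u -> gB R m (r - r').
Proof.
move=> h h'; apply/(lifts_B (lifts_sub h h')); rewrite subrr.
by exists 0; [exact: gZ0 | rewrite tj0 subr0; exact: gB0].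
Qed.

Lemma lifts_B_low m r u : lifts m r u -> gB R m r -> low (m + e)%N u.
Proof. by move=> h /(lifts_B h). Qed.

Lemma lifts_add m r u r' u' : lifts m r u -> lifts m r' u' -> lifts m (r + r') (u + u' : tM t).
Proof.
move=> h h'; rewrite -[r']opprK -[u']opprK; apply: lifts_sub => //.
rewrite -[- r']sub0r -[- u']sub0r; apply: lifts_sub => //.
by apply: lifts_BB; exact: gB0.
Qed.

Lemma low_upto l n u : low n u -> upto l n u. Proof. by left. Qed.

Lemma subm_upto l : (forall d r, (d, r) \in l -> gZ R d r) -> subm (upto l).
Proof.
move=> hl; have hl' : forall d r, (d, r) \in l -> gZ (reg R) d r by [].
have lowlift m u : low (m + e)%N u -> exists2 r, lifts m r u & gspan (M := reg R) l m r.
  by move=> h; exists 0; [exact: lifts_low | apply: gs0; exact: gB0].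
split.
- by move=> n u [/low_Z //|[m [r [-> /liftsZ [_]]]]].
- by move=> n u /(subB subm_low); left.
- have key m (r r' : R) u v : lifts m r u -> gspan (M := reg R) l m r -> lifts m r' v ->
      gspan (M := reg R) l m r' -> upto l (m + e)%N (u - v).
    move=> h hs h' hs'; right; exists m, (r - r'); split=> //; first exact: lifts_sub.
    by apply: gspan_add => //; exact: gspan_opp.
  move=> n u v [hu|[m [r [en hu hs]]]] [hv|[m' [r' [en' hv hs']]]].
  + by left; apply: (sub_sub subm_low).
  + rewrite en' in hu *; have [r h hs] := lowlift _ _ hu; exact: key h hs hv hs'.
  + rewrite en in hv *; have [r' h hs'] := lowlift _ _ hv; exact: key hu hs h hs'.
  + have /eqP := en'; rewrite en eqn_add2r => /eqP em; subst m'.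
    exact: key hu hs hv hs'.
- move=> m n r u hr [hu|[m' [r' [-> hu hs]]]]; first by left; apply: (sub_act subm_low).
  right; exists (m + m')%N, (rmul r r'); split; first by rewrite addnA.
    exact: lifts_act.
  exact: (@gspan_act R (reg R) l m r m' r' hl' hr hs).
Qed.

Lemma gspan_nil (M : gmd R) n (x : M) : gspan (M := M) [::] n x -> gB M n x.
Proof. by case. Qed.

Lemma upto_nil n u : upto [::] n u -> low n u.
Proof. by case=> // -[m [r [-> h /gspan_nil]]]; exact: lifts_B_low. Qed.

End One.

Lemma gspan_cons (M : gmd R) (d : nat) (w : M) l n (x : M) : gZ M d w ->
  (forall d' w', (d', w') \in l -> gZ M d' w') ->
  gspan ((d, w) :: l) n x -> gspan l n x \/
  exists m r, [/\ n = (m + d)%N, gZ R m r & gspan l n (x - act M m r w)].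
Proof.
move=> hw hl; elim=> {n x} [n b hb|m d' r u x].
  by left; apply: gs0.
rewrite inE => /orP[/eqP[-> ->]|hu] hr _ [h|[m' [r' [em hr' h]]]].
- by right; exists m, r; split=> //; rewrite addrC addKr.
- move/eqP: em; rewrite eqn_add2r => /eqP em; subst m'.
  right; exists m, (r + r'); split=> //; first exact: gZD.
  apply: (gspan_eqv _ h); apply: gBC.
  suff -> : x - act M m r' w - (act M m r w + x - act M m (r + r') w)
      = act M m (r + r') w - (act M m r w + act M m r' w) by exact: actDl.
  by rewrite opprB addrC -addrA; congr (_ + _); rewrite !opprD addrA subrK.
- by left; apply: gsa.
- right; exists m', r'; split=> //.
  by rewrite -addrA; apply: gsa.
Qed.

Section Family.
Variables (O : Type) (P : O -> Prop) (e : nat) (t : O -> triangle e).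
Hypothesis noethR : noeth (reg R).

Let iso y z := miso (tM (t y)) (tM (t z)).
Let iso' y z := miso (tM' (t y)) (tM' (t z)).

(** The kernel of [tj] is generated by [del], so an isomorphism of the modules M' that matches the
    two [del] descends to their images. *)
Lemma low_giso y z (rho : nat -> tM' (t y) -> tM' (t z) -> Prop) :
  giso rho -> glin rho -> rho e.+1 (del (t y)) (del (t z)) ->
  forall (hy : subm (@upto _ (t y) [::])) (hz : subm (@upto _ (t z) [::])),
  miso (subgmd hy) (subgmd hz).
Proof.
move=> gr lr hdel hy hz.
pose R0 n (u : tM (t y)) (v : tM (t z)) := exists u' v',
  [/\ rho n u' v', gB _ n (u - tj u') & gB _ n (v - tj v')].
exists R0; last first.
  move=> m n r u v hr [u' [v' [h bu bv]]].
  exists (act _ m r u'), (act _ m r v'); have [hu hv] := gi_Z gr h.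
  split; first exact: lr.
    apply: gBT (gBC (tj_act hr hu)); apply: act_eqv => //; last exact: tjZ.
    exact: gZ_eqv (gBC bu) (tjZ hu).
  apply: gBT (gBC (tj_act hr hv)); apply: act_eqv => //; last exact: tjZ.
  exact: gZ_eqv (gBC bv) (tjZ hv).
split.
- move=> n u v [u' [v' [/(gi_Z gr) [hu hv] bu bv]]]; split; apply: low_upto; by eexists; eauto.
- move=> n u /= /upto_nil [u' hu' b]; have [v' h] := gi_tot gr hu'.
  by exists (tj v'), u', v'; split=> //; exact: gBxx.
- move=> n u /= /upto_nil [u' hu' b]; have [v' h] := gi_sur gr hu'.
  by exists (tj v'), v', u'; split=> //; exact: gBxx.
- move=> n u v x y' [u' [v' [h bu bv]]] [x' [y'' [h' bx by_]]].
  exists (u' - x'), (v' - y''); split; first exact: (gi_sub gr h h').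
    by rewrite tjB; exact: gB_sub.
  by rewrite tjB; exact: gB_sub.
- move=> n u v [u' [v' [h bu bv]]] /=; rewrite (gB_iff bu) (gB_iff bv).
  have [hu hv] := gi_Z gr h; rewrite (tj_B hu) (tj_B hv).
  split=> [[b|[m [r [en hr b]]]]|[b|[m [r [en hr b]]]]].
  + by left; apply/(gi_B gr h).
  + right; exists m, r; split=> //; subst n.
    by apply/(gi_B gr (gi_sub gr h (lr _ _ _ _ _ hr hdel))).
  + by left; apply/(gi_B gr h).
  + right; exists m, r; split=> //; subst n.
    by apply/(gi_B gr (gi_sub gr h (lr _ _ _ _ _ hr hdel))).
- move=> n u v bu bv; exists 0, 0; split; first exact: gi_0.
    by rewrite tj0 subr0.
  by rewrite tj0 subr0.
Qed.

Lemma triangle_fincol : fincol P iso' -> fincol P iso.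
Proof.
move=> fc; apply: (fincol_refine fc) => x0 px0.
have [rho hrho] : {rho : forall y, nat -> tM' (t x0) -> tM' (t y) -> Prop & forall y, iso' x0 y ->
    giso (rho y) /\ glin (rho y)}.
  have ch y : exists rho : nat -> tM' (t x0) -> tM' (t y) -> Prop, iso' x0 y ->
    giso rho /\ glin rho.
    case: (pselect (iso' x0 y)) => [[rho h1 h2]|ne]; first by exists rho.
    by exists (fun _ _ _ => False).
  exists (fun y => sval (cid (ch y))) => y; exact: (svalP (cid (ch y))).
(* First finite invariant of the extension: the preimage of [del] in the reference M', an element of
   a finite group in degree e + 1. *)
have [F [en hen]] := gfin (tM' (t x0)) e.+1.
apply: (@fincol_code _ _ _ (tM' (t x0)) F en (gZ _ e.+1) (fun y w => rho y e.+1 w (del (t y)))).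
- exact: hen.
- move=> y [py iy]; have [gy _] := hrho _ iy; have [w hw] := gi_sur gy (delZ (t y)).
  by exists w => //; case: (gi_Z gy hw).
move=> w hw; pose P2 y := (P y /\ iso' x0 y) /\ rho y e.+1 w (del (t y)).
rewrite -/P2.
(* The annihilator of [del] is the ideal of elements of R that lift to M. Fixing the preimage of
   [del] makes it common to all members, so one list [lK] of generators serves the whole family. *)
pose K n r := gZ R n r /\ gB (tM' (t x0)) (n + e.+1)%N (act _ n r w).
have [lK [lKK Kl]] : exists l : seq (nat * R), (forall d r, (d, r) \in l -> K d r) /\
    forall n r, K n r -> gspan (M := reg R) l n r.
  apply: (noethR (U := K)); split.
  - by move=> n r [].
  - by move=> n r b; split; [exact: gBZ | exact: actRB].
  - move=> n r r' [h b] [h' b']; split; first exact: gZB.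
    by apply/(gB_iff (actBl h h' hw)); exact: gBB.
  - move=> m n r r' hr [hr' b]; split; first exact: rmulZ.
    apply/(gB_iff (actA hr hr' hw)); rewrite -addnA; exact: actB.
have KE y n r : P2 y -> gZ R n r -> K n r <-> exists u, @lifts _ (t y) n r u.
  move=> [[py iy] hd] hr; have [gy ly] := hrho _ iy; rewrite lifts_del //.
  rewrite -(gi_B gy (ly _ _ _ _ _ hr hd)); by split=> [[]|].
have lKZ d r : (d, r) \in lK -> gZ R d r by move=> /lKK [].
have sub_iso (Ul : forall y, nat -> tM (t y) -> Prop) (hU : forall y, subm (@Ul y)) :
    fincol P2 (fun y z => miso (subgmd (hU y)) (subgmd (hU z))) ->
    (forall y n u, P2 y -> gZ _ n u -> Ul y n u) -> fincol P2 iso.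
  move=> h hall; apply: fincol_sub h => // y z py pz [r gr lr]; exists r => //.
  split.
  - by move=> n u v /(gi_Z gr) [/(subZ (hU y)) ? /(subZ (hU z))].
  - by move=> n u /(hall _ _ _ py); exact: (gi_tot gr).
  - by move=> n u /(hall _ _ _ pz); exact: (gi_sur gr).
  - exact: (gi_sub gr).
  - exact: (gi_B gr).
  - exact: (gi_BB gr).
suff H (l : seq (nat * R)) (hl : {subset l <= lK})
    (hU : forall y, subm (@upto _ (t y) l)) :
    fincol P2 (fun y z => miso (subgmd (hU y)) (subgmd (hU z))).
  apply: (sub_iso _ (fun y => subm_upto (t y) lKZ)); first exact: H.
  move=> y n u py hu; case: (lifts_ex hu) => [[m [r [-> h]]]|h]; last by left.
  right; exists m, r; split=> //; apply: Kl; have [hr _] := liftsZ h.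
  by apply/(KE y) => //; exists u.
elim: l hl hU => [|[d k] l IH] hl hU.
  apply: fincol_triv => y z [[py iy] hy] [[pz iz] hz].
  have [gy ly] := hrho _ iy; have [gz lz] := hrho _ iz.
  apply: (@low_giso y z (gcomp (gsym (rho y)) (rho z))).
  - by apply: giso_comp gz; exact: giso_sym.
  - by move=> m n r a b hr [c ra rb]; exists (act _ m r c); [exact: ly | exact: lz].
  - by exists w.
have hl1 : {subset l <= lK} by move=> x hx; apply: hl; rewrite inE hx orbT.
have lZ d' r' : (d', r') \in l -> gZ R d' r' by move=> /hl1/lKZ.
have dkK : (d, k) \in lK by apply: hl; rewrite mem_head.
have kZ := lKZ _ _ dkK.
have [kap hkap] : {kap : forall y, tM (t y) & forall y, P2 y -> lifts d k (kap y)}.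
  have ch y : exists u : tM (t y), P2 y -> lifts d k u.
    case: (pselect (P2 y)) => [p2|np]; last by exists 0.
    by have [u hu] := proj1 (KE _ _ _ p2 kZ) (lKK _ _ dkK); exists u.
  exists (fun y => sval (cid (ch y))) => y; exact: (svalP (cid (ch y))).
(* The relation ideal of the new generator [kap] is a colon ideal: the r for which r k falls into
   the ideal spanned by l. It is computed inside R and so does not vary with the member. *)
pose I m r := gspan (M := reg R) l (m + d)%N (rmul r k).
apply: (@cyclic_fincol _ _ P2 _ _ _ (fun y => subm_upto (t y) lZ) hU kap (d + e)%N I) => //.
- move=> y n u py [h|[m [r [-> h hs]]]]; first by left.
  right; exists m, r; split=> //; apply: gspan_mono hs => x hx; by rewrite inE hx orbT.
- move=> y py; right; exists d, k; split=> //; first exact: hkap.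
  by apply: gspan_mem => //; rewrite mem_head.
- move=> y n u py [h|[m [r [en' h hs]]]]; first by left; left.
  have [h'|[m' [r' [em hr' h']]]] := gspan_cons (M := reg R) kZ lZ hs.
    by left; right; exists m, r.
  right; exists m', r'; split=> //; first by rewrite en' em addnA.
  right; exists m, (r - rmul r' k); split=> //.
  apply: lifts_sub => //; rewrite em; exact: lifts_act (hkap _ py).
- move=> y m r py hr; have hk := lifts_act hr (hkap _ py).
  rewrite /I addnA; split.
    case=> [/lifts_low h|[m' [r' [/eqP em h hs]]]].
      by apply: gs0; have := lifts_uniq hk h; rewrite subr0.
    move: em; rewrite eqn_add2r => /eqP em; subst m'.
    by apply: gspan_eqv hs; apply: lifts_uniq hk h.
  by move=> h; right; exists (m + d)%N, (rmul r k).
- exact: IH.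
Qed.
End Family.

Lemma gspan_tj e (t : triangle e) l n x : (forall d u, (d, u) \in l -> gZ (tM' t) d u) ->
  gspan l n x -> gspan [seq (a.1, tj a.2) | a <- l] n (tj x : tM t).
Proof.
move=> hl; elim=> {n x} [n b hb|m d r u x hu hr hx IH]; first by apply: gs0; exact: tjBB.
rewrite tjD; apply: (gspan_eqv (x := act (tM t) m r (tj u) + tj x)).
  by apply: gB_add (gBxx _ _); apply: tj_act => //; exact: hl.
by apply: gsa => //; apply/mapP; exists (d, u).
Qed.

(** U is generated by lifts of generators of its image in R, together with the images of generators
    of its preimage in M'. *)
Lemma triangle_noeth e (t : triangle e) : noeth (reg R) -> noeth (tM' t) -> noeth (tM t).
Proof.
move=> nR nM' U hU.
have [lr [hlr slr]] : exists l : seq (nat * R),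
    (forall d r, (d, r) \in l -> exists2 u, lifts d r u & U (d + e)%N (u : tM t)) /\
    (forall n r, (exists2 u, lifts n r u & U (n + e)%N (u : tM t)) -> gspan (M := reg R) l n r).
  apply: (nR (fun n r => exists2 u, lifts n r u & U (n + e)%N (u : tM t))); split.
  - by move=> n r [u /liftsZ []].
  - move=> n r b; exists 0; first by apply: lifts_BB => //; exact: gB0.
    by apply: (subB hU); exact: gB0.
  - move=> n r r' [u h hu] [u' h' hu']; exists (u - u'); first exact: lifts_sub.
    exact: (sub_sub hU).
  - move=> m n r r' hr [u h hu]; exists (act _ m r u); first exact: lifts_act.
    by rewrite -addnA; apply: (sub_act hU).
have [l' [hl' sl']] : exists l : seq (nat * tM' t),
    (forall d u, (d, u) \in l -> gZ (tM' t) d u /\ U d (tj u)) /\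
    (forall n u, gZ (tM' t) n u /\ U n (tj u) -> gspan l n u).
  apply: (nM' (fun n u => gZ (tM' t) n u /\ U n (tj u))); split.
  - by move=> n u [].
  - by move=> n u b; split; [exact: gBZ | apply: (subB hU); exact: tjBB].
  - move=> n u v [h hu] [h' hv]; split; first exact: gZB.
    by rewrite tjB; apply: (sub_sub hU).
  - move=> m n r u hr [h hu]; split; first exact: actZ.
    apply: (sub_eqv hU (gBC (tj_act hr h))); exact: (sub_act hU).
have [lu hlu] : exists lu : seq (nat * tM t), (forall d u, (d, u) \in lu -> U d u) /\
    forall d r, (d, r) \in lr -> exists2 u, lifts d r u & ((d + e)%N, u) \in lu.
  elim: lr hlr {slr} => [|[d r] lr IH] h; first by exists [::].
  have [|lu [h1 h2]] := IH; first by move=> d' r' h'; apply: h; rewrite inE h' orbT.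
  have [u hu Uu] := h d r (mem_head _ _); exists (((d + e)%N, u) :: lu); split.
    by move=> d' u'; rewrite inE => /orP[/eqP[-> ->] //|]; exact: h1.
  move=> d' r'; rewrite inE => /orP[/eqP[-> ->]|/h2 [u' hu' h']].
    by exists u; rewrite ?mem_head.
  by exists u'; rewrite // inE h' orbT.
have [hlu1 hlu2] := hlu.
exists (lu ++ [seq (a.1, tj a.2) | a <- l']); split.
  move=> d u; rewrite mem_cat => /orP[|/mapP[[d' u'] /hl' [_ h] [-> ->]]] //.
  exact: hlu1.
have lowcase n u : U n u -> low n u -> gspan (lu ++ [seq (a.1, tj a.2) | a <- l']) n u.
  move=> hu [u' hu' b].
  have h : gspan l' n u' by apply: sl'; split=> //; exact: (sub_eqv hU b).
  apply: (gspan_eqv b); apply: (gspan_mono (l := [seq (a.1, tj a.2) | a <- l'])).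
    by move=> x hx; rewrite mem_cat hx orbT.
  by apply: gspan_tj => // d v /hl' [].
have lrZ d r : (d, r) \in lr -> gZ R d r by move=> /hlr [u /liftsZ []].
have liftspan m r : gspan (M := reg R) lr m r -> exists2 u, lifts m r u & gspan lu (m + e)%N u.
  elim=> {m r} [n b hb|m d r' u x hu hr' hx [v h1 h2]].
    by exists 0; [apply: lifts_BB => //; exact: gB0 | apply: gs0; exact: gB0].
  have [v' h' hin] := hlu2 _ _ hu.
  exists (act _ m r' v' + v); first by apply: lifts_add => //; exact: lifts_act.
  by rewrite -addnA in h2 *; apply: gsa.
move=> n u hu; case: (lifts_ex (subZ hU hu)) => [[m [r [en h]]]|h]; last exact: lowcase.
subst n; have hs : gspan (M := reg R) lr m r by apply: slr; exists u.
have [v hv sv] := liftspan _ _ hs.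
rewrite -(subrK v u); apply: gspan_add; last first.
  by apply: gspan_mono sv => x hx; rewrite mem_cat hx.
apply: lowcase.
  apply: (sub_sub hU) => //; exact: (sub_gspan hU hlu1).
have := lifts_sub h hv; rewrite subrr => /lifts_B_low; apply; exact: gB0.
Qed.
End Triangle.

Section FincolMore.
Variable O : Type.
Implicit Types (P : O -> Prop) (E : O -> O -> Prop).

Lemma fincol_and P E E' : fincol P E -> fincol P E' -> fincol P (fun x y => E x y /\ E' x y).
Proof.
move=> [F [c h]] [F' [c' h']]; exists (F * F')%type, (fun x => (c x, c' x)) => x y px py [e e'].
by split; [exact: h | exact: h'].
Qed.

Lemma fincol_all (I : eqType) (l : seq I) P (E : I -> O -> O -> Prop) :
  (forall i, i \in l -> fincol P (E i)) -> fincol P (fun x y => forall i, i \in l -> E i x y).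
Proof.
elim: l => [|i l IH] h; first exact: fincol_triv.
have h1 := h i (mem_head _ _).
have h2 : fincol P (fun x y => forall j, j \in l -> E j x y).
  by apply: IH => j hj; apply: h; rewrite inE hj orbT.
apply: fincol_sub (fincol_and h1 h2) => // x y _ _ [e1 e2] j.
by rewrite inE => /orP[/eqP->|/e2].
Qed.
End FincolMore.

Section RingB.
Variable A : grg.
Implicit Types a b c : A.

Lemma rmulDl a b c : rmul (a + b) c = rmul a c + rmul b c.
Proof.
have h0 : rmul (0 : A) c = 0 by have := rmulBl 0 0 c; rewrite !subrr.
by rewrite -[b]opprK rmulBl -[in LHS](sub0r b) rmulBl h0 sub0r !opprK.
Qed.
Lemma rmulDr a b c : rmul c (a + b) = rmul c a + rmul c b.
Proof. by rewrite -[b]opprK rmulBr -[in LHS](sub0r b) rmulBr rmulr0 sub0r !opprK. Qed.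
Lemma rmul0r c : rmul (0 : A) c = 0.
Proof. by have := rmulBl 0 0 c; rewrite !subrr. Qed.
Lemma rmulNl a c : rmul (- a) c = - rmul a c.
Proof. by rewrite -sub0r rmulBl rmul0r sub0r. Qed.

Lemma rmul_eqvr m n a b c : gZ A m c -> gB A n (a - b) -> gB A (m + n)%N (rmul c a - rmul c b).
Proof. by move=> hc b'; rewrite -rmulBr; exact: rmulZB. Qed.
Lemma rmul_even m n a z : ~~ odd n -> gZ A m a -> gZ A n z ->
  gB A (m + n)%N (rmul a z - rmul z a).
Proof. by move=> /negbTE e ha hz; have := rmulC ha hz; rewrite e andbF. Qed.
End RingB.

(** * Algebras free over a polynomial subring k[z] *)

Section Split.
Variables (R : grg) (N : nat).
Hypotheses (N_even : ~~ odd N) (N_gt0 : (0 < N)%N).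

(* A is free over k[z] on the image of sM under the correspondence sj. *)
Record splitting := Splitting {
  sA : grg;
  sM : gmd R;
  sphi : nat -> R -> sA;
  sj : nat -> sM -> sA -> Prop;
  sz : sA;
  sphiZ : forall m r, gZ R m r -> gZ sA m (sphi m r);
  szZ : gZ sA N sz;
  sj_Z : forall n u a, sj n u a -> gZ sM n u /\ gZ sA n a;
  sj_tot : forall n u, gZ sM n u -> exists a, sj n u a;
  sj_sub : forall n u a u' a', sj n u a -> sj n u' a' -> sj n (u - u') (a - a');
  sj_BB : forall n u a, gB sM n u -> gB sA n a -> sj n u a;
  sj_wd : forall n u a, sj n u a -> gB sM n u -> gB sA n a;
  sj_act : forall m n r u a, gZ R m r -> sj n u a ->
    sj (m + n)%N (act sM m r u) (rmul (sphi m r) a);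
  s_ex : forall n a, gZ sA n a -> exists u b c, [/\ sj n u b, gZ sA (n - N)%N c,
    ((n < N)%N -> c = 0) & gB sA n (a - (b + rmul c sz))];
  s_uniq : forall n u b c, sj n u b -> gZ sA (n - N)%N c -> ((n < N)%N -> c = 0) ->
    gB sA n (b + rmul c sz) -> gB sM n u /\ gB sA (n - N)%N c
}.

Section SplitOne.
Variable t : splitting.

Lemma sj0 n : sj (s := t) n 0 0. Proof. by apply: sj_BB; exact: gB0. Qed.
Lemma sj_opp n u a : sj (s := t) n u a -> sj n (- u) (- a).
Proof. by move=> h; rewrite -sub0r -[- a]sub0r; apply: sj_sub (sj0 n) h. Qed.
Lemma sj_add n u a u' a' : sj (s := t) n u a -> sj n u' a' -> sj n (u + u') (a + a').
Proof. by move=> h h'; rewrite -[u']opprK -[a']opprK; apply: sj_sub h (sj_opp h'). Qed.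
Lemma sj_fun n u a u' a' : sj (s := t) n u a -> sj n u' a' -> gB _ n (u - u') -> gB _ n (a - a').
Proof. by move=> h h'; apply: sj_wd (sj_sub h h'). Qed.

End SplitOne.

Section Pair.
Variables (y z : splitting) (rho : nat -> sM y -> sM z -> Prop).
Hypotheses (gr : giso rho) (lr : glin rho).

(* The least additive relation extending rho and commuting with z. *)
Inductive RA : nat -> sA y -> sA z -> Prop :=
| RA_j n u u' a b : rho n u u' -> sj n u a -> sj n u' b -> RA n a b
| RA_z n a b : RA n a b -> RA (n + N)%N (rmul a (sz y)) (rmul b (sz z))
| RA_add n a b a' b' : RA n a b -> RA n a' b' -> RA n (a + a') (b + b')
| RA_BB n a b : gB _ n a -> gB _ n b -> RA n a b.

Lemma RA_Z n a b : RA n a b -> gZ _ n a /\ gZ _ n b.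
Proof.
elim=> {n a b}.
- by move=> n u u' a b _ /sj_Z [_ ha] /sj_Z [_ hb].
- by move=> n a b _ [ha hb]; split; apply: rmulZ => //; exact: szZ.
- by move=> n a b a' b' _ [ha hb] _ [ha' hb']; split; exact: gZD.
- by move=> n a b ha hb; split; exact: gBZ.
Qed.

Lemma RA_opp n a b : RA n a b -> RA n (- a) (- b).
Proof.
elim=> {n a b}.
- by move=> n u u' a b h h1 h2; apply: RA_j (gi_opp gr h) (sj_opp h1) (sj_opp h2).
- by move=> n a b _ h; rewrite -!rmulNl; exact: RA_z.
- by move=> n a b a' b' _ h _ h'; rewrite !opprD; exact: RA_add.
- by move=> n a b ha hb; apply: RA_BB; exact: gBN.
Qed.

Lemma RA_sat n a b a' b' : RA n a b -> gB _ n (a' - a) -> gB _ n (b' - b) -> RA n a' b'.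
Proof.
by move=> h ha hb; rewrite -[a'](subrK a) -[b'](subrK b); apply: RA_add (RA_BB ha hb) h.
Qed.

(** A decomposition as in [s_ex], made on both sides simultaneously; [s_uniq] applied to it shows
    that [RA] preserves and reflects [gB]. *)
Lemma RA_NF n a b : RA n a b -> exists u u' a0 b0 a1 b1,
  [/\ rho n u u', sj n u a0, sj n u' b0 & [/\ RA (n - N)%N a1 b1, (n < N)%N -> a1 = 0 /\ b1 = 0,
   gB _ n (a - (a0 + rmul a1 (sz y))) & gB _ n (b - (b0 + rmul b1 (sz z)))]].
Proof.
elim=> {n a b}.
- move=> n u u' a b h h1 h2; exists u, u', a, b, 0, 0; split=> //; split=> //.
  + by apply: RA_BB; exact: gB0.
  + by rewrite rmul0r addr0; exact: gBxx.
  + by rewrite rmul0r addr0; exact: gBxx.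
- move=> n a b h _; exists 0, 0, 0, 0, a, b; split; try exact: sj0.
    exact: gi_0.
  split; first by rewrite addnK.
  + by rewrite ltnNge leq_addl.
  + by rewrite add0r; exact: gBxx.
  + by rewrite add0r; exact: gBxx.
- move=> n a b a' b' _ [u [u' [a0 [b0 [a1 [b1 [h1 h2 h3 [h4 h5 h6 h7]]]]]]]].
  move=> _ [v [v' [a0' [b0' [a1' [b1' [g1 g2 g3 [g4 g5 g6 g7]]]]]]]].
  exists (u + v), (u' + v'), (a0 + a0'), (b0 + b0'), (a1 + a1'), (b1 + b1'); split.
  + exact: (gi_add gr).
  + exact: sj_add.
  + exact: sj_add.
  split.
  + exact: RA_add.
  + by move=> hn; have [-> ->] := h5 hn; have [-> ->] := g5 hn; rewrite !addr0.
  + by rewrite rmulDl addrACA; exact: gB_add.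
  + by rewrite rmulDl addrACA; exact: gB_add.
- move=> n a b ha hb; exists 0, 0, 0, 0, 0, 0; split; try exact: sj0.
    exact: gi_0.
  split=> //; first by apply: RA_BB; exact: gB0.
  + by rewrite rmul0r addr0 subr0.
  + by rewrite rmul0r addr0 subr0.
Qed.

Lemma RA_giso : giso RA.
Proof.
split.
- exact: RA_Z.
(* Strong induction on the degree: division by z lowers it by N > 0. *)
- move=> n; have [k] := ubnP n; elim: k n => // k IH n hk a ha.
  have [u [b [c [h hc hn0 hB]]]] := s_ex ha.
  have [u' hu'] := gi_tot gr (proj1 (sj_Z h)).
  have [b' hb'] := sj_tot (proj2 (gi_Z gr hu')).
  case: (leqP N n) => hn; last first.
    exists b'; apply: (RA_sat (RA_j hu' h hb') _ (gBxx _ _)).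
    by move: hB; rewrite hn0 // rmul0r addr0.
  have [c' hc'] : exists c', RA (n - N)%N c c' by apply: IH => //; move: hk hn N_gt0; lia.
  exists (b' + rmul c' (sz z)).
  have hz := RA_z hc'; rewrite subnK // in hz.
  exact: (RA_sat (RA_add (RA_j hu' h hb') hz) hB (gBxx _ _)).
- move=> n; have [k] := ubnP n; elim: k n => // k IH n hk a ha.
  have [u [b [c [h hc hn0 hB]]]] := s_ex ha.
  have [u' hu'] := gi_sur gr (proj1 (sj_Z h)).
  have [b' hb'] := sj_tot (proj1 (gi_Z gr hu')).
  case: (leqP N n) => hn; last first.
    exists b'; apply: (RA_sat (RA_j hu' hb' h) (gBxx _ _)).
    by move: hB; rewrite hn0 // rmul0r addr0.
  have [c' hc'] : exists c', RA (n - N)%N c' c by apply: IH => //; move: hk hn N_gt0; lia.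
  exists (b' + rmul c' (sz y)).
  have hz := RA_z hc'; rewrite subnK // in hz.
  exact: (RA_sat (RA_add (RA_j hu' hb' h) hz) (gBxx _ _) hB).
- by move=> n a b a' b' h h'; apply: RA_add h (RA_opp h').
- move=> n; have [k] := ubnP n; elim: k n => // k IH n hk a b.
  move=> /RA_NF [u [u' [a0 [b0 [a1 [b1 [h1 h2 h3 [h4 h5 h6 h7]]]]]]]].
  rewrite (gB_iff h6) (gB_iff h7); have [ha1 hb1] := RA_Z h4.
  split=> hB.
  + have [bu bc] := s_uniq h2 ha1 (fun e => proj1 (h5 e)) hB.
    apply: gBD; first by apply: sj_wd h3 _; apply/(gi_B gr h1).
    case: (leqP N n) => hn; last by rewrite (proj2 (h5 hn)) rmul0r; exact: gB0.
    have b1B : gB _ (n - N)%N b1 by apply/(IH _ _ _ _ h4) => //; move: hk hn N_gt0; lia.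
    by have := rmulBZ b1B (szZ z); rewrite subnK.
  + have [bu bc] := s_uniq h3 hb1 (fun e => proj2 (h5 e)) hB.
    apply: gBD; first by apply: sj_wd h2 _; apply/(gi_B gr h1).
    case: (leqP N n) => hn; last by rewrite (proj1 (h5 hn)) rmul0r; exact: gB0.
    have a1B : gB _ (n - N)%N a1 by apply/(IH _ _ _ _ h4) => //; move: hk hn N_gt0; lia.
    by have := rmulBZ a1B (szZ y); rewrite subnK.
- exact: RA_BB.
Qed.

Lemma RA_act m n r a b : gZ R m r -> RA n a b ->
  RA (m + n)%N (rmul (sphi y m r) a) (rmul (sphi z m r) b).
Proof.
move=> hr; elim=> {n a b}.
- by move=> n u u' a b h h1 h2; apply: RA_j (lr hr h) (sj_act hr h1) (sj_act hr h2).
- by move=> n a b _ h; rewrite !rmulA addnA; exact: RA_z.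
- by move=> n a b a' b' _ h _ h'; rewrite !rmulDr; exact: RA_add.
- by move=> n a b ha hb; apply: RA_BB; apply: rmulZB => //; exact: sphiZ.
Qed.

End Pair.

Definition aiso (A B : grg) := exists2 r : nat -> A -> B -> Prop, giso r &
  forall m n a b a' b', r m a b -> r n a' b' -> r (m + n)%N (rmul a a') (rmul b b').

Section Mult.
Variables (x : gmd R) (y z : splitting).
Variables (ry : nat -> x -> sM y -> Prop) (rz : nat -> x -> sM z -> Prop).
Hypotheses (gy : giso ry) (ly : glin ry) (gz : giso rz) (lz : glin rz).
Let rho := gcomp (gsym ry) rz.
Variables (l : seq (nat * x)) (by_ : nat * x -> sA y) (bz : nat * x -> sA z).
Hypothesis lspan : forall n u, gZ x n u -> gspan l n u.
Hypothesis hby : forall i, i \in l -> exists2 u, ry i.1 i.2 u & sj i.1 u (by_ i).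
Hypothesis hbz : forall i, i \in l -> exists2 u, rz i.1 i.2 u & sj i.1 u (bz i).
Hypothesis hprod : forall i j, i \in l -> j \in l ->
  RA rho (i.1 + j.1)%N (rmul (by_ i) (by_ j)) (rmul (bz i) (bz j)).

Let gr : giso rho. Proof. by apply: giso_comp gz; exact: giso_sym. Qed.
Let lr : glin rho.
Proof. by move=> m n r a b hr [c ra rb]; exists (act _ m r c); [exact: ly | exact: lz]. Qed.

(** Induction on [RA] in which the pieces coming from M are reduced further to the finitely many
    generators of M. It brings multiplicativity of [RA] down to products of two generators. *)
Lemma RA_ind2 (Q : nat -> sA y -> sA z -> Prop) :
  (forall n a b, gB _ n a -> gB _ n b -> Q n a b) ->
  (forall n a b a' b', gZ _ n a -> gZ _ n b -> gZ _ n a' -> gZ _ n b' ->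
     Q n a b -> Q n a' b' -> Q n (a + a') (b + b')) ->
  (forall n a b, gZ _ n a -> gZ _ n b -> Q n a b -> Q (n + N)%N (rmul a (sz y)) (rmul b (sz z))) ->
  (forall m n r a b, gZ R m r -> gZ _ n a -> gZ _ n b -> Q n a b ->
     Q (m + n)%N (rmul (sphi y m r) a) (rmul (sphi z m r) b)) ->
  (forall i, i \in l -> Q i.1 (by_ i) (bz i)) ->
  forall n a b, RA rho n a b -> Q n a b.
Proof.
move=> QB QD Qz Qa Ql n a b; elim=> {n a b}; last exact: QB.
- move=> n u u' a b [c hy hz] ju ju'.
  have hc := lspan (proj1 (gi_Z gy hy)).
  suff [v [v' [a0 [b0 [h1 h2 h3 [h4 h5]]]]]] : exists v v' a0 b0,
      [/\ ry n c v, rz n c v', sj n v a0 & sj n v' b0 /\ Q n a0 b0].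
    have ba : gB _ n (a - a0) by apply: (sj_fun ju h3); apply: (gi_uniq gy hy h1).
    have bb : gB _ n (b - b0) by apply: (sj_fun ju' h4); apply: (gi_uniq gz hz h2).
    have [[_ ha0] [_ hb0]] := (sj_Z h3, sj_Z h4).
    rewrite -[a](subrK a0) -[b](subrK b0); apply: QD => //; try exact: gBZ.
    exact: QB.
  elim: hc {hy hz} => {n c u u' a b ju ju'} [n b hb|m d r u c hu hr hc].
    exists 0, 0, 0, 0; split; try exact: sj0.
    + by apply: (gi_BB gy) => //; exact: gB0.
    + by apply: (gi_BB gz) => //; exact: gB0.
    + by split; [exact: sj0 | apply: QB; exact: gB0].
  move=> [v [v' [a0 [b0 [h1 h2 h3 [h4 h5]]]]]].
  have [w hw jw] := hby hu; have [w' hw' jw'] := hbz hu; rewrite /= in hw jw hw' jw'.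
  exists (act _ m r w + v), (act _ m r w' + v'),
    (rmul (sphi y m r) (by_ (d, u)) + a0), (rmul (sphi z m r) (bz (d, u)) + b0).
  have [[_ Zw] [_ Zw']] := (sj_Z jw, sj_Z jw').
  have [[_ Za] [_ Zb]] := (sj_Z h3, sj_Z h4).
  split.
  + by apply: (gi_add gy) => //; exact: ly.
  + by apply: (gi_add gz) => //; exact: lz.
  + by apply: sj_add => //; exact: sj_act.
  split; first by apply: sj_add => //; exact: sj_act.
  apply: QD => //; try (by apply: rmulZ => //; exact: sphiZ).
  by apply: Qa => //; exact: (Ql (d, u)).
- by move=> n a b /(RA_Z) [ha hb]; exact: Qz.
- by move=> n a b a' b' /RA_Z [ha hb] h /RA_Z [ha' hb'] h'; exact: QD.
Qed.

Lemma RA_mul m n a b a' b' : RA rho m a b -> RA rho n a' b' ->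
  RA rho (m + n)%N (rmul a a') (rmul b b').
Proof.
move=> h h'; move: m a b h n a' b' h'.
apply: (RA_ind2 (Q := fun m a b => forall n a' b', RA rho n a' b' ->
   RA rho (m + n)%N (rmul a a') (rmul b b'))).
- by move=> m a b ha hb n a' b' /RA_Z [ha' hb']; apply: RA_BB; exact: rmulBZ.
- by move=> m a b c d _ _ _ _ h1 h2 n a' b' h'; rewrite !rmulDl; apply: RA_add; [exact: h1 | exact: h2].
- move=> m a b ha hb h n a' b' h'; have [ha' hb'] := RA_Z h'.
  have := RA_z (h _ _ _ h'); rewrite -addnA [(n + N)%N]addnC addnA.
  (* The even degree of z lets it move past d without a sign. *)
  have key (t : splitting) (c d : sA t) : gZ _ m c -> gZ _ n d ->
      gB _ (m + N + n)%N (rmul (rmul c (sz t)) d - rmul (rmul c d) (sz t)).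
    move=> hc hd; rewrite -!rmulA -addnA [(N + n)%N]addnC; apply: rmul_eqvr => //; apply: gBC.
    by apply: rmul_even => //; exact: szZ.
  by move/RA_sat; apply; exact: key.
- move=> m0 m r a b hr ha hb h n a' b' h'; rewrite -!rmulA -addnA.
  by apply: (RA_act lr hr); exact: h.
- move=> i hi.
  have [w hw /sj_Z [_ biZ]] := hby hi; have [w' hw' /sj_Z [_ ciZ]] := hbz hi.
  apply: (RA_ind2 (Q := fun n a' b' => RA rho (i.1 + n)%N (rmul (by_ i) a') (rmul (bz i) b'))).
  + by move=> n a b ha hb; apply: RA_BB; exact: rmulZB.
  + by move=> n a b a' b' _ _ _ _ h h'; rewrite !rmulDr; exact: RA_add.
  + by move=> n a b _ _ h; rewrite !rmulA addnA; exact: RA_z.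
  + move=> m n r a b hr ha hb h.
    have h1 := RA_act lr hr h; rewrite addnA [(m + i.1)%N]addnC -addnA in h1.
    (* Moving the scalar from R to the front costs the sign recorded by s, the same on both sides;
       [RA] is stable under opposites. *)
    pose s := odd m && odd i.1.
    have key (t : splitting) (c d : sA t) : gZ _ i.1 c -> gZ _ n d ->
      gB _ (i.1 + (m + n))%N (rmul c (rmul (sphi t m r) d) -
         (if s then - rmul (sphi t m r) (rmul c d) else rmul (sphi t m r) (rmul c d))).
      move=> hc hd; have hp := sphiZ t hr; rewrite !rmulA addnA.
      have := rmulC hc hp; rewrite /s [odd i.1 && _]andbC; case: ifP => _ hB.
        by rewrite opprK -rmulDl; exact: rmulBZ.
      by rewrite -rmulBl; exact: rmulBZ.
    apply: (RA_sat _ (key _ _ _ biZ ha) (key _ _ _ ciZ hb)).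
    by case: s {key} => //; exact: RA_opp.
  + by move=> j hj; exact: hprod.
Qed.

Lemma splitting_aiso : aiso (sA y) (sA z).
Proof. by exists (RA rho); [exact: RA_giso | exact: RA_mul]. Qed.
End Mult.

Lemma RA_comp (x y z : splitting) (ry : nat -> sM x -> sM y -> Prop) (rz : nat -> sM x -> sM z -> Prop) :
  giso ry -> giso rz -> forall n a b c, RA ry n a b -> RA rz n a c ->
  RA (gcomp (gsym ry) rz) n b c.
Proof.
move=> gy gz n a b c h h'.
suff [c' h1 h2] : exists2 c', RA rz n a c' & RA (gcomp (gsym ry) rz) n b c'.
  apply: (RA_sat h2 (gBxx _ _)); exact: (gi_uniq (RA_giso gz) h' h1).
elim: h {h'} => {n a b c}.
- move=> n u u' a b h ju ju'; have [v hv] := gi_tot gz (proj1 (gi_Z gy h)).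
  have [c jc] := sj_tot (proj2 (gi_Z gz hv)); exists c; first exact: RA_j hv ju jc.
  by apply: (RA_j _ ju' jc); exists u.
- by move=> n a b _ [c h1 h2]; exists (rmul c (sz z)); exact: RA_z.
- by move=> n a b a' b' _ [c h1 h2] _ [c' h1' h2']; exists (c + c'); exact: RA_add.
- by move=> n a b ha hb; exists 0; apply: RA_BB => //; exact: gB0.
Qed.

Lemma splitting_fincol (O : Type) (P : O -> Prop) (t : O -> splitting) :
  (forall y, P y -> noeth (sM (t y))) ->
  fincol P (fun y z => miso (sM (t y)) (sM (t z))) ->
  fincol P (fun y z => aiso (sA (t y)) (sA (t z))).
Proof.
move=> nM fc; apply: (fincol_refine fc) => x0 px0.
have [rho hrho] : {rho : forall y, nat -> sM (t x0) -> sM (t y) -> Prop &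
    forall y, miso (sM (t x0)) (sM (t y)) -> giso (rho y) /\ glin (rho y)}.
  have ch y : exists rho : nat -> sM (t x0) -> sM (t y) -> Prop, miso (sM (t x0)) (sM (t y)) ->
    giso rho /\ glin rho.
    case: (pselect (miso (sM (t x0)) (sM (t y)))) => [[rho h1 h2]|ne]; first by exists rho.
    by exists (fun _ _ _ => False).
  exists (fun y => sval (cid (ch y))) => y; exact: (svalP (cid (ch y))).
have [l [lZ ls]] : exists l : seq (nat * sM (t x0)), (forall d u, (d, u) \in l -> gZ _ d u) /\
    forall n u, gZ _ n u -> gspan l n u.
  apply: (nM x0 px0 (fun n u => gZ _ n u)); split=> //.
  + by move=> n u; exact: gBZ.
  + by move=> n u v; exact: gZB.
  + by move=> m n r u; exact: actZ.
set P2 := (fun y => P y /\ _).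
have [b hb] : {b : forall y, nat * sM (t x0) -> sA (t y) & forall y, P2 y -> forall i, i \in l ->
    exists2 u, rho y i.1 i.2 u & sj i.1 u (b y i)}.
  have ch y i : exists b : sA (t y), P2 y -> i \in l -> exists2 u, rho y i.1 i.2 u & sj i.1 u b.
    case: (pselect (P2 y /\ i \in l)) => [[[py iy] hi]|ne]; last first.
      by exists 0 => h1 h2; case: ne.
    have [gy _] := hrho _ iy; have [v hv] : exists v, rho y i.1 i.2 v.
      by apply: (gi_tot gy); apply: lZ; case: (i) hi.
    by have [b jb] := sj_tot (proj2 (gi_Z gy hv)); exists b => _ _; exists v.
  exists (fun y i => sval (cid (ch y i))) => y hy i; exact: (svalP (cid (ch y i))).
(* The remaining finite invariant: for each pair of generators of M, the preimage of their product
   in the algebra of the reference member. *)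
pose E (ij : (nat * sM (t x0)) * (nat * sM (t x0))) y z := exists2 c,
  RA (rho y) (ij.1.1 + ij.2.1)%N c (rmul (b y ij.1) (b y ij.2)) &
  RA (rho z) (ij.1.1 + ij.2.1)%N c (rmul (b z ij.1) (b z ij.2)).
have fE : fincol P2 (fun y z => forall ij, ij \in [seq (i, j) | i <- l, j <- l] -> E ij y z).
  apply: fincol_all => -[i j] /allpairsP [[i' j'] [/= hi hj [-> ->]]].
  have [F [en hen]] := gfin (sA (t x0)) (i'.1 + j'.1)%N.
  apply: (@fincol_code _ _ _ (sA (t x0)) F en (gZ _ (i'.1 + j'.1)%N) (fun y c =>
     RA (rho y) (i'.1 + j'.1)%N c (rmul (b y i') (b y j')))) => //.
    move=> y p2; have [gy _] := hrho _ (proj2 p2).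
    have [u _ /sj_Z [_ h1]] := hb y p2 _ hi; have [u' _ /sj_Z [_ h2]] := hb y p2 _ hj.
    have [c hc] := gi_sur (RA_giso gy) (rmulZ h1 h2).
    by exists c => //; case: (RA_Z hc).
  move=> c _; apply: fincol_triv => y z [_ h] [_ h']; by exists c.
apply: fincol_sub fE => // y z p2 p2' h.
have [gy ly] := hrho _ (proj2 p2); have [gz lz] := hrho _ (proj2 p2').
refine (splitting_aiso gy ly gz lz ls (hb y p2) (hb z p2') _).
move=> i j hi hj; have [c h1 h2] := h (i, j) (allpairs_f _ hi hj).
exact: RA_comp gy gz _ _ _ _ h1 h2.
Qed.

(** * Hilbert's basis theorem *)

Section Hilbert.
Variable t : splitting.
Hypothesis nM : noeth (sM t).
Notation A := (sA t).
Notation ze := (sz t).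

Definition zm k (c : A) := iter k (fun x => rmul x ze) c.

Lemma zmB k a b : zm k (a - b) = zm k a - zm k b.
Proof. by elim: k => // k IH; rewrite /= IH rmulBl. Qed.
Lemma zm_mul k a b : zm k (rmul a b) = rmul a (zm k b).
Proof. by elim: k => // k IH; rewrite /= IH rmulA. Qed.
Lemma zmBB k n a : gB A n a -> gB A (n + k * N)%N (zm k a).
Proof.
move=> h; elim: k => [|k IH]; first by rewrite addn0.
by rewrite mulSnr addnA; apply: rmulBZ => //; exact: szZ.
Qed.

Definition okc n (c : A) := gZ A (n - N)%N c /\ ((n < N)%N -> c = 0).

Lemma okcB n c d : okc n c -> okc n d -> okc n (c - d).
Proof.
by move=> [h h0] [h' h0']; split; [exact: gZB | move=> hn; rewrite h0 // h0' // subrr].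
Qed.
Lemma okc0 n : okc n 0. Proof. by split=> //; exact: gZ0. Qed.
Lemma okc_act m n r c : gZ R m r -> okc n c -> okc (m + n)%N (rmul (sphi t m r) c).
Proof.
move=> hr [h h0]; have hp := sphiZ t hr; split.
  case: (leqP N n) => hn; first by rewrite -addnBA //; exact: rmulZ.
  by rewrite h0 // rmulr0; exact: gZ0.
by move=> hn; rewrite h0 ?rmulr0 // (leq_ltn_trans (leq_addl _ _) hn).
Qed.

(* Lowest coefficients of the elements of U divisible by z^k, as in Hilbert's
   basis theorem. *)
Definition lowc (U : nat -> A -> Prop) k n u := exists b c,
  [/\ sj n u b, okc n c & U (n + k * N)%N (zm k (b + rmul c ze))].

Lemma sub_zm U k n a : subm (M := reg A) U -> U n a -> U (n + k * N)%N (zm k a).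
Proof.
move=> hU h; elim: k => [|k IH]; first by rewrite addn0.
have hZ := subZ hU IH; rewrite mulSnr addnA.
apply: (sub_eqv hU (x := rmul ze (zm k a))).
  by apply: gBC; apply: rmul_even => //; exact: szZ.
by rewrite [X in U X]addnC; apply: (sub_act hU) => //; exact: szZ.
Qed.

Lemma subm_lowc U k : subm (M := reg A) U -> subm (lowc U k).
Proof.
move=> hU; split.
- by move=> n u [b [c [/sj_Z []]]].
- move=> n u hu; exists 0, 0; split; [apply: sj_BB => //; exact: gB0|exact: okc0|].
  by rewrite rmul0r addr0; apply: (subB hU); apply: zmBB; exact: gB0.
- move=> n u v [b [c [h1 h2 h3]]] [b' [c' [h1' h2' h3']]].
  exists (b - b'), (c - c'); split; [exact: sj_sub|exact: okcB|].
  by rewrite rmulBl addrACA -opprD zmB; apply: (sub_sub hU).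
- move=> m n r u hr [b [c [h1 h2 h3]]]; have hp := sphiZ t hr.
  exists (rmul (sphi t m r) b), (rmul (sphi t m r) c); split; [exact: sj_act|exact: okc_act|].
  by rewrite -rmulA -rmulDr zm_mul -addnA; apply: (sub_act hU).
Qed.

Lemma lowcS U k n u : subm (M := reg A) U -> lowc U k n u -> lowc U k.+1 n u.
Proof.
move=> hU [b [c [h1 h2 h3]]]; exists b, c; split=> //.
by have := sub_zm 1 hU h3; rewrite mul1n mulSnr addnA.
Qed.

Lemma lowc_le U k k' n u : subm (M := reg A) U -> (k <= k')%N -> lowc U k n u -> lowc U k' n u.
Proof. by move=> hU /leP; elim=> // k'' _ IH /IH; exact: lowcS. Qed.

(** Generators of the module of coefficients are lifted to U once and for all; every submodule V
    containing these lifts then has all the coefficients of U at level k. *)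
Lemma lowc_span U k : subm (M := reg A) U -> exists l : seq (nat * A),
  (forall d a, (d, a) \in l -> U d a) /\
  forall V, subm (M := reg A) V -> (forall d a, (d, a) \in l -> V d a) ->
   forall n u, lowc U k n u -> lowc V k n u.
Proof.
move=> hU; have [lu [h1 h2]] := nM (subm_lowc k hU).
suff [l [h3 h4]] : exists l : seq (nat * A), (forall d a, (d, a) \in l -> U d a) /\
   forall V : nat -> A -> Prop, (forall d a, (d, a) \in l -> V d a) ->
   forall d u, (d, u) \in lu -> lowc V k d u.
  exists l; split=> // V hV hl n u /h2; apply: (sub_gspan (subm_lowc k hV)).
  exact: h4.
elim: lu h1 {h2} => [|[d u] lu IH] h; first by exists [::].
have [|l [h3 h4]] := IH; first by move=> d' r' h'; apply: h; rewrite inE h' orbT.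
have [b [c [g1 g2 g3]]] := h d u (mem_head _ _).
exists (((d + k * N)%N, zm k (b + rmul c ze)) :: l); split.
  by move=> d' a'; rewrite inE => /orP[/eqP[-> ->] //|]; exact: h3.
move=> V hV d' u'; rewrite inE => /orP[/eqP[-> ->]|hu'].
  by exists b, c; split=> //; apply: hV; rewrite mem_head.
by apply: h4 hu' => d'' a'' ha; apply: hV; rewrite inE ha orbT.
Qed.

Lemma lowc_stab U : subm (M := reg A) U -> exists K, forall k n u, lowc U k n u -> lowc U K n u.
Proof.
move=> hU; have [] := nM (U := fun n u => exists k, lowc U k n u).
  split.
  - by move=> n u [k /(subZ (subm_lowc k hU))].
  - by move=> n u hu; exists 0%N; apply: (subB (subm_lowc 0 hU)).
  - move=> n u v [k h] [k' h']; exists (maxn k k').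
    apply: (sub_sub (subm_lowc _ hU)); first exact: lowc_le (leq_maxl _ _) h.
    exact: lowc_le (leq_maxr _ _) h'.
  - by move=> m n r u hr [k h]; exists k; apply: (sub_act (subm_lowc _ hU)).
move=> l [h1 h2].
have [K hK] : exists K, forall d u, (d, u) \in l -> lowc U K d u.
  elim: l h1 {h2} => [|[d u] l IH] h; first by exists 0%N.
  have [|K hK] := IH; first by move=> d' r' h'; apply: h; rewrite inE h' orbT.
  have [k hk] := h d u (mem_head _ _); exists (maxn k K) => d' u'.
  rewrite inE => /orP[/eqP[-> ->]|/hK h']; first exact: (lowc_le hU (leq_maxl _ _) hk).
  exact: (lowc_le hU (leq_maxr _ _) h').
exists K => k n u hu; apply: (sub_gspan (subm_lowc K hU) hK); apply: h2; by exists k.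
Qed.

Lemma splitting_noeth : noeth (reg A).
Proof.
move=> U hU; have [K hK] := lowc_stab hU.
have [l [hl lspan]] : exists l : seq (nat * A), (forall d a, (d, a) \in l -> U d a) /\
  forall V, subm (M := reg A) V -> (forall d a, (d, a) \in l -> V d a) ->
   forall k n u, (k < K.+1)%N -> lowc U k n u -> lowc V k n u.
  elim: K.+1 => [|K' [l [h1 h2]]]; first by exists [::].
  have [l' [h1' h2']] := lowc_span K' hU.
  exists (l ++ l'); split.
    by move=> d a; rewrite mem_cat => /orP[/h1|/h1'].
  move=> V hV hVl k n u; rewrite ltnS leq_eqVlt => /orP[/eqP->|hk].
    by apply: h2' => // d a ha; apply: hVl; rewrite mem_cat ha orbT.
  by apply: h2 => // d a ha; apply: hVl; rewrite mem_cat ha.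
exists l; split=> //.
pose V n a := gspan (M := reg A) l n a.
have lZ d a : (d, a) \in l -> gZ (reg A) d a by move=> /hl /(subZ hU).
have hV : subm (M := reg A) V.
  split.
  - by move=> n a; exact: gspan_Z.
  - by move=> n a; exact: gs0.
  - by move=> n a b ha hb; apply: gspan_add => //; exact: gspan_opp.
  - by move=> m n r a hr ha; exact: gspan_act.
have VU n a : V n a -> U n a by apply: (sub_gspan hU).
have hVl d a : (d, a) \in l -> V d a by move=> h; apply: gspan_mem => //; exact: lZ.
(* By stabilisation levels above K bring no new coefficient, so the lifts collected for the levels
   up to K suffice. *)
have H k n u : lowc U k n u -> lowc V k n u.
  case: (leqP k K) => hk h; first exact: lspan.
  by apply: (lowc_le hV (ltnW hk)); apply: lspan => //; exact: hK h.
(* The exponent k must be general: the induction replaces c by c'' of degree n - N and k by k + 1,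
   while the degree n + kN of the element of U stays fixed. *)
suff main n c k : gZ A n c -> U (n + k * N)%N (zm k c) -> V (n + k * N)%N (zm k c).
  by move=> n a ha; have := main n a 0%N (subZ hU ha); rewrite addn0; exact.
have [m] := ubnP n; elim: m n c k => // m IH n c k hm hc hu.
have [u [b [c1 [h1 h2 h3 hB]]]] := s_ex hc.
have hlow : lowc U k n u.
  exists b, c1; split=> //; apply: (sub_eqv hU _ hu).
  by rewrite -zmB; exact: zmBB.
have [b2 [c2 [g1 [g2 g2'] g3]]] := H _ _ _ hlow.
(* [H] provides an element of V with the same lowest coefficient as c; the difference is then
   divisible by z, with quotient c''. *)
pose c'' := c1 - c2.
have [okZ ok0] : okc n c'' by exact: okcB.
have eqc : gB A n (c - (b2 + rmul c2 ze) - rmul c'' ze).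
  rewrite rmulBl; have hb := sj_fun h1 g1 (gBxx _ _).
  have -> : c - (b2 + rmul c2 ze) - (rmul c1 ze - rmul c2 ze)
      = c - (b + rmul c1 ze) + (b - b2).
    by rewrite subr_swap addrK opprD [- b - _]addrC [RHS]addrA addrA subrK.
  exact: gBD.
have eqz : gB A (n + k * N)%N (zm k c - zm k (b2 + rmul c2 ze) - zm k (rmul c'' ze)).
  by rewrite -!zmB; exact: zmBB.
rewrite -(subrK (zm k (b2 + rmul c2 ze)) (zm k c)).
apply: (sub_add hV) => //.
apply: (sub_eqv hV (gBC eqz)).
case: (leqP N n) => hn; last first.
  by rewrite ok0 // rmul0r; apply: (subB hV); apply: zmBB; exact: gB0.
have -> : zm k (rmul c'' ze) = zm k.+1 c'' by rewrite /zm iterSr.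
have en : (n + k * N = (n - N) + k.+1 * N)%N by rewrite mulSn addnA subnK.
rewrite en; apply: IH => //; first by move: hm hn N_gt0; lia.
rewrite -en /zm iterSr; apply: (sub_eqv hU eqz).
by apply: (sub_sub hU) => //; exact: VU.
Qed.
End Hilbert.
End Split.

(** * Homogeneous cochains *)

Section Simplices.
Variable k : comNzRingType.

Definition altsign (n : nat) : k := (-1) ^+ n.
Local Notation sg := altsign.

Lemma sgS n : sg n.+1 = - sg n.
Proof. by rewrite /sg exprS mulN1r. Qed.

Lemma sgD m n : sg (m + n) = sg m * sg n.
Proof. exact: exprD. Qed.

Lemma sg2 n : sg n * sg n = 1.
Proof. by rewrite /sg -expr2 sqrr_sign. Qed.

Lemma sg_odd n : sg (odd n) = sg n.
Proof. exact: signr_odd. Qed.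

Section OneType.
Variable T : Type.
Implicit Types (f g : seq T -> k) (s : seq T).

(* Cochains are functions on lists of vertices, and degree n means lists of size
   n.+1.  [bd s f] evaluates f on the boundary of s; [cut s G] sums G over the
   splittings of s into a front and a back face sharing one vertex. *)
Fixpoint bd s f : k :=
  if s is a :: s' then f s' - bd s' (fun x => f (a :: x)) else 0.

Fixpoint cut s (G : seq T -> seq T -> k) : k :=
  if s is a :: s' then G [:: a] s + cut s' (fun x y => G (a :: x) y) else 0.

Definition cob f : seq T -> k := fun s => bd s f.
Definition cupf f g : seq T -> k := fun s => cut s (fun x y => f x * g y).
Definition onef : seq T -> k := fun s => (size s == 1)%:R.

Lemma eq_bd s f g : (forall x, (size x).+1 = size s -> f x = g x) -> bd s f = bd s g.
Proof.
elim: s f g => //= a s IH f g e; rewrite e //; congr (_ - _).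
by apply: IH => x /= sx; apply: e => /=; rewrite sx.
Qed.

Lemma eq_cut s G H :
  (forall x y, (0 < size x)%N -> (0 < size y)%N ->
    (size x + size y = (size s).+1)%N -> G x y = H x y) -> cut s G = cut s H.
Proof.
elim: s G H => //= a s IH G H e; rewrite e //; congr (_ + _).
by apply: IH => x y hx hy sz; apply: e => //=; rewrite addSn sz.
Qed.

Lemma bd0 s : bd s (fun=> 0) = 0.
Proof. by elim: s => //= a s ->; rewrite subr0. Qed.

Lemma bdD s f g : bd s (fun x => f x + g x) = bd s f + bd s g.
Proof. by elim: s f g => [|a s IH] f g /=; rewrite ?addr0 // IH; ring. Qed.

Lemma bdN s f : bd s (fun x => - f x) = - bd s f.
Proof. by elim: s f => [|a s IH] f /=; rewrite ?oppr0 // IH; ring. Qed.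

Lemma bdB s f g : bd s (fun x => f x - g x) = bd s f - bd s g.
Proof. by rewrite bdD bdN. Qed.

Lemma bdZ s c f : bd s (fun x => c * f x) = c * bd s f.
Proof. by elim: s f => [|a s IH] f /=; rewrite ?mulr0 // IH; ring. Qed.

Lemma bdZr s c f : bd s (fun x => f x * c) = bd s f * c.
Proof. by rewrite mulrC -bdZ; apply: eq_bd => x _; rewrite mulrC. Qed.

Lemma cut0 s : cut s (fun _ _ => 0) = 0.
Proof. by elim: s => //= a s ->; rewrite addr0. Qed.

Lemma cutD s G H : cut s (fun x y => G x y + H x y) = cut s G + cut s H.
Proof. by elim: s G H => [|a s IH] G H /=; rewrite ?addr0 // IH; ring. Qed.

Lemma cutZ s c G : cut s (fun x y => c * G x y) = c * cut s G.
Proof. by elim: s G => [|a s IH] G /=; rewrite ?mulr0 // IH; ring. Qed.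

Lemma cutN s G : cut s (fun x y => - G x y) = - cut s G.
Proof. by elim: s G => [|a s IH] G /=; rewrite ?oppr0 // IH; ring. Qed.

Lemma bd_bd s f : bd s (fun x => bd x f) = 0.
Proof.
elim: s f => //= a s IH f.
by rewrite bdB IH subr0 subrr.
Qed.

Lemma cob_cob f : cob (cob f) = fun=> 0.
Proof. by apply: funext => s; exact: bd_bd. Qed.

(** Additive functionals play the part of chains in a second variable: they commute with [bd] and
    [cut] ([bd_lin], [cut_lin]), which allows sums over two simplices to be interchanged. *)
Definition additive_fl Y (psi : (Y -> k) -> k) :=
  forall f g : Y -> k, psi (fun y => f y - g y) = psi f - psi g.

Lemma addfl0 Y (psi : (Y -> k) -> k) : additive_fl psi -> psi (fun=> 0) = 0.
Proof.
move=> h; rewrite -[RHS](subrr (psi (fun=> 0))) -h.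
by congr psi; apply: funext => y; rewrite subr0.
Qed.

Lemma addflN Y (psi : (Y -> k) -> k) (f : Y -> k) :
  additive_fl psi -> psi (fun y => - f y) = - psi f.
Proof.
move=> h; rewrite -[RHS]sub0r -(addfl0 h) -h.
by congr psi; apply: funext => y; rewrite sub0r.
Qed.

Lemma addflD Y (psi : (Y -> k) -> k) (f g : Y -> k) :
  additive_fl psi -> psi (fun y => f y + g y) = psi f + psi g.
Proof.
move=> h; rewrite -[psi g]opprK -(addflN _ h) -h.
by congr psi; apply: funext => y; rewrite opprK.
Qed.

Lemma addfl_sg Y (psi : (Y -> k) -> k) n (f : Y -> k) :
  additive_fl psi -> psi (fun y => sg n * f y) = sg n * psi f.
Proof.
move=> h; rewrite -sg_odd /sg; case: (odd n) => /=.
  by rewrite expr1 mulN1r -(addflN _ h); congr psi; apply: funext => y; rewrite mulN1r.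
by rewrite expr0 mul1r; congr psi; apply: funext => y; rewrite mul1r.
Qed.

Lemma addfl_sum Y (psi : (Y -> k) -> k) n (H : nat -> Y -> k) : additive_fl psi ->
  psi (fun y => \sum_(i < n) H i y) = \sum_(i < n) psi (H i).
Proof.
move=> h; elim: n => [|n IH].
  by rewrite big_ord0 -[RHS](addfl0 h); congr psi; apply: funext => y; rewrite big_ord0.
rewrite big_ord_recr -IH -[RHS](addflD _ _ h); congr psi; apply: funext => y.
by rewrite big_ord_recr.
Qed.

Lemma cut_sum s n (H : nat -> seq T -> seq T -> k) :
  cut s (fun x y => \sum_(i < n) H i x y) = \sum_(i < n) cut s (H i).
Proof.
elim: n => [|n IH].
  by rewrite big_ord0 -[RHS](cut0 s); apply: eq_cut => *; rewrite big_ord0.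
by rewrite big_ord_recr /= -IH -cutD; apply: eq_cut => *; rewrite big_ord_recr.
Qed.

Lemma bd_lin Y (psi : (Y -> k) -> k) s (H : seq T -> Y -> k) : additive_fl psi ->
  psi (fun y => bd s (fun x => H x y)) = bd s (fun x => psi (H x)).
Proof.
move=> h; elim: s H => [|a s IH] H /=; first exact: addfl0.
by rewrite h IH.
Qed.

Lemma cut_lin Y (psi : (Y -> k) -> k) s (H : seq T -> seq T -> Y -> k) :
  additive_fl psi ->
  psi (fun y => cut s (fun u v => H u v y)) = cut s (fun u v => psi (H u v)).
Proof.
move=> h; elim: s H => [|a s IH] H /=; first exact: addfl0.
by rewrite addflD // IH.
Qed.

Lemma additive_bd s : additive_fl (bd s).
Proof. by move=> f g; exact: bdB. Qed.

(* Alexander-Whitney: the Leibniz rule for a function of two simplices. *)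
Lemma bd_cut s G : (forall x, G x [::] = 0) ->
  bd s (fun x => cut x G) =
  cut s (fun x y => bd x (fun u => G u y) + sg (size x).+1 * bd y (G x)) - G [::] s.
Proof.
elim: s G => [|a s IH] G G0 /=; first by rewrite G0 subr0.
rewrite bdD IH => [|x]; last exact: G0.
rewrite /sg expr2 mulrNN mulr1 mul1r subr0.
set B := bd s _; set X := cut s _; set Y := cut s _.
suff -> : cut s (fun x y => bd (a :: x) (fun u => G u y) +
    (-1) ^+ (size (a :: x)).+1 * bd y (G (a :: x))) = X - Y by ring.
rewrite /X /Y -cutN -cutD; apply: eq_cut => x y _ _ _.
by rewrite /= !exprS; ring.
Qed.

Lemma cutA s (H : seq T -> seq T -> seq T -> k) :
  cut s (fun x z => cut x (fun u v => H u v z)) =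
  cut s (fun u y => cut y (fun v z => H u v z)).
Proof.
elim: s H => //= a s IH H.
rewrite addr0 cutD IH; ring.
Qed.

Lemma cupfA f g h : cupf f (cupf g h) = cupf (cupf f g) h.
Proof.
apply: funext => s; rewrite /cupf.
under eq_cut => x y _ _ _ do rewrite -cutZ.
rewrite -cutA; apply: eq_cut => x y _ _ _.
rewrite mulrC -cutZ; apply: eq_cut => u v _ _ _; ring.
Qed.

Lemma cut_one_l s G : (0 < size s)%N ->
  cut s (fun x y => (size x == 1)%:R * G y) = G s.
Proof.
case: s => // a s _ /=; rewrite mul1r -[RHS]addr0; congr (_ + _).
rewrite -[RHS](cut0 s); apply: eq_cut => x y hx _ _.
by case: x hx => // b x _ /=; rewrite mul0r.
Qed.

Lemma cut_one_r s G : (0 < size s)%N ->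
  cut s (fun x y => G x * (size y == 1)%:R) = G s.
Proof.
elim: s G => // a [|b s] IH G _ /=; first by rewrite mulr1 addr0.
by move: (IH (fun x => G (a :: x)) isT) => /= ->; rewrite mulr0 add0r.
Qed.

End OneType.

Lemma bd_map T T' (u : T -> T') s f : bd (map u s) f = bd s (fun x => f (map u x)).
Proof. by elim: s f => //= a s IH f; rewrite IH. Qed.

Lemma cut_map T T' (u : T -> T') s G :
  cut (map u s) G = cut s (fun x y => G (map u x) (map u y)).
Proof. by elim: s G => //= a s IH G; rewrite IH. Qed.

(* Two maps of vertex sets induce homotopic maps. *)
Section Prism.
Variables (T T' : Type) (u v : T -> T').

Fixpoint prism s (f : seq T' -> k) : k :=
  if s is a :: s' then
    f (u a :: v a :: map v s') - prism s' (fun x => f (u a :: x)) else 0.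

Lemma prismB s f g : prism s (fun x => f x - g x) = prism s f - prism s g.
Proof. by elim: s f g => [|a s IH] f g /=; rewrite ?subr0 // IH; ring. Qed.

Lemma prism_bd s f :
  prism s (fun x => bd x f) + bd s (fun x => prism x f) =
  f (map v s) - f (map u s).
Proof.
elim: s f => [|a s IH] f /=; first by rewrite addr0 subrr.
have H := IH (fun x => f (u a :: x)).
move/(canRL (addrK _)): H => H.
by rewrite bdB prismB !bd_map H; ring.
Qed.

End Prism.
End Simplices.

(** * Steenrod powers *)

Section Tensor.
Variable k : comNzRingType.
Local Notation sg := (altsign k).

Lemma sgM2 m n : sg (m * n.+1) = sg (m * n) * sg m.
Proof. by rewrite mulnS addnC sgD. Qed.

Section OneType.
Variable T : Type.
Implicit Types (F G : seq (seq T) -> k) (s x : seq T) (w : seq (seq T)).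

Fixpoint tbd w F : k :=
  if w is s :: w' then
    bd s (fun x => F (x :: w')) + sg (size s).+1 * tbd w' (fun v => F (s :: v))
  else 0.

Definition tcob F w := tbd w F.

(** A simplex of degree n is a list of n + 1 vertices and counts n + 2, which has the parity of n;
    signs computed from [tdg] are therefore the Koszul signs. *)
Definition tdg w := sumn [seq (size s).+1 | s : seq T <- w].
Definition hase w := has (fun s : seq T => size s == 0) w.

Lemma tdg_rcons w s : tdg (rcons w s) = (tdg w + (size s).+1)%N.
Proof. by rewrite /tdg map_rcons sumn_rcons. Qed.

Lemma eq_tbd w F G :
  (forall v, size v = size w -> (tdg v).+1 = tdg w -> (hase w -> hase v) -> F v = G v) ->
  tbd w F = tbd w G.
Proof.
elim: w F G => //= s w IH F G e; congr (_ + _ * _).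
  apply: eq_bd => x sx; apply: e => //=; first by rewrite /tdg /= -sx.
  by rewrite -sx /= => ->; rewrite orbT.
apply: IH => v sv tv hv; apply: e => /=; first by rewrite sv.
  by rewrite /tdg /= -/(tdg v) -/(tdg w) -tv addnS.
by case/orP => [->|/hv ->]; rewrite ?orbT.
Qed.

Lemma tbdB w F G : tbd w (fun v => F v - G v) = tbd w F - tbd w G.
Proof.
elim: w F G => [|s w IH] F G /=; first by rewrite subr0.
by rewrite bdB IH; ring.
Qed.

Lemma additive_tbd w : additive_fl (tbd w).
Proof. by move=> F G; exact: tbdB. Qed.

Lemma tbd0 w : tbd w (fun=> 0) = 0.
Proof. exact: (addfl0 (@additive_tbd w)). Qed.

Lemma tbdZ w c F : tbd w (fun v => c * F v) = c * tbd w F.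
Proof.
elim: w F => [|s w IH] F /=; first by rewrite mulr0.
by rewrite bdZ IH; ring.
Qed.

Lemma tbd_tbd w F : tbd w (tcob F) = 0.
Proof.
rewrite /tcob; elim: w F => //= s w IH F.
rewrite bdD bd_bd add0r addflD; last exact: additive_tbd.
rewrite tbdZ IH mulr0 addr0.
have -> : bd s (fun x => sg (size x).+1 * tbd w (fun v => F (x :: v))) =
          bd s (fun x => sg (size s) * tbd w (fun v => F (x :: v))).
  by apply: eq_bd => x ->.
rewrite bdZ sgS (bd_lin _ (fun x v => F (x :: v)) (@additive_tbd w)); ring.
Qed.

Lemma tbd_rcons w s F :
  tbd (rcons w s) F =
  tbd w (fun v => F (rcons v s)) + sg (tdg w) * bd s (fun x => F (rcons w x)).
Proof.
elim: w F => [|x w IH] F /=; first by rewrite mulr0 addr0 add0r /altsign mul1r.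
by rewrite IH /tdg /= -/(tdg w) sgD mulrDr addrA mulrA.
Qed.

(** Dual of the cyclic rotation of tensor factors, with the Koszul sign of moving the first factor
    past the others. *)
Definition rotT F w :=
  if w is s :: w' then sg ((size s).+1 * tdg w') * F (rcons w' s) else F [::].

Lemma rotT_tcob F : rotT (tcob F) = tcob (rotT F).
Proof.
apply: funext => -[|s w] //=; rewrite /tcob /= tbd_rcons mulrDr addrC; congr (_ + _).
  rewrite mulrA -bdZ; apply: eq_bd => x sx; rewrite sx; congr (_ * _).
  by rewrite mulnC sgM2 -mulrA sg2 mulr1 mulnC.
rewrite -!tbdZ; apply: eq_tbd => v _ <- _; rewrite sgM2 mulrA; ring.
Qed.

Lemma rotTB F G : rotT (fun w => F w - G w) = (fun w => rotT F w - rotT G w).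
Proof. by apply: funext => -[|s w] //=; ring. Qed.

Fixpoint sgrot D w : nat :=
  if w is s :: w' then ((size s).+1 * (D + (size s).+1) + sgrot D w')%N else 0%N.

Lemma iter_rotT w v F :
  iter (size w) rotT F (w ++ v) = sg (sgrot (tdg (w ++ v)) w) * F (v ++ w).
Proof.
elim: w v => [|s w IH] v /=; first by rewrite cats0 /altsign mul1r.
rewrite rcons_cat IH -cats1 -catA cat1s mulrA -sgD; congr (_ * _).
have -> : tdg (w ++ v ++ [:: s]) = tdg (s :: w ++ v).
  by rewrite /tdg /= !map_cat !sumn_cat /=; lia.
rewrite (sgD _ (_ * _)) [RHS]sgD; congr (_ * _).
have -> : tdg (s :: w ++ v) = ((size s).+1 + tdg (w ++ v))%N by [].
have E a b : odd (a * b)%N = odd (a * (a + b + a))%N.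
  by rewrite !oddM !oddD; do 2 case: (odd _).
by rewrite -sg_odd E sg_odd.
Qed.

(** With D the total of the weights a, the exponent is the sum of a (D + a), congruent to D^2 + D
    modulo 2. Hence the r-th power of the rotation is the identity on words of length r. *)
Lemma sgrot_full w : odd (sgrot (tdg w) w) = false.
Proof.
have H D u : odd (sgrot D u) = (odd (tdg u) && odd D) (+) odd (tdg u).
  elim: u => //= s u IH; rewrite /tdg /= -/(tdg u) oddD IH oddM !oddD.
  by rewrite /=; case: (odd (size s)); case: (odd D); case: (odd (tdg u)).
by rewrite H andbb addbb.
Qed.

Lemma iter_rotT_full F w : iter (size w) rotT F w = F w.
Proof.
have := iter_rotT w [::] F; rewrite cats0 /= => ->.
by rewrite -sg_odd sgrot_full /altsign mul1r.
Qed.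

Definition okl r w := (size w == r) && ~~ hase w.
Definition good r F := forall w, ~~ okl r w -> F w = 0.

Lemma good_rotT r F : good r F -> good r (rotT F).
Proof.
move=> gF [|s w] h /=; first exact: gF.
rewrite gF ?mulr0 //; move: h.
by rewrite /okl /hase size_rcons has_rcons.
Qed.

Lemma good_iter r F i : good r F -> good r (iter i rotT F).
Proof. by move=> gF; elim: i => //= i; exact: good_rotT. Qed.

Lemma good_tcob r F : good r F -> good r (tcob F).
Proof.
move=> gF w h; rewrite /tcob -[RHS](tbd0 w); apply: eq_tbd => v sv _ hv.
apply: gF; move: h; rewrite /okl sv; case: (_ == r) => //=.
by rewrite !negbK.
Qed.

Lemma iter_rotT_r r F : good r F -> iter r rotT F = F.
Proof.
move=> gF; apply: funext => w; case: (eqVneq (size w) r) => [<-|ne].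
  exact: iter_rotT_full.
by rewrite (good_iter _ gF) ?gF // /okl (negbTE ne).
Qed.

(* The differentials of the periodic resolution of the cyclic group of rotations. *)
Definition theta r i F : seq (seq T) -> k := fun w =>
  if odd i then rotT F w - F w else \sum_(j < r) iter j rotT F w.

Lemma good_theta r i F : good r F -> good r (theta r i F).
Proof.
move=> gF w h; rewrite /theta; case: ifP => _.
  by rewrite (good_rotT gF) // (gF w) // subrr.
by apply: big1 => j _; rewrite (good_iter _ gF).
Qed.

Lemma iter_rotTB j F G :
  iter j rotT (fun w => F w - G w) = (fun w => iter j rotT F w - iter j rotT G w).
Proof. by elim: j => //= j ->; rewrite rotTB. Qed.

Lemma thetaB r i F G w :
  theta r i (fun w => F w - G w) w = theta r i F w - theta r i G w.
Proof.
rewrite /theta; case: ifP => _; first by rewrite rotTB; ring.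
by rewrite -sumrB; apply: eq_bigr => j _; rewrite iter_rotTB.
Qed.

Lemma rotT_sum r (H : nat -> seq (seq T) -> k) w :
  rotT (fun v => \sum_(j < r) H j v) w = \sum_(j < r) rotT (H j) w.
Proof. by case: w => //= s w; rewrite mulr_sumr. Qed.

Lemma theta_tcob r i F : theta r i (tcob F) = tcob (theta r i F).
Proof.
have it j : iter j rotT (tcob F) = tcob (iter j rotT F).
  by elim: j => //= j ->; rewrite rotT_tcob.
apply: funext => w; rewrite /theta /tcob; case: (odd i).
  by rewrite tbdB rotT_tcob.
under eq_bigr => j _ do rewrite it /tcob.
elim: r => [|r IH]; first by rewrite big_ord0 -[LHS](tbd0 w); apply: eq_tbd => v _ _ _; rewrite big_ord0.
rewrite big_ord_recr /= IH -addflD; last exact: additive_tbd.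
by apply: eq_tbd => v _ _ _; rewrite big_ord_recr.
Qed.

Lemma theta_theta r i F : good r F -> theta r i (theta r i.+1 F) = (fun=> 0).
Proof.
move=> gF; have tel w : \sum_(j < r) (iter j.+1 rotT F w - iter j rotT F w) = 0.
  rewrite -(big_mkord xpredT (fun j => iter j.+1 rotT F w - iter j rotT F w)).
  by rewrite telescope_sumr // iter_rotT_r // subrr.
apply: funext => w; rewrite /theta /=; case: (odd i) => /=.
  rewrite (rotT_sum r (fun j => iter j rotT F)) -sumrB -[RHS](tel w).
  by apply: eq_bigr.
rewrite -[RHS](tel w); apply: eq_bigr => j _.
by rewrite iter_rotTB -iterSr.
Qed.

(* Contraction of the r-fold tensor product obtained by coning at the vertex a. *)
Fixpoint ct a w F : k :=
  if w is s :: w' then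
    if size s == 0%N then 0 else
    F ((a :: s) :: w') + (if size s == 1%N then ct a w' (fun v => F ([:: a] :: v)) else 0)
  else 0.

Definition ctr a F w := ct a w F.

Definition aug a F w := if all (fun s : seq T => size s == 1%N) w
  then F [seq [:: a] | _ <- w] else 0.

Lemma ctB a w F G : ct a w (fun v => F v - G v) = ct a w F - ct a w G.
Proof.
elim: w F G => [|s w IH] F G /=; first by rewrite subr0.
case: ifP => _; first by rewrite subr0.
by rewrite IH; case: ifP => _; ring.
Qed.

Lemma additive_ct a w : additive_fl (ct a w).
Proof. by move=> F G; exact: ctB. Qed.

Lemma good_ctr r a F : good r F -> good r (ctr a F).
Proof.
move=> gF w; rewrite /ctr /okl.
elim: w r F gF => [|s w IH] r F gF /= h //.
case: ifP => // s0; move: h; rewrite s0 /= => h.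
rewrite gF ?add0r; last by rewrite /okl /= .
case: ifP => // _; case: r gF h => [|r] gF h.
  have -> : (fun v => F ([:: a] :: v)) = fun=> 0 by apply: funext => v; rewrite gF.
  by rewrite (addfl0 (@additive_ct a w)).
by apply: (IH r) => // v hv; apply: gF; rewrite /okl /= eqSS.
Qed.

(** Homotopy identity for the contraction: it deforms the identity into [aug], the projection to the
    constant word at a. *)
Lemma ct_tbd a F w : (forall v, hase v -> F v = 0) -> ~~ hase w ->
  ct a w (tcob F) + tbd w (ctr a F) = F w - aug a F w.
Proof.
elim: w F => [|s w IH] F gF /=; first by rewrite /aug /= subrr addr0.
rewrite negb_or => /andP[s0 hw]; rewrite (negbTE s0) /tcob /= /ctr /=.
have gF1 v : hase v -> F ([:: a] :: v) = 0 by move=> hv; rewrite gF //= hv.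
have IH1 := IH _ gF1 hw.
have E1 : ct a w (fun v => F [:: [::], [:: a] & v] ) = 0.
  rewrite -(addfl0 (@additive_ct a w)); congr ct; apply: funext => v.
  by rewrite gF.
have E2 : ct a w (fun v => tbd ([:: a] :: v) F) = ct a w (tcob (fun v => F ([:: a] :: v))).
  congr ct; apply: funext => v /=.
  by rewrite gF //= /altsign expr2 mulrNN mulr1 mul1r subr0 add0r.
case: s s0 => [|b [|c s]] // _.
- rewrite [size [:: b] == 1%N]eqxx E2 /=.
  have -> : tbd w (fun v => F [:: [:: a; b] & v] + ct a v (fun u => F ([:: a] :: u))) =
      tbd w (fun v => F [:: [:: a; b] & v]) + tbd w (ctr a (fun u => F ([:: a] :: u))).
    by rewrite addflD //; exact: additive_tbd.
  move: IH1; rewrite /aug /=.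
  set A := ct a w _; set B := tbd w (ctr _ _); set X := tbd w _; set Y := if _ then _ else _.
  move/(canRL (addrK _)) => ->.
  by rewrite /altsign; ring.
- rewrite (_ : size [:: b, c & s] == 1%N = false) // addr0.
  have -> : bd (b :: c :: s) (fun x => if size x == 0%N then 0 else F ((a :: x) :: w) +
      (if size x == 1%N then ct a w (fun v => F ([:: a] :: v)) else 0)) =
      bd (b :: c :: s) (fun x => F ((a :: x) :: w)).
    case: s => [|d s]; first by rewrite /=; ring.
    by apply: eq_bd => -[|e [|e' x]] //= _; rewrite addr0.
  have -> : aug a F ((b :: c :: s) :: w) = 0 by [].
  rewrite (sgS _ (size _).+1); set A := tbd w _.
  have -> : tbd w (fun v => F [:: [:: a, b, c & s] & v] + 0) = A.
    by congr tbd; apply: funext => v; rewrite addr0.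
  ring.
Qed.

End OneType.
End Tensor.

Section Power.
Variable k : comNzRingType.
Local Notation sg := (altsign k).

Section OneType.
Variable T : Type.
Implicit Types (F G : seq (seq T) -> k) (s x : seq T) (w : seq (seq T)).

Fixpoint tcut r s F : k :=
  if r is r'.+1 then cut s (fun x y => tcut r' y (fun w => F (x :: w)))
  else (size s == 1%N)%:R * F [::].

(** Acyclic models made explicit: the value on s comes from applying the contraction at the first
    vertex of s to the boundary that the new diagonal must have. The recursion passes to faces, so
    the size of s is enough fuel. *)
Definition fillc (P : seq T -> (seq (seq T) -> k) -> k) r i :=
  fix phin n s F {struct n} : k :=
    match n, s with
    | n'.+1, a :: _ =>
        sg i * bd s (fun x => phin n' x (ctr a F)) + P s (theta r i (ctr a F))
    | _, _ => 0
    end.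

(* The carrier [phi r i] is a natural equivariant system of higher diagonals:
   [phi r 0] is the r-fold Alexander-Whitney diagonal, and the boundary of
   [phi r i.+1] is [phi r i] followed by T - 1 or by the norm of the rotation T. *)
Fixpoint phi r i : seq T -> (seq (seq T) -> k) -> k :=
  if i is i'.+1 then fun s => fillc (phi r i') r i (size s) s else tcut r.

Lemma tcutB r s F G : tcut r s (fun w => F w - G w) = tcut r s F - tcut r s G.
Proof.
elim: r s F G => [|r IH] s F G /=; first by ring.
by rewrite -cutN -cutD; apply: eq_cut => x y _ _ _; rewrite IH.
Qed.

Lemma additive_tcut r s : additive_fl (tcut r s).
Proof. by move=> F G; exact: tcutB. Qed.

Lemma ctrB a F G : ctr a (fun w => F w - G w) = (fun w => ctr a F w - ctr a G w).
Proof. by apply: funext => w; rewrite /ctr ctB. Qed.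

Lemma theta_fB r i F G :
  theta r i (fun w => F w - G w) = (fun w => theta r i F w - theta r i G w).
Proof. by apply: funext => w; rewrite thetaB. Qed.

Lemma phiS r i a s F :
  phi r i.+1 (a :: s) F =
  sg i.+1 * bd (a :: s) (fun x => phi r i.+1 x (ctr a F)) +
  phi r i (a :: s) (theta r i.+1 (ctr a F)).
Proof.
change (phi r i.+1 (a :: s) F) with (sg i.+1 *
  bd (a :: s) (fun x => fillc (phi r i) r i.+1 (size s) x (ctr a F)) +
  phi r i (a :: s) (theta r i.+1 (ctr a F))).
by congr (_ * _ + _); apply: eq_bd => x [<-].
Qed.

Lemma phiB r i s F G : phi r i s (fun w => F w - G w) = phi r i s F - phi r i s G.
Proof.
elim: i s F G => [|i IHi] s F G; first exact: tcutB.
elim: {s}(size s) {-2}s (erefl (size s)) F G => [|n IHn] [|a s] // sz F G.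
  by rewrite /= subr0.
rewrite !phiS ctrB theta_fB IHi.
have -> : bd (a :: s) (fun x => phi r i.+1 x (fun w => ctr a F w - ctr a G w)) =
    bd (a :: s) (fun x => phi r i.+1 x (ctr a F) - phi r i.+1 x (ctr a G)).
  by apply: eq_bd => x /= [sx]; apply: IHn; rewrite sx; case: sz.
rewrite bdB; ring.
Qed.

Lemma additive_phi r i s : additive_fl (phi r i s).
Proof. by move=> F G; exact: phiB. Qed.

Lemma phi0 r i s : phi r i s (fun=> 0) = 0.
Proof. exact: (addfl0 (@additive_phi r i s)). Qed.

Lemma rotTZ c F : rotT (fun w => c * F w) = fun w => c * rotT F w.
Proof. by apply: funext => -[|s w] //=; rewrite mulrCA. Qed.

Lemma iter_rotTZ j c F :
  iter j (@rotT k T) (fun w => c * F w) = fun w => c * iter j (@rotT k T) F w.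
Proof. by elim: j => //= j ->; rewrite rotTZ. Qed.

Lemma thetaZ r i c F : theta r i (fun w => c * F w) = fun w => c * theta r i F w.
Proof.
apply: funext => w; rewrite /theta rotTZ; case: ifP => _; first by rewrite -mulrBr.
by rewrite mulr_sumr; apply: eq_bigr => j _; rewrite iter_rotTZ.
Qed.

Lemma ctrZ a c F : ctr a (fun w => c * F w) = fun w => c * ctr a F w.
Proof.
apply: funext => w; rewrite /ctr; elim: w F => [|s w IH] F /=; first by rewrite mulr0.
case: ifP => _; first by rewrite mulr0.
by rewrite IH mulrDr; case: ifP => _ //; rewrite mulr0.
Qed.

Lemma phiZ r i s c F : phi r i s (fun w => c * F w) = c * phi r i s F.
Proof.
elim: i s F => [|i IHi] s F.
  elim: r s F => [|r IH] s F /=; first by rewrite mulrCA.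
  by rewrite -cutZ; apply: eq_cut => x y _ _ _; exact: (IH y (fun w => F (x :: w))).
elim: {s}(size s).+1 {-2}s (ltnSn (size s)) F => // n IHn [|a s] sz F; first by rewrite mulr0.
rewrite !phiS ctrZ thetaZ IHi.
have -> : bd (a :: s) (fun x => phi r i.+1 x (fun w => c * ctr a F w)) =
    bd (a :: s) (fun x => c * phi r i.+1 x (ctr a F)).
  by apply: eq_bd => x sx; apply: IHn; rewrite sx -ltnS.
rewrite bdZ; ring.
Qed.

Lemma tcut_cob r s F : (forall w, hase w -> F w = 0) ->
  bd s (fun x => tcut r x F) = tcut r s (tcob F).
Proof.
elim: r s F => [|r IH] s F gF /=.
  rewrite mulr0 bdZr (_ : bd s _ = 0) ?mul0r //.
  case: s => [|a [|b [|c s]]] /=; try ring.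
  by rewrite bd0; ring.
rewrite bd_cut => [|x]; last by case: r {IH} => [|r] //=; rewrite mul0r.
have -> : tcut r s (fun w => F ([::] :: w)) = 0.
  have -> : (fun w => F ([::] :: w)) = fun=> 0 by apply: funext => w; rewrite gF.
  by move: (phi0 r 0 s).
rewrite subr0; apply: eq_cut => x y sx _ _.
transitivity (tcut r y (fun w => bd x (fun u => F (u :: w)) +
    sg (size x).+1 * tcob (fun v => F (x :: v)) w)); last by [].
rewrite (addflD _ _ (@additive_tcut r y)) /=; congr (_ + _).
  by rewrite (bd_lin _ (fun u w => F (u :: w)) (@additive_tcut r y)).
rewrite (addfl_sg _ _ (@additive_tcut r y)) IH // => w hw.
by rewrite gF //= hw orbT.
Qed.

Lemma rotT_aug r a F : good r F -> rotT (aug a F) = aug a F.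
Proof.
move=> gF; apply: funext => -[|s w] //=.
rewrite /aug all_rcons /= map_rcons /=; case: ifP => [/andP[/eqP s1 h]|_]; last exact: mulr0.
have -> : rcons [seq [:: a] | _ <- w] [:: a] = [:: a] :: [seq [:: a] | _ <- w].
  by elim: w {h} => //= x w ->.
rewrite s1 mul2n -sg_odd odd_double /altsign mul1r //.
Qed.

(** The contraction always creates a simplex with at least two vertices, on which [aug] vanishes.
    The augmentation terms of the homotopy identity thus disappear from the higher diagonals. *)
Lemma phi_aug r i s a F : phi r i.+1 s (aug a F) = 0.
Proof.
case: s => [|b s] //; rewrite phiS.
have Z : ctr b (aug a F) = fun=> 0.
  apply: funext => w; rewrite /ctr.
  elim: w F => [|x w IH] F //=; case: ifP => // x0.
  rewrite {1}/aug /= eqSS x0 /= add0r; case: ifP => // _.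
  have -> : (fun v => aug a F ([:: b] :: v)) = aug a (fun v => F ([:: a] :: v)).
    by apply: funext => v; rewrite /aug /=.
  exact: IH.
rewrite Z; have -> : theta r i.+1 (fun=> 0 : k) = (fun=> 0) :> (seq (seq T) -> k).
  apply: funext => w; rewrite -[RHS](subrr (theta r i.+1 (fun=> 0) w)) -thetaB.
  by congr theta; apply: funext => v; rewrite subr0.
rewrite phi0 addr0 (_ : bd _ _ = 0) ?mulr0 // -[RHS](bd0 _ (b :: s)).
by apply: eq_bd => x _; rewrite phi0.
Qed.

Lemma ctr_tcob r a F : good r F ->
  ctr a (tcob F) = (fun w => F w - aug a F w - tcob (ctr a F) w).
Proof.
move=> gF; apply: funext => w; case: (boolP (okl r w)) => [/andP[_ hw]|h].
  have gF' v : hase v -> F v = 0 by move=> hv; apply: gF; rewrite /okl hv andbF.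
  by rewrite -(ct_tbd _ gF' hw) /tcob /ctr; ring.
rewrite (good_ctr a (good_tcob gF)) // gF // (good_tcob (good_ctr a gF)) //.
rewrite subr0 sub0r /aug; case: ifP => h1; last by rewrite oppr0.
rewrite gF ?oppr0 //; apply: contra h => /andP[/eqP <-].
rewrite /okl size_map eqxx => _ /=; rewrite /hase -all_predC.
by apply: sub_all h1 => x /= /eqP ->.
Qed.

(** [aug a F] is rotation invariant, so T - 1 kills it; the norm occurs with a diagonal of positive
    index, where [phi_aug] applies. *)
Lemma phi_theta_aug r i s a F : good r F -> phi r i s (theta r i.+1 (aug a F)) = 0.
Proof.
move=> gF; have it j : iter j (@rotT k T) (aug a F) = aug a F.
  by elim: j => //= j ->; exact: rotT_aug gF.
case: i => [|i].
  rewrite -[RHS](phi0 r 0 s); congr phi; apply: funext => w.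
  by rewrite /theta /= (rotT_aug _ gF) subrr.
case: (boolP (odd i)) => oi.
  rewrite -[RHS](phi0 r i.+1 s); congr phi; apply: funext => w.
  by rewrite /theta /= oi (rotT_aug _ gF) subrr.
rewrite -[RHS](phi_aug r i s a (fun w => F w *+ r)); congr phi; apply: funext => w.
rewrite /theta /= (negbTE oi) /=.
under eq_bigr => j _ do rewrite it.
by rewrite sumr_const card_ord /aug; case: ifP => // _; rewrite mul0rn.
Qed.

Lemma phi_cob_step r i a s F (H := ctr a F) : good r F ->
  phi r i (a :: s) (tcob (theta r i.+1 H)) =
    sg i * bd (a :: s) (fun x => phi r i x (theta r i.+1 H)) ->
  (forall x, (size x).+1 = size (a :: s) -> phi r i.+1 x (tcob H) =
    sg i.+1 * bd x (fun x => phi r i.+1 x H) + phi r i x (theta r i.+1 H)) ->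
  phi r i.+1 (a :: s) (tcob F) =
  sg i.+1 * bd (a :: s) (fun x => phi r i.+1 x F) + phi r i (a :: s) (theta r i.+1 F).
Proof.
move=> gF HP IH; rewrite phiS (ctr_tcob a gF) -/H.
rewrite !theta_fB !phiB (phi_theta_aug _ _ _ gF) subr0 theta_tcob HP.
have -> : bd (a :: s) (fun x => phi r i.+1 x (fun w => F w - aug a F w - tcob H w)) =
    bd (a :: s) (fun x => phi r i.+1 x F - (sg i.+1 * bd x (fun x => phi r i.+1 x H) +
      phi r i x (theta r i.+1 H))).
  by apply: eq_bd => x sx; rewrite !phiB phi_aug subr0 IH.
rewrite bdB bdD bdZ bd_bd sgS; ring.
Qed.

(** Induction on the index and on the size of s. The contraction solves the boundary equation
    because the prescribed boundary is a cycle: consecutive [theta] compose to zero and the previous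
    diagonal satisfies its own equation. *)
Lemma phi_cob r i s F : good r F -> (0 < r)%N ->
  phi r i.+1 s (tcob F) =
  sg i.+1 * bd s (fun x => phi r i.+1 x F) + phi r i s (theta r i.+1 F).
Proof.
move=> gF r0; elim: i s F gF => [|i IHi] s F gF.
all: elim: {s}(size s).+1 {-2}s (ltnSn (size s)) F gF => // n IHn [|a s] sz F gF.
- by rewrite /= mulr0 add0r; case: r r0 {gF IHn}.
- apply: phi_cob_step => // [|x sx].
    rewrite /phi -tcut_cob ?/altsign ?mul1r // => w hw.
    by apply: (good_theta 1 (good_ctr a gF)); rewrite /okl hw andbF.
  by apply: (IHn x _ _ (good_ctr a gF)); rewrite sx -ltnS.
- by rewrite /= mulr0 add0r.
- apply: phi_cob_step => // [|x sx].
    by rewrite (IHi _ _ (good_theta _ (good_ctr a gF))) (theta_theta _ (good_ctr a gF)) phi0 addr0.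
  by apply: (IHn x _ _ (good_ctr a gF)); rewrite sx -ltnS.
Qed.

Lemma ct_supp a w F : (forall v, tdg v = (tdg w).+1 -> F v = 0) -> ct a w F = 0.
Proof.
elim: w F => //= s w IH F hF; case: ifP => // _.
rewrite hF ?add0r; last by rewrite /tdg.
case: eqP => // s1; apply: IH => v hv; apply: hF.
by rewrite /tdg /= -/(tdg v) -/(tdg w) hv s1 addnS.
Qed.

Lemma tdg_iter_rotT j F m :
  (forall w, tdg w = m -> F w = 0) -> forall w, tdg w = m -> iter j (@rotT k T) F w = 0.
Proof.
move=> hF; elim: j => //= j IH [|s w] h /=; first exact: IH.
by rewrite IH ?mulr0 // tdg_rcons -h /tdg /= addnC.
Qed.

(** Degree count: a word of r simplices has [tdg] equal to its total degree plus 2r, and the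
    diagonal of index i raises the degree by i. *)
Lemma phi_supp r i s F :
  (forall w, ((tdg w).+1 = size s + i + r.*2)%N -> F w = 0) -> phi r i s F = 0.
Proof.
elim: i s F => [|i IHi] s F.
  elim: r s F => [|r IH] s F hF /=.
    case: eqP => [s1|_]; last exact: mul0r.
    by rewrite hF ?mulr0 // s1.
  rewrite -[RHS](cut0 _ s); apply: eq_cut => x y _ _ sxy; apply: (IH y) => w hw.
  by apply: hF; rewrite /tdg /= -/(tdg w); move: hw sxy; lia.
elim: {s}(size s).+1 {-2}s (ltnSn (size s)) F => // n IHn [|a s] // sz F hF.
rewrite phiS IHi ?addr0.
  rewrite (_ : bd _ _ = 0) ?mulr0 // -[RHS](bd0 _ (a :: s)); apply: eq_bd => x sx.
  apply: IHn; first by rewrite sx -ltnS.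
  by move=> w hw; apply: ct_supp => v hv; apply: hF; move: sx => /=; lia.
move=> w hw.
have hc v : tdg v = tdg w -> ctr a F v = 0.
  by move=> hv; apply: ct_supp => u hu; apply: hF; move: hw hv hu => /=; lia.
rewrite /theta; case: ifP => _.
  by have := @tdg_iter_rotT 1 _ _ hc w erefl; rewrite /= => ->; rewrite hc // subrr.
by apply: big1 => j _; rewrite (@tdg_iter_rotT j _ _ hc).
Qed.

End OneType.

Section Naturality.
Variables (T T' : Type) (u : T -> T').
Implicit Types (F : seq (seq T') -> k).
Local Notation pb F := (fun w : seq (seq T) => F (map (map u) w)).

Lemma tdg_map w : tdg [seq map u s | s <- w] = tdg w.
Proof. by elim: w => //= s w IH; rewrite /tdg /= size_map -!/(tdg _) IH. Qed.

Lemma rotT_pb F : rotT (pb F) = pb (rotT F).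
Proof.
apply: funext => -[|s w] //=.
by rewrite map_rcons size_map tdg_map.
Qed.

Lemma theta_pb r i F : theta r i (pb F) = pb (theta r i F).
Proof.
have it j : iter j (@rotT k T) (pb F) = pb (iter j (@rotT k T') F).
  by elim: j => //= j ->; rewrite rotT_pb.
apply: funext => w; rewrite /theta rotT_pb; case: ifP => // _.
by apply: eq_bigr => j _; rewrite it.
Qed.

Lemma ctr_pb a F : ctr a (pb F) = pb (ctr (u a) F).
Proof.
apply: funext => w; rewrite /ctr; elim: w F => //= s w IH F.
rewrite size_map; case: ifP => // _; congr (_ + _); case: ifP => // _.
exact: (IH (fun v => F ([:: u a] :: v))).
Qed.

Lemma phi_map r i s F : phi r i (map u s) F = phi r i s (pb F).
Proof.
elim: i s F => [|i IHi] s F.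
  elim: r s F => [|r IH] s F /=; first by rewrite size_map.
  by rewrite cut_map; apply: eq_cut => x y _ _ _; exact: (IH y (fun w => F (map u x :: w))).
elim: {s}(size s).+1 {-2}s (ltnSn (size s)) F => // n IHn [|a s] // sz F.
rewrite map_cons !phiS -map_cons ctr_pb theta_pb -IHi bd_map; congr (_ * _ + _).
by apply: eq_bd => x sx; apply: IHn; rewrite sx -ltnS.
Qed.

End Naturality.
End Power.

Section FunOps.
Variables (k : comNzRingType) (T : Type).
Implicit Types f g h : seq T -> k.

Lemma funDE f g s : (f + g) s = f s + g s. Proof. by []. Qed.
Lemma funNE f s : (- f) s = - f s. Proof. by []. Qed.
Lemma fun0E s : (0 : seq T -> k) s = 0. Proof. by []. Qed.
Definition funE := (funDE, funNE, fun0E).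

Lemma cobB f g : cob (f - g) = cob f - cob g.
Proof. by apply: funext => s; exact: bdB. Qed.
Lemma cobD f g : cob (f + g) = cob f + cob g.
Proof. by apply: funext => s; exact: bdD. Qed.
Lemma cobN f : cob (- f) = - cob f.
Proof. by apply: funext => s; exact: bdN. Qed.
Lemma cob0 : cob (0 : seq T -> k) = 0.
Proof. by apply: funext => s; exact: bd0. Qed.
Lemma cobK f : cob (cob f) = 0.
Proof. exact: cob_cob. Qed.

Lemma cupDl f g h : cupf (f + g) h = cupf f h + cupf g h.
Proof.
by apply: funext => s; rewrite !funE /cupf -cutD; apply: eq_cut => x y _ _ _; rewrite !funE; ring.
Qed.
Lemma cupDr f g h : cupf f (g + h) = cupf f g + cupf f h.
Proof.
by apply: funext => s; rewrite !funE /cupf -cutD; apply: eq_cut => x y _ _ _; rewrite !funE; ring.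
Qed.
Lemma cupNl f h : cupf (- f) h = - cupf f h.
Proof.
by apply: funext => s; rewrite !funE /cupf -cutN; apply: eq_cut => x y _ _ _; rewrite !funE; ring.
Qed.
Lemma cupNr f h : cupf f (- h) = - cupf f h.
Proof.
by apply: funext => s; rewrite !funE /cupf -cutN; apply: eq_cut => x y _ _ _; rewrite !funE; ring.
Qed.
Lemma cupBl f g h : cupf (f - g) h = cupf f h - cupf g h.
Proof. by rewrite cupDl cupNl. Qed.
Lemma cupBr f g h : cupf f (g - h) = cupf f g - cupf f h.
Proof. by rewrite cupDr cupNr. Qed.
Lemma cup0f f : cupf 0 f = 0.
Proof. by have := cupBl 0 0 f; rewrite !subrr. Qed.
Lemma cupf0 f : cupf f 0 = 0.
Proof. by have := cupBr f 0 0; rewrite !subrr. Qed.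

Lemma cup1f f : f [::] = 0 -> cupf (onef k (T := T)) f = f.
Proof.
move=> f0; apply: funext => -[|a s] //; rewrite /cupf.
exact: (cut_one_l (s := a :: s) f).
Qed.
Lemma cupf1 f : f [::] = 0 -> cupf f (onef k (T := T)) = f.
Proof.
move=> f0; apply: funext => -[|a s] //; rewrite /cupf.
exact: (cut_one_r (s := a :: s) f).
Qed.

Definition szd m f := f [::] = 0 /\ forall s, size s != m -> f s = 0.

Lemma cob_cup m f g : szd m.+1 f -> g [::] = 0 ->
  cob (cupf f g) = cupf (cob f) g + (fun s => altsign k m * cupf f (cob g) s).
Proof.
move=> [f0 fm] g0; apply: funext => s; rewrite /cob /cupf.
rewrite (bd_cut s (G := fun x y => f x * g y)) => [|x]; last by rewrite g0 mulr0.
rewrite f0 mul0r subr0 [RHS]funE -cutZ -cutD; apply: eq_cut => x y _ _ _; rewrite bdZr bdZ; congr (_ + _).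
case: (eqVneq (size x) m.+1) => [->|/fm ->]; last by ring.
by rewrite !sgS; ring.
Qed.

Lemma szd_cob m f : szd m f -> szd m.+1 (cob f).
Proof.
move=> [f0 fm]; split=> // s sm; rewrite /cob -[RHS](bd0 _ s).
by apply: eq_bd => x sx; apply: fm; move: sm; rewrite -sx eqSS.
Qed.

Lemma szd_cup m n f g : szd m.+1 f -> szd n.+1 g -> szd (m + n).+1%N (cupf f g).
Proof.
move=> [f0 fm] [g0 gn]; split=> // s sm; rewrite /cupf -[RHS](cut0 _ s).
apply: eq_cut => x y _ _ sxy.
case: (eqVneq (size x) m.+1) => [ex|/fm ->]; last by ring.
rewrite gn ?mulr0 //; apply: contra sm => /eqP ey; apply/eqP; lia.
Qed.

Lemma szdB m f g : szd m f -> szd m g -> szd m (f - g).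
Proof.
move=> [f0 fm] [g0 gm]; split=> [|s h]; rewrite !funE ?f0 ?g0 ?subr0 //.
by rewrite fm // gm // subr0.
Qed.

Lemma szd0 m : szd m 0. Proof. by split. Qed.

Lemma szd_one : szd 1 (onef k (T := T)).
Proof. by split=> // s; rewrite /onef => /negbTE ->. Qed.

Lemma cob_one : cob (onef k (T := T)) = 0.
Proof.
apply: funext => -[|a [|b [|c s]]] //; rewrite /onef /cob /= ?subr0 ?subrr //.
by rewrite bd0 !subr0.
Qed.
End FunOps.

(** * Group cohomology by invariant cochains *)

Section GroupCochains.
Variables (k : comNzRingType) (G : finGroupType).
Implicit Types f g h : seq G -> k.

Definition ginv f := forall a s, f (map (mulg a) s) = f s.
(** The index is the number of vertices, one more than the degree. The cochains below degree 0 are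
    then [coch 0], which is zero, and [Bc 0] needs no separate clause. *)
Definition coch m f := szd m f /\ ginv f.
Definition Zc n f := coch n.+1 f /\ cob f = 0.
Definition Bc n f := exists2 g, coch n g & f = cob g.

Lemma coch0 m : coch m 0. Proof. by split; first exact: szd0. Qed.
Lemma cochB m f g : coch m f -> coch m g -> coch m (f - g).
Proof.
move=> [fs fi] [gs gi]; split; first exact: szdB.
by move=> a s; rewrite !funE fi gi.
Qed.
Lemma cochN m f : coch m f -> coch m (- f).
Proof. by move=> h; rewrite -sub0r; apply: cochB (coch0 m) h. Qed.
Lemma cochD m f g : coch m f -> coch m g -> coch m (f + g).
Proof. by move=> hf hg; rewrite -[g]opprK; apply: cochB hf (cochN hg). Qed.
Lemma cochZ m c f : coch m f -> coch m (fun s => c * f s).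
Proof.
move=> [[f0 fm] fi]; split; first by split=> [|s h]; rewrite ?f0 ?fm // mulr0.
by move=> a s; rewrite fi.
Qed.
Lemma coch_cob m f : coch m f -> coch m.+1 (cob f).
Proof.
move=> [fs fi]; split; first exact: szd_cob.
by move=> a s; rewrite /cob bd_map; apply: eq_bd => x _; rewrite fi.
Qed.
Lemma coch_cup m n f g : coch m.+1 f -> coch n.+1 g -> coch (m + n).+1%N (cupf f g).
Proof.
move=> [fs fi] [gs gi]; split; first exact: szd_cup.
by move=> a s; rewrite /cupf cut_map; apply: eq_cut => x y _ _ _; rewrite fi gi.
Qed.

Lemma Zc0 n : Zc n 0. Proof. by split; [exact: coch0 | exact: cob0]. Qed.
Lemma ZcB n f g : Zc n f -> Zc n g -> Zc n (f - g).
Proof. by move=> [fs fc] [gs gc]; split; [exact: cochB | rewrite cobB fc gc subrr]. Qed.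
Lemma Bc0 n : Bc n 0. Proof. by exists 0; [exact: coch0 | rewrite cob0]. Qed.
Lemma BcB n f g : Bc n f -> Bc n g -> Bc n (f - g).
Proof.
by move=> [u hu ->] [v hv ->]; exists (u - v); [exact: cochB | rewrite cobB].
Qed.
Lemma Bc_Zc n f : Bc n f -> Zc n f.
Proof. by move=> [u hu ->]; split; [exact: coch_cob | exact: cobK]. Qed.

Lemma Zc_one : Zc 0 (onef k (T := G)).
Proof.
split; last exact: cob_one.
by split; [exact: szd_one | move=> a s; rewrite /onef size_map].
Qed.

Lemma coch_nil m f : coch m f -> f [::] = 0. Proof. by case=> -[]. Qed.

Lemma Zc_cup m n f g : Zc m f -> Zc n g -> Zc (m + n)%N (cupf f g).
Proof.
move=> [fs fc] [gs gc]; split; first exact: coch_cup.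
rewrite (cob_cup (proj1 fs) (coch_nil gs)) fc gc cup0f cupf0.
by apply: funext => s; rewrite !funE mulr0 addr0.
Qed.

Lemma coch_size0 f : coch 0 f -> f = 0.
Proof.
move=> [[f0 fm] _]; apply: funext => -[|a s]; rewrite ?f0 //.
by rewrite fm.
Qed.

Lemma Bc_cupl m n f g : Bc m f -> Zc n g -> Bc (m + n)%N (cupf f g).
Proof.
move=> [u hu ->] [gs gc]; case: m hu => [|m] hu.
  by rewrite (coch_size0 hu) cob0 cup0f; exact: Bc0.
exists (cupf u g); first exact: (@coch_cup m n).
rewrite (cob_cup (proj1 hu) (coch_nil gs)) gc cupf0.
by apply: funext => s; rewrite !funE mulr0 addr0.
Qed.

Lemma Bc_cupr m n f g : Zc m f -> Bc n g -> Bc (m + n)%N (cupf f g).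
Proof.
move=> [fs fc] [u hu ->]; case: n hu => [|n] hu.
  by rewrite (coch_size0 hu) cob0 cupf0; exact: Bc0.
exists (fun s => altsign k m * cupf f u s).
  by rewrite addnS; apply: cochZ; exact: coch_cup.
apply: funext => s; rewrite /cob bdZ -/(cob (cupf f u) s).
rewrite (cob_cup (proj1 fs) (coch_nil hu)) fc cup0f.
by rewrite !funE add0r mulrA sg2 mul1r.
Qed.

(** The cup-one product: [phi 2 1] is a homotopy between the diagonal and its transpose, and it is
    applied to the tensor of f and g. *)
Lemma cup_comm m n f g : Zc m f -> Zc n g ->
  Bc (m + n)%N (cupf f g - (fun s => altsign k (m * n)%N * cupf g f s)).
Proof.
move=> [[[f0 fm] fi] fc] [[[g0 gn] gi] gc].
pose F w := if w is [:: x; y] then f x * g y else 0.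
have gF : good 2 F.
  move=> [|x [|y [|z w]]] //=; rewrite /okl /= orbF negbK.
  by case/orP => /eqP/size0nil ->; rewrite ?f0 ?g0 ?mul0r ?mulr0.
have hF w : F w != 0 -> ((tdg w) = (m + n).+4)%N.
  case: w => [|x [|y [|z w]]]; rewrite ?eqxx //= => h.
  case: (eqVneq (size x) m.+1) h => [ex|/fm ->]; last by rewrite mul0r eqxx.
  case: (eqVneq (size y) n.+1) => [ey|/gn ->]; last by rewrite mulr0 eqxx.
  by rewrite /tdg /= ex ey; lia.
have F0 w : F w = 0 \/ ((tdg w) = (m + n).+4)%N.
  by case: (eqVneq (F w) 0) => [->|/hF]; [left|right].
have dF : tcob F = fun=> 0.
  apply: funext => w; case: (boolP (okl 2 w)) => [|h]; last exact: good_tcob h.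
  case: w => [|x [|y [|z w]]] // _; rewrite /tcob /= mulr0 addr0 bdZr -/(cob f x) fc.
  by rewrite bdZ -/(cob g y) gc !funE mul0r add0r !mulr0.
exists (fun s => - phi 2 1 s F).
  split; first split.
  - by rewrite /= oppr0.
  - move=> s hs; rewrite phi_supp ?oppr0 // => w hw.
    by case: (F0 w) => // e; move: hw hs; rewrite e; lia.
  - move=> a s; rewrite phi_map; congr (- phi _ _ _ _); apply: funext => w.
    by case: w => [|x [|y [|z w]]] //=; rewrite fi gi.
apply: funext => s; rewrite /cob bdN.
have tcut1 y (H : seq (seq G) -> k) : (0 < size y)%N -> tcut 1 y H = H [:: y].
  move=> y0 /=; rewrite -(cut_one_r (fun x => H [:: x]) y0).
  by apply: eq_cut => x z _ _ _; rewrite mulrC.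
have := phi_cob 0 s gF isT; rewrite dF phi0 sgS /altsign expr0 mulN1r => /esym/eqP.
rewrite addrC subr_eq0 => /eqP <-.
have -> : theta 2 1 F = fun w => rotT F w - F w by [].
rewrite phiB opprB !funE; congr (_ - _).
  rewrite -[phi 2 0 s F]/(cut s (fun x y => tcut 1 y (fun w => F (x :: w)))).
  by apply: eq_cut => x y _ y0 _; rewrite tcut1.
rewrite -[phi 2 0 s _]/(cut s (fun x y => tcut 1 y (fun w => rotT F (x :: w)))).
rewrite -cutZ; apply: eq_cut => x y _ y0 _; rewrite tcut1 //=.
rewrite /tdg /= addn0.
case: (eqVneq (size y) m.+1) => [ey|/fm ->]; last by rewrite !mul0r !mulr0.
case: (eqVneq (size x) n.+1) => [ex|/gn ->]; last by rewrite !(mulr0, mul0r).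
rewrite ex ey [g x * _]mulrC; congr (_ * _).
have E : odd (m * n)%N = odd (n.+2 * m.+2)%N by rewrite !oddM /= !negbK andbC.
have E' : altsign k (m * n)%N = altsign k (n.+2 * m.+2)%N by rewrite -sg_odd E sg_odd.
by rewrite -/(altsign _ _) E'.
Qed.

End GroupCochains.

Section Pullback.
Variables (k : comNzRingType) (G H : finGroupType) (u : G -> H).
Hypothesis uM : forall x y, (u (x * y) = u x * u y)%g.
Definition pb T T' (v : T -> T') (f : seq T' -> k) : seq T -> k := fun s => f (map v s).

Lemma pb_cob T T' (v : T -> T') f : pb v (cob f) = cob (pb v f).
Proof. by apply: funext => s; rewrite /pb /cob bd_map. Qed.
Lemma pb_cup T T' (v : T -> T') f g : pb v (cupf f g) = cupf (pb v f) (pb v g).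
Proof. by apply: funext => s; rewrite /pb /cupf cut_map. Qed.
Lemma pb_coch m f : coch m f -> coch m (pb u f).
Proof.
move=> [[f0 fm] fi]; split.
  by split=> // s hs; rewrite /pb fm // size_map.
move=> a s; rewrite /pb -(fi (u a) (map u s)) -!map_comp.
by congr f; apply: eq_map => x /=; rewrite uM.
Qed.
Lemma pb_Zc n f : Zc n f -> Zc n (pb u f).
Proof.
by move=> [fs fc]; split; [exact: pb_coch | rewrite -pb_cob fc].
Qed.
End Pullback.

(** * Transgression of p-th powers *)

Section Steenrod.
Variables (k : fieldType) (p : nat) (T : Type) (n : nat) (f : seq T -> k).
Hypothesis pk : p \in [pchar k].
Hypothesis fs : szd n.+1 f.
Hypothesis n_even : ~~ odd n.
Local Notation sg := (altsign k).
Local Notation t := (cob f).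
Implicit Types (F G : seq (seq T) -> k) (w : seq (seq T)) (v : seq bool).

(* Tensor words in f and t = cob f; [wspan r j] is spanned by the words of length
   r with j letters t. *)
Fixpoint tw v w : k :=
  match v, w with
  | [::], [::] => 1
  | b :: v', s :: w' => (if b then t s else f s) * tw v' w'
  | _, _ => 0
  end.

Inductive wspan r j : (seq (seq T) -> k) -> Prop :=
| span_tw v : size v = r -> count id v = j -> wspan r j (tw v)
| spanD F G : wspan r j F -> wspan r j G -> wspan r j (F + G)
| spanZ c F : wspan r j F -> wspan r j (fun w => c * F w).

Fixpoint shape r j w : bool :=
  match r, w with
  | 0, [::] => j == 0%N
  | r'.+1, s :: w' => if size s == n.+1 then shape r' j w' else
                      [&& size s == n.+2, (0 < j)%N & shape r' j.-1 w']
  | _, _ => false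
  end.

Lemma ts : szd n.+2 t. Proof. exact: szd_cob. Qed.

Lemma tw_shape v w : ~~ shape (size v) (count id v) w -> tw v w = 0.
Proof.
elim: v w => [|b v IH] [|s w] //=.
have [f0 fm] := fs; have [t0 tm] := ts.
case: b => /=; rewrite ?add0n.
  case: eqP => [e _|_]; first by rewrite tm ?mul0r // e neq_ltn ltnSn.
  by case: eqP => [e|/eqP ne _] /=; [move=> h; rewrite IH ?mulr0 | rewrite tm ?mul0r].
by case: eqP => [e h|/eqP ne _]; [rewrite IH ?mulr0 | rewrite fm ?mul0r].
Qed.

Lemma span_shape r j F : wspan r j F -> forall w, ~~ shape r j w -> F w = 0.
Proof.
elim=> [v <- <-|{}F G _ IF _ IG|c {}F _ IF] w h; first exact: tw_shape.
  by rewrite !funE IF // IG // addr0.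
by rewrite IF // mulr0.
Qed.

Lemma shape_size r j w : shape r j w -> size w = r.
Proof.
elim: r j w => [|r IH] j [|s w] //=; case: ifP => _; first by move/IH => ->.
by case/and3P => _ _ /IH ->.
Qed.

Lemma shape_hase r j w : shape r j w -> ~~ hase w.
Proof.
elim: r j w => [|r IH] j [|s w] //=; case: ifP => [/eqP -> /IH //|_].
by case/and3P => /eqP -> _ /IH.
Qed.

Lemma shape_tdg r j w : shape r j w -> tdg w = (r * n.+2 + j)%N.
Proof.
rewrite /tdg; elim: r j w => [|r IH] j [|s w] //=; first by move/eqP->.
case: ifP => [/eqP -> /IH ->|_]; first by lia.
by case/and3P => /eqP -> j0 /IH ->; lia.
Qed.

Lemma shape_count r j w : shape r j w -> count (fun s => size s == n.+2) w = j.
Proof.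
elim: r j w => [|r IH] j [|s w] //=; first by move/eqP->.
case: ifP => [/eqP -> /IH ->|_]; first by rewrite eqn_leq ltnn andbF.
by case/and3P => /eqP -> j0 /IH ->; rewrite eqxx; lia.
Qed.

Lemma span_good r j F : wspan r j F -> good r F.
Proof.
move=> sF w h; apply: (span_shape sF); apply: contra h => h.
by rewrite /okl (shape_size h) eqxx (shape_hase h).
Qed.

Lemma spanN r j F : wspan r j F -> wspan r j (- F).
Proof.
by move=> /(spanZ (-1)); congr wspan; apply: funext => w; rewrite !funE mulN1r.
Qed.

Lemma span_sum r j m (H : nat -> seq (seq T) -> k) F : wspan r j F ->
  (forall i, (i < m)%N -> wspan r j (H i)) -> wspan r j (fun w => \sum_(i < m) H i w).
Proof.
move=> sF; elim: m => [|m IH] h.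
  have := spanZ 0 sF; congr wspan; apply: funext => w; by rewrite big_ord0 mul0r.
have := spanD (IH (fun i hi => h i (ltnW hi))) (h m (ltnSn m)).
by congr wspan; apply: funext => w; rewrite big_ord_recr.
Qed.

Lemma tw_rcons v b w s : size v = size w ->
  tw (rcons v b) (rcons w s) = (if b then t s else f s) * tw v w.
Proof.
by elim: v w => [|c v IH] [|x w] //= [/IH ->]; rewrite mulrCA.
Qed.

Lemma tw_size v w : size v != size w -> tw v w = 0.
Proof.
by move=> h; apply: tw_shape; apply: contra h => /shape_size ->.
Qed.

(** As n is even, f has even degree and t odd degree; the sign comes from moving a letter t past the
    other letters t. *)
Lemma rot_tw v b : rotT (tw (rcons v b)) = fun w => sg (b * count id v) * tw (b :: v) w.
Proof.
apply: funext => -[|s w]; first by rewrite /= tw_size ?mulr0 // size_rcons.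
rewrite [LHS]/= [tw (b :: v) _]/=; case: (eqVneq (size v) (size w)) => e; last first.
  rewrite (tw_size (v := v)) // tw_size ?mulr0 //.
  by rewrite !size_rcons eqSS.
rewrite tw_rcons //; case: (boolP (shape (size v) (count id v) w)) => [hs|h]; last first.
  by rewrite tw_shape // !mulr0.
have bs : (if b then t s else f s) = 0 \/ odd (size s).+1 = b.
  case: (b); [have [_ hm] := ts | have [_ hm] := fs].
    by case: (eqVneq (size s) n.+2) => [->|/hm ->]; [right; rewrite /= n_even | left].
  by case: (eqVneq (size s) n.+1) => [->|/hm ->]; [right; rewrite /= negbK (negbTE n_even) | left].
case: bs => [->|bs]; first by rewrite !mul0r !mulr0.
congr (_ * _); rewrite -sg_odd -[RHS]sg_odd !oddM bs oddb (shape_tdg hs).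
by rewrite oddD oddM /= (negbTE n_even) andbF.
Qed.

Lemma span_rot r j F : wspan r j F -> wspan r j (rotT F).
Proof.
elim=> [v <- <-|{}F G _ IF _ IG|c {}F _ IF]; first last.
- by have := spanZ c IF; congr wspan; apply: funext => -[|s w] //=; ring.
- by have := spanD IF IG; congr wspan; apply: funext => -[|s w] //=; rewrite !funE /=; ring.
case/lastP: v => [|v b].
  have -> : rotT (tw [::]) = tw [::]; last exact: span_tw.
  by apply: funext => -[|s w] //=; case: w => [|x w] /=; rewrite mulr0.
rewrite rot_tw.
apply: spanZ; apply: span_tw; first by rewrite /= size_rcons.
by rewrite -cats1 count_cat /= addn0 addnC.
Qed.

Lemma span_iter r j i F : wspan r j F -> wspan r j (iter i (@rotT k T) F).
Proof. by move=> h; elim: i => //= i; exact: span_rot. Qed.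

Lemma span_cons r j F (b : bool) : wspan r j F ->
  wspan r.+1 (b + j) (fun w => if w is s :: w' then (if b then t s else f s) * F w' else 0).
Proof.
elim=> [v <- <-|{}F G _ IF _ IG|c {}F _ IF].
- have -> : (fun w => if w is s :: w' then (if b then t s else f s) * tw v w' else 0) = tw (b :: v).
    by apply: funext => -[].
  exact: span_tw.
- have := spanD IF IG; congr wspan; apply: funext => -[|s w]; rewrite !funE ?addr0 //; ring.
- have := spanZ c IF; congr wspan; apply: funext => -[|s w]; rewrite ?mulr0 //; ring.
Qed.

Lemma span_tcob r j F : (j < r)%N -> wspan r j F -> wspan r j.+1 (tcob F).
Proof.
move=> jr; elim=> [v sv cv|{}F G _ IF _ IG|c {}F _ IF]; first last.
- have := spanZ c IF; congr wspan; apply: funext => w; rewrite /tcob -tbdZ //.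
- have := spanD IF IG; congr wspan; apply: funext => w.
  exact: esym (addflD F G (@additive_tbd k T w)).
elim: v r j jr sv cv => [|b v IH] [|r] j //= jr [sv] cv.
case: b cv => cv.
  case: j jr cv => // j jr [cv]; rewrite ltnS in jr.
  have := spanN (span_cons true (IH _ _ jr sv cv)); congr wspan.
  apply: funext => -[|s w]; rewrite !funE ?oppr0 // /tcob /= bdZr -/(cob t s) cobK funE mul0r add0r.
  rewrite tbdZ; case: (eqVneq (size s) n.+2) => [->|/(proj2 ts) ->].
    by rewrite /= -sg_odd /= n_even /altsign; ring.
  by rewrite mul0r mulr0 oppr0.
move: cv; rewrite add0n => cv.
have E : tcob (tw (false :: v)) =
    tw (true :: v) + (fun w => if w is s :: w' then f s * tcob (tw v) w' else 0).
  apply: funext => -[|s w]; rewrite !funE ?addr0 // /tcob /= bdZr -/(cob f s); congr (_ + _).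
  rewrite tbdZ; case: (eqVneq (size s) n.+1) => [->|/(proj2 fs) ->].
    by rewrite -sg_odd /= negbK (negbTE n_even) /altsign; ring.
  by rewrite !mul0r mulr0.
rewrite E; case: (ltnP j r) => jr'.
  apply: spanD; first by apply: span_tw; rewrite /= ?sv ?cv.
  exact: (span_cons false (IH _ _ jr' sv cv)).
have -> : tcob (tw v) = fun=> 0.
  have {}jr : j = size v by apply/eqP; rewrite eqn_leq -{1}cv count_size /= sv jr'.
  have va : all id v by rewrite all_count cv jr.
  elim: v va {IH sv cv jr E} => [_|b v IH] /=.
    by apply: funext => -[|s w] //; rewrite /tcob /= bd0 tbd0 mulr0 addr0.
  case/andP => -> /IH h; apply: funext => -[|s w] //.
  rewrite /tcob /= bdZr -/(cob t s) cobK funE mul0r add0r tbdZ.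
  by move/(congr1 (fun F => F w)): h; rewrite /tcob => ->; rewrite !mulr0.
have := @span_tw r.+1 j.+1 (true :: v); rewrite /= sv cv => /(_ erefl erefl).
by congr wspan; apply: funext => -[|s w]; rewrite !funE ?mulr0 ?addr0.
Qed.

Lemma span_top r F : wspan r r F -> exists c, F = fun w => c * tw (nseq r true) w.
Proof.
elim=> [v sv cv|{}F G _ [c ->] _ [d ->]|c {}F _ [d ->]].
- exists 1; have -> : v = nseq r true; last by apply: funext => w; rewrite mul1r.
  have: all id v by rewrite all_count cv sv.
  by rewrite -sv; elim: v {sv cv} => //= b v IH /andP[-> /IH <-].
- by exists (c + d); apply: funext => w; rewrite !funE; ring.
- by exists (c * d); apply: funext => w; ring.
Qed.

(* For 0 < j < p, a word with j letters t has j rotations that begin with t, so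
   averaging over them splits the norm. *)
Definition rho F w : k := if w is s :: _ then (size s == n.+2)%:R * F w else 0.

Lemma span_rho r j F : (0 < j <= r)%N -> wspan r j F -> wspan r j (rho F).
Proof.
move=> jr; elim=> [v sv cv|{}F G _ IF _ IG|c {}F _ IF]; first last.
- have := spanZ c IF; congr wspan; apply: funext => -[|s w]; rewrite /= ?mulr0 //; ring.
- have := spanD IF IG; congr wspan; apply: funext => -[|s w]; rewrite !funE /= ?addr0 // !funE; ring.
have st := span_tw sv cv.
case: v sv cv st => [|b v] sv cv st; first by move: jr; rewrite -cv.
have -> : rho (tw (b :: v)) = fun w => b%:R * tw (b :: v) w; last exact: spanZ.
apply: funext => -[|s w] /=; first by rewrite mulr0.
case: (b).
  by case: eqP => [_|/eqP/(proj2 ts) ->]; rewrite ?mul0r ?mulr0.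
case: eqP => [e|_]; last by rewrite !mul0r.
by rewrite (proj2 fs) ?mul0r ?mulr0 // e neq_ltn ltnSn orbT.
Qed.

Lemma iter_rho i F w : (0 < size w)%N ->
  iter i (@rotT k T) (rho F) w =
  (size (head [::] (iter i (@seq.rot (seq T) 1) w)) == n.+2)%:R * iter i (@rotT k T) F w.
Proof.
elim: i w => [|i IH] w w0; first by case: w w0.
case: w w0 => //= s w _; rewrite IH ?size_rcons // mulrCA.
by rewrite -iterS iterSr rot1_cons.
Qed.

Lemma sum_rot (P : pred (seq T)) w :
  \sum_(i < size w) (P (head [::] (iter i (@seq.rot (seq T) 1) w)))%:R = (count P w)%:R :> k.
Proof.
have it i : (i < size w)%N -> head [::] (iter i (@seq.rot (seq T) 1) w) = nth [::] w i.
  move=> hi; have -> : iter i (@seq.rot (seq T) 1) w = seq.rot i w.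
    elim: i hi => [|i IH] hi; first by rewrite rot0.
    by rewrite /= (IH (ltnW hi)) -rotS // ltnW.
  by rewrite /seq.rot (drop_nth [::] hi).
under eq_bigr => i _ do rewrite it ?ltn_ord //.
elim: {it} w => [|s w IH]; first by rewrite big_ord0.
by rewrite big_ord_recl /= IH natrD.
Qed.

Section Solve.
Variables (j : nat) (V : seq (seq T) -> k).
Hypotheses (jp : (0 < j < p)%N) (sV : wspan p j V).

Let p_gt0 : (0 < p)%N. Proof. by case/andP: jp => j0 /(ltn_trans j0). Qed.

Lemma natj : j%:R != 0 :> k.
Proof.
rewrite -(dvdn_pcharf pk); case/andP: jp => j0 jp'.
by apply/negP => /(dvdn_leq j0); rewrite leqNgt jp'.
Qed.

(** The conjugates of [rho] under the p rotations test the successive letters of a word for being t,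
    and j of them are. *)
Lemma sum_iter_rho w :
  \sum_(i < p) iter i (@rotT k T) (rho (iter (p - i) (@rotT k T) V)) w = j%:R * V w.
Proof.
case: (eqVneq (size w) p) => [sw|ne]; last first.
  have h (F : seq (seq T) -> k) : wspan p j F -> F w = 0.
    by move=> sF; apply: (span_shape sF); apply: contra ne => /shape_size ->.
  rewrite (h _ sV) mulr0; apply: big1 => i _; apply: (h); apply/span_iter/span_rho.
    by case/andP: jp => -> /ltnW.
  exact: span_iter.
have E : iter p (@rotT k T) V w = V w by rewrite -sw iter_rotT_full.
transitivity (\sum_(i < size w) (size (head [::] (iter i (@seq.rot (seq T) 1) w)) == n.+2)%:R * V w).
  rewrite sw; apply: eq_bigr => i _; rewrite iter_rho ?sw //.
  by rewrite -iterD subnKC 1?ltnW // E.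
rewrite -mulr_suml (sum_rot (fun s => size s == n.+2)).
case: (boolP (shape p j w)) => [/shape_count ->//|/(span_shape sV) ->].
by rewrite !mulr0.
Qed.

(** The conjugates of [rho] add up to the invertible scalar j, so the span is acyclic for the
    periodic complex, as a free module would be. An invariant V is the norm of rho V / j; if the
    norm of V is zero, partial sums of the conjugates telescope to a primitive for T - 1. *)
Lemma solve i : theta p i V = (fun=> 0) ->
  exists2 U, wspan p j U & theta p i.+1 U = - V.
Proof.
move=> h0; have j1 := natj.
have jle : (0 < j <= p)%N by case/andP: jp => -> /ltnW.
case: (boolP (odd i)) => oi.
  exists (fun w => - j%:R^-1 * rho V w); first exact/spanZ/span_rho.
  have rV : rotT V = V.
    apply: funext => w; have := congr1 (fun F => F w) h0.
    by rewrite /theta oi => /eqP; rewrite subr_eq0 => /eqP.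
  have itV m : iter m (@rotT k T) V = V by elim: m => //= m ->.
  apply: funext => w; rewrite /theta /= oi /=.
  under eq_bigr => m _ do rewrite iter_rotTZ.
  rewrite -mulr_sumr; have := sum_iter_rho w.
  under eq_bigr => m _ do rewrite itV.
  by move=> ->; rewrite mulrA mulNr mulVf // funNE mulN1r.
pose U0 w := \sum_(m < p) \sum_(l < m) iter l (@rotT k T) (rho (iter (p - m) (@rotT k T) V)) w.
have sU : wspan p j U0.
  apply: (span_sum (H := fun m w => \sum_(l < m) iter l (@rotT k T) (rho (iter (p - m) (@rotT k T) V)) w) sV).
  move=> m _; apply: (span_sum (H := fun l => iter l (@rotT k T) (rho (iter (p - m) (@rotT k T) V))) sV).
  by move=> l _; apply/span_iter/span_rho => //; exact: span_iter.
exists (fun w => - j%:R^-1 * U0 w); first exact: spanZ.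
apply: funext => w; rewrite /theta /= oi.
rewrite rotTZ -mulrBr funNE.
suff -> : rotT U0 w - U0 w = j%:R * V w by rewrite mulrA mulNr mulVf // mulN1r.
have -> : rotT U0 w = \sum_(m < p) \sum_(l < m)
    iter l.+1 (@rotT k T) (rho (iter (p - m) (@rotT k T) V)) w.
  rewrite (rotT_sum p (fun m w => \sum_(l < m) iter l (@rotT k T) (rho (iter (p - m) (@rotT k T) V)) w)).
  apply: eq_bigr => m _.
  by rewrite (rotT_sum m (fun l => iter l (@rotT k T) (rho (iter (p - m) (@rotT k T) V)))).
rewrite -sumrB; transitivity (\sum_(m < p) (iter m (@rotT k T) (rho (iter (p - m) (@rotT k T) V)) w
    - rho (iter (p - m) (@rotT k T) V) w)).
  apply: eq_bigr => m _; rewrite -sumrB.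
  rewrite -(big_mkord xpredT (fun l => iter l.+1 (@rotT k T) (rho (iter (p - m) (@rotT k T) V)) w -
    iter l (@rotT k T) (rho (iter (p - m) (@rotT k T) V)) w)).
  by rewrite telescope_sumr.
rewrite sumrB sum_iter_rho.
have -> : \sum_(m < p) rho (iter (p - m) (@rotT k T) V) w = 0; last by rewrite subr0.
have -> : \sum_(m < p) rho (iter (p - m) (@rotT k T) V) w =
    rho (fun w => \sum_(m < p) iter m.+1 (@rotT k T) V w) w.
  case: w => [|s w] /=; first by apply: big1.
  rewrite mulr_sumr (reindex_inj rev_ord_inj); apply: eq_bigr => m _ /=.
  by rewrite subKn.
have -> : (fun w => \sum_(m < p) iter m.+1 (@rotT k T) V w) = rotT (theta p i V).
  by rewrite /theta (negbTE oi); apply: funext => v; rewrite (rotT_sum p (fun m => iter m (@rotT k T) V)).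
by rewrite h0; case: w => [|s [|s' w]] //=; rewrite ?mulr0.
Qed.

End Solve.

Fixpoint cpw r : seq T -> k := if r is r'.+1 then cupf f (cpw r') else onef k (T := T).

Lemma tcut_cpw r s : tcut r s (tw (nseq r false)) = cpw r s.
Proof.
elim: r s => [|r IH] s /=; first by rewrite mulr1.
apply: eq_cut => x y _ _ _; rewrite -IH.
elim: (r) y (f x) (tw (nseq r false)) => [|r' IH'] y c F /=; first by rewrite mulrCA.
by rewrite -cutZ; apply: eq_cut => u v _ _ _; rewrite (IH' v c (fun w => F (u :: w))).
Qed.

Lemma power_transgression : exists (m : nat -> seq (seq T) -> k) (c : k),
  [/\ m 0%N = tw (nseq p false), forall i, (i < p)%N -> wspan p i (m i) &
  cob (fun s => \sum_(i < p) phi p i s (m i)) =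
    (fun s => c * phi p p.-1 s (tw (nseq p true)))].
Proof.
have p_pr : prime p by exact: pcharf_prime pk.
have p0 : (0 < p)%N by exact: prime_gt0.
suff H j : (j < p)%N -> exists m : nat -> seq (seq T) -> k,
    [/\ m 0%N = tw (nseq p false), forall i, (i <= j)%N -> wspan p i (m i),
     theta p j (tcob (m j)) = (fun=> 0) &
     cob (fun s => \sum_(i < j.+1) phi p i s (m i)) = (fun s => sg j * phi p j s (tcob (m j)))].
  have [|m [m0 ms _ mc]] := H p.-1; first by rewrite prednK.
  rewrite prednK // in mc.
  have p1 : (p.-1 < p)%N by rewrite prednK.
  have := span_tcob p1 (ms _ (leqnn _)); rewrite prednK // => /span_top [c E].
  exists m, (sg p.-1 * c); split=> // [i ip|]; first by apply: ms; rewrite -ltnS prednK.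
  rewrite mc; apply: funext => s; rewrite E -mulrA; congr (_ * _).
  by rewrite phiZ.
elim: j => [|j IH] jp.
  exists (fun=> tw (nseq p false)).
  have s0 : wspan p 0 (tw (nseq p false)).
    by apply: span_tw; rewrite ?size_nseq // count_nseq mul0n.
  split=> // [i||]; first by rewrite leqn0 => /eqP ->.
    (* f has even degree, so rotating f...f costs no sign; its norm is p times itself, which
       vanishes in characteristic p and starts the induction. *)
    have rT : rotT (tw (nseq p false)) = tw (nseq p false).
      rewrite -(prednK p0) -{1}addn1 nseqD cats1 rot_tw.
      by apply: funext => w; rewrite mul0n /altsign mul1r.
    rewrite theta_tcob.
    have -> : theta p 0 (tw (nseq p false)) = fun=> 0.
      have it m : iter m (@rotT k T) (tw (nseq p false)) = tw (nseq p false).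
        by elim: m => //= m ->.
      apply: funext => w; rewrite /theta /=; under eq_bigr => m _ do rewrite it.
      by rewrite sumr_const card_ord -mulr_natl (pcharf0 pk) mul0r.
    by apply: funext => w; rewrite /tcob tbd0.
  apply: funext => s; rewrite /cob.
  have -> : (fun s => \sum_(i < 1) phi p i s (tw (nseq p false))) = (fun s => tcut p s (tw (nseq p false))).
    by apply: funext => x; rewrite big_ord1.
  rewrite tcut_cob /altsign ?mul1r // => w hw.
  by apply: (span_good s0); rewrite /okl hw andbF.
have [m [m0 ms mt mc]] := IH (ltnW jp).
have [|U sU Ue] := solve _ (span_tcob (ltnW jp) (ms _ (leqnn j))) mt; first by rewrite jp.
exists (fun i => if i == j.+1 then U else m i); split; first exact: m0.
- move=> i ij; case: eqP => [->//|ne]; apply: ms.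
  by rewrite -ltnS ltn_neqAle ij andbT; apply/eqP.
- rewrite eqxx theta_tcob Ue; apply: funext => w.
  by rewrite /tcob (addflN _ (@additive_tbd k T w)) -/(tcob (m j)) tbd_tbd oppr0.
rewrite eqxx; apply: funext => s.
have -> : (fun s => \sum_(i < j.+2) phi p i s (if i == j.+1 :> nat then U else m i)) =
    (fun s => \sum_(i < j.+1) phi p i s (m i) + phi p j.+1 s U).
  apply: funext => x; rewrite big_ord_recr /= eqxx; congr (_ + _).
  by apply: eq_bigr => i _; rewrite ltn_eqF // ltnS ltnW.
rewrite /cob bdD -/(cob _ s) mc.
rewrite (phi_cob j s (span_good sU) p0) Ue (addflN _ (@additive_phi k T p j s)).
by rewrite sgS mulrDr mulrA mulrNN sg2 mul1r; ring.
Qed.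

End Steenrod.

Section TransgressivePower.
Variables (k : fieldType) (p : nat).
Hypothesis pk : p \in [pchar k].

Lemma tw_pb T T' (u : T -> T') (f : seq T' -> k) g v w :
  (forall s, f (map u s) = g s) -> tw f v (map (map u) w) = tw g v w.
Proof.
move=> fu; elim: v w => [|b v IH] [|s w] //=; rewrite IH; congr (_ * _).
by case: b; rewrite ?fu // /cob bd_map; apply: eq_bd => x _; rewrite fu.
Qed.

Lemma span_inv T (u : T -> T) (f : seq T -> k) r j F :
  (forall s, f (map u s) = f s) -> wspan f r j F ->
  forall w, F (map (map u) w) = F w.
Proof.
move=> fu; elim=> [v sv cv|{}F G _ IF _ IG|c {}F _ IF] w.
- exact: tw_pb.
- by rewrite !funE IF IG.
- by rewrite IF.
Qed.

Lemma span_vanish T T' (u : T -> T') (f : seq T' -> k) r j F :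
  (forall s, cob f (map u s) = 0) -> (0 < j)%N -> wspan f r j F ->
  forall w, F (map (map u) w) = 0.
Proof.
move=> fu j0; elim=> [v sv cv|{}F G _ IF _ IG|c {}F _ IF] w.
- have : has id v by rewrite has_count cv.
  elim: v w {sv cv} => [|b v IH] [|s w] //= /orP[->|hv]; first by rewrite fu mul0r.
  by rewrite IH // mulr0.
- by rewrite !funE IF IG addr0.
- by rewrite IF mulr0.
Qed.

Lemma cpw_pb T T' (u : T -> T') (f : seq T' -> k) r : pb u (cpw f r) = cpw (pb u f) r.
Proof.
elim: r => [|r IH] /=; first by apply: funext => s; rewrite /pb /onef size_map.
by rewrite pb_cup IH.
Qed.

Variables (C G Q : finGroupType) (io : C -> G) (pr : G -> Q).
Hypotheses (prM : forall x y, pr (x * y)%g = (pr x * pr y)%g).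
Hypothesis pr_surj : forall y, exists x, pr x = y.
Hypothesis pr_io : forall c, pr (io c) = 1%g.

Lemma lift_seq (s : seq Q) : exists s', map pr s' = s.
Proof.
elim: s => [|y s [s' <-]]; first by exists [::].
by have [x <-] := pr_surj y; exists (x :: s').
Qed.

Lemma pb_inj (t t' : seq Q -> k) : pb pr t = pb pr t' -> t = t'.
Proof.
move=> e; apply: funext => s; have [s' <-] := lift_seq s.
exact: (congr1 (fun f => f s') e).
Qed.

Lemma pb_coch_surj m (t : seq Q -> k) : coch m (pb pr t) -> coch m t.
Proof.
move=> [[t0 tm] ti]; split; first split.
- exact: t0.
- by move=> s; have [s' <-] := lift_seq s; rewrite size_map => /tm.
move=> a s; have [s' <-] := lift_seq s; have [b <-] := pr_surj a.
rewrite -[RHS]/(pb pr t s') -(ti b s') /pb -!map_comp; congr t.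
by apply: eq_map => x /=; rewrite prM.
Qed.

Lemma io_const (t : seq Q -> k) s : t (map pr (map io s)) = t (nseq (size s) 1%g).
Proof.
rewrite -map_comp; congr t; elim: s => //= a s ->; by rewrite pr_io.
Qed.

Lemma bd_nseq (t : seq Q -> k) m : bd (nseq m.+1 1%g) t = (~~ odd m)%:R * t (nseq m 1%g).
Proof.
elim: m t => [|m IH] t; first by rewrite /= subr0 mul1r.
have := IH (fun x => t (1%g :: x)) => /= ->.
by case: (odd m); rewrite /=; ring.
Qed.

(** C maps to the identity of Q, so the value at a constant simplex is at stake. Evaluating cob t =
    0 on n + 3 equal vertices leaves one copy of that value, since n is even. *)
Lemma odd_cocycle_vanish n (t : seq Q -> k) : ~~ odd n ->
  coch n.+2 t -> cob t = 0 -> forall s, t (map pr (map io s)) = 0.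
Proof.
move=> n_even [[t0 tm] _] tc s; rewrite io_const.
case: (eqVneq (size s) n.+2) => [->|ne]; last by rewrite tm // size_nseq.
have := congr1 (fun h => h (nseq n.+3 1%g)) tc.
by rewrite /cob bd_nseq /= negbK n_even mul1r.
Qed.

Lemma transgressive_power n (f : seq G -> k) (t : seq Q -> k) : ~~ odd n ->
  coch n.+1 f -> cob f = pb pr t ->
  exists f' t', [/\ coch (p * n).+1%N f', coch (p * n).+2%N t', cob f' = pb pr t' &
    pb io f' = cpw (pb io f) p].
Proof.
move=> n_even [fs fi] ft; have p0 := prime_gt0 (pcharf_prime pk).
have [m [c [m0 ms mc]]] := power_transgression pk fs n_even.
set g := fun s => _ in mc.
have ct : coch n.+2 t by apply: pb_coch_surj; rewrite -ft; apply: coch_cob.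
have t_cl : cob t = 0.
  by apply: pb_inj; rewrite pb_cob -ft cobK.
have tio s : cob f (map io s) = 0.
  by rewrite ft; exact: odd_cocycle_vanish n_even ct t_cl s.
have gc : coch (p * n).+1%N g.
  split; first split.
  - rewrite /g; apply: big1 => -[[|i] hi] _ //=.
    by case: (p) p0 (m 0%N).
  - move=> s hs; rewrite /g; apply: big1 => i _; apply: phi_supp => w hw.
    apply: (span_shape fs (ms i (ltn_ord i))); apply/negP => /(shape_tdg pk n_even) e.
    by move: hs; rewrite (_ : size s = (p * n).+1%N) ?eqxx //; nia.
  - move=> a s; rewrite /g; apply: eq_bigr => i _; rewrite phi_map; congr phi.
    by apply: funext => w; apply: (span_inv (fi a) (ms i (ltn_ord i))).
pose tt := fix tt r (w : seq (seq Q)) : k :=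
  match r, w with 0, [::] => 1 | r'.+1, s :: w' => t s * tt r' w' | _, _ => 0 end.
pose t' s := c * phi p p.-1 s (tt p).
have e : cob g = pb pr t'.
  rewrite mc; apply: funext => s; rewrite /pb /t' phi_map; congr (_ * phi _ _ _ _).
  apply: funext => w; elim: (p) w => [|r IH] [|x w] //=.
  by rewrite -IH ft.
exists g, t'; split=> //.
  by apply: pb_coch_surj; rewrite -e; apply: coch_cob.
apply: funext => s; rewrite /pb /g -cpw_pb /pb.
rewrite (bigD1 (Ordinal p0)) //= big1 ?addr0 ?m0 ?tcut_cpw // => i i0.
rewrite phi_map -[RHS](phi0 k p i s); congr phi; apply: funext => w.
by apply: (span_vanish tio _ (ms _ (ltn_ord i))); rewrite lt0n.
Qed.

End TransgressivePower.

(** * Cyclic groups *)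

Section Cone.
Variables (k : comNzRingType) (T : Type) (a0 : T).
Implicit Types f : seq T -> k.

(** Contraction of the cochains when invariance is forgotten. The cohomology of a cyclic group is
    then computed by comparing such primitives with their translates by the generator. *)
Definition cone f : seq T -> k := fun s => if s is _ :: _ then f (a0 :: s) else 0.

Lemma szd_cone m f : szd m.+2 f -> szd m.+1 (cone f).
Proof. by move=> [f0 fm]; split=> // -[|a s] //= h; rewrite fm. Qed.

Lemma cob_cone m f : szd m.+2 f -> cob f = 0 -> cob (cone f) = f.
Proof.
move=> [f0 fm] fc; apply: funext => -[|a [|b s]] //.
  by rewrite /cob /= fm // subr0.
have := congr1 (fun h => h (a0 :: a :: b :: s)) fc; rewrite /cob.
rewrite -[bd (a0 :: _) f]/(f (a :: b :: s) - bd (a :: b :: s) (fun x => f (a0 :: x))).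
move/eqP; rewrite subr_eq0 => /eqP ->; apply: eq_bd => -[|c x] //.
Qed.

Lemma closed0_const f : szd 1 f -> cob f = 0 -> forall a b, f [:: a] = f [:: b].
Proof.
move=> _ fc a b; have := congr1 (fun h => h [:: a; b]) fc.
by rewrite /cob /= subr0 => /eqP; rewrite subr_eq0 => /eqP ->.
Qed.
End Cone.

Section CyclicGroup.
Variables (k : fieldType) (p : nat).
Hypothesis pk : p \in [pchar k].
Variables (C : finGroupType) (z : C).
Hypothesis z_gen : forall c, c \in <[z]>%g.
Hypothesis pC : (p %| #[z]%g)%N.
Local Notation q := #[z]%g.
Implicit Types (f g h : seq C -> k) (a b c : C).

Definition clog c : nat := s2val (cyclePmin (z_gen c)).

Lemma clog_lt c : (clog c < q)%N.
Proof. by rewrite /clog; case: cyclePmin. Qed.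

Lemma clogK c : (z ^+ clog c)%g = c.
Proof. by rewrite /clog; case: cyclePmin. Qed.

Lemma clog_exp i : clog (z ^+ i)%g = (i %% q)%N.
Proof.
have := clogK (z ^+ i)%g => /eqP; rewrite eq_expg_mod_order => /eqP.
by rewrite modn_small // clog_lt.
Qed.

Lemma clogM a b : clog (a * b)%g = ((clog a + clog b) %% q)%N.
Proof. by rewrite -{1}(clogK a) -{1}(clogK b) -expgD clog_exp. Qed.

Lemma clog1 : clog 1%g = 0%N.
Proof. by rewrite -(expg0 z) clog_exp mod0n. Qed.

Lemma q_gt0 : (0 < q)%N. Proof. exact: order_gt0. Qed.

Lemma q_gt1 : (1 < q)%N.
Proof.
have p1 := prime_gt1 (pcharf_prime pk).
by apply: leq_trans p1 _; apply: dvdn_leq (order_gt0 z) pC.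
Qed.

Lemma qk : q%:R = 0 :> k.
Proof. by apply/eqP; rewrite -(dvdn_pcharf pk). Qed.

Local Notation Tz := (pb (mulg z)).

Lemma inv_gen f : Tz f = f -> ginv f.
Proof.
move=> fz c s; rewrite -(clogK c); elim: (clog c) s => [|i IH] s.
  by rewrite expg0; congr f; rewrite -[RHS]map_id; apply: eq_map => x; rewrite mul1g.
rewrite -[RHS]IH -[RHS](congr1 (fun h => h _) fz) /pb -map_comp; congr f.
by apply: eq_map => x /=; rewrite expgS mulgA.
Qed.

Lemma inv_pb f : ginv f -> Tz f = f.
Proof. by move=> fi; apply: funext => s; rewrite /pb fi. Qed.

Definition nrm f : seq C -> k := fun s => \sum_(i < q) f (map (mulg (z ^+ i)%g) s).

Lemma nrmB f g : nrm (f - g) = nrm f - nrm g.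
Proof. by apply: funext => s; rewrite /nrm !funE -sumrB. Qed.

Lemma nrm_cob f : nrm (cob f) = cob (nrm f).
Proof.
apply: funext => s; rewrite /nrm /cob.
under eq_bigr => i _ do rewrite bd_map.
by rewrite -(addfl_sum q (fun i x => f (map (mulg (z ^+ i)%g) x)) (@additive_bd k C s)).
Qed.

Lemma map_expS i (s : seq C) :
  map (mulg (z ^+ i)%g) (map (mulg z) s) = map (mulg (z ^+ i.+1)%g) s.
Proof. by rewrite -map_comp; apply: eq_map => x /=; rewrite mulgA -expgSr. Qed.

Lemma sum_shift f s : \sum_(i < q) f (map (mulg (z ^+ i.+1)%g) s) = nrm f s.
Proof.
rewrite /nrm -(big_mkord xpredT (fun i => f (map (mulg (z ^+ i.+1)%g) s))).
rewrite -(big_mkord xpredT (fun i => f (map (mulg (z ^+ i)%g) s))).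
have := q_gt0; case E: q => [|m] // _.
by rewrite big_nat_recr //= [RHS]big_nat_recl //= addrC -E expg_order expg0.
Qed.

Lemma nrm_inv f : ginv (nrm f).
Proof.
apply: inv_gen; apply: funext => s; rewrite /pb /nrm -[RHS]sum_shift.
by apply: eq_bigr => i _; rewrite map_expS.
Qed.

Lemma nrm_Tz f : nrm (Tz f) = nrm f.
Proof.
apply: funext => s; rewrite -[RHS]sum_shift /nrm /pb; apply: eq_bigr => i _.
congr f; rewrite -map_comp; apply: eq_map => x /=.
by rewrite mulgA -expgS.
Qed.

Lemma nrm_id f : ginv f -> nrm f = 0.
Proof.
move=> fi; apply: funext => s; rewrite /nrm.
under eq_bigr => i _ do rewrite fi.
by rewrite sumr_const card_ord -mulr_natl qk mul0r.
Qed.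

Lemma szd_nrm m f : szd m f -> szd m (nrm f).
Proof.
move=> [f0 fm]; split; first by rewrite /nrm big1.
by move=> s hs; rewrite /nrm big1 // => i _; rewrite fm // size_map.
Qed.

Lemma szd_pb T T' (u : T -> T') m (f : seq T' -> k) : szd m f -> szd m (pb u f).
Proof. by move=> [f0 fm]; split=> // s hs; rewrite /pb fm // size_map. Qed.

(** The telescoping of [solve] in abstract form: for f of norm zero, the sum of the conjugates of R
    applied to f lies in the image of T - 1. *)
Lemma cyclic_solve (V : zmodType) (T R : V -> V) m (f : V) :
  (forall x y, T (x - y) = T x - T y) -> (forall x y, R (x - y) = R x - R y) ->
  iter m T f = f -> \sum_(i < m) iter i T f = 0 ->
  \sum_(i < m) iter i T (R (iter (m - i) T f)) =
  T (\sum_(i < m) \sum_(j < i) iter j T (R (iter (m - i) T f))) -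
  \sum_(i < m) \sum_(j < i) iter j T (R (iter (m - i) T f)).
Proof.
move=> TB RB Tm sT.
have sum_ad (S : V -> V) n (F : 'I_n -> V) : (forall x y, S (x - y) = S x - S y) ->
    S (\sum_(i < n) F i) = \sum_(i < n) S (F i).
  move=> SB; have S0 : S 0 = 0 by have := SB 0 0; rewrite !subrr.
  have SD x y : S (x + y) = S x + S y.
    by rewrite -[y]opprK SB -{1}[-y]sub0r SB S0 sub0r !opprK.
  by elim/big_rec2: _ => [//|i y1 y2 _ <-]; rewrite SD.
rewrite (sum_ad T) // -sumrB.
rewrite -[LHS]subr0 -[X in _ - X](_ : \sum_(i < m) R (iter (m - i) T f) = 0).
  rewrite -sumrB; apply: eq_bigr => i _; rewrite (sum_ad T) // -sumrB.
  rewrite -(big_mkord xpredT (fun j => T (iter j T (R (iter (m - i) T f))) - iter j T (R (iter (m - i) T f)))).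
  by rewrite telescope_sumr.
have R0 : R 0 = 0 by have := RB 0 0; rewrite !subrr.
have T0 : T 0 = 0 by have := TB 0 0; rewrite !subrr.
rewrite -(sum_ad R) // (reindex_inj rev_ord_inj) /=.
rewrite (eq_bigr (fun i : 'I_m => T (iter i T f))); last by move=> i _; rewrite subKn.
by rewrite -(sum_ad T) // sT T0.
Qed.

Definition rho1 f : seq C -> k := fun s =>
  if s is c :: _ then (c == 1%g)%:R * f s else 0.

Lemma iter_Tz i f : iter i (fun f => Tz f) f = pb (mulg (z ^+ i)%g) f.
Proof.
elim: i => [|i IH]; apply: funext => s; rewrite /pb /=.
  by congr f; rewrite -[LHS]map_id; apply: eq_map => x; rewrite expg0 mul1g.
by rewrite IH /pb /= map_expS.
Qed.

Lemma sum_rho1 g s : g [::] = 0 ->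
  \sum_(i < q) (if s is c :: _ then ((z ^+ i * c)%g == 1%g)%:R * g s else 0) = g s.
Proof.
move=> g0; case: s => [|c s]; first by rewrite g0 big1.
rewrite -mulr_suml (bigD1 (Ordinal (clog_lt c^-1%g))) //= clogK mulVg eqxx big1 ?addr0 ?mul1r //.
move=> i ne; case: eqP => // e; case/eqP: ne; apply/val_inj => /=.
by rewrite -(modn_small (ltn_ord i)) -clog_exp; congr clog; apply: (mulIg c); rewrite e mulVg.
Qed.

Lemma fun_sumE n (F : 'I_n -> seq C -> k) s : (\sum_(i < n) F i) s = \sum_(i < n) F i s.
Proof. by elim/big_rec2: _ => // i y1 y2 _ <-. Qed.

(** Cochains without invariance form an induced module over the powers of z: the conjugates of
    [rho1], the projection to simplices starting at 1, add up to the identity. *)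
Lemma ker_nrm m f : szd m f -> nrm f = 0 -> exists2 a, szd m a & f = Tz a - a.
Proof.
move=> fs nf; have [f0 fm] := fs.
have := @cyclic_solve (seq C -> k) (fun f => Tz f) rho1 q f.
set a := \sum_(i < q) \sum_(j < i) _ => E.
exists a.
  have sum0 n (F : 'I_n -> seq C -> k) : (forall i, szd m (F i)) -> szd m (\sum_(i < n) F i).
    move=> h; elim/big_ind: _ => [|x y hx hy|i _ //]; first exact: szd0.
    by rewrite -[y]opprK; apply: szdB hx _; rewrite -sub0r; apply: szdB (szd0 _ _ _) hy.
  apply: (sum0) => i; apply: (sum0) => j; rewrite !iter_Tz; apply: szd_pb.
  have [g0 gm] := szd_pb (mulg (z ^+ (q - i))%g) fs.
  by split=> // -[|c s] hs //=; rewrite gm ?mulr0.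
rewrite -E //.
- apply: funext => s; rewrite fun_sumE -[LHS](sum_rho1 s f0); apply: eq_bigr => i _.
  rewrite !iter_Tz /pb; case: s => [|c s] //=; congr (_ * _); rewrite -map_comp.
  rewrite -[LHS](congr1 f (map_id (c :: s))); congr f; apply: eq_map => x /=.
  by rewrite mulgA -expgD subnK ?expg_order ?mul1g // ltnW.
- by move=> x y; apply: funext => -[|c s] /=; rewrite ?funE ?subr0 //= mulrBr.
- rewrite iter_Tz expg_order; apply: funext => s; rewrite /pb; congr f.
  by rewrite -[RHS]map_id; apply: eq_map => x; rewrite mul1g.
- by rewrite -[RHS]nf; apply: funext => s; rewrite /nrm fun_sumE; apply: eq_bigr => i _; rewrite iter_Tz.
Qed.

Lemma nrm_cup f g : ginv f -> nrm (cupf f g) = cupf f (nrm g).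
Proof.
move=> fi; apply: funext => s; rewrite /nrm /cupf.
transitivity (cut s (fun x y => \sum_(i < q) f x * g (map (mulg (z ^+ i)%g) y))).
  rewrite (cut_sum s q (fun i x y => f x * g (map (mulg (z ^+ i)%g) y))).
  by apply: eq_bigr => i _; rewrite cut_map; apply: eq_cut => x y _ _ _; rewrite fi.
by apply: eq_cut => x y _ _ _; rewrite mulr_sumr.
Qed.

(** First step of a zigzag from the unit to the periodicity class: [u0] has norm 1, (T - 1) [v0] is
    the coboundary of [u0], and hence [ycl], the coboundary of [v0], is invariant. *)
Definition u0 : seq C -> k := fun s => if s is [:: c] then ((z * c)%g == 1%g)%:R else 0.
Definition v0 : seq C -> k := fun s => if s is [:: a; b] then (clog b < clog a)%N%:R else 0.
Definition ycl : seq C -> k := cob v0.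

Lemma szd_u0 : szd 1 u0. Proof. by split=> // -[|a [|b s]]. Qed.
Lemma szd_v0 : szd 2 v0. Proof. by split=> // -[|a [|b [|c s]]]. Qed.

Lemma clog_z c : clog (z * c)%g = if (z * c)%g == 1%g then 0%N else (clog c).+1.
Proof.
case: eqP => [->|ne]; first exact: clog1.
have E : (z * c)%g = (z ^+ (clog c).+1)%g by rewrite expgS clogK.
rewrite E clog_exp modn_small // ltn_neqAle clog_lt andbT.
by apply: contra_not_neq ne => e; rewrite E e expg_order.
Qed.

Lemma clog_pred a : (z * a)%g = 1%g -> clog a = q.-1.
Proof.
move=> za; have -> : a = (z ^+ q.-1)%g.
  by apply: (mulgI z); rewrite za -expgS prednK ?expg_order ?q_gt0.
by rewrite clog_exp modn_small // prednK ?q_gt0.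
Qed.

Lemma clog_npred a : (z * a)%g != 1%g -> (clog a < q.-1)%N.
Proof.
move=> za; have := clog_z a; rewrite (negbTE za) => e.
by have := clog_lt (z * a)%g; rewrite e -{1}(prednK q_gt0) ltnS.
Qed.

Lemma v0_Tz : Tz v0 - v0 = cob u0.
Proof.
apply: funext => s; rewrite !funE /pb /cob.
case: s => [|a [|b [|c s]]]; rewrite ?[bd _ _]/= /= ?subrr ?subr0 //.
  rewrite !clog_z; case: (eqVneq (z * a)%g 1%g) => ea; case: (eqVneq (z * b)%g 1%g) => eb.
  - have -> : a = b by apply: (mulgI z); rewrite ea eb.
    by rewrite !ltnn !subrr.
  - by rewrite (clog_pred ea) (clog_npred eb) ltn0.
  - by rewrite (clog_pred eb) [(q.-1 < _)%N]ltnNge (ltnW (clog_npred ea)).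
  - by rewrite ltnS !subrr.
rewrite (_ : bd s _ = 0) ?subr0 //.
by rewrite -[RHS](bd0 _ s); apply: eq_bd.
Qed.

Lemma nrm_u0 : nrm u0 = onef k (T := C).
Proof.
apply: funext => s; rewrite /nrm /onef; case: s => [|c [|d s]] /=; try by rewrite big1.
have h : (fun s : seq C => 1 : k) [::] = 1 by [].
pose g (s : seq C) : k := if s is [::] then 0 else 1.
rewrite -[RHS](sum_rho1 (g := g) [:: (z * c)%g]) //; apply: eq_bigr => i _.
by rewrite /= mulr1 !mulgA -expgS -expgSr.
Qed.

Lemma cob_ycl : cob ycl = 0. Proof. exact: cobK. Qed.

Lemma coch_ycl : coch 3 ycl.
Proof.
split; first exact/szd_cob/szd_v0.
apply: inv_gen; rewrite /ycl pb_cob -[pb _ v0](subrK v0) v0_Tz cobD cobK.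
by rewrite add0r.
Qed.

Lemma Zc_ycl : Zc 2 ycl. Proof. by split; [exact: coch_ycl | exact: cob_ycl]. Qed.

Definition sgn_f m f : seq C -> k := fun s => altsign k m * f s.

Lemma cob_sgn m f : cob (sgn_f m f) = sgn_f m (cob f).
Proof. by apply: funext => s; rewrite /cob /sgn_f bdZ. Qed.

Lemma sgn_sgn m f : sgn_f m (sgn_f m f) = f.
Proof. by apply: funext => s; rewrite /sgn_f mulrA sg2 mul1r. Qed.

Lemma szd_sgn j m f : szd m f -> szd m (sgn_f j f).
Proof. by move=> [f0 fm]; split=> [|s hs]; rewrite /sgn_f ?f0 ?fm // mulr0. Qed.

Lemma cob_cup_closed n f g : Zc n f -> g [::] = 0 -> cob (cupf f g) = sgn_f n (cupf f (cob g)).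
Proof.
by move=> [[fs _] fc] g0; rewrite (cob_cup fs g0) fc cup0f; apply: funext => s; rewrite funE add0r.
Qed.

Lemma Tz_cob f : Tz (cob f) = cob (Tz f). Proof. exact: pb_cob. Qed.

Lemma Tz_cup f g : ginv f -> Tz (cupf f g) = cupf f (Tz g).
Proof. by move=> fi; rewrite pb_cup inv_pb. Qed.

(** The zigzag is inverted: g = cob v, then (T - 1) v = cob u, and f is the norm of u. Since u - f
    u0 has norm zero it equals (T - 1) a; correcting v by f v0 and by cob a makes it an invariant
    primitive of g - f y. *)
Lemma cup_ycl_surj n g : Zc n.+2 g -> exists2 f, Zc n f & Bc n.+2 (g - cupf f ycl).
Proof.
move=> [[gs gi] gc]; pose v := cone 1%g g.
have vs : szd n.+2 v by exact: szd_cone.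
have gv : cob v = g by apply: cob_cone gs gc.
pose u := cone 1%g (Tz v - v).
have dv : cob (Tz v - v) = 0 by rewrite cobB -Tz_cob gv (inv_pb gi) subrr.
have dvs : szd n.+2 (Tz v - v) by apply: szdB (szd_pb _ vs) vs.
have us : szd n.+1 u by exact: szd_cone.
have uv : cob u = Tz v - v by apply: cob_cone dvs dv.
have Zf : Zc n (nrm u).
  split; first by split; [exact: szd_nrm | exact: nrm_inv].
  by rewrite -nrm_cob uv nrmB nrm_Tz subrr.
exists (nrm u) => //; set f := nrm u.
have [fs fi] := Zf.1.
have fu0 : nrm (u - cupf f u0) = 0.
  by rewrite nrmB (nrm_cup _ fi) nrm_u0 cupf1 ?subrr //; case: fs.
have us' : szd n.+1 (u - cupf f u0).
  by apply: szdB us _; have := szd_cup fs szd_u0; rewrite addn0.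
have [a as_ ea] := ker_nrm us' fu0.
have fvs : szd n.+2 (cupf f v0) by have := szd_cup fs szd_v0; rewrite addn1.
pose w := v - sgn_f n (cupf f v0) - cob a.
have ws : szd n.+2 w.
  by apply: szdB (szd_cob as_); apply: szdB vs (szd_sgn _ fvs).
exists w; last first.
  by rewrite /w !cobB cobK subr0 gv cob_sgn (cob_cup_closed Zf) ?(proj1 szd_v0) // sgn_sgn.
split=> //; apply: inv_gen; apply/eqP; rewrite -subr_eq0; apply/eqP.
have -> : Tz w - w = (Tz v - v) - (Tz (sgn_f n (cupf f v0)) - sgn_f n (cupf f v0)) -
    (Tz (cob a) - cob a).
  by rewrite /w; apply: funext => s; rewrite /pb !funE; ring.
have -> : Tz (cob a) - cob a = cob (u - cupf f u0) by rewrite Tz_cob -cobB -ea.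
have -> : Tz (sgn_f n (cupf f v0)) - sgn_f n (cupf f v0) = cob (cupf f u0).
  rewrite (cob_cup_closed Zf) ?(proj1 szd_u0) // -v0_Tz cupBr -(Tz_cup _ fi).
  by apply: funext => s; rewrite /pb /sgn_f !funE; ring.
by rewrite cobB uv; apply: funext => s; rewrite !funE; ring.
Qed.

(** In positive degree e is the coboundary of a cone, whose norm is invariant. In degree 0 e is
    constant and its norm is a multiple of the order of C, which is 0 in k. *)
Lemma nrm_closed n e : szd n.+1 e -> cob e = 0 -> Bc n (nrm e).
Proof.
case: n => [|n] es ec.
  have e1 : ginv e.
    move=> c [|x [|y s]] //=; first exact: closed0_const.
    by rewrite !(proj2 es).
  by rewrite (nrm_id e1); exact: Bc0.
exists (nrm (cone 1%g e)).
  by split; [exact/szd_nrm/szd_cone | exact: nrm_inv].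
by rewrite -nrm_cob (cob_cone _ es ec).
Qed.

(** A primitive w of f y yields, through the zigzag, a closed but not necessarily invariant e whose
    norm is f; [nrm_closed] concludes. *)
Lemma cup_ycl_inj n f : Zc n f -> Bc n.+2 (cupf f ycl) -> Bc n f.
Proof.
move=> Zf [w [ws wi] ew]; have [[fs fi] fc] := Zf.
have fvs : szd n.+2 (cupf f v0) by have := szd_cup fs szd_v0; rewrite addn1.
pose d := w - sgn_f n (cupf f v0).
have ds : szd n.+2 d by apply: szdB ws (szd_sgn _ fvs).
have dc : cob d = 0.
  by rewrite cobB -ew cob_sgn (cob_cup_closed Zf) ?(proj1 szd_v0) // sgn_sgn subrr.
pose a := cone 1%g d.
have as_ : szd n.+1 a by exact: szd_cone.
have da : cob a = d by apply: cob_cone ds dc.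
pose e := (Tz a - a) + cupf f u0.
have fus : szd n.+1 (cupf f u0) by have := szd_cup fs szd_u0; rewrite addn0.
have es : szd n.+1 e.
  rewrite /e -[cupf f u0]opprK -[- cupf _ _]sub0r.
  by apply: szdB (szdB (szd_pb _ as_) as_) (szdB (szd0 _ _ _) fus).
have ec : cob e = 0.
  rewrite cobD cobB -Tz_cob da (cob_cup_closed Zf) ?(proj1 szd_u0) // -v0_Tz cupBr -(Tz_cup _ fi).
  apply: funext => s; have := congr1 (fun h => h s) (inv_pb wi).
  by rewrite /d /pb /sgn_f !funE => ->; ring.
have ne : nrm e = f.
  rewrite /e -[cupf f u0]opprK -[- cupf _ _]sub0r !nrmB nrm_Tz subrr sub0r.
  rewrite (_ : nrm 0 = 0); last by apply: funext => s; rewrite /nrm big1.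
  by rewrite sub0r opprK (nrm_cup _ fi) nrm_u0 cupf1 //; case: fs.
by rewrite -ne; exact: nrm_closed.
Qed.

Definition xcl : seq C -> k := fun s => if s is [:: a; b] then (clog b)%:R - (clog a)%:R else 0.

Lemma natr_mod m : (m %% q)%N%:R = m%:R :> k.
Proof. by rewrite {2}(divn_eq m q) natrD natrM qk mulr0 add0r. Qed.

Lemma Zc_xcl : Zc 1 xcl.
Proof.
have e : xcl = cob (fun s => if s is [:: a] then (clog a)%:R else 0).
  apply: funext => -[|a [|b [|c s]]] //; rewrite /cob /= ?subr0 //.
  by rewrite (_ : bd s _ = 0) ?subr0 // -[RHS](bd0 _ s); apply: eq_bd.
split; last by rewrite e cobK.
split; first by split=> // -[|a [|b [|c s]]].
by move=> c [|a [|b [|d s]]] //=; rewrite !clogM !natr_mod !natrD; ring.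
Qed.

Lemma xcl_nB : ~ Bc 1 xcl.
Proof.
move=> [g [[g0 gm] gi] e].
have := congr1 (fun h => h [:: 1%g; z]) e; rewrite /xcl /cob /= subr0 clog1.
have {2}-> : z = (z * 1)%g by rewrite mulg1.
rewrite (gi z [:: 1%g]) subrr subr0 => /eqP.
rewrite -{1}(expg1 z) clog_exp modn_small ?q_gt1 // oner_eq0 //.
Qed.

Lemma H1_xcl f : Zc 1 f -> exists c : k, f = fun s => c * xcl s.
Proof.
move=> [[fs fi] fc]; pose v := cone 1%g f.
have vs : szd 1 v by exact: szd_cone.
have dv : cob v = f by exact: (cob_cone _ fs fc).
have vc : cob (Tz v - v) = 0 by rewrite cobB -Tz_cob dv (inv_pb fi) subrr.
have cst := closed0_const (szdB (szd_pb _ vs) vs) vc.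
exists ((Tz v - v) [:: 1%g]); apply: funext => s.
(* The primitive v changes by a constant under translation by z, so it is affine in the discrete
   logarithm. *)
have vz c : v [:: c] = v [:: 1%g] + (clog c)%:R * (Tz v - v) [:: 1%g].
  rewrite -{1}(clogK c); elim: (clog c) => [|i IH]; first by rewrite expg0 mul0r addr0.
  have e : v [:: (z * z ^+ i)%g] = v [:: (z ^+ i)%g] + (Tz v - v) [:: 1%g].
    by rewrite -(cst (z ^+ i)%g) /pb !funE /=; ring.
  by rewrite expgS e IH -natr1; ring.
have [f0 fm] := fs.
case: s => [|a [|b [|c s]]]; try by rewrite /= mulr0 ?f0 ?fm.
rewrite -[in LHS]dv; transitivity (v [:: b] - (v [:: a] - 0)) => //.
by rewrite (vz a) (vz b) /=; ring.
Qed.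

Lemma H0_const f : Zc 0 f -> exists c : k, f = fun s => c * onef k s.
Proof.
move=> [[fs fi] fc]; exists (f [:: 1%g]); apply: funext => -[|a [|b s]].
- by rewrite mulr0; case: fs.
- by rewrite mulr1; exact: closed0_const.
- by rewrite mulr0; case: fs => _ ->.
Qed.

Lemma one_nB : ~ Bc 0 (onef k (T := C)).
Proof.
move=> [g /coch_size0 -> e]; have := congr1 (fun h => h [:: 1%g]) e.
by rewrite cob0 /onef /= => /eqP; rewrite oner_eq0.
Qed.

(* H^n(C) is one-dimensional; ycl is the polynomial generator in degree 2. *)
Fixpoint ygen n : seq C -> k :=
  match n with 0 => onef k (T := C) | 1 => xcl | n'.+2 => cupf (ygen n') ycl end.

Lemma Zc_ygen n : Zc n (ygen n).
Proof.
suff: Zc n (ygen n) /\ Zc n.+1 (ygen n.+1) by case.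
elim: n => [|n [IH1 IH2]]; first by split; [exact: Zc_one | exact: Zc_xcl].
by split=> //=; rewrite -addn2; exact: Zc_cup Zc_ycl.
Qed.

Lemma ygen_nB n : ~ Bc n (ygen n).
Proof.
suff: ~ Bc n (ygen n) /\ ~ Bc n.+1 (ygen n.+1) by case.
elim: n => [|n [IH1 IH2]]; first by split; [exact: one_nB | exact: xcl_nB].
by split=> // /(cup_ycl_inj (Zc_ygen n)).
Qed.

Lemma ygen_span n f : Zc n f -> exists c : k, Bc n (f - (fun s => c * ygen n s)).
Proof.
suff: (forall f, Zc n f -> exists c : k, Bc n (f - (fun s => c * ygen n s))) /\ (forall f, Zc n.+1 f -> exists c : k, Bc n.+1 (f - (fun s => c * ygen n.+1 s))).
  by case=> H _; exact: H.
elim: n {f} => [|n [IH1 IH2]].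
  split=> f.
    by move/H0_const => [c ->]; exists c; rewrite subrr; exact: Bc0.
  by move/H1_xcl => [c ->]; exists c; rewrite subrr; exact: Bc0.
split=> // g /cup_ycl_surj [f Zf Bg]; have [c Bf] := IH1 _ Zf; exists c.
have -> : g - (fun s => c * ygen n.+2 s) =
    (g - cupf f ycl) - (0 - cupf (f - (fun s => c * ygen n s)) ycl).
  rewrite cupBl.
  have -> : cupf (fun s => c * ygen n s) ycl = (fun s => c * ygen n.+2 s).
    apply: funext => s; rewrite /= /cupf -cutZ; apply: eq_cut => x y _ _ _; ring.
  by apply: funext => s; rewrite !funE; ring.
apply: BcB => //; apply: BcB (Bc0 _ _ _) _.
by rewrite -addn2; exact: Bc_cupl Bf Zc_ycl.
Qed.

End CyclicGroup.

(** * The filtered complex of a central extension *)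

Section Join.
Variables (k : comNzRingType) (G Q : finGroupType) (pr : G -> Q).
Hypothesis prM : forall x y, pr (x * y)%g = (pr x * pr y)%g.
Local Notation sg := (altsign k).
Local Notation Kf := (seq Q -> seq G -> k).
Implicit Types (F H W : Kf).

Lemma KfDE F H (s : seq Q) (w : seq G) : (F + H) s w = F s w + H s w. Proof. by []. Qed.
Lemma KfNE F (s : seq Q) (w : seq G) : (- F) s w = - F s w. Proof. by []. Qed.
Lemma Kf0E (s : seq Q) (w : seq G) : (0 : Kf) s w = 0. Proof. by []. Qed.
Definition KfE := (KfDE, KfNE, Kf0E).

Lemma Kf_ext F H : (forall s w, F s w = H s w) -> F = H.
Proof. by move=> h; apply: funext => s; apply: funext => w. Qed.

Lemma bd_cat T (s w : seq T) (f : seq T -> k) :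
  bd (s ++ w) f = bd s (fun x => f (x ++ w)) + sg (size s) * bd w (fun y => f (s ++ y)).
Proof.
elim: s f => [|a s IH] f /=; first by rewrite /altsign expr0 mul1r add0r.
by rewrite IH sgS; ring.
Qed.

(* G-invariant cochains on the join of the simplices on Q and on G; a cochain of
   degree m is supported on pairs of lists of total size m + 2. *)
Definition dK F : Kf := fun s w => bd s (fun x => F x w) + sg (size s).+1 * bd w (F s).

Lemma dKB F H : dK (F - H) = dK F - dK H.
Proof. by apply: Kf_ext => s w; rewrite !KfE /dK !bdB; ring. Qed.
Lemma dKN F : dK (- F) = - dK F.
Proof. by apply: Kf_ext => s w; rewrite !KfE /dK !bdN; ring. Qed.
Lemma dK0 : dK 0 = 0.
Proof. by rewrite -[0 in LHS](subrr (0 : Kf)) dKB subrr. Qed.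
Lemma dKD F H : dK (F + H) = dK F + dK H.
Proof. by apply: Kf_ext => s w; rewrite !KfE /dK !bdD; ring. Qed.

Lemma dKK F : dK (dK F) = 0.
Proof.
apply: Kf_ext => s w; rewrite !KfE /dK bdD bd_bd bdD bdZ bd_bd add0r mulr0 addr0.
rewrite (eq_bd (g := fun x => sg (size s) * bd w (F x))) => [|x <- //].
by rewrite bdZ -(bd_lin s (fun x => F x) (@additive_bd k _ w)) sgS; ring.
Qed.

Definition Kp d F := [/\ forall s, F s [::] = 0,
  forall s w, (size s + size w)%N != d -> F s w = 0 &
  forall a s w, F (map (mulg (pr a)) s) (map (mulg a) w) = F s w].
Definition Kd d F := Kp d F /\ forall w, F [::] w = 0.

Lemma KpB d F H : Kp d F -> Kp d H -> Kp d (F - H).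
Proof.
move=> [F0 Fd Fi] [H0 Hd Hi]; split.
- by move=> s; rewrite !KfE F0 H0 subr0.
- by move=> s w h; rewrite !KfE Fd ?Hd ?subr0.
- by move=> a s w; rewrite !KfE Fi Hi.
Qed.
Lemma Kp0 d : Kp d 0. Proof. by []. Qed.
Lemma KpD d F H : Kp d F -> Kp d H -> Kp d (F + H).
Proof.
move=> [F0 Fd Fi] [H0 Hd Hi]; split.
- by move=> s; rewrite !KfE F0 H0 addr0.
- by move=> s w h; rewrite !KfE Fd ?Hd ?addr0.
- by move=> a s w; rewrite !KfE Fi Hi.
Qed.
Lemma KdB d F H : Kd d F -> Kd d H -> Kd d (F - H).
Proof.
by move=> [F1 F0] [H1 H0]; split; [exact: KpB | move=> w; rewrite !KfE F0 H0 subr0].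
Qed.
Lemma Kd0 d : Kd d 0. Proof. by []. Qed.
Lemma KdN d F : Kd d F -> Kd d (- F).
Proof. by move=> h; rewrite -sub0r; apply: KdB (Kd0 d) h. Qed.
Lemma KdD d F H : Kd d F -> Kd d H -> Kd d (F + H).
Proof. by move=> h h'; rewrite -[H]opprK; apply: KdB h (KdN h'). Qed.

Lemma Kp_dK d F : Kp d F -> Kp d.+1 (dK F).
Proof.
move=> [F0 Fd Fi]; split.
- by move=> s; rewrite /dK /= mulr0 addr0 -[RHS](bd0 k s); apply: eq_bd => x _.
- move=> s w h; rewrite /dK.
  have -> : bd s (fun x => F x w) = 0.
    rewrite -[RHS](bd0 k s); apply: eq_bd => x sx; apply: Fd.
    by apply: contra h; rewrite -sx addSn eqSS.
  have -> : bd w (F s) = 0.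
    rewrite -[RHS](bd0 k w); apply: eq_bd => x sx; apply: Fd.
    by apply: contra h; rewrite -sx addnS eqSS.
  by ring.
- move=> a s w; rewrite /dK !bd_map size_map; congr (_ + _ * _).
    by apply: eq_bd => x _.
  by apply: eq_bd => x _.
Qed.

Lemma Kd_dK d F : Kd d F -> Kd d.+1 (dK F).
Proof.
move=> [hF F0]; split; first exact: Kp_dK.
move=> w; rewrite /dK add0r (_ : bd w (F [::]) = 0) ?mulr0 // -[RHS](bd0 k w).
by apply: eq_bd => x _.
Qed.

(** Contraction of the augmented complex: the image of the first vertex on the G side is added to
    the simplex of Q, a choice compatible with the action of G. *)
Definition hK F : Kf := fun s w => if w is b :: _ then F (pr b :: s) w else 0.

Lemma Kp_hK d F : Kp d F -> Kp d.-1 (hK F).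
Proof.
move=> [F0 Fd Fi]; split=> //.
- move=> s [|b w] //= h; apply: Fd => /=; move: h; rewrite /= !addnS; lia.
- by move=> a s [|b w] //=; rewrite prM -[RHS](Fi a).
Qed.

Lemma Kp_acyclic d F : Kp d F -> dK F = 0 -> exists2 W, Kp d.-1 W & F = dK W.
Proof.
move=> KF cF; case: d KF => [|d] KF.
  exists 0; [exact: Kp0 | rewrite dK0].
  by have [F0 Fd _] := KF; apply: Kf_ext => s [|b w] //; apply: Fd; rewrite addnS.
(* F' vanishes when the G side has at most j vertices. Subtracting dK (hK F') raises j by one, and
   nothing is left once j reaches the total size d + 1; m counts the remaining steps. *)
suff H m j F' : (d.+1 <= j + m)%N -> Kp d.+1 F' -> dK F' = 0 ->
    (forall s w, (size w <= j)%N -> F' s w = 0) -> exists2 W, Kp d W & F' = dK W.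
  apply: (H d.+1 0%N) => // s w; rewrite leqn0 => /eqP/size0nil ->; by case: KF.
elim: m j F' => [|m IH] j F' hj KF' cF' low.
  exists 0; rewrite ?dK0; [exact: Kp0 | apply: Kf_ext => s w].
  case: (leqP (size w) j) => hw; first exact: low.
  by case: KF' => _ h _; apply: h; rewrite addn0 in hj; apply/eqP; lia.
have Kh := Kp_hK KF'.
have [||||W KW eW] := IH j.+1 (F' - dK (hK F')).
- by rewrite addSnnS.
- by apply: KpB => //; exact: (Kp_dK Kh).
- by rewrite dKB dKK cF' subr0.
- move=> s w hw; rewrite !KfE.
  have z1 (f : seq G -> k) : (forall x, (size x <= j)%N -> f x = 0) -> bd w f = 0.
    by move=> h; rewrite -[RHS](bd0 k w); apply: eq_bd => x sx; apply: h; move: hw; rewrite -sx ltnS.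
  rewrite /dK (z1 (hK F' s)) => [|[|b x] //= hx]; last exact: low.
  case: w hw z1 => [|b w] hw z1.
    case: KF' => -> _ _; rewrite (_ : bd s _ = 0) ?mulr0 ?addr0 ?subr0 //.
    by rewrite -[RHS](bd0 k s); apply: eq_bd => x _.
  have := congr1 (fun f => f (pr b :: s) (b :: w)) cF'.
  rewrite {1}/dK (z1 (F' (pr b :: s))) => [|x]; last exact: low.
  by rewrite /= KfE !mulr0 !addr0.
exists (W + hK F').
  exact: KpD.
by rewrite dKD -eW subrK.
Qed.

(** Cochains of G enter through the one-vertex simplices of Q by [emb], or through the empty
    simplex, outside [Kd], by [iemb]. By [dK_iemb] the latter provides primitives for the former in
    the larger complex. *)
Definition emb (g : seq G -> k) : Kf := fun s w => (size s == 1)%:R * g w.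
Definition iemb (g : seq G -> k) : Kf := fun s w => (size s == 0)%:R * g w.

Lemma dK_iemb g : dK (iemb g) = emb g - iemb (cob g).
Proof.
apply: Kf_ext => s w; rewrite !KfE /dK /iemb /emb bdZ /cob.
case: s => [|a [|b s]] /=; rewrite ?sgS /altsign ?expr0; try ring.
by rewrite !(mul0r, mulr0, addr0, subr0, bd0, oppr0).
Qed.

Lemma emb_cob g : dK (emb g) = emb (cob g).
Proof.
have := congr1 dK (dK_iemb g); rewrite dKK dKB dK_iemb.
have -> : cob (cob g) = 0 by exact: cobK.
have -> : iemb 0 = 0 by apply: Kf_ext => s w; rewrite /iemb !KfE mulr0.
by rewrite subr0 => /esym/eqP; rewrite subr_eq0 => /eqP.
Qed.

Lemma Kd_emb d g : coch d g -> Kd d.+1 (emb g).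
Proof.
move=> [[g0 gd] gi]; split; last by move=> w; rewrite /emb mul0r.
split.
- by move=> s; rewrite /emb g0 mulr0.
- move=> s w; rewrite /emb; case: (size s =P 1%N) => [->|_ _]; last by rewrite mul0r.
  by rewrite add1n eqSS => /gd ->; rewrite mulr0.
- by move=> a s w; rewrite /emb size_map gi.
Qed.

Lemma Kp_iemb d g : coch d g -> Kp d (iemb g).
Proof.
move=> [[g0 gd] gi]; split.
- by move=> s; rewrite /iemb g0 mulr0.
- move=> s w; rewrite /iemb; case: (size s =P 0%N) => [->|_ _]; last by rewrite mul0r.
  by rewrite add0n => /gd ->; rewrite mulr0.
- by move=> a s w; rewrite /iemb size_map gi.
Qed.

Lemma Kp_coch d F : Kp d F -> coch d (F [::]).
Proof.
move=> [F0 Fd Fi]; split; last by move=> a w; rewrite -[RHS](Fi a).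
by split=> // w h; apply: Fd.
Qed.

Lemma embB g g' : emb (g - g') = emb g - emb g'.
Proof. by apply: Kf_ext => s w; rewrite /emb !KfE !funE mulrBr. Qed.

(* Adjoining the empty simplex of Q makes the complex contractible, so the
   complex computes the cohomology of G. *)
Lemma emb_surj m F : Kd m.+2 F -> dK F = 0 ->
  exists2 g, Zc m g & exists2 H, Kd m.+1 H & F - emb g = dK H.
Proof.
move=> [KF F0] cF; have [W KW eW] := Kp_acyclic KF cF.
pose g := W [::]; have cg : coch m.+1 g by exact: Kp_coch KW.
have dg : cob g = 0.
  apply: funext => w; have := F0 w; rewrite eW /dK /= add0r sgS /altsign expr0 mulN1r.
  by move/eqP; rewrite oppr_eq0 => /eqP.
exists g => //; exists (W - iemb g).
  split; first by apply: KpB => //; exact: Kp_iemb.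
  by move=> w; rewrite !KfE /iemb mul1r subrr.
rewrite dKB -eW dK_iemb dg.
have -> : iemb 0 = 0 by apply: Kf_ext => s w; rewrite /iemb !KfE mulr0.
by rewrite subr0.
Qed.

Lemma emb_inj m g H : coch m.+1 g -> Kd m.+1 H -> emb g = dK H -> Bc m g.
Proof.
move=> cg [KH H0] e.
have cE : dK (iemb g - H) = 0.
  rewrite dKB dK_iemb -e addrAC subrr sub0r.
  have dg : emb (cob g) = 0 by rewrite -emb_cob e dKK.
  apply: Kf_ext => s w; rewrite !KfE /iemb.
  have := congr1 (fun F => F [:: 1%g] w) dg; rewrite /emb /= mul1r => ->.
  by rewrite mulr0 oppr0.
have KE : Kp m.+1 (iemb g - H) by apply: KpB => //; exact: Kp_iemb.
have [V KV eV] := Kp_acyclic KE cE; rewrite /= in KV.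
exists (- V [::]); first exact: cochN (Kp_coch KV).
apply: funext => w; have := congr1 (fun F => F [::] w) eV.
rewrite !KfE H0 subr0 /iemb /= mul1r => ->.
by rewrite /dK /= add0r sgS /altsign expr0 mulN1r /cob -bdN.
Qed.

Definition lcup (f : seq Q -> k) F : Kf := fun s w => cut s (fun x y => f x * F y w).
Definition rcup F (g : seq G -> k) : Kf := fun s w => cut w (fun x y => F s x * g y).

Lemma lcupB f F H : lcup f (F - H) = lcup f F - lcup f H.
Proof.
apply: Kf_ext => s w; rewrite !KfE /lcup -cutN -cutD.
by apply: eq_cut => x y _ _ _; rewrite !KfE; ring.
Qed.
Lemma lcupBl f f' F : lcup (f - f') F = lcup f F - lcup f' F.
Proof.
apply: Kf_ext => s w; rewrite !KfE /lcup -cutN -cutD.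
by apply: eq_cut => x y _ _ _; rewrite !funE; ring.
Qed.
Lemma rcupB F H g : rcup (F - H) g = rcup F g - rcup H g.
Proof.
apply: Kf_ext => s w; rewrite !KfE /rcup -cutN -cutD.
by apply: eq_cut => x y _ _ _; rewrite !KfE; ring.
Qed.
Lemma lcup0 F : lcup 0 F = 0.
Proof. by rewrite -[0 in LHS](subrr 0) lcupBl subrr. Qed.
Lemma lcup0r f : lcup f 0 = 0.
Proof. by rewrite -[0 in LHS](subrr (0 : Kf)) lcupB subrr. Qed.
Lemma rcup0 g : rcup 0 g = 0.
Proof. by rewrite -[0 in LHS](subrr 0) rcupB subrr. Qed.
Lemma rcupN F g : rcup (- F) g = - rcup F g.
Proof. by rewrite -sub0r rcupB rcup0 sub0r. Qed.
Lemma rcupD F H g : rcup (F + H) g = rcup F g + rcup H g.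
Proof. by rewrite -[H in LHS]opprK rcupB rcupN opprK. Qed.

Lemma lcup_cup f f' F : lcup (cupf f f') F = lcup f (lcup f' F).
Proof.
apply: Kf_ext => s w; rewrite /lcup /cupf.
under eq_cut => x y _ _ _ do rewrite mulrC -cutZ.
rewrite cutA; apply: eq_cut => x y _ _ _.
by rewrite -cutZ; apply: eq_cut => u v _ _ _; ring.
Qed.

Lemma lcup_one F : (forall w, F [::] w = 0) -> lcup (onef k (T := Q)) F = F.
Proof.
move=> F0; apply: Kf_ext => -[|a s] w; first by rewrite F0.
exact: (cut_one_l (s := a :: s) (fun y => F y w)).
Qed.

Lemma lcup_rcup f F g : lcup f (rcup F g) = rcup (lcup f F) g.
Proof.
apply: Kf_ext => s w; rewrite /lcup /rcup.
transitivity (cut s (fun x y => cut w (fun u v => f x * F y u * g v))).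
  apply: eq_cut => x y _ _ _; rewrite -cutZ; apply: eq_cut => u v _ _ _; ring.
have h : additive_fl (fun H : seq G * seq G -> k => cut w (fun u v => H (u, v))).
  by move=> H H'; rewrite /= -cutN -cutD.
have := cut_lin s (fun x y uv => f x * F y uv.1 * g uv.2) h => /= <-.
apply: eq_cut => u v _ _ _; rewrite mulrC -cutZ; apply: eq_cut => x y _ _ _; ring.
Qed.

Lemma rcup_emb g g' : rcup (emb g) g' = emb (cupf g g').
Proof.
apply: Kf_ext => s w; rewrite /rcup /emb /cupf -cutZ.
by apply: eq_cut => x y _ _ _; ring.
Qed.

Definition sgK j F : Kf := fun s w => sg j * F s w.

Lemma sgKK j F : sgK j (sgK j F) = F.
Proof. by apply: Kf_ext => s w; rewrite /sgK mulrA sg2 mul1r. Qed.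
Lemma sgK0 j : sgK j 0 = 0.
Proof. by apply: Kf_ext => s w; rewrite /sgK !KfE mulr0. Qed.
Lemma dK_sgK j F : dK (sgK j F) = sgK j (dK F).
Proof. by apply: Kf_ext => s w; rewrite /sgK /dK !bdZ; ring. Qed.
Lemma Kd_sgK j d F : Kd d F -> Kd d (sgK j F).
Proof.
move=> [[F0 Fd Fi] F1]; split; last by move=> w; rewrite /sgK F1 mulr0.
split; first by move=> s; rewrite /sgK F0 mulr0.
  by move=> s w h; rewrite /sgK Fd ?mulr0.
by move=> a s w; rewrite /sgK Fi.
Qed.

Lemma dK_lcup j f F : szd j.+1 f -> (forall w, F [::] w = 0) ->
  dK (lcup f F) = lcup (cob f) F + sgK j (lcup f (dK F)).
Proof.
move=> [f0 fj] F0; apply: Kf_ext => s w; rewrite !KfE /sgK /dK /lcup.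
rewrite (bd_cut s (G := fun x y => f x * F y w)) => [|x]; last by rewrite F0 mulr0.
rewrite f0 mul0r subr0.
have -> : bd w (fun v => cut s (fun x y => f x * F y v)) = cut s (fun x y => bd w (fun v => f x * F y v)).
  exact: (cut_lin s (fun x y v => f x * F y v) (@additive_bd k _ w)).
rewrite -!cutZ -!cutD; apply: eq_cut => x y _ _ sxy; rewrite bdZr !bdZ -/(cob f x).
case: (eqVneq (size x) j.+1) => [ex|/fj ->]; last by ring.
have -> : sg (size s).+1 = sg j * sg (size y).+1.
  by rewrite -sxy ex addSn -addnS sgS sgD !sgS; ring.
by rewrite ex !sgS; ring.
Qed.

Lemma dK_rcup F g : g [::] = 0 -> cob g = 0 -> (forall s, F s [::] = 0) ->
  dK (rcup F g) = rcup (dK F) g.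
Proof.
move=> g0 gc F0; apply: Kf_ext => s w; rewrite /dK /rcup.
rewrite (bd_cut w (G := fun x y => F s x * g y)) => [|x]; last by rewrite g0 mulr0.
rewrite F0 mul0r subr0.
have -> : bd s (fun u => cut w (fun x y => F u x * g y)) = cut w (fun x y => bd s (fun u => F u x * g y)).
  symmetry.
  have h : additive_fl (fun H : seq G * seq G -> k => cut w (fun u v => H (u, v))).
    by move=> H H'; rewrite /= -cutN -cutD.
  exact: (bd_lin s (fun u xy => F u xy.1 * g xy.2) h).
rewrite -cutZ -cutD; apply: eq_cut => x y _ _ _; rewrite !bdZr bdZ -/(cob g y) gc funE.
by ring.
Qed.

Lemma Kd_lcup j d f F : coch j.+1 f -> Kd d F -> Kd (j + d)%N (lcup f F).
Proof.
move=> [[f0 fj] fi] [[F0 Fd Fi] F1]; split=> //; split.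
- by move=> s; rewrite /lcup -[RHS](cut0 k s); apply: eq_cut => x y _ _ _; rewrite F0 mulr0.
- move=> s w h; rewrite /lcup -[RHS](cut0 k s); apply: eq_cut => x y _ _ sxy.
  case: (eqVneq (size x) j.+1) => [ex|/fj ->]; last by ring.
  by rewrite Fd ?mulr0 //; apply: contra h => /eqP h; apply/eqP; lia.
- by move=> a s w; rewrite /lcup cut_map; apply: eq_cut => x y _ _ _; rewrite fi Fi.
Qed.

Lemma Kd_rcup j d F g : coch j.+1 g -> Kd d F -> Kd (d + j)%N (rcup F g).
Proof.
move=> [[g0 gj] gi] [[F0 Fd Fi] F1]; split; last first.
  by move=> w; rewrite /rcup -[RHS](cut0 k w); apply: eq_cut => x y _ _ _; rewrite F1 mul0r.
split=> //.
- move=> s w h; rewrite /rcup -[RHS](cut0 k w); apply: eq_cut => x y _ _ sxy.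
  case: (eqVneq (size y) j.+1) => [ey|/gj ->]; last by ring.
  by rewrite Fd ?mul0r //; apply: contra h => /eqP h; apply/eqP; lia.
- by move=> a s w; rewrite /rcup cut_map; apply: eq_cut => x y _ _ _; rewrite gi Fi.
Qed.

(* The restriction of a cocycle of Q to the join of Q and G interpolates
   between the cup product in Q and the cup product with its inflation. *)
Lemma lcup_emb j m f g : Zc j f -> Zc m g -> exists2 U, Kd (j + m).+1%N U &
  lcup f (emb g) - emb (cupf (pb pr f) g) = dK U.
Proof.
move=> [[[f0 fj] fi] fc] [[[g0 gm] gi] gc].
(* The homotopy evaluates f on one long simplex: s followed by the image in Q of the front face of
   w. *)
pose U0 : Kf := fun s w => (0 < size s)%N%:R * cut w (fun x y => f (s ++ map pr x) * g y).
pose V : Kf := fun s w => sg (size s) * U0 s w.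
have V0 w : V [::] w = 0 by rewrite /V /U0 mul0r mulr0.
have KV : Kd (j + m).+1%N V.
  split=> //; split.
  - by move=> s; rewrite /V /U0 /= !mulr0.
  - move=> s w h; rewrite /V /U0 (_ : cut _ _ = 0) ?mulr0 // -[RHS](cut0 k w).
    apply: eq_cut => x y _ _ sxy.
    case: (eqVneq (size y) m.+1) => [ey|/gm ->]; last by ring.
    rewrite fj ?mul0r // size_cat size_map.
    by apply: contra h => /eqP h; apply/eqP; lia.
  - move=> a s w; rewrite /V /U0 !size_map cut_map; congr (_ * (_ * _)).
    apply: eq_cut => x y _ _ _; rewrite gi; congr (_ * _).
    rewrite -[RHS](fi (pr a)) map_cat -!map_comp; congr (f (_ ++ _)).
    by apply: eq_map => b /=; rewrite prM.
exists V => //.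
apply: Kf_ext => s w; rewrite !KfE.
suff -> : dK V s w = (0 < size s)%N%:R * (f s * g w) -
    (size s == 1)%:R * cut w (fun x y => f (map pr x) * g y).
  congr (_ - _); rewrite /lcup /emb.
  under eq_cut => x y _ _ _ do rewrite mulrCA mulrC mulrC.
  case: s => [|a s]; first by rewrite mul0r.
  rewrite mul1r -[f _ * g w](cut_one_r (s := a :: s) (fun x => f x * g w)) //.
  by apply: eq_cut => x y _ _ _; ring.
rewrite /dK; case: s => [|a s].
  rewrite /= !mul0r subrr add0r (_ : bd w (V [::]) = 0) ?mulr0 //.
  by rewrite -[RHS](bd0 k w); apply: eq_bd => x _; exact: V0.
rewrite /U0 !bdZ (_ : (0 < size (a :: s))%N) // mul1r.
rewrite (bd_cut w (G := fun x y => f ((a :: s) ++ map pr x) * g y)); last by move=> x; rewrite g0 mulr0.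
rewrite cats0.
set Sg := sg _; set Sg' := sg (size (a :: s)).
have eS : Sg = - Sg' by rewrite /Sg sgS.
have -> : cut w (fun x y => bd x (fun u => f ((a :: s) ++ [seq pr i | i <- u]) * g y) +
   sg (size x).+1 * bd y (fun y0 => f ((a :: s) ++ [seq pr i | i <- x]) * g y0)) =
   - Sg' * cut w (fun x y => bd (a :: s) (fun u => f (u ++ map pr x)) * g y).
  rewrite -cutZ; apply: eq_cut => x y _ _ _; rewrite bdZr bdZ -/(cob g y) gc funE !mulr0 addr0.
  have := congr1 (fun h => h ((a :: s) ++ map pr x)) fc; rewrite /cob bd_cat bd_map.
  rewrite -/Sg' fun0E => /eqP; rewrite addrC addr_eq0 => /eqP h.
  have -> : bd x (fun u => f ((a :: s) ++ [seq pr i | i <- u])) =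
     - (Sg' * bd (a :: s) (fun u => f (u ++ [seq pr i | i <- x]))).
    by rewrite -[LHS]mul1r -(sg2 k (size (a :: s))) -/Sg' -mulrA h; ring.
  by ring.
have e2 : Sg' * Sg' = 1 by exact: sg2.
have -> : bd (a :: s) (fun x => V x w) = - Sg' * (cut w (fun x y => bd (a :: s) (fun u => f (u ++ map pr x)) * g y)
    - (size (a :: s) == 1)%:R * cut w (fun x y => f (map pr x) * g y)).
  have -> : bd (a :: s) (fun x => V x w) = bd (a :: s) (fun x => - Sg' * U0 x w).
    by apply: eq_bd => x /eqP; rewrite /= eqSS /V /Sg' /= sgS => /eqP ->; ring.
  rewrite bdZ; congr (_ * _).
  have -> : bd (a :: s) (fun x => U0 x w) = bd (a :: s) (fun x => cut w (fun u v => f (x ++ map pr u) * g v))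
      - (size (a :: s) == 1)%:R * cut w (fun u v => f (map pr u) * g v).
    rewrite /U0; case: s {Sg Sg' eS e2} => [|b s].
      by rewrite /= !mul0r !subr0 mul1r subrr.
    rewrite mul0r subr0; apply: eq_bd => -[|c x] //= _; by rewrite mul1r.
  congr (_ - _).
  have h : additive_fl (fun H : seq G * seq G -> k => cut w (fun u v => H (u, v))).
    by move=> H H'; rewrite /= -cutN -cutD.
  have := bd_lin (a :: s) (fun u xy => f (u ++ map pr xy.1) * g xy.2) h => /= <-.
  by apply: eq_cut => x y _ _ _; rewrite bdZr; ring.
rewrite eS.
set X := cut w _; set Y := cut w _.
have -> : - Sg' * (X - (size (a :: s) == 1)%:R * Y) + - Sg' * (Sg' * (- Sg' * X - f (a :: s) * g w)) =
  (Sg' * Sg') * (Sg' * X + f (a :: s) * g w) - Sg' * X + Sg' * ((size (a :: s) == 1)%:R * Y) by ring.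
rewrite e2.
case: s @Sg @Sg' eS e2 @X => [|b s] Sg Sg' eS e2 X /=; first by rewrite /Sg' /= sgS /altsign expr0; ring.
by ring.
Qed.
End Join.

Section PrismMore.
Variables (k : comNzRingType) (X X' T T' : Type).

Lemma prism_equiv (al : X -> X') (be : T -> T') (u v : X -> T) (u' v' : X' -> T') s (f : seq T' -> k) :
  (forall x, u' (al x) = be (u x)) -> (forall x, v' (al x) = be (v x)) ->
  prism u' v' (map al s) f = prism u v s (fun y => f (map be y)).
Proof.
move=> hu hv; elim: s f => //= a s IH f; rewrite hu hv IH; congr (f [:: _, _ & _] - _).
by rewrite -!map_comp; apply: eq_map => x /=; rewrite hv.
Qed.

Lemma prism_supp (u v : X -> T) s (f : seq T -> k) :
  (forall x, size x = (size s).+1 -> f x = 0) -> prism u v s f = 0.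
Proof.
elim: s f => //= a s IH f h; rewrite h /= ?size_map // sub0r IH ?oppr0 // => x hx.
by apply: h; rewrite /= hx.
Qed.

Lemma szd_prism (u v : X -> T) n (f : seq T -> k) :
  szd n.+1 f -> szd n (fun s => prism u v s f).
Proof.
move=> [f0 fn]; split=> // s hs; apply: prism_supp => x hx; apply: fn.
by rewrite hx eqSS.
Qed.

Lemma cob_prism (u v : X -> T) (f : seq T -> k) : cob f = 0 ->
  cob (fun s => prism u v s f) = pb v f - pb u f.
Proof.
move=> fc; apply: funext => s; rewrite funDE funNE /pb -prism_bd.
rewrite (_ : prism u v s (fun x => bd x f) = 0) ?add0r // prism_supp // => x _.
by rewrite -[bd x f]/(cob f x) fc.
Qed.
End PrismMore.

Section Coefficient.
Variables (k : fieldType) (p : nat).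
Hypothesis pk : p \in [pchar k].
Variables (C : finGroupType) (z : C).
Hypothesis z_gen : forall c, c \in <[z]>%g.
Hypothesis pC : (p %| #[z]%g)%N.
Local Notation yg := (ygen k z_gen).

(* Coefficient of the class of f on the generator of H^n(C), and 0 off cocycles. *)
Definition kap n (f : seq C -> k) : k :=
  if pselect (exists c : k, Bc n (f - (fun s => c * yg n s))) is left h then sval (cid h) else 0.

Let ygZ n : Zc n (yg n) := Zc_ygen pk z_gen pC n.

Lemma Zc_scale n c (f : seq C -> k) : Zc n f -> Zc n (fun s => c * f s).
Proof.
move=> [hf fc]; split; first exact: cochZ.
by apply: funext => s; rewrite /cob bdZ -/(cob f s) fc !funE mulr0.
Qed.

Lemma Bc_scale n c (f : seq C -> k) : Bc n f -> Bc n (fun s => c * f s).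
Proof.
move=> [g hg ->]; exists (fun s => c * g s); first exact: cochZ.
by apply: funext => s; rewrite /cob bdZ.
Qed.

Lemma kapP n f : Zc n f -> Bc n (f - (fun s => kap n f * yg n s)).
Proof.
move=> /(ygen_span z_gen) h; rewrite /kap; case: pselect => [h'|//].
exact: (svalP (cid h')).
Qed.

Lemma kap_uniq n c c' f : Bc n (f - (fun s => c * yg n s)) -> Bc n (f - (fun s => c' * yg n s)) -> c = c'.
Proof.
move=> h h'; case: (eqVneq c c') => // ne.
have hB := BcB h' h.
case: (ygen_nB pk pC (n := n) (z_gen := z_gen)).
have -> : yg n = fun s => (c - c')^-1 * ((f - (fun s => c' * yg n s)) - (f - (fun s => c * yg n s))) s.
  have nz : c - c' != 0 by rewrite subr_eq0.
  by apply: funext => s; rewrite !funE; field.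
exact: Bc_scale.
Qed.

Lemma kap_eq n c f : Bc n (f - (fun s => c * yg n s)) -> kap n f = c.
Proof.
move=> h; rewrite /kap; case: pselect => [h'|[]]; last by exists c.
exact: kap_uniq (svalP (cid h')) h.
Qed.

Lemma kap_Bc n f : Bc n f -> kap n f = 0.
Proof.
move=> h; apply: kap_eq; rewrite (_ : (fun s => 0 * yg n s) = 0) ?subr0 //.
by apply: funext => s; rewrite mul0r.
Qed.

Lemma kap_0 n : kap n 0 = 0. Proof. by apply: kap_Bc; exact: Bc0. Qed.

Lemma Bc_kap n f : Zc n f -> kap n f = 0 -> Bc n f.
Proof.
move=> /kapP h e; move: h; rewrite e (_ : (fun s => 0 * yg n s) = 0) ?subr0 //.
by apply: funext => s; rewrite mul0r.
Qed.

Lemma kapB n f g : Zc n f -> Zc n g -> kap n (f - g) = kap n f - kap n g.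
Proof.
move=> /kapP hf /kapP hg; apply: kap_eq; have := BcB hf hg.
by congr (Bc n _); apply: funext => s; rewrite !funE; ring.
Qed.

Lemma kap_eqv n f g : Zc n f -> Zc n g -> Bc n (f - g) -> kap n f = kap n g.
Proof. by move=> hf hg /kap_Bc; rewrite kapB // => /eqP; rewrite subr_eq0 => /eqP. Qed.

Lemma kapZ n c f : Zc n f -> kap n (fun s => c * f s) = c * kap n f.
Proof.
move=> /kapP hf; apply: kap_eq; have := Bc_scale c hf.
by congr (Bc n _); apply: funext => s; rewrite !funE; ring.
Qed.

Lemma kap_ygen n : kap n (yg n) = 1.
Proof.
apply: kap_eq; rewrite (_ : (fun s => 1 * yg n s) = yg n) ?subrr; first exact: Bc0.
by apply: funext => s; rewrite mul1r.
Qed.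

Lemma Zc_bd T (s : seq T) n (H : seq T -> seq C -> k) : (forall x, Zc n (H x)) ->
  Zc n (fun w => bd s (fun x => H x w)) /\
  kap n (fun w => bd s (fun x => H x w)) = bd s (fun x => kap n (H x)).
Proof.
elim: s H => [|a s IH] H hH /=; first by split; [exact: Zc0 | exact: kap_0].
have [h1 h2] := IH (fun x => H (a :: x)) (fun x => hH _).
have e : (fun w => H s w - bd s (fun x => H (a :: x) w)) = H s - (fun w => bd s (fun x => H (a :: x) w)) by [].
by rewrite e; split; [exact: ZcB | rewrite kapB // h2].
Qed.

Lemma Zc_cut T (s : seq T) n (f : seq T -> k) (H : seq T -> seq C -> k) : (forall x, Zc n (H x)) ->
  Zc n (fun w => cut s (fun x y => f x * H y w)) /\
  kap n (fun w => cut s (fun x y => f x * H y w)) = cut s (fun x y => f x * kap n (H y)).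
Proof.
move=> hH; elim: s f => [|a s IH] f /=; first by split; [exact: Zc0 | exact: kap_0].
have [h1 h2] := IH (fun x => f (a :: x)).
have e : (fun w => f [:: a] * H (a :: s) w + cut s (fun x y => f (a :: x) * H y w)) =
  (fun w => f [:: a] * H (a :: s) w) - (0 - (fun w => cut s (fun x y => f (a :: x) * H y w))).
  by rewrite sub0r opprK.
have h3 := Zc_scale (f [:: a]) (hH (a :: s)).
have h4 := ZcB (Zc0 _ _ n) h1.
rewrite e; split; first exact: ZcB.
by rewrite kapB // kapB //; [rewrite kapZ // h2 kap_0 sub0r opprK | exact: Zc0].
Qed.

Lemma ygen_cup n N : cupf (yg n) (yg N.*2) = yg (n + N.*2)%N.
Proof.
elim: N => [|N IH]; first by rewrite addn0 /= cupf1 //; exact: coch_nil (proj1 (ygZ n)).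
by rewrite doubleS !addnS /= cupfA IH.
Qed.
End Coefficient.

(** Given by maps between group types rather than by subgroups, so that C and Q have cohomology
    rings of their own. The last two fields make C cyclic of order divisible by p, as the
    computation of H^*(C) requires. *)
Record cext (p : nat) (C G Q : finGroupType) (io : C -> G) (pr : G -> Q) (z : C) : Prop := Cext {
  ce_ioM : forall a b, io (a * b)%g = (io a * io b)%g;
  ce_inj : injective io;
  ce_prM : forall a b, pr (a * b)%g = (pr a * pr b)%g;
  ce_surj : forall y, exists x, pr x = y;
  ce_io : forall c, pr (io c) = 1%g;
  ce_ker : forall g, pr g = 1%g -> exists c, io c = g;
  ce_cen : forall c g, (io c * g)%g = (g * io c)%g;
  ce_gen : forall c, c \in <[z]>%g;
  ce_pC : (p %| #[z]%g)%N
}.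

Section Filtration.
Variables (k : fieldType) (p : nat).
Hypothesis pk : p \in [pchar k].
Variables (C G Q : finGroupType) (io : C -> G) (pr : G -> Q) (z : C).
Hypothesis cx : cext p io pr z.
Local Notation Kf := (seq Q -> seq G -> k).
Local Notation yg := (ygen k (ce_gen cx)).
Local Notation kap := (@kap k C z (ce_gen cx)).
Local Notation Kd := (@Kd k G Q pr).
Local Notation sg := (altsign k).
Implicit Types (F H : Kf).

Let ygZ n : Zc n (yg n) := Zc_ygen pk (ce_gen cx) (ce_pC cx) n.

Lemma pr1 : pr 1%g = 1%g.
Proof. by have := ce_prM cx 1%g 1%g; rewrite mulg1 => /esym/(canRL (mulgK _)); rewrite mulgV. Qed.
Lemma prV g : pr g^-1%g = (pr g)^-1%g.
Proof. by apply: (mulgI (pr g)); rewrite -(ce_prM cx) !mulgV pr1. Qed.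
Lemma io1 : io 1%g = 1%g.
Proof. by have := ce_ioM cx 1%g 1%g; rewrite mulg1 => /esym/(canRL (mulgK _)); rewrite mulgV. Qed.
Lemma ioV c : io c^-1%g = (io c)^-1%g.
Proof. by apply: (mulgI (io c)); rewrite -(ce_ioM cx) !mulgV io1. Qed.
Lemma pr_eq g h : pr g = pr h -> exists c, g = (h * io c)%g.
Proof.
move=> e; have [|c hc] := ce_ker cx (g := (h^-1 * g)%g); last by exists c; rewrite hc mulKVg.
by rewrite (ce_prM cx) prV e mulVg.
Qed.
Lemma C_comm (a b : C) : (a * b = b * a)%g.
Proof. by apply: (ce_inj cx); rewrite !(ce_ioM cx) (ce_cen cx). Qed.

Definition sec (q : Q) : G := sval (cid (ce_surj cx q)).
Lemma secK q : pr (sec q) = q. Proof. exact: svalP (cid (ce_surj cx q)). Qed.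

(** The factor (sec 1)^-1 normalises the section, so that the C-equivariant retraction [ret] is the
    identity on C. *)
Lemma ret_ex g : exists c, g = (io c * (sec (pr g) * (sec 1)^-1))%g.
Proof.
have [|c ->] := @pr_eq g (sec (pr g) * (sec 1)^-1)%g; last first.
  by exists c; rewrite (ce_prM cx) (ce_io cx) mulg1 (ce_prM cx) prV !secK invg1 mulg1 (ce_cen cx).
by rewrite (ce_prM cx) prV !secK invg1 mulg1.
Qed.
Definition ret g : C := sval (cid (ret_ex g)).
Lemma retP g : g = (io (ret g) * (sec (pr g) * (sec 1)^-1))%g.
Proof. exact: svalP (cid (ret_ex g)). Qed.
Lemma ret_uniq g c : g = (io c * (sec (pr g) * (sec 1)^-1))%g -> ret g = c.
Proof. by move=> e; apply: (ce_inj cx); apply: (mulIg (sec (pr g) * (sec 1)^-1)%g); rewrite -retP. Qed.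
Lemma retM c g : ret (io c * g)%g = (c * ret g)%g.
Proof.
apply: ret_uniq; rewrite (ce_prM cx) (ce_io cx) mul1g (ce_ioM cx) -mulgA -retP //.
Qed.
Lemma ret_io c : ret (io c) = c.
Proof. by apply: ret_uniq; rewrite (ce_io cx) mulgV mulg1. Qed.

Definition trunc n F := forall s w, (n < size w)%N -> F s w = 0.
(* The quotient of E n.+1 by E n computes H^*(Q; H^n(C)) = H^*(Q), through qn. *)
Definition E n F := trunc n F /\ trunc n (dK F).

Lemma truncB n F H : trunc n F -> trunc n H -> trunc n (F - H).
Proof. by move=> h h' s w hw; rewrite !KfE h // h' // subr0. Qed.
Lemma trunc0 n : trunc n 0. Proof. by []. Qed.
Lemma truncN n F : trunc n F -> trunc n (- F).
Proof. by move=> h s w hw; rewrite !KfE h // oppr0. Qed.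
Lemma trunc_le m n F : (m <= n)%N -> trunc m F -> trunc n F.
Proof. by move=> hmn h s w hw; apply: h; exact: leq_ltn_trans hw. Qed.
Lemma trunc_lcup n f F : trunc n F -> trunc n (lcup f F).
Proof.
by move=> h s w hw; rewrite /lcup -[RHS](cut0 k s); apply: eq_cut => x y _ _ _; rewrite h ?mulr0.
Qed.
Lemma trunc_sgK n j F : trunc n F -> trunc n (sgK j F).
Proof. by move=> h s w hw; rewrite /sgK h ?mulr0. Qed.
Lemma trunc_rcup n j F g : szd j.+1 g -> trunc n F -> trunc (n + j)%N (rcup F g).
Proof.
move=> [g0 gj] h s w hw; rewrite /rcup -[RHS](cut0 k w); apply: eq_cut => x y _ _ sxy.
case: (eqVneq (size y) j.+1) => [ey|/gj ->]; last by rewrite mulr0.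
by rewrite h ?mul0r //; move: hw sxy; lia.
Qed.
Lemma E0 n : E n 0. Proof. by split; rewrite ?dK0. Qed.
Lemma EB n F H : E n F -> E n H -> E n (F - H).
Proof. by move=> [h1 h2] [h3 h4]; split; rewrite ?dKB; exact: truncB. Qed.
Lemma EN n F : E n F -> E n (- F).
Proof. by move=> h; rewrite -sub0r; apply: EB (E0 n) h. Qed.
Lemma ED n F H : E n F -> E n H -> E n (F + H).
Proof. by move=> h h'; rewrite -[H]opprK; apply: EB h (EN h'). Qed.
Lemma E_le m n F : (m <= n)%N -> E m F -> E n F.
Proof. by move=> hmn [h1 h2]; split; exact: (trunc_le hmn). Qed.
Lemma E_dK n F : E n F -> E n (dK F).
Proof. by move=> [h1 h2]; split=> //; rewrite dKK; exact: trunc0. Qed.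
Lemma E_lcup n d j f F : Zc j f -> Kd d F -> E n F -> E n (lcup f F).
Proof.
move=> [[fs fi] fc] [_ F0] [h1 h2]; split; first exact: trunc_lcup.
by rewrite (dK_lcup fs F0) fc lcup0 add0r; apply: trunc_sgK; exact: trunc_lcup.
Qed.
Lemma E_lcupc n d j f F : coch j f -> Kd d F -> E n F -> E n (lcup f F).
Proof.
case: j => [/coch_size0 ->|j [fs fi]]; first by rewrite lcup0 => *; exact: E0.
move=> [_ F0] [h1 h2]; split; first exact: trunc_lcup.
rewrite (dK_lcup fs F0) -[X in _ + X]opprK; apply: truncB; first exact: trunc_lcup.
by apply: truncN; apply: trunc_sgK; exact: trunc_lcup.
Qed.
Lemma E_rcup n d j F g : Zc j g -> Kd d F -> E n F -> E (n + j)%N (rcup F g).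
Proof.
move=> [[gs gi] gc] [[F0 _ _] _] [h1 h2]; have [g0 _] := gs.
by split; [|rewrite dK_rcup //]; exact: trunc_rcup.
Qed.
Lemma Kd_trunc n d F : Kd d F -> (d <= n.+1)%N -> trunc n F.
Proof.
move=> [[_ Fd _] F0] hd [|a s] w hw; first exact: F0.
by apply: Fd; rewrite /=; apply/eqP; move: hw hd; lia.
Qed.
Lemma Kd_E n d F : Kd d F -> (d <= n)%N -> E n F.
Proof.
move=> KF hd; split; first by apply: (Kd_trunc KF); exact: leqW.
by apply: (Kd_trunc (Kd_dK KF)).
Qed.
Lemma E0_eq d F : Kd d F -> E 0 F -> F = 0.
Proof. by move=> [[F0 _ _] _] [h _]; apply: Kf_ext => s [|b w]; [exact: F0 | exact: h]. Qed.

Lemma bdE (s : seq G) (f : seq G -> k) : (forall x, (size x).+1 = size s -> f x = 0) -> bd s f = 0.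
Proof. by move=> h; rewrite -[RHS](bd0 k s); exact: eq_bd. Qed.
Lemma bdQ (s : seq Q) (f : seq Q -> k) : (forall x, f x = 0) -> bd s f = 0.
Proof. by move=> h; rewrite -[RHS](bd0 k s); apply: eq_bd => x _. Qed.

Lemma E_closed n F s w : E n.+1 F -> size w = n.+2 -> bd w (F s) = 0.
Proof.
move=> [h1 h2] sw; have := h2 s w; rewrite sw ltnSn /dK => /(_ isT).
rewrite bdQ => [|x]; last by apply: h1; rewrite sw.
move/(congr1 (fun x => sg (size s).+1 * x)); rewrite mulr0 add0r mulrA sg2 mul1r.
by [].
Qed.

Definition part n F s : seq G -> k := fun w => if size w == n then F s w else 0.

Lemma szd_part n d F s : Kd d F -> szd n (part n F s).
Proof.
move=> [[F0 _ _] _]; split; first by rewrite /part F0 if_same.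
by move=> w /negbTE h; rewrite /part h.
Qed.
Lemma part_io n d F s c w : Kd d F -> part n F s (map (mulg (io c)) w) = part n F s w.
Proof.
move=> [[_ _ Fi] _]; rewrite /part size_map -[in RHS](Fi (io c)) (ce_io cx).
by rewrite (_ : map (mulg 1%g) s = s) // -[RHS]map_id; apply: eq_map => x; rewrite mul1g.
Qed.
Lemma cob_part n d F s : Kd d F -> E n.+1 F -> cob (part n.+1 F s) = 0.
Proof.
move=> KF EF; apply: funext => w; rewrite fun0E /cob.
case: (eqVneq (size w) n.+2) => [sw|nw]; last first.
  apply: bdE => x sx; rewrite /part; case: eqP => // ex.
  by case/eqP: nw; rewrite -sx ex.
rewrite -(E_closed s EF sw); apply: eq_bd => x; rewrite sw => -[sx].
by rewrite /part sx eqxx.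
Qed.

Definition rs n F s : seq C -> k := pb io (part n F s).

Lemma coch_rs n d F s : Kd d F -> coch n (rs n F s).
Proof.
move=> KF; split; first by apply: szd_pb; exact: szd_part KF.
move=> c w; rewrite /rs /pb -[RHS](part_io n s c _ KF) -!map_comp.
by congr (part _ _ _ _); apply: eq_map => x /=; rewrite (ce_ioM cx).
Qed.
Lemma Zc_rs n d F s : Kd d F -> E n.+1 F -> Zc n (rs n.+1 F s).
Proof.
by move=> KF EF; split; [exact: coch_rs KF | rewrite /rs -pb_cob (cob_part _ KF EF)].
Qed.

Definition qn n F : seq Q -> k := fun s => kap n (rs n.+1 F s).

Lemma rsB n F H s : rs n (F - H) s = rs n F s - rs n H s.
Proof.
by apply: funext => w; rewrite /rs /pb /part !funE; case: eqP; rewrite ?KfE ?subr0.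
Qed.

Lemma qnB n d d' F H : Kd d F -> Kd d' H -> E n.+1 F -> E n.+1 H -> qn n (F - H) = qn n F - qn n H.
Proof.
move=> KF KH EF EH; apply: funext => s; rewrite !funE /qn rsB.
by apply: (kapB pk (ce_gen cx) (ce_pC cx)); [exact: Zc_rs KF EF | exact: Zc_rs KH EH].
Qed.

Lemma qn_low n F : trunc n F -> qn n F = 0.
Proof.
move=> h; apply: funext => s; rewrite /qn.
rewrite (_ : rs _ _ _ = 0); first exact: (kap_0 pk _ (ce_pC cx)).
apply: funext => w; rewrite /rs /pb /part; case: eqP => // e.
by rewrite h // e.
Qed.

Lemma part_d0 n d F s : Kd d F -> (size s + n)%N != d -> part n F s = 0.
Proof.
move=> [[_ Fd _] _] h; apply: funext => w; rewrite /part; case: eqP => // e.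
by rewrite Fd // e.
Qed.

Lemma pb0 T T' (v : T -> T') : pb v (0 : seq T' -> k) = 0. Proof. by []. Qed.

(* Translating by g in G does not change the class in H^n(C), since left and
   right translations by C agree in G. *)
Lemma pb_homotopic n (u v : C -> G) (f : seq G -> k) : szd n.+1 f -> cob f = 0 ->
  (forall c w, f (map (mulg (io c)) w) = f w) ->
  (forall c x, u (c * x)%g = (io c * u x)%g) -> (forall c x, v (c * x)%g = (io c * v x)%g) ->
  Bc n (pb v f - pb u f).
Proof.
move=> fs fc fi hu hv; exists (fun s => prism u v s f); last by rewrite cob_prism.
split; first exact: szd_prism.
move=> c s; rewrite (prism_equiv (be := mulg (io c)) (u := u) (v := v)) //.
by congr (prism _ _ _ _); apply: funext => w; exact: fi.
Qed.

Lemma coch_qn n d F : Kd d F -> E n.+1 F -> coch (d - n.+1)%N (qn n F).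
Proof.
move=> KF EF; split; first split.
- rewrite /qn (_ : rs _ _ _ = 0); first exact: (kap_0 pk _ (ce_pC cx)).
  by apply: funext => w; rewrite /rs /pb /part; case: KF => _ ->; rewrite if_same.
- move=> s hs; rewrite /qn /rs (part_d0 KF) ?pb0; first exact: (kap_0 pk _ (ce_pC cx)).
  by apply/eqP; move: hs => /eqP; lia.
- move=> a s; have [g <-] := ce_surj cx a; rewrite /qn.
  have e : rs n.+1 F (map (mulg (pr g)) s) = pb (fun c => (g^-1 * io c)%g) (part n.+1 F s).
    apply: funext => w; rewrite /rs /pb /part !size_map; case: eqP => // _.
    have [[_ _ Fi] _] := KF; rewrite -[RHS](Fi g) -!map_comp; congr F.
    by apply: eq_map => c /=; rewrite mulKVg.
  have hB : Bc n (pb (fun c => (g^-1 * io c)%g) (part n.+1 F s) - pb io (part n.+1 F s)).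
    apply: pb_homotopic.
    + exact: szd_part KF.
    + exact: cob_part KF EF.
    + by move=> c w; exact: part_io KF.
    + by move=> c x; rewrite (ce_ioM cx).
    + by move=> c x; rewrite (ce_ioM cx) !mulgA (ce_cen cx c g^-1%g).
  rewrite e; apply: (kap_eqv pk (ce_gen cx) (ce_pC cx)) => //; last exact: Zc_rs KF EF.
  have := ZcB (Bc_Zc hB) (ZcB (Zc0 _ _ _) (Zc_rs s KF EF)).
  by rewrite sub0r opprK -/(rs n.+1 F s) subrK.
Qed.

(** The part of dK along G contributes the coboundary of the piece with n vertices, which vanishes
    in H^n(C); the part along Q remains. *)
Lemma qn_dK n d F : Kd d F -> E n.+1 F -> qn n (dK F) = cob (qn n F).
Proof.
move=> KF EF; apply: funext => s; rewrite /qn /cob.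
have [h1 h2] := Zc_bd pk (ce_gen cx) (ce_pC cx) s (H := rs n.+1 F) (fun x => Zc_rs x KF EF).
rewrite -h2; apply: (kap_eqv pk (ce_gen cx) (ce_pC cx)) => //.
  exact: Zc_rs (Kd_dK KF) (E_dK EF).
exists (fun w => sg (size s).+1 * rs n F s w); first by apply: cochZ; exact: coch_rs KF.
apply: funext => w; rewrite !funE /cob bdZ /rs /pb /part size_map.
case: (eqVneq (size w) n.+1) => [sw|nw].
  rewrite /dK addrAC subrr add0r bd_map; congr (_ * _).
  by apply: eq_bd => x; rewrite sw size_map => -[->]; rewrite eqxx.
rewrite bdQ => [|x] //; rewrite subr0 (_ : bd w _ = 0) ?mulr0 //.
rewrite -[RHS](bd0 k w); apply: eq_bd => x sx; rewrite size_map; case: eqP => // e.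
by case/eqP: nw; rewrite -sx e.
Qed.

Lemma qn_lcup n d f F : Kd d F -> E n.+1 F -> qn n (lcup f F) = cupf f (qn n F).
Proof.
move=> KF EF; apply: funext => s; rewrite /qn /cupf.
have [h1 h2] := Zc_cut pk (ce_gen cx) (ce_pC cx) s f (H := rs n.+1 F) (fun x => Zc_rs x KF EF).
rewrite -h2; congr kap; apply: funext => w; rewrite /rs /pb /part size_map.
case: eqP => // _; rewrite -[LHS](cut0 k s); apply: eq_cut => x y _ _ _; by rewrite mulr0.
Qed.

(** The restriction of g to C is cohomologous to y^N, and multiplication by y^N sends the generator
    of H^n(C) to that of H^(n+2N)(C), so coefficients do not change. *)
Lemma qn_rcup n N d F g : Zc N.*2 g -> Bc N.*2 (pb io g - yg N.*2) -> Kd d F -> E n.+1 F ->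
  qn (n + N.*2)%N (rcup F g) = qn n F.
Proof.
move=> hg hB KF EF; apply: funext => s; rewrite /qn.
have -> : rs (n + N.*2).+1%N (rcup F g) s = cupf (rs n.+1 F s) (pb io g).
  apply: funext => w; rewrite /rs -pb_cup /pb; move: (map io w) => {}w.
  rewrite {1}/part; have [[[g0 gN] _] _] := hg.
  have hs := szd_part n.+1 s KF.
  case: eqP => [sw|/eqP nw]; last first.
    have := szd_cup (n := N.*2) hs (f := part n.+1 F s) (g := g); case; first by split.
    by move=> _ ->.
  apply: eq_cut => x y _ _ sxy; rewrite /part.
  case: (eqVneq (size y) N.*2.+1) => [ey|/gN ->]; last by rewrite !mulr0.
  by rewrite (_ : size x = n.+1) ?eqxx //; move: sxy; rewrite sw ey; lia.
have hr := Zc_rs s KF EF; have hk := kapP (ce_gen cx) hr.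
apply: (kap_eq pk (ce_pC cx)); rewrite -(ygen_cup pk (ce_gen cx) (ce_pC cx)).
set c := kap n _.
have hg' : Zc N.*2 (pb io g) by apply: pb_Zc => //; exact: ce_ioM cx.
have h1 := Bc_cupl hk hg'.
have h2 := Bc_cupr (Zc_scale c (ygZ n)) hB.
have := BcB h1 (BcB (Bc0 _ _ _) h2); congr (Bc _ _).
rewrite cupBl cupBr sub0r opprK addrA subrK; congr (_ - _).
apply: funext => w; rewrite /cupf -cutZ; apply: eq_cut => x y _ _ _; ring.
Qed.

(** The generator of H^n(C) is transported to the fibre over each vertex a of Q by means of the
    section; this provides a cochain with symbol 1. *)
Definition gliftF n : Kf := fun s w =>
  if s is [:: a] then yg n (map (fun g => ret ((sec a)^-1 * g)%g) w) else 0.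

Lemma Kd_gliftF n : Kd n.+2 (gliftF n).
Proof.
have [[[y0 yn] yi] _] := ygZ n.
split=> //; split.
- by move=> [|a [|b s]].
- by move=> [|a [|b s]] w //=; rewrite add1n eqSS => h; apply: yn; rewrite size_map.
- move=> g [|a [|b s]] w //=.
  have [|c hc] := @pr_eq (sec (pr g * a)%g) (g * sec a)%g; first by rewrite (ce_prM cx) !secK.
  rewrite hc -(yi c) -!map_comp; congr (yg n _); apply: eq_map => x /=.
  by rewrite -retM !invMg -!mulgA mulKVg mulKg.
Qed.

Lemma cob_gliftF n s : cob (gliftF n s) = 0.
Proof.
have [_ yc] := ygZ n; case: s => [|a [|b s]]; try exact: cob0.
by have := pb_cob (fun g => ret ((sec a)^-1 * g)%g) (yg n); rewrite yc pb0.
Qed.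

Lemma E_gliftF n : E n.+1 (gliftF n).
Proof.
have h : trunc n.+1 (gliftF n).
  move=> [|a [|b s]] w //= hw; have [[[_ yn] _] _] := ygZ n.
  by apply: yn; rewrite size_map; apply/eqP; move: hw; lia.
split=> // s w hw; rewrite /dK bdQ => [|x]; last exact: h.
by rewrite -[bd w _]/(cob (gliftF n s) w) cob_gliftF mulr0 addr0.
Qed.

Lemma qn_gliftF n : qn n (gliftF n) = onef k (T := Q).
Proof.
apply: funext => s; rewrite /qn /onef.
case: s => [|a [|b s]].
- rewrite (_ : rs _ _ _ = 0); first exact: (kap_0 pk _ (ce_pC cx)).
  by apply: funext => w; rewrite /rs /pb /part if_same.
- rewrite (_ : rs _ _ _ = yg n); first exact: (kap_ygen pk _ (ce_pC cx)).
  have [[[y0 yn] yi] _] := ygZ n.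
  apply: funext => w; rewrite /rs /pb /part size_map; case: eqP => [sw|/eqP/yn //].
  rewrite /= -[RHS](yi (ret (sec a)^-1%g)) -map_comp; congr (yg n _).
  by apply: eq_map => c /=; rewrite -(ce_cen cx) retM C_comm.
- rewrite (_ : rs _ _ _ = 0); first exact: (kap_0 pk _ (ce_pC cx)).
  by apply: funext => w; rewrite /rs /pb /part if_same.
Qed.

(** On each fibre the top part of F restricts to a coboundary of C. Primitives chosen fibre by fibre
    assemble into w, whose coboundary cancels the top part and lowers the filtration. *)
Lemma ker_qn n d F : Kd d F -> E n.+1 F -> trunc n (dK F) -> qn n F = 0 ->
  exists w, [/\ Kd d.-1 w, trunc n w & E n (F - dK w)].
Proof.
move=> KF EF tF qF0.
(* The last clause forces a zero primitive where the top part vanishes; it keeps w homogeneous of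
   the right degree. *)
have [v hv] : {v : seq Q -> seq G -> k & forall s, [/\ szd n (v s),
    forall c w, v s (map (mulg (io c)) w) = v s w, cob (v s) = part n.+1 F s &
    part n.+1 F s = 0 -> v s = 0]}.
  have ch s : exists v, [/\ szd n v, forall c w, v (map (mulg (io c)) w) = v w,
     cob v = part n.+1 F s & part n.+1 F s = 0 -> v = 0].
    case: (pselect (part n.+1 F s = 0)) => [e0|ne].
      by exists 0; split; rewrite ?cob0 ?e0 //; exact: szd0.
    have hB : Bc n (rs n.+1 F s).
      apply: (Bc_kap (z_gen := ce_gen cx)); first exact: Zc_rs KF EF.
      exact: (congr1 (fun f => f s) qF0).
    have [b [bs bi] eb] := hB.
    (* b is a primitive on C. Its pullback along [ret] handles the map g -> io (ret g), and the
       prism operator accounts for the difference with the identity of G. *)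
    exists (pb ret b + (fun x => prism (fun g => io (ret g)) id x (part n.+1 F s))); split=> //.
    + split=> [|w hw]; rewrite funDE.
        by have [-> _] := szd_pb ret bs; rewrite add0r.
      have [_ ->] := szd_pb ret bs; rewrite // add0r.
      have [_ ->] // := szd_prism (fun g => io (ret g)) id (szd_part n.+1 s KF).
    + move=> c w; rewrite !funDE; congr (_ + _).
        rewrite /pb -[RHS](bi c) -!map_comp; congr b; apply: eq_map => g /=; exact: retM.
      rewrite (prism_equiv (be := mulg (io c)) (u := fun g => io (ret g)) (v := id)) //.
        by congr (prism _ _ _ _); apply: funext => x; exact: part_io KF.
      by move=> g; rewrite retM (ce_ioM cx).
    + rewrite cobD cob_prism; last exact: cob_part KF EF.
      rewrite -pb_cob -eb /rs.
      have -> : pb ret (pb io (part n.+1 F s)) = pb (fun g => io (ret g)) (part n.+1 F s).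
        by apply: funext => x; rewrite /pb -map_comp.
      rewrite addrC subrK; apply: funext => x; rewrite /pb map_id //.
  exists (fun s => sval (cid (ch s))) => s; exact: (svalP (cid (ch s))).
(* Translating s so that it starts at 1, and x by the chosen lift of a, makes w invariant under G;
   another lift changes nothing because the primitives are C-invariant. *)
pose w : Kf := fun s x => if s is a :: _ then
  sg (size s).+1 * v (map (mulg a^-1%g) s) (map (mulg (sec a)^-1%g) x) else 0.
have wn : trunc n w.
  move=> [|a s] x hx //; rewrite /w; have [[_ vn] _ _ _] := hv (map (mulg a^-1%g) (a :: s)).
  by rewrite vn ?mulr0 // size_map gtn_eqF.
have Kw : Kd d.-1 w.
  split=> //; split.
  - move=> [|a s] //; rewrite /w; have [[v0 _] _ _ _] := hv (map (mulg a^-1%g) (a :: s)).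
    by rewrite v0 mulr0.
  - move=> [|a s] x hx //; rewrite /w.
    have [[_ vn] _ _ vz] := hv (map (mulg a^-1%g) (a :: s)).
    case: (eqVneq (size x) n) => [ex|nx]; last by rewrite vn ?mulr0 // size_map.
    rewrite vz ?mulr0 //; apply: (part_d0 KF); rewrite size_map.
    by move: hx; rewrite ex /= => /eqP hx; apply/eqP; lia.
  - move=> h [|a s] x //; rewrite /w.
    have -> : map (mulg (pr h)) (a :: s) = (pr h * a)%g :: map (mulg (pr h)) s by [].
    have -> : [seq ((pr h * a)^-1 * i)%g | i <- (pr h * a)%g :: [seq (pr h * i)%g | i <- s]] = map (mulg a^-1%g) (a :: s).
      by rewrite -[_ :: _]/(map (mulg (pr h)) (a :: s)) -map_comp; apply: eq_map => b /=; rewrite invMg -!mulgA mulKg.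
    rewrite /= size_map; congr (_ * _).
    have [|c hc] := @pr_eq (sec (pr h * a)%g) (h * sec a)%g; first by rewrite (ce_prM cx) !secK.
    have [_ vi _ _] := hv (map (mulg a^-1%g) (a :: s)).
    rewrite /= in vi; rewrite -(vi c) hc -!map_comp; congr (v _ _); apply: eq_map => y /=.
    by rewrite !invMg -!mulgA mulKVg mulKg.
exists w; split=> //; split; last by rewrite dKB dKK subr0.
move=> s x hx; rewrite !KfE {1}/dK bdQ => [|y]; last exact: wn.
have [[F0 Fd Fi] F00] := KF.
case: (eqVneq (size x) n.+1) => [sx|nx]; last first.
  have hx' : (n.+1 < size x)%N by move: hx nx; lia.
  rewrite (proj1 EF) // bdE ?mulr0 ?addr0 ?subr0 // => y sy; apply: wn; by rewrite -ltnS sy.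
case: s => [|a s]; first by rewrite F00 /= bdE ?mulr0 ?addr0 ?subr0 // => y _.
rewrite add0r /w bdZ mulrA sg2 mul1r.
have [_ _ vc _] := hv (map (mulg a^-1%g) (a :: s)).
have := congr1 (fun f => f (map (mulg (sec a)^-1%g) x)) vc; rewrite /cob bd_map => ->.
rewrite /part size_map sx eqxx.
have := Fi (sec a) (map (mulg a^-1%g) (a :: s)) (map (mulg (sec a)^-1%g) x).
have e1 : map (mulg a) (map (mulg a^-1%g) (a :: s)) = a :: s.
  by rewrite -map_comp -[RHS]map_id; apply: eq_map => b /=; rewrite mulKVg.
have e2 : map (mulg (sec a)) (map (mulg (sec a)^-1%g) x) = x.
  by rewrite -map_comp -[RHS]map_id; apply: eq_map => b /=; rewrite mulKVg.
by rewrite secK e1 e2 => ->; rewrite subrr.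
Qed.
End Filtration.

(** * The cohomology ring and the modules of the filtration *)

Section CohomologyRing.
Variables (k : finFieldType) (G : finGroupType).

Lemma Zc_fin n : exists (F : finType) (e : (seq G -> k) -> F),
  forall x y, Zc n x -> Zc n y -> e x = e y -> x = y.
Proof.
exists {ffun n.+1.-tuple G -> k}, (fun f => [ffun t : n.+1.-tuple G => f t]).
move=> f g [[[_ fn] _] _] [[[_ gn] _] _] /ffunP e; apply: funext => s.
case: (eqVneq (size s) n.+1) => [/eqP hs|hs]; last by rewrite fn ?gn.
by have := e (Tuple hs); rewrite !ffunE.
Qed.

Definition Hgm : gm :=
  @Gm (seq G -> k) (@Zc k G) (@Bc k G) (@ZcB k G) (@Bc0 k G) (@BcB k G) (@Bc_Zc k G) Zc_fin.

Lemma cup_commZ m n (f g : seq G -> k) : Zc m f -> Zc n g ->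
  Bc (m + n)%N (if odd m && odd n then cupf f g + cupf g f else cupf f g - cupf g f).
Proof.
move=> hf hg; have := cup_comm hf hg.
have -> : (fun s => altsign k (m * n)%N * cupf g f s) =
    if odd m && odd n then - cupf g f else cupf g f.
  apply: funext => s; rewrite -sg_odd oddM; case: (odd m && odd n).
    by rewrite /altsign expr1 mulN1r.
  by rewrite /altsign expr0 mul1r.
by case: (odd m && odd n); rewrite ?opprK.
Qed.

Definition Hring : grg.
Proof.
apply: (@Grg Hgm (@cupf k G) (onef k (T := G))) => /=.
- exact: cupBl.
- by move=> a b c; exact: cupBr.
- exact: cupfA.
- exact: Zc_cup.
- exact: Bc_cupl.
- exact: Bc_cupr.
- exact: Zc_one.
- by move=> n a [/coch_nil h _]; exact: cup1f.
- by move=> n a [/coch_nil h _]; exact: cupf1.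
- exact: cup_commZ.
Defined.
End CohomologyRing.

(* th represents an isomorphism from R to H^*(Q). *)
Record thetaP (k : finFieldType) (R : grg) (Q : finGroupType) (th : nat -> R -> seq Q -> k) : Prop := ThetaP {
  thZ : forall m r, gZ R m r -> Zc m (th m r);
  thB : forall m r, gZ R m r -> gB R m r <-> Bc m (th m r);
  thsub : forall m r r', gZ R m r -> gZ R m r' -> Bc m (th m (r - r') - (th m r - th m r'));
  thsur : forall m s, Zc m s -> exists2 r, gZ R m r & Bc m (s - th m r);
  thmul : forall m n r r', gZ R m r -> gZ R n r' ->
    Bc (m + n)%N (th (m + n)%N (rmul r r') - cupf (th m r) (th n r'));
  th1 : Bc 0 (th 0 (rone R) - onef k (T := Q))
}.

Section Modules.
Variables (k : finFieldType) (p : nat).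
Hypothesis pk : p \in [pchar k].
Variables (C G Q : finGroupType) (io : C -> G) (pr : G -> Q) (z : C).
Hypothesis cx : cext p io pr z.
Variables (R : grg) (th : nat -> R -> seq Q -> k).
Hypothesis hth : thetaP th.
Local Notation Kf := (seq Q -> seq G -> k).
Local Notation Kd := (@Kd k G Q pr).
Local Notation E := (@E k G Q).
Local Notation trunc := (@trunc k G Q).
Local Notation qn := (@qn k p C G Q io pr z cx).
Implicit Types (F H W : Kf).

Definition KZ n d F := [/\ Kd d.+2 F, E n F & dK F = 0].
Definition KB n d F := exists2 H, Kd d.+1 H /\ E n H & F = dK H.

Lemma KZB n d F H : KZ n d F -> KZ n d H -> KZ n d (F - H).
Proof.
move=> [h1 h2 h3] [g1 g2 g3]; split; [exact: KdB | exact: EB |].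
by rewrite dKB h3 g3 subrr.
Qed.
Lemma KB0 n d : KB n d 0.
Proof. by exists 0; rewrite ?dK0 //; split; [exact: Kd0 | exact: E0]. Qed.
Lemma KBB n d F H : KB n d F -> KB n d H -> KB n d (F - H).
Proof.
move=> [F' [h1 h2] ->] [H' [g1 g2] ->]; exists (F' - H'); last by rewrite dKB.
by split; [exact: KdB | exact: EB].
Qed.
Lemma KB_KZ n d F : KB n d F -> KZ n d F.
Proof.
by move=> [H [h1 h2] ->]; split; [exact: Kd_dK | exact: E_dK | rewrite dKK].
Qed.
Lemma KZ_fin n d : exists (F : finType) (e : Kf -> F),
  forall x y, KZ n d x -> KZ n d y -> e x = e y -> x = y.
Proof.
exists {ffun (d.+2.-bseq Q * d.+2.-bseq G) -> k}.
exists (fun f => [ffun t : d.+2.-bseq Q * d.+2.-bseq G => f t.1 t.2]).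
move=> f g [[[_ fd _] _] _ _] [[[_ gd _] _] _ _] /ffunP e; apply: Kf_ext => s w.
case: (eqVneq (size s + size w)%N d.+2) => [h|h]; last by rewrite fd ?gd.
have hs : (size s <= d.+2)%N by rewrite -h leq_addr.
have hw : (size w <= d.+2)%N by rewrite -h leq_addl.
by have := e (Bseq hs, Bseq hw); rewrite !ffunE.
Qed.

Lemma KB_lcup n m d s F : Zc m s -> KB n d F -> KB n (m + d)%N (lcup s F).
Proof.
move=> hs [H [h1 h2] ->]; have [[sz si] sc] := hs; have [_ H0] := h1.
exists (sgK m (lcup s H)).
  split; first by apply: Kd_sgK; rewrite -addnS; apply: Kd_lcup.
  split; first by apply: trunc_sgK; apply: trunc_lcup; case: h2.
  rewrite dK_sgK (dK_lcup sz H0) sc lcup0 add0r sgKK; apply: trunc_lcup; by case: h2.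
by rewrite dK_sgK (dK_lcup sz H0) sc lcup0 add0r sgKK.
Qed.

Lemma Kd_lcupc j d (c : seq Q -> k) F : coch j c -> Kd d.+1 F -> Kd (j + d)%N (lcup c F).
Proof.
case: j => [/coch_size0 ->|j hc hF]; first by rewrite lcup0 => _; exact: Kd0.
by rewrite addSnnS; exact: Kd_lcup.
Qed.

Lemma lcup_cob j c F : coch j c -> (forall w, F [::] w = 0) -> dK F = 0 ->
  lcup (cob c) F = dK (lcup c F).
Proof.
case: j => [/coch_size0 ->|j [cs _]] F0 cF; first by rewrite cob0 !lcup0 dK0.
by rewrite (dK_lcup cs F0) cF lcup0r sgK0 addr0.
Qed.

Lemma Bc_lcup n m d b F : Bc m b -> KZ n d F -> KB n (m + d)%N (lcup b F).
Proof.
move=> [c hc ->] [KF EF cF]; have [_ F0] := KF; exists (lcup c F); last exact: lcup_cob hc F0 cF.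
by split; [rewrite -addnS; exact: Kd_lcupc | exact: E_lcupc hc KF EF].
Qed.

Lemma KZ_lcup n m d s F : Zc m s -> KZ n d F -> KZ n (m + d)%N (lcup s F).
Proof.
move=> hs [KF EF cF]; have [[sz si] sc] := hs; have [_ F0] := KF; split.
- by rewrite -!addnS; exact: Kd_lcup.
- exact: E_lcup hs KF EF.
- by rewrite (dK_lcup sz F0) sc cF lcup0 add0r lcup0r sgK0.
Qed.

Definition Kgm (n : nat) : gm := @Gm Kf (KZ n) (KB n) (@KZB n) (@KB0 n) (@KBB n) (@KB_KZ n) (KZ_fin n).

Definition Kmod (n : nat) : gmd R.
Proof.
apply: (@Gmd R (Kgm n) (fun m r F => lcup (th m r) F)) => /=.
- by move=> m d r F /(thZ hth) hr; exact: KZ_lcup.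
- by move=> m d r F /(thZ hth) hr; exact: KB_lcup.
- move=> m d r F hr; apply: Bc_lcup; apply/(thB hth) => //; exact: gBZ.
- by move=> m d r r' F hr hr' hF; rewrite -!lcupBl; apply: Bc_lcup hF; exact: thsub.
- by move=> m d r F H _ _ _; rewrite lcupB subrr; exact: KB0.
- move=> m m' d r r' F hr hr' hF; rewrite -lcup_cup -lcupBl; apply: Bc_lcup hF; exact: thmul.
- move=> d F hF; have [[_ F0] _ _] := hF.
  by rewrite -[X in _ - X](lcup_one F0) -lcupBl; apply: (Bc_lcup (m := 0)) hF; exact: th1.
Defined.

(* Multiplication by such an F splits qn. *)
Definition isF n F := [/\ Kd n.+2 F, E n.+1 F, trunc n (dK F) & qn n F = onef k (T := Q)].

Lemma qn0 n : qn n 0 = 0. Proof. by apply: (qn_low pk); exact: trunc0. Qed.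

Lemma E_w n F w : E n.+1 F -> trunc n w -> E n (F - dK w) -> E n.+1 w.
Proof.
move=> [h1 h2] hw [h3 _]; split; first exact: (trunc_le _ hw).
rewrite -[dK w]opprK -[- dK w](addKr F) opprD opprK.
apply: truncB => //; exact: (trunc_le _ h3).
Qed.

(** The symbol of [gliftF] is closed, so its coboundary has symbol zero; the correction w from
    [ker_qn] moves that coboundary down one level without affecting the symbol. *)
Lemma isF_ex n : exists F, isF n F.
Proof.
have KF := Kd_gliftF pk cx n; have EF := E_gliftF pk cx n; have qF := qn_gliftF pk cx n.
have tdd : trunc n (dK (dK (@gliftF k p C G Q io pr z cx n))) by rewrite dKK; exact: trunc0.
have q0 : qn n (dK (@gliftF k p C G Q io pr z cx n)) = 0 by rewrite (qn_dK pk cx KF EF) qF cob_one.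
have [w [Kw tw Ew]] := ker_qn (Kd_dK KF) (E_dK EF) tdd q0.
have Ew' : E n.+1 w := E_w (E_dK EF) tw Ew.
exists (@gliftF k p C G Q io pr z cx n - w); split.
- exact: KdB.
- exact: EB.
- by rewrite dKB; case: Ew.
- by rewrite (qnB pk cx KF Kw EF Ew') qF (qn_low pk cx tw) subr0.
Qed.

Lemma dK_lcupF n m s F : Zc m s -> isF n F -> dK (lcup s F) = sgK m (lcup s (dK F)).
Proof. by move=> [[sz _] sc] [[_ F0] _ _ _]; rewrite (dK_lcup sz F0) sc lcup0 add0r. Qed.

Lemma qn_lcupF n m s F : coch m s -> isF n F -> qn n (lcup s F) = s.
Proof.
by move=> hs [KF EF _ qF]; rewrite (qn_lcup pk cx s KF EF) qF cupf1 //; exact: coch_nil hs.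
Qed.

(** One step down the filtration: removing the multiple s Ph and the coboundary of c Ph leaves
    symbol zero, to which [ker_qn] applies. *)
Lemma peel n j Ph F s : isF n Ph -> Kd (j + n.+1)%N F -> E n.+1 F -> trunc n (dK F) ->
  coch j s -> cob s = 0 -> (exists2 c, coch j.-1 c & qn n F - s = cob c) ->
  exists W, [/\ Kd (j + n)%N W, E n.+1 W & E n (F - lcup s Ph - dK W)].
Proof.
move=> hP KF EF tF hs sc [c hc e]; have [KP EP tP qP] := hP.
have hc' : coch j.-1 c := hc.
have Kc : Kd (j + n)%N (lcup c Ph).
  case: (j) hc => [/coch_size0 ->|j1 hc1]; first by rewrite lcup0; exact: Kd0.
  by rewrite addSnnS; exact: Kd_lcupc.
have Ec := E_lcupc hc' KP EP.
have Ks : Kd (j + n.+1)%N (lcup s Ph) by exact: Kd_lcupc.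
have Es := E_lcupc hs KP EP.
pose F' := F - lcup s Ph - dK (lcup c Ph).
have KF' : Kd (j + n.+1)%N F'.
  by apply: KdB; [exact: KdB | rewrite addnS; exact: Kd_dK].
have EF' : E n.+1 F' by apply: EB; [exact: EB | exact: E_dK].
have tF' : trunc n (dK F').
  rewrite !dKB dKK subr0; apply: truncB => //.
  case: (j) hs sc => [/coch_size0 ->|m hs sc]; first by rewrite lcup0 dK0.
  by rewrite (dK_lcupF (m := m) _ hP) //; apply: trunc_sgK; exact: trunc_lcup.
have q0 : qn n F' = 0.
  have K1 : Kd (j + n.+1)%N (F - lcup s Ph) by exact: KdB.
  have E1 : E n.+1 (F - lcup s Ph) by exact: EB.
  rewrite (qnB pk cx K1 (Kd_dK Kc) E1 (E_dK Ec)) (qnB pk cx KF Ks EF Es) (qn_dK pk cx Kc Ec).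
  by rewrite (qn_lcupF hc hP) (qn_lcupF hs hP) e subrr.
have [w [Kw tw Ew]] := ker_qn KF' EF' tF' q0.
rewrite addnS /= in Kw.
exists (lcup c Ph + w); split.
- exact: KdD.
- by apply: ED => //; exact: E_w EF' tw Ew.
- by rewrite dKD opprD [X in E n X]addrA; exact: Ew.
Qed.

Section Level.
Variable n : nat.
Let Ph := sval (cid (isF_ex n)).
Let hP : isF n Ph := svalP (cid (isF_ex n)).

Definition Klifts m (r : R) F := [/\ gZ R m r, KZ n.+1 (m + n)%N F & Bc m (th m r - qn n F)].

Lemma KZ_le m m' d F : (m <= m')%N -> KZ m d F -> KZ m' d F.
Proof. by move=> h [h1 h2 h3]; split=> //; exact: (E_le h). Qed.
Lemma KB_le m m' d F : (m <= m')%N -> KB m d F -> KB m' d F.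
Proof. by move=> h [H [h1 h2] e]; exists H => //; split=> //; exact: (E_le h). Qed.

Lemma Zc_qn m F : KZ n.+1 (m + n)%N F -> Zc m (qn n F).
Proof.
move=> [KF EF cF]; split; last by rewrite -(qn_dK pk cx KF EF) cF qn0.
by have := coch_qn pk cx KF EF; rewrite subSS subSn ?leq_addl // addnK.
Qed.

Lemma qn_KB m F : KB n.+1 (m + n)%N F -> Bc m (qn n F).
Proof.
move=> [H [h1 h2] ->]; rewrite (qn_dK pk cx h1 h2); exists (qn n H) => //.
by have := coch_qn pk cx h1 h2; rewrite subSS addnK.
Qed.

Lemma KZ_del : KZ n n.+1 (dK Ph).
Proof.
have [KP EP tP qP] := hP; split; [exact: Kd_dK | | by rewrite dKK].
by split=> //; rewrite dKK; exact: trunc0.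
Qed.

Lemma Klifts_B m r F : Klifts m r F -> gB R m r <->
  exists2 F', KZ n (m + n)%N F' & KB n.+1 (m + n)%N (F - F').
Proof.
move=> [hr hF hB]; rewrite (thB hth hr); have [KF EF cF] := hF; split.
  move=> h; have hq : Bc m (qn n F) by have := BcB h hB; rewrite subKr.
  have [c hc e] := hq.
  have [||||||W [KW EW EV]] := @peel n m.+1 Ph F 0 hP.
  - by rewrite addSn addnS.
  - exact: EF.
  - by rewrite cF; exact: trunc0.
  - exact: coch0.
  - exact: cob0.
  - by exists c => //; rewrite subr0.
  rewrite lcup0 subr0 in EV; exists (F - dK W); last first.
    by rewrite subKr; exists W.
  split=> //; last by rewrite dKB dKK cF subr0.
  by apply: KdB => //; exact: Kd_dK.
move=> [F' [KF' EF' cF'] h].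
have := qn_KB h; rewrite (qnB pk cx KF KF' EF (E_le (leqnSn n) EF')) (qn_low pk cx (proj1 EF')) subr0 => h'.
by have := BcB hB (BcB (Bc0 _ _ _) h'); rewrite sub0r opprK subrK.
Qed.

(** The multiple of Ph by a cocycle s has coboundary s dK Ph up to sign, of level n. It can be
    corrected within level n to a cocycle precisely when this class is a boundary there: [dK Ph] is
    the connecting class. *)
Lemma Klifts_del m r : gZ R m r ->
  (exists F, Klifts m r F) <-> KB n (m + n.+1)%N (lcup (th m r) (dK Ph)).
Proof.
move=> hr; have hs := thZ hth hr; have [[sz si] sc] := hs; have [KP EP tP qP] := hP; split.
  move=> [F [_ [KF EF cF] [c hc e]]].
  have [||||||W [KW EW EV]] := @peel n m.+1 Ph F (th m r) hP.
  - by rewrite addSn addnS.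
  - exact: EF.
  - by rewrite cF; exact: trunc0.
  - by split.
  - exact: sc.
  - by exists (- c); [exact: cochN | rewrite cobN -e opprB].
  set V := F - _ - _ in EV; exists (- sgK m V).
    split; last by apply: EN; split; rewrite ?dK_sgK; apply: trunc_sgK; case: EV.
    have e0 : ((m + n.+1).+1 = (m + n).+2)%N by rewrite addnS.
    rewrite e0; apply: KdN; apply: Kd_sgK; apply: KdB; last exact: (Kd_dK KW).
    by apply: KdB => //; rewrite -!addnS; apply: Kd_lcup.
  rewrite dKN dK_sgK /V !dKB dKK subr0 cF sub0r (dK_lcupF hs hP).
  apply: Kf_ext => a w; rewrite !KfE /sgK !KfE; rewrite mulrN opprK mulrA sg2 mul1r //.
move=> [V [KV EV] e].
have Ks : Kd (m + n.+2)%N (lcup (th m r) Ph) by exact: Kd_lcup.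
have Es := E_lcup hs KP EP.
have ES : E n (sgK m V) by split; rewrite ?dK_sgK; apply: trunc_sgK; case: EV.
have KS := Kd_sgK m KV.
exists (lcup (th m r) Ph - sgK m V); split=> //.
  split.
  - by apply: KdB; [rewrite -!addnS | rewrite -addnS].
  - by apply: EB => //; exact: E_le ES.
  - by rewrite dKB dK_sgK -e (dK_lcupF hs hP) subrr.
rewrite (qnB pk cx Ks KS Es (E_le (leqnSn n) ES)) (qn_low pk cx (proj1 ES)) subr0.
by rewrite (qn_lcupF (proj1 hs) hP) subrr; exact: Bc0.
Qed.

(** The symbol of a primitive H of level n + 1 is a cocycle of Q. Peeling the corresponding multiple
    of Ph off H changes F by a multiple of dK Ph and leaves a primitive of level n. *)
Lemma K_tjB d F : KZ n d F -> KB n.+1 d F <-> KB n d F \/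
  exists m r, [/\ d = (m + n.+1)%N, gZ R m r & KB n d (F - lcup (th m r) (dK Ph))].
Proof.
move=> [KF EF cF]; have [KP EP tP qP] := hP; split.
  move=> [H [KH EH] e].
  case: (leqP n.+1 d) => hd; last first.
    left; exists H => //; split=> //; split; last by rewrite -e; case: EF.
    by apply: (Kd_trunc p KH); rewrite ltnS.
  right; pose m := (d - n.+1)%N; have ed : d = (m + n.+1)%N by rewrite subnK.
  have qZ : Zc m (qn n H).
    split; last by rewrite -(qn_dK pk cx KH EH) -e (qn_low pk cx) //; case: EF.
    have := coch_qn pk cx KH EH; rewrite {1}ed subSS addnS -addSn addnK //.
  (* The sign anticipates the one in [dK_lcupF]. *)
  have qZ' : Zc m (fun s => altsign k m * qn n H s).
    split; first by apply: cochZ; case: qZ.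
    by apply: funext => s; rewrite /cob bdZ -/(cob (qn n H) s) (proj2 qZ) mulr0.
  have [r hr [c hc ec]] := thsur hth qZ'; exists m, r; split=> //.
  have hs := thZ hth hr; have [[sz si] sc] := hs.
  pose s := fun x => altsign k m * th m r x.
  have hs' : Zc m s.
    split; first by apply: cochZ; split.
    by apply: funext => x; rewrite /cob bdZ -/(cob (th m r) x) sc mulr0.
  have [||||||W [KW EW EV]] := @peel n m.+1 Ph H s hP.
  - by rewrite addSn -ed.
  - exact: EH.
  - by rewrite -e; case: EF.
  - by case: hs'.
  - by case: hs'.
  - exists (fun x => altsign k m * c x); first exact: cochZ.
    apply: funext => x; rewrite /cob bdZ -/(cob c x) -ec !funE mulrBr mulrA sg2 mul1r //.
  exists (H - lcup s Ph - dK W).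
    split=> //; apply: KdB; last by rewrite ed addnS -addSn; exact: Kd_dK.
    by apply: KdB => //; rewrite ed -addSn addSnnS; apply: Kd_lcup => //; case: hs'.
  rewrite !dKB dKK subr0 -e (dK_lcupF hs' hP); congr (_ - _).
  apply: Kf_ext => a w; rewrite /sgK /lcup -cutZ; apply: eq_cut => x y _ _ _.
  by rewrite /s !mulrA sg2 mul1r.
case=> [|[m [r [-> hr [H [KH EH] e]]]]]; first exact: KB_le.
have hs := thZ hth hr; have [[sz si] sc] := hs.
rewrite -(subrK (lcup (th m r) (dK Ph)) F) e -[X in _ + X](sgKK m) -(dK_lcupF hs hP) -dK_sgK -dKD.
exists (H + sgK m (lcup (th m r) Ph)) => //; split.
  by apply: KdD => //; apply: Kd_sgK; rewrite -addnS; exact: Kd_lcup.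
apply: ED; first exact: E_le EH.
have Es := E_lcup hs KP EP.
by split; rewrite ?dK_sgK; apply: trunc_sgK; case: Es.
Qed.

(** Here the shift n is the degree of the generator of H^n(C), and the map to R is the symbol [qn]
    read through [th]. *)
Definition Ktri : triangle R n.
Proof.
apply: (@Triangle R n (Kmod n) (Kmod n.+1) id Klifts (dK Ph)) => //=.
- by move=> d F; exact: KZ_le.
- by move=> m d r F _ _; rewrite subrr; exact: KB0.
- by move=> m r F [].
- move=> d F hF; have [KF EF cF] := hF; case: (leqP n d) => hd; last first.
    right; exists F; last by rewrite subrr; exact: KB0.
    split=> //; split; last by rewrite cF; exact: trunc0.
    by apply: (Kd_trunc p KF).
  left; rewrite -(subnK hd) in hF *; have [r hr b] := thsur hth (Zc_qn hF).
  exists (d - n)%N, r; split=> //; split=> //.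
  by have := BcB (Bc0 k Q _) b; rewrite sub0r opprB.
- move=> m r F r' F' [hr hF b] [hr' hF' b']; split; [exact: gZB | exact: KZB |].
  have [[KF EF _] [KF' EF' _]] := (hF, hF').
  rewrite (qnB pk cx KF KF' EF EF').
  have h := thsub hth hr hr'; have := BcB h (BcB (BcB (Bc0 k Q m) b) (BcB (Bc0 k Q m) b')).
  by congr (Bc m _); apply: funext => x; rewrite !funE; ring.
- move=> m m' r r' F hr' [hr hF b]; have hs := thZ hth hr'; split.
  + exact: rmulZ.
  + by rewrite -addnA; exact: KZ_lcup.
  + have [KF EF _] := hF; rewrite (qn_lcup pk cx _ KF EF).
    have h := thmul hth hr' hr; have h' := Bc_cupr hs b.
    have := BcB h (BcB (Bc0 k Q _) h'); rewrite cupBr; congr (Bc _ _).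
    by apply: funext => x; rewrite !funE; ring.
- exact: Klifts_B.
- move=> m r F hr hF; split; [exact: gBZ | exact: KB_KZ |].
  by apply: BcB; [apply/(thB hth) => //; exact: gBZ | exact: qn_KB].
- move=> m F hF; split; [exact: gZ0 | exact: (KZ_le (leqnSn n)) |].
  rewrite (qn_low pk cx) ?subr0; last by case: hF => _ [].
  by apply/(thB hth); [exact: gZ0 | exact: gB0].
- exact: KZ_del.
- exact: Klifts_del.
- exact: K_tjB.
Defined.
End Level.
End Modules.

(** * Splitting off the periodicity class *)

Section Splitting.
Variables (k : finFieldType) (p : nat).
Hypothesis pk : p \in [pchar k].
Variables (C G Q : finGroupType) (io : C -> G) (pr : G -> Q) (z : C).
Hypothesis cx : cext p io pr z.
Variables (R : grg) (th : nat -> R -> seq Q -> k).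
Hypothesis hth : thetaP th.
Variables (N : nat) (ze : seq G -> k).
Hypothesis zeZ : Zc N.*2 ze.
Hypothesis zeB : Bc N.*2 (pb io ze - ygen k (ce_gen cx) N.*2).
Local Notation N2 := (N.*2).
Local Notation Kf := (seq Q -> seq G -> k).
Local Notation Kd := (@Kd k G Q pr).
Local Notation E := (@E k G Q).
Local Notation trunc := (@trunc k G Q).
Local Notation qn := (@qn k p C G Q io pr z cx).
Local Notation KZ := (@KZ k G Q pr).
Local Notation KB := (@KB k G Q pr).
Implicit Types (F H W : Kf).

Let ze0 : ze [::] = 0. Proof. exact: coch_nil (proj1 zeZ). Qed.
Let zec : cob ze = 0. Proof. by case: zeZ. Qed.
Let zes : szd N2.+1 ze. Proof. by case: zeZ => -[]. Qed.

Lemma dK_ze d F : Kd d F -> dK (rcup F ze) = rcup (dK F) ze.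
Proof. by move=> [[F0 _ _] _]; exact: dK_rcup. Qed.
Lemma Kd_ze d F : Kd d F -> Kd (d + N2)%N (rcup F ze).
Proof. by apply: Kd_rcup; case: zeZ. Qed.
Lemma E_ze d n F : Kd d F -> E n F -> E (n + N2)%N (rcup F ze).
Proof. exact: (E_rcup p zeZ). Qed.

Lemma isF_ze n F : isF cx n F -> isF cx (n + N2)%N (rcup F ze).
Proof.
move=> [KF EF tF qF]; split.
- exact: (Kd_ze KF).
- exact: (E_ze KF EF).
- by rewrite (dK_ze KF); apply: trunc_rcup.
- by rewrite (qn_rcup pk zeZ zeB KF EF).
Qed.

(* Five lemma: multiplication by ze is an isomorphism from the cohomology of E L
   to that of E (L + 2N) / E 2N. *)
Definition surL L := forall e F, Kd (e + N2)%N F -> E (L + N2)%N F -> trunc N2 (dK F) ->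
  exists c H, [/\ Kd e c, E L c, dK c = 0, Kd (e + N2).-1 H &
    E (L + N2)%N H /\ E N2 (F - rcup c ze - dK H)].
Definition injL L := forall d c H, KZ L d c -> Kd (d.+1 + N2)%N H -> E (L + N2)%N H ->
  E N2 (rcup c ze - dK H) -> KB L d c.

Lemma inj0 : injL 0.
Proof.
move=> d c H [Kc Ec cc] _ _ _; rewrite (E0_eq Kc Ec); exact: KB0.
Qed.

Lemma sur0 : surL 0.
Proof.
move=> e F KF EF tF; exists 0, 0; split; [exact: Kd0 | exact: E0 | exact: dK0 | exact: Kd0 |].
split; first exact: E0.
by rewrite rcup0 dK0 !subr0.
Qed.

(** Ph ze again satisfies [isF], so the symbol of F is also that of cs ze with cs a multiple of Ph.
    As cs need not be closed, injectivity at level L provides X of level L with the same coboundary;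
    after subtracting (cs - X) ze the induction hypothesis applies. *)
Lemma surS L : surL L -> injL L -> surL L.+1.
Proof.
move=> IS II e F KF EF tF.
case: (leqP L.+1 e) => he; last first.
  have EF' : E (L + N2)%N F by apply: (Kd_E p KF); rewrite leq_add2r.
  have [c [H [h1 h2 h3 h4 [h5 h6]]]] := IS e F KF EF' tF.
  exists c, H; split=> //; first exact: (E_le (leqnSn L)).
  by split=> //; apply: E_le h5; rewrite leq_add2r.
have [Ph hP] := isF_ex pk cx L; have hPz := isF_ze hP; have [KP EP tP qP] := hP.
pose j := (e - L.+1)%N; have ej : e = (j + L.+1)%N by rewrite subnK.
have KF' : Kd (j + (L + N2).+1)%N F by rewrite -addSn addnA -ej.
pose s := qn (L + N2)%N F.
have hs : coch j s by have := coch_qn pk cx KF' EF; rewrite addnK.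
have tF' : trunc (L + N2)%N (dK F) by apply: trunc_le tF; exact: leq_addl.
have sc : cob s = 0 by rewrite -(qn_dK pk cx KF' EF) (qn_low pk cx tF').
have [||||||W [KW EW EV]] := peel pk hPz (j := j) (F := F) (s := s) => //.
  by exists 0; [exact: coch0 | rewrite subrr cob0].
pose cs := lcup s Ph; set V := F - _ - _ in EV.
have Kcs : Kd e cs by rewrite ej; exact: Kd_lcupc.
have Ecs : E L.+1 cs := E_lcupc hs KP EP.
have tcs : trunc L (dK cs).
  rewrite /cs; case: (j) hs sc => [/coch_size0 ->|m hs sc]; first by rewrite lcup0 dK0.
  by rewrite (dK_lcupF (cx := cx) (m := m) _ hP) //; apply: trunc_sgK; exact: trunc_lcup.
have eV : F = V + rcup cs ze + dK W.
  by rewrite /V lcup_rcup -/cs; apply: Kf_ext => a b; rewrite !KfE; ring.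
have KW' : Kd (e + N2).-1 W.
  by rewrite ej -addnA addSn addnS /=.
have dV : rcup (dK cs) ze - dK (- V) = dK F.
  by have := congr1 (@dK k G Q) eV; rewrite (dKD _ (dK W)) (dKD V) dKK addr0 (dK_ze Kcs) => ->; rewrite dKN opprK addrC.
have KV : Kd (e + N2)%N V.
  rewrite /V; apply: KdB.
    by apply: KdB => //; rewrite lcup_rcup; exact: Kd_ze.
  by have := Kd_dK KW'; rewrite prednK // ej addnS addSn.
have [||||X [KX EX] eX] := II e.-1 (dK cs) (- V).
- split; [|by split=> //; rewrite dKK; exact: trunc0 | exact: dKK].
  by rewrite prednK; [exact: Kd_dK | exact: leq_ltn_trans he].
- by rewrite prednK; [exact: KdN | exact: leq_ltn_trans he].
- exact: EN.
- by rewrite dV; split=> //; rewrite dKK; exact: trunc0.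
rewrite prednK in KX; last exact: leq_ltn_trans he.
pose c0 := cs - X.
have Kc0 : Kd e c0 by exact: KdB.
have dc0 : dK c0 = 0 by rewrite dKB eX subrr.
have [|||c' [H' [h1 h2 h3 h4 [h5 h6]]]] := IS e (F - rcup c0 ze - dK W).
- apply: KdB; first by apply: KdB => //; exact: Kd_ze.
  by have := Kd_dK KW'; rewrite prednK // ej addnS addSn.
- have -> : F - rcup c0 ze - dK W = V + rcup X ze.
    by rewrite /c0 rcupB {1}eV opprB; apply: Kf_ext => a b; rewrite !KfE; ring.
  by apply: ED => //; exact: E_ze KX EX.
- by rewrite !dKB dKK (dK_ze Kc0) dc0 rcup0 !subr0.
exists (c0 + c'), (W + H'); split.
- exact: KdD.
- apply: ED; last exact: E_le h2.
  by apply: EB => //; exact: E_le EX.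
- by rewrite dKD dc0 h3 addr0.
- exact: KdD.
split; first by apply: ED => //; apply: E_le h5; rewrite leq_add2r.
move: h6; congr (E _ _); rewrite (rcupD c0 c') (dKD W).
by apply: Kf_ext => a b; rewrite !KfE; ring.
Qed.

(** The symbol of c is a coboundary because it agrees with that of dK H, so c peels down to level L.
    The symbol left in H is then removed by a multiple of Ph ze, and injectivity at level L
    finishes. *)
Lemma injS L : injL L -> injL L.+1.
Proof.
move=> II d c H [Kc Ec cc] KH EH hE.
case: (leqP L d) => hd; last first.
  have Ec' : E L c.
    split; last by rewrite cc; exact: trunc0.
    by apply: (Kd_trunc p Kc).
  apply: (KB_le (leqnSn L)); refine (II d c H _ KH _ hE) => //.
  by apply: (Kd_E p KH); rewrite leq_add2r.
have [Ph hP] := isF_ex pk cx L; have hPz := isF_ze hP; have [KP EP tP qP] := hP.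
pose m := (d - L)%N; have ed : d = (m + L)%N by rewrite subnK.
pose t := qn (L + N2)%N H.
have KH' : Kd (m + (L + N2).+1)%N H by rewrite -addSn addnA addnS -ed.
have ht : coch m t by have := coch_qn pk cx KH' EH; rewrite addnK.
have qc : qn L c = cob t.
  rewrite -(qn_rcup pk zeZ zeB Kc Ec) -(qn_dK pk cx KH' EH).
  have := qn_low pk cx (n := (L + N2)%N) (trunc_le (leq_addl L N2) (proj1 hE)).
  rewrite (qnB pk cx (Kd_ze Kc) (Kd_dK KH') (E_ze Kc Ec) (E_dK EH)).
  by move/eqP; rewrite subr_eq0 => /eqP.
have [||||||W [KW EW EV]] := peel pk hP (j := m.+1) (F := c) (s := 0).
- by rewrite addSn addnS -ed.
- exact: Ec.
- by rewrite cc; exact: trunc0.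
- exact: coch0.
- exact: cob0.
- by exists t; rewrite // subr0.
rewrite lcup0 subr0 in EV.
have KW' : Kd d.+1 W by rewrite ed.
pose c1 := c - dK W; pose H1 := H - rcup W ze.
have KH1 : Kd (m + (L + N2).+1)%N H1.
  by apply: KdB => //; rewrite -addSn addnA addnS -ed; exact: Kd_ze.
have EH1 : E (L + N2).+1 H1 by apply: EB => //; exact: (E_ze KW' EW).
have dH1 : rcup c1 ze - dK H1 = rcup c ze - dK H.
  by rewrite /c1 /H1 rcupB dKB (dK_ze KW'); apply: Kf_ext => a b; rewrite !KfE; ring.
have Kc1 : Kd d.+2 c1 by apply: KdB => //; exact: Kd_dK.
have tH1 : trunc (L + N2)%N (dK H1).
  have -> : dK H1 = rcup c1 ze - (rcup c ze - dK H) by rewrite -dH1 opprB addrC subrK.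
  apply: truncB; first by have [] := E_ze Kc1 EV.
  by apply: trunc_le (proj1 hE); exact: leq_addl.
pose s := qn (L + N2)%N H1.
have hs : coch m s by have := coch_qn pk cx KH1 EH1; rewrite addnK.
have sc : cob s = 0 by rewrite -(qn_dK pk cx KH1 EH1) (qn_low pk cx tH1).
have [||||||W' [KW1 EW1 EV1]] := peel pk hPz (j := m) (F := H1) (s := s) => //.
  by exists 0; [exact: coch0 | rewrite subrr cob0].
pose cs := lcup s Ph; set V := H1 - _ - _ in EV1.
have Kcs : Kd d.+1 cs by rewrite ed -addnS; exact: Kd_lcupc.
have Ecs : E L.+1 cs := E_lcupc hs KP EP.
have tcs : trunc L (dK cs).
  rewrite /cs; case: (m) hs sc => [/coch_size0 ->|m' hs sc]; first by rewrite lcup0 dK0.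
  by rewrite (dK_lcupF (cx := cx) (m := m') _ hP) //; apply: trunc_sgK; exact: trunc_lcup.
have [||||X [KX EX] eX] := II d (c1 - dK cs) V.
- split; first by apply: KdB => //; exact: Kd_dK.
    by apply: EB => //; split=> //; rewrite dKK; exact: trunc0.
  by rewrite /c1 !dKB !dKK cc !subrr.
- have e0 : (d.+1 + N2 = m + (L + N2).+1)%N by rewrite ed; lia.
  rewrite e0; apply: KdB.
    apply: KdB => //; rewrite -e0 lcup_rcup; exact: Kd_ze.
  by rewrite addnS; exact: Kd_dK.
- exact: EV1.
- move: hE; rewrite -dH1; congr (E _ _).
  have -> : dK V = dK H1 - rcup (dK cs) ze.
    by rewrite /V lcup_rcup -/cs (dKB _ (dK W')) (dKB H1) dKK subr0 (dK_ze Kcs).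
  rewrite (rcupB c1 (dK cs)).
  by apply: Kf_ext => a b; rewrite !KfE; ring.
exists (X + W + cs).
  split; first by apply: KdD => //; exact: KdD.
  by apply: ED => //; apply: ED => //; exact: E_le EX.
by rewrite (dKD (X + W)) (dKD X) -eX /c1; apply: Kf_ext => a b; rewrite !KfE; ring.
Qed.

Lemma surinj L : surL L /\ injL L.
Proof.
elim: L => [|L [h1 h2]]; first by split; [exact: sur0 | exact: inj0].
by split; [exact: surS | exact: injS].
Qed.

(** A class of level 2N is matched with the cocycles of G that represent it in the unfiltered
    complex, where [emb] computes H^*(G). *)
Definition Ksj n F (a : seq G -> k) :=
  [/\ KZ N2 n F, Zc n a & exists2 H, Kd n.+1 H & F - emb a = dK H].

Lemma KZ_emb n L a : Zc n a -> (n.+2 <= L)%N -> KZ L n (emb a).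
Proof.
move=> [ha ac] hL; have Ka := Kd_emb pr ha; split=> //; first exact: (Kd_E p Ka).
by rewrite emb_cob ac; apply: Kf_ext => s w; rewrite /emb !KfE mulr0.
Qed.

Lemma emb0 : emb (0 : seq G -> k) = 0 :> Kf.
Proof. by apply: Kf_ext => s w; rewrite /emb !KfE mulr0. Qed.

Lemma Ksj_ex n a : Zc n a -> exists F b c, [/\ Ksj n F b, Zc (n - N2)%N c,
    ((n < N2)%N -> c = 0) & Bc n (a - (b + cupf c ze))].
Proof.
move=> ha; have [ca ac] := ha; case: (leqP N2 n) => hn; last first.
  exists (emb a), a, 0; split=> //; last by rewrite cup0f addr0 subrr; exact: Bc0.
    split=> //; last by exists 0; [exact: Kd0 | rewrite dK0 subrr].
    have Ka := Kd_emb pr ca; have da : dK (emb (Q := Q) a) = 0 by rewrite emb_cob ac emb0.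
    split=> //; split; last by rewrite da; exact: trunc0.
    by apply: (Kd_trunc p Ka).
  exact: Zc0.
pose e := (n - N2).+2; have ee : (e + N2 = n.+2)%N by rewrite !addSn subnK.
have [Ka Ea da] := KZ_emb (L := (n.+2 + N2)%N) ha (leq_addr _ _).
(* At level n + 2 the filtration exhausts the degrees concerned, so this is a statement about the
   unfiltered complex. *)
have [S _] := surinj n.+2.
have [||| c0 [H [Kc Ec dc KH [EH EV]]]] := S e (emb a); rewrite ?ee //.
  by rewrite da; exact: trunc0.
have [c hc [H2 KH2 eH2]] := emb_surj (ce_prM cx) Kc dc.
have KH' : Kd n.+1 H by move: KH; rewrite ee.
exists (emb a - rcup c0 ze - dK H), (a - cupf c ze), c; split=> //.
- have hb : Zc n (a - cupf c ze) by apply: ZcB => //; have := Zc_cup hc zeZ; rewrite subnK.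
  split=> //.
    split=> //.
      apply: KdB; last exact: Kd_dK.
      by apply: KdB => //; have := Kd_ze Kc; rewrite ee.
    by rewrite !dKB dKK da (dK_ze Kc) dc rcup0 !subrr.
  exists (- rcup H2 ze - H).
    apply: KdB => //; apply: KdN; have := Kd_ze KH2; rewrite addSn subnK //.
  rewrite dKB dKN (dK_ze KH2) -eH2 rcupB rcup_emb embB.
  by apply: Kf_ext => s w; rewrite !KfE; ring.
- by rewrite subrK subrr; exact: Bc0.
Qed.

Lemma Ksj_uniq n F b c : Ksj n F b -> Zc (n - N2)%N c -> ((n < N2)%N -> c = 0) ->
  Bc n (b + cupf c ze) -> KB N2 n F /\ Bc (n - N2)%N c.
Proof.
move=> [hF hb [H0 KH0 e0]] hc hn0 [g hg eg]; have [KF EF cF] := hF.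
pose H := H0 + emb g.
have KH : Kd n.+1 H by apply: KdD => //; exact: Kd_emb.
have dH : dK H = F + emb (cupf c ze).
  rewrite (dKD H0) -e0 emb_cob -eg.
  have -> : emb (b + cupf c ze) = emb b + emb (cupf c ze) :> Kf.
    by apply: Kf_ext => s w; rewrite /emb !KfE !funE mulrDr.
  by rewrite addrA subrK.
case: (leqP N2 n) => hn; last first.
  rewrite hn0 // in dH *; split; last exact: Bc0.
  rewrite cup0f emb0 addr0 in dH; exists H => //; split=> //.
  by apply: (Kd_E p KH).
pose m := (n - N2)%N; have em : (m + N2)%N = n by rewrite subnK.
rewrite -/m in hc *; have [S I] := surinj n.+2.
have hce : KZ n.+2 m (emb c) by apply: KZ_emb => //; rewrite !ltnS leq_subr.
have KH' : Kd (m.+1 + N2)%N H by rewrite addSn em.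
have [X [KX EX] eX] : KB n.+2 m (emb c).
  apply: (I m (emb c) H) => //.
    by apply: (Kd_E p KH); rewrite addSn ltnS leqW // leq_addr.
  rewrite rcup_emb dH.
  have -> : emb (cupf c ze) - (F + emb (cupf c ze)) = - F.
    by apply: Kf_ext => s w; rewrite !KfE; ring.
  exact: EN.
split; last by apply: (emb_inj (ce_prM cx) (proj1 hc) KX eX).
have KXz : Kd (m.+1 + N2)%N (rcup X ze) by exact: Kd_ze.
have dF : dK (H - rcup X ze) = F.
  by rewrite dKB (dK_ze KX) -eX rcup_emb dH addrK.
have [||| c' [H' [Kc' Ec' dc' KH1 [EH1 EV]]]] := S m.+1 (H - rcup X ze).
- exact: KdB.
- apply: (Kd_E p (KdB KH' KXz)); rewrite addSn em leqW // leq_addr //.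
- by rewrite dF; case: EF.
exists (H - rcup X ze - rcup c' ze - dK H'); last by rewrite !dKB dKK (dK_ze Kc') dc' rcup0 !subr0 -dKB dF.
split=> //; have en : (m.+1 + N2)%N = n.+1 by rewrite addSn em.
rewrite -en; apply: KdB; first by apply: KdB; [exact: KdB | exact: Kd_ze].
by have := Kd_dK KH1; rewrite addSn.
Qed.

Lemma Ksj_act m n (r : R) F a : gZ R m r -> Ksj n F a ->
  Ksj (m + n)%N (lcup (th m r) F) (cupf (pb pr (th m r)) a).
Proof.
move=> hr [hF ha [H KH e]]; have hs := thZ hth hr; split.
- exact: KZ_lcup.
- by apply: Zc_cup => //; apply: pb_Zc => //; exact: ce_prM cx.
have [U KU eU] := lcup_emb (ce_prM cx) hs ha.
have [[sz _] sc] := hs; have [_ H0] := KH.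
exists (sgK m (lcup (th m r) H) + U).
  by apply: KdD => //; apply: Kd_sgK; rewrite -addnS; apply: Kd_lcup; case: hs.
rewrite (dKD _ U) dK_sgK (dK_lcup sz H0) sc lcup0 add0r sgKK -e lcupB -eU.
by rewrite addrA subrK.
Qed.

Lemma KB_emb n a H : Zc n a -> Kd n.+1 H -> emb a = dK H -> Bc n a.
Proof. by move=> [ha _]; apply: (emb_inj (ce_prM cx)). Qed.

Definition Ksplit : splitting R N2.
Proof.
refine (@Splitting R N2 (Hring k G) (Kmod pr hth N2) (fun m r => pb pr (th m r)) Ksj ze _ _ _ _ _ _ _ _ _ _) => /=.
- by move=> m r hr; apply: pb_Zc; [exact: ce_prM cx | exact: thZ].
- exact: zeZ.
- by move=> n F a [].
- move=> n F [KF EF cF]; have [g hg [H KH e]] := emb_surj (ce_prM cx) KF cF.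
  by exists g; split=> //; exists H.
- move=> n F a F' a' [hF ha [H KH e]] [hF' ha' [H' KH' e']]; split.
  + exact: KZB.
  + exact: ZcB.
  + exists (H - H'); first exact: KdB.
    by rewrite dKB -e -e' embB subr_swap.
- move=> n F a hF [g hg eg]; split; [exact: KB_KZ | by apply: Bc_Zc; exists g |].
  have [H [KH EH] ->] := hF; exists (H - emb g); first by apply: KdB => //; exact: Kd_emb.
  by rewrite dKB emb_cob eg.
- move=> n F a [_ ha [H KH e]] [H' [KH' _] e']; apply: (KB_emb ha (KdB KH' KH)).
  by rewrite dKB -e -e' subKr.
- exact: Ksj_act.
- exact: Ksj_ex.
- exact: Ksj_uniq.
Defined.
End Splitting.

(** * The carry cochain *)

Section Carry.
Variables (k : fieldType) (p : nat).
Hypothesis pk : p \in [pchar k].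
Variables (C G Q : finGroupType) (io : C -> G) (pr : G -> Q) (z : C).
Hypothesis cx : cext p io pr z.
Local Notation q := (#[z]%g).
Local Notation clog := (clog (ce_gen cx)).
Local Notation ret := (ret cx).
Let sig (u : Q) : G := (sec cx u * (sec cx 1)^-1)%g.
Let retE g : g = (io (ret g) * sig (pr g))%g := retP cx g.

(** Factor set of the extension, read through the discrete logarithm as a natural number below the
    order of C. *)
Definition eps2 (u v : Q) : nat := clog (ret (sig u * sig v)%g).

Lemma clog_ret_mul x y : (clog (ret (x * y)%g) = clog (ret x) + clog (ret y) + eps2 (pr x) (pr y) %[mod q])%N.
Proof.
have e : ret (x * y)%g = (ret x * ret y * ret (sig (pr x) * sig (pr y)))%g.
  rewrite -(retM cx (ret x * ret y)%g) (ce_ioM cx); congr (ret _).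
  rewrite [in LHS](retE x) [in LHS](retE y) -!mulgA; congr (_ * _)%g.
  by rewrite !mulgA; do 2!congr (_ * _)%g; rewrite -(ce_cen cx) !mulgA.
by rewrite e !clogM !modn_mod modnDml.
Qed.

Definition phi2 (s : seq G) : int := if s is [:: a; b] then (clog (ret (a^-1 * b)%g))%:Z else 0.
(* The coboundary of phi2 agrees with the inflation of eps3 modulo the order of C;
   the quotient of their difference is the carry cochain. *)
Definition eps3 (s : seq Q) : int :=
  if s is [:: a; b; c] then - (eps2 (a^-1 * b)%g (b^-1 * c)%g)%:Z else 0.
Definition carryz (s : seq G) : int := ((cob phi2 s - eps3 (map pr s)) %/ q)%Z.

Lemma carryzK s : (q%:Z * carryz s)%R = cob phi2 s - eps3 (map pr s).
Proof.
rewrite /carryz mulrC divzK //.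
case: s => [|a [|b [|c [|d s]]]].
- by rewrite /cob /= subr0 dvdz0.
- by rewrite /cob /= !subr0 dvdz0.
- by rewrite /cob /= !subr0 dvdz0.
- have := clog_ret_mul (a^-1 * b)%g (b^-1 * c)%g.
  rewrite (ce_prM cx) (ce_prM cx) !(prV cx) mulgA mulgK => /eqP.
  rewrite -eqz_nat -!modz_nat eqz_mod_dvd => h.
  rewrite /cob /= -rpredN; set X := (X in X \in _); set Y := (X in is_true (_ %| X)%Z) in h.
  have -> : X = Y; last exact: h.
  by rewrite /X /Y !PoszD; ring.
- have szphi : szd 2 phi2 by split=> // -[|a' [|b' [|c' s']]].
  have [_ ->] // := szd_cob szphi.
Qed.

Lemma bd_int T (s : seq T) (f : seq T -> int) : bd s (fun x => (f x)%:~R) = (bd s f)%:~R :> k.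
Proof. by elim: s f => //= a s IH f; rewrite IH intrB. Qed.

Lemma carry : exists f t, [/\ coch 3 f, cob f = pb pr t & pb io f = ycl k (ce_gen cx)].
Proof.
have q0 : q%:Z != 0 by rewrite eqz_nat -lt0n order_gt0.
pose f s : k := (carryz s)%:~R; pose t s : k := - (cob eps3 s %/ q)%Z%:~R.
have szphi : szd 2 phi2 by split=> // -[|a [|b [|c s]]].
have szeps : szd 3 eps3 by split=> // -[|a [|b [|c [|d s]]]].
exists f, t; split.
- split; first split.
  + by rewrite /f /carryz /cob /= subr0 div0z.
  + move=> s hs; rewrite /f; have [_ h1] := szd_cob szphi; have [_ h2] := szeps.
    have := carryzK s; rewrite h1 // h2 ?size_map // subr0 => /eqP.
    by rewrite mulf_eq0 (negbTE q0) /= => /eqP ->.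
  + move=> a s; rewrite /f; congr (_%:~R); apply: (mulfI q0); rewrite !carryzK.
    congr (_ - _).
      rewrite /cob bd_map; apply: eq_bd => -[|b [|c [|d x]]] _ //=.
      by rewrite invMg -!mulgA mulKg.
    rewrite -map_comp; case: s => [|b [|c [|d [|e s]]]] //=.
    by rewrite !(ce_prM cx) !invMg -!mulgA !mulKg.
- apply: funext => s; rewrite /f /cob bd_int /pb /t -rmorphN; congr (_%:~R).
  (* The coboundary of phi2 is closed, so eps3 alone contributes: the coboundary of the carry is
     inflated from Q. *)
  have e : q%:Z * bd s carryz = - cob eps3 (map pr s).
    rewrite -bdZ (eq_bd (g := fun x => cob phi2 x - eps3 (map pr x))) => [|x _]; last exact: carryzK.
    rewrite bdB /cob bd_bd sub0r; congr (- _).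
    by rewrite bd_map.
  by rewrite -[cob eps3 _]opprK -e -mulrN mulKz // opprK.
- apply: funext => s; rewrite /pb /f.
  have -> : carryz (map io s) = cob (fun x => if x is [:: a; b] then (clog b < clog a)%N%:Z else 0) s.
    apply: (mulfI q0); rewrite carryzK -map_comp.
    have ret_sig : ret (sig 1 * sig 1)%g = 1%g.
      by rewrite /sig mulgV mulg1 -(io1 cx) ret_io.
    have -> : eps3 (map (pr \o io) s) = 0.
      case: s => [|a [|b [|c [|d s]]]] //=; rewrite !(ce_io cx) invg1 mulg1 /eps2 ret_sig.
      by rewrite clog1.
    rewrite subr0 /cob bd_map -[RHS]bdZ.
    (* On C the logarithm of a^-1 b is log b - log a, plus q when log b < log a. Hence phi2 is q
       times the cochain behind [v0] plus the coboundary of the logarithm. *)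
    have -> : bd s (fun x => phi2 (map io x)) =
       bd s (fun x => (q%:Z * if x is [:: a; b] then (clog b < clog a)%N%:Z else 0) +
         cob (fun y => if y is [:: a] then (clog a)%:Z else 0) x).
      apply: eq_bd => -[|a [|b [|c x]]] _.
      + by rewrite /cob /= mulr0 addr0.
      + by rewrite /cob /= mulr0 add0r subr0.
      + rewrite /cob /= !subr0.
        rewrite -(ioV cx) -(ce_ioM cx) ret_io.
        have e : (clog a + clog (a^-1 * b)%g = clog b %[mod q])%N.
          by rewrite -clogM mulKVg modn_small ?clog_lt.
        have [[la lb] lc] := (clog_lt (ce_gen cx) a, clog_lt (ce_gen cx) b, clog_lt (ce_gen cx) (a^-1 * b)%g).
        move: e; rewrite [RHS]modn_small //.
        case: (ltnP (clog a + clog (a^-1 * b)%g)%N q) => h.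
          rewrite modn_small // => e.
          have -> : (clog b < clog a)%N = false by rewrite -e ltnNge leq_addr.
          by rewrite mulr0 add0r -e PoszD; ring.
        have -> : (clog a + clog (a^-1 * b)%g = q + (clog a + clog (a^-1 * b)%g - q))%N by rewrite subnKC.
        rewrite modnDl modn_small => [e|]; last by lia.
        have -> : (clog b < clog a)%N = true by lia.
        have e2 : (clog a + clog (a^-1 * b)%g = q + clog b)%N by rewrite -e subnKC.
        apply: (addrI (clog a)%:Z); rewrite -PoszD e2 PoszD /=; ring.
      + have szx : szd 1 (fun y : seq C => if y is [:: a] then (clog a)%:Z else 0).
          by split=> // -[|a' [|b' y]].
        by have [_ ->] // := szd_cob szx; rewrite /= mulr0 addr0.
    rewrite bdD [X in _ + X](_ : _ = 0) ?addr0 //.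
    exact: bd_bd.
  rewrite /ycl /cob -bd_int; apply: eq_bd => -[|a [|b [|c x]]] _ //=.
Qed.
End Carry.

Lemma bd_size (k : comNzRingType) T T' (s : seq T) (s' : seq T') (f : seq T -> k) (f' : seq T' -> k) :
  (forall x y, size x = size y -> f x = f' y) -> size s = size s' -> bd s f = bd s' f'.
Proof.
elim: s s' f f' => [|a s IH] [|b s'] //= f f' h [e]; rewrite (h s s') //; congr (_ - _).
by apply: IH => // x y exy; apply: h; rewrite /= exy.
Qed.

(** * The tower of transgressions *)

Section Tower.
Variables (k : finFieldType) (p : nat).
Hypothesis pk : p \in [pchar k].
Variables (C G Q : finGroupType) (io : C -> G) (pr : G -> Q) (z : C).
Hypothesis cx : cext p io pr z.
Local Notation yg := (ygen k (ce_gen cx)).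
Let ygZ n : Zc n (yg n) := Zc_ygen pk (ce_gen cx) (ce_pC cx) n.

(** An inflated cochain is constant on the simplices of C, which map to the identity of Q; in even
    positive degree a constant is the coboundary of a constant. *)
Lemma Bc_const n (w : seq Q -> k) : coch n.+1 w -> ~~ odd n -> (0 < n)%N ->
  Bc n (pb io (pb pr w)).
Proof.
move=> [[w0 wn] _] n_even n0.
pose c := w (nseq n.+1 1%g); pose b (s : seq C) : k := (size s == n)%:R * c.
exists b.
  split; last by move=> a s; rewrite /b size_map.
  split; first by rewrite /b; case: (n) n0 => //= *; rewrite mul0r.
  by move=> s /negbTE h; rewrite /b h mul0r.
apply: funext => s; rewrite /pb (io_const (ce_io cx)) /cob.
case: (eqVneq (size s) n.+1) => [sn|sn].
  rewrite sn -/c (bd_size (s' := nseq n.+1 1%g) (f' := fun y : seq Q => (size y == n)%:R * c)).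
  - by rewrite bd_nseq (negbTE n_even) size_nseq eqxx !mul1r.
  - by move=> x y; rewrite /b => ->.
  - by rewrite size_nseq.
rewrite wn ?size_nseq // -[LHS](bd0 k s); apply: eq_bd => x sx; rewrite /b.
by case: eqP => [e|_]; [case/eqP: sn; rewrite -sx e | rewrite mul0r].
Qed.

Variables (R : grg) (th : nat -> R -> seq Q -> k).
Hypothesis hth : thetaP th.

(* r is the transgression of the restriction of f to C. *)
Definition transg n (r : R) (f : seq G -> k) := exists t, [/\ coch n f, coch n.+1 t, cob f = pb pr t,
  Zc n.-1 (pb io f) & gZ R n r /\ Bc n (t - th n r)].

Lemma cob_inj (t : seq Q -> k) : cob (pb pr t) = 0 -> cob t = 0.
Proof. by move=> h; apply: (pb_inj (ce_surj cx)); rewrite pb_cob h. Qed.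

(** Each coefficient r has degree a difference of two odd numbers, hence even and positive, so its
    inflation is a coboundary on C. The sum of the r f therefore lifts x and is trivial on C. *)
Lemma span_lift n (l : seq (nat * R)) : odd n -> (1 < n)%N ->
  (forall d r, (d, r) \in l -> [/\ odd d, (d < n)%N & exists f, transg d r f]) ->
  forall x, gspan (M := reg R) l n x ->
  exists g, [/\ coch n g, cob g = pb pr (th n x), Bc n.-1 (pb io g) & gZ R n x].
Proof.
move=> n_odd n1 hl x hx.
have hprM := ce_prM cx.
have fix_c (g : seq G -> k) s s' : coch n g -> cob g = pb pr s -> Bc n.-1 (pb io g) -> Bc n (s' - s) ->
    exists g, [/\ coch n g, cob g = pb pr s' & Bc n.-1 (pb io g)].
  move=> hg eg hB [c hc ec]; exists (g + pb pr c); split.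
  - by apply: cochD => //; exact: pb_coch.
  - by rewrite cobD eg -pb_cob -ec; apply: funext => w; rewrite /pb !funE addrC subrK.
  - have h2 : Bc n.-1 (pb io (pb pr c)).
      by apply: Bc_const; rewrite ?prednK //; case: (n) n_odd n1 => // -[|m] //=; rewrite negbK.
    have := BcB hB (BcB (Bc0 _ _ _) h2); rewrite sub0r opprK; congr (Bc _ _).
move: n n_odd n1 hl fix_c x hx.
move=> n n_odd n1 hl fix_c x hx; move: n_odd n1 hl fix_c.
elim: hx => {n x} [n b hb|m d r u x hu hr hx IH] n_odd n1 hl fix_c.
  have [||||g [h1 h2 h3]] := fix_c 0 0 (th n b).
  - exact: coch0.
  - by rewrite cob0.
  - exact: Bc0.
  - by rewrite subr0; apply/(thB hth) => //; exact: gBZ.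
  by exists g; split=> //; exact: gBZ.
have [d_odd hdn [f [t [hf ht et hC [hu' bt]]]]] := hl _ _ hu.
have [g [hg eg gB gx]] := IH n_odd n1 hl fix_c.
have m_even : ~~ odd m by move: n_odd; rewrite oddD d_odd addbT.
have m0 : (0 < m)%N by move: hdn; case: (m) => //; rewrite add0n ltnn.
have d0 : (0 < d)%N by case: (d) d_odd.
have hs := thZ hth hr; have hps : Zc m (pb pr (th m r)) by exact: pb_Zc.
pose h := cupf (pb pr (th m r)) f.
have [[hsz _] hsc] := hps.
have hh : coch (m + d)%N h by rewrite -(prednK d0) addnS; apply: coch_cup; [case: hps | rewrite prednK].
have eh : cob h = pb pr (cupf (th m r) t).
  rewrite (cob_cup hsz (coch_nil hf)) hsc cup0f add0r pb_cup et.
  by apply: funext => w; rewrite -(sg_odd k m) (negbTE m_even) /altsign expr0 mul1r.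
have hB : Bc (m + d).-1 (pb io h).
  have -> : ((m + d).-1 = m + d.-1)%N by rewrite -!subn1 addnBA.
  rewrite pb_cup; apply: Bc_cupl hC.
  by apply: Bc_const => //; case: hs.
have ru : gZ R (m + d)%N (rmul r u) by exact: rmulZ.
have [||||g' [h1 h2 h3]] := fix_c (h + g) (cupf (th m r) t + th (m + d)%N x) (th (m + d)%N (rmul r u + x)).
- exact: cochD.
- by rewrite cobD eh eg.
- have := BcB hB (BcB (Bc0 _ _ _) gB); rewrite sub0r opprK; congr (Bc _ _).
- have h1 := thsub hth (gZD ru gx) gx; rewrite addrK in h1.
  have h2 := thmul hth hr hu'.
  have h3 := Bc_cupr hs bt.
  have := BcB (BcB (BcB (Bc0 k Q _) h1) (BcB (Bc0 k Q _) h2)) h3.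
  rewrite cupBr; congr (Bc _ _); apply: funext => w; rewrite !funE; ring.
by exists g'; split=> //; exact: gZD.
Qed.

Definition tdeg a := ((p ^ a).*2)%N.

Lemma tdegS a : (p * tdeg a)%N = tdeg a.+1.
Proof. by rewrite /tdeg expnS -!muln2 mulnA. Qed.

Lemma cpw_ygen N (f : seq C -> k) r : Zc N.*2 f -> Bc N.*2 (f - yg N.*2) ->
  Zc (r * N).*2 (cpw f r) /\ Bc (r * N).*2 (cpw f r - yg (r * N).*2).
Proof.
move=> hf hB; elim: r => [|r [IH1 IH2]].
  by split; [exact: Zc_one | rewrite /= subrr; exact: Bc0].
have e : ((r.+1 * N).*2 = N.*2 + (r * N).*2)%N by rewrite mulSn doubleD.
rewrite e; split; first exact: Zc_cup.
rewrite -(ygen_cup pk (ce_gen cx) (ce_pC cx)) /=.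
have h1 := Bc_cupl hB IH1; have h2 := Bc_cupr (ygZ N.*2) IH2.
have := BcB h1 (BcB (Bc0 _ _ _) h2); rewrite sub0r opprK cupBl cupBr.
by rewrite addrA subrK.
Qed.

(** Induction from the carry cochain by [transgressive_power]; on C the p-th power of y^(p^a) is
    y^(p^(a+1)). *)
Lemma tower_ex a : exists r f, transg (tdeg a).+1 r f /\ Bc (tdeg a) (pb io f - yg (tdeg a)).
Proof.
suff [f [t [hf et hB]]] : exists f t, [/\ coch (tdeg a).+1 f, cob f = pb pr t &
    Bc (tdeg a) (pb io f - yg (tdeg a))].
  have ht : coch (tdeg a).+2 t.
    by apply: (pb_coch_surj (ce_prM cx) (ce_surj cx)); rewrite -et; apply: coch_cob.
  have tc : cob t = 0 by apply: cob_inj; rewrite -et cobK.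
  have [r hr b] := thsur hth (conj ht tc); exists r, f; split=> //; exists t; split=> //.
  have := ZcB (Bc_Zc hB) (ZcB (Zc0 _ _ _) (ygZ (tdeg a))).
  by rewrite sub0r opprK subrK.
elim: a => [|a [f [t [hf et hB]]]].
  have [f [t [h1 h2 h3]]] := carry pk cx; exists f, t; split=> //.
  by rewrite h3 /= cup1f ?subrr; [exact: Bc0 | exact: coch_nil (coch_ycl k (ce_gen cx))].
have [|f' [t' [h1 _ h2 h3]]] := transgressive_power pk (ce_prM cx) (ce_surj cx) (ce_io cx) _ hf et.
  by rewrite odd_double.
exists f', t'; rewrite -tdegS; split=> //.
have hZ : Zc (tdeg a) (pb io f).
  have := ZcB (Bc_Zc hB) (ZcB (Zc0 _ _ _) (ygZ (tdeg a))).
  by rewrite sub0r opprK subrK.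
rewrite h3; have [_] := cpw_ygen p hZ hB.
by rewrite doubleMr.
Qed.

(** The a-th cochain f and the cochain g of [span_lift] have coboundaries inflated from cohomologous
    cocycles. Subtracting g and an inflated w closes f up, and neither correction affects the class
    on C. *)
Lemma zeta_ex a (r : nat -> R) :
  (forall j, (j <= a)%N -> exists f, transg (tdeg j).+1 (r j) f /\ Bc (tdeg j) (pb io f - yg (tdeg j))) ->
  gspan (M := reg R) [seq ((tdeg j).+1, r j) | j <- iota 0 a] (tdeg a).+1 (r a) ->
  exists ze, Zc (tdeg a) ze /\ Bc (tdeg a) (pb io ze - yg (tdeg a)).
Proof.
move=> hr hs; have p1 : (1 < p)%N by exact: prime_gt1 (pcharf_prime pk).
have td_lt i j : (i < j)%N -> (tdeg i < tdeg j)%N by move=> h; rewrite ltn_double ltn_exp2l.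
have td0 j : (0 < tdeg j)%N by rewrite double_gt0 expn_gt0 ltnW.
have [|||g [hg eg gB gx]] := span_lift _ _ _ hs.
- by rewrite /= odd_double.
- by rewrite ltnS.
- move=> d x /mapP [j]; rewrite mem_iota add0n /= => hj [-> ->]; split.
  + by rewrite /= odd_double.
  + by rewrite ltnS td_lt.
  + by have [f [h _]] := hr j (ltnW hj); exists f.
have [f [[t [hf ht et hZ [_ [w hw ew]]]] hB]] := hr a (leqnn a).
have hcw : Bc (tdeg a) (pb io (pb pr w)).
  by apply: Bc_const => //; rewrite odd_double.
exists (f - g - pb pr w); split.
  split.
    by apply: cochB; [exact: cochB | apply: pb_coch => //; exact: ce_prM cx].
  rewrite !cobB et eg -pb_cob -ew; apply: funext => s; rewrite /pb !funE; ring.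
have := BcB (BcB hB gB) hcw; congr (Bc _ _).
by apply: funext => s; rewrite /pb !funE; ring.
Qed.
End Tower.

(** * A uniform bound from the ascending chain condition *)

Section Koenig.
Variables (R : grg) (deg : nat -> nat).
Hypothesis noethR : noeth (reg R).

Let ideal a (r : nat -> R) := gspan (M := reg R) [seq (deg j, r j) | j <- iota 0 a] (deg a) (r a).

Lemma koenig (O : Type) (P : O -> Prop) (r : O -> nat -> R) :
  (forall y j, P y -> gZ R (deg j) (r y j)) ->
  exists A, forall y, P y -> exists2 a, (a < A)%N & ideal a (r y).
Proof.
move=> rZ; apply: contrapT => nA.
have bad A : exists2 y, P y & forall a, (a < A)%N -> ~ ideal a (r y).
  apply: contrapT => h; apply: nA; exists A => y py; apply: contrapT => h'.
  by apply: h; exists y => // a ha hid; apply: h'; exists a.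
(* prefixes s that extend to arbitrarily long bad sequences *)
pose inf (s : seq R) := forall A, exists y, [/\ P y, forall a, (a < A)%N -> ~ ideal a (r y) &
  forall j, (j < size s)%N -> r y j = nth 0 s j].
have inf0 : inf [::] by move=> A; have [y py hy] := bad A; exists y.
have infS s : inf s -> exists x, inf (rcons s x).
  move=> hs; apply: contrapT => h.
  have [F [e he]] := gfin R (deg (size s)).
  have hx : forall x, exists A, forall y, P y -> (forall a, (a < A)%N -> ~ ideal a (r y)) ->
     (forall j, (j < (size s).+1)%N -> r y j = nth 0 (rcons s x) j) -> False.
    move=> x; apply: contrapT => h1; apply: h; exists x => A; apply: contrapT => h2; apply: h1; exists A.
    by move=> y py h3 h4; apply: h2; exists y; split=> //; rewrite size_rcons.
  (* Only finitely many next terms are possible; the maximum of the lengths at which they fail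
     contradicts the assumption that s extends arbitrarily far. *)
  have [B hB] : exists B : F -> nat, forall x y, gZ R (deg (size s)) x -> P y ->
      (forall a, (a < B (e x))%N -> ~ ideal a (r y)) ->
      (forall j, (j < (size s).+1)%N -> r y j = nth 0 (rcons s x) j) -> False.
    have hF (f : F) : exists A, forall x, gZ R (deg (size s)) x -> e x = f -> forall y, P y ->
       (forall a, (a < A)%N -> ~ ideal a (r y)) ->
       (forall j, (j < (size s).+1)%N -> r y j = nth 0 (rcons s x) j) -> False.
      case: (pselect (exists x, gZ R (deg (size s)) x /\ e x = f)) => [[x [xZ ex]]|ne]; last first.
        by exists 0%N => x xZ ex; case: ne; exists x.
      have [A hA] := hx x; exists A => x' xZ' ex'.
      by rewrite (he _ _ xZ' xZ) ?ex ?ex'.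
    exists (fun f => sval (cid (hF f))) => x y xZ.
    exact: (svalP (cid (hF (e x)))).
  have [y [py hy1 hy2]] := hs (\max_(f : F) B f).
  apply: (hB (r y (size s)) y) => //; first exact: rZ.
    by move=> a ha; apply: hy1; apply: leq_trans ha _; exact: leq_bigmax.
  move=> j; rewrite ltnS leq_eqVlt => /orP[/eqP->|hj].
    by rewrite nth_rcons ltnn eqxx.
  by rewrite nth_rcons hj hy2.
pose ext s : R := if pselect (inf s) is left h then sval (cid (infS s h)) else 0.
pose pre := fix pre n := if n is n'.+1 then rcons (pre n') (ext (pre n')) else [::].
have pre_inf n : inf (pre n).
  elim: n => // n IH /=; rewrite /ext; case: pselect => // h.
  exact: (svalP (cid (infS _ h))).
have pre_size n : size (pre n) = n by elim: n => //= n IH; rewrite size_rcons IH.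
pose x n := ext (pre n).
have pre_nth n j : (j < n)%N -> nth 0 (pre n) j = x j.
  elim: n => // n IH; rewrite ltnS leq_eqVlt => /orP[/eqP->|hj] /=.
    by rewrite nth_rcons pre_size ltnn eqxx.
  by rewrite nth_rcons pre_size hj IH.
have xy n : exists y, [/\ P y, forall j, (j < n)%N -> r y j = x j & forall a, (a < n)%N -> ~ ideal a (r y)].
  have [y [py h1 h2]] := pre_inf n n; exists y; split=> // j hj.
  by rewrite h2 ?pre_size // pre_nth.
have xZ j : gZ R (deg j) (x j).
  by have [y [py h _]] := xy j.+1; rewrite -h //; exact: rZ.
have xbad a : ~ ideal a x.
  have [y [py h1 h2]] := xy a.+1; have := h2 a (ltnSn a); rewrite /ideal h1 //.
  have -> : [seq (deg j, r y j) | j <- iota 0 a] = [seq (deg j, x j) | j <- iota 0 a].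
    by apply/eq_in_map => j; rewrite mem_iota => /andP [_ hj]; rewrite h1 // ltnS ltnW.
  by [].
(* The union of the ideals spanned by the L n is finitely generated, hence spanned by some L K,
   which then contains x K. *)
pose L n := [seq (deg j, x j) | j <- iota 0 n].
have LZ n d u : (d, u) \in L n -> gZ (reg R) d u by move=> /mapP [j _ [-> ->]]; exact: xZ.
have Lmono m n : (m <= n)%N -> {subset L m <= L n}.
  move=> hmn u /mapP [j]; rewrite mem_iota /= add0n => hj ->; apply/mapP; exists j => //.
  by rewrite mem_iota /= add0n (leq_trans hj).
have [|l [h1 h2]] := noethR (U := fun n u => exists m, gspan (M := reg R) (L m) n u).
  split.
  - by move=> n u [m]; apply: gspan_Z; exact: LZ.
  - by move=> n u hu; exists 0%N; exact: gs0.
  - move=> n u v [m hu] [m' hv]; exists (maxn m m'); apply: gspan_add.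
      by apply: gspan_mono hu; apply: Lmono; exact: leq_maxl.
    apply: gspan_opp; first exact: LZ.
    by apply: gspan_mono hv; apply: Lmono; exact: leq_maxr.
  - move=> m n u v hu [m' hv]; exists m'; apply: gspan_act => //; exact: LZ.
have [K hK] : exists K, forall d u, (d, u) \in l -> gspan (M := reg R) (L K) d u.
  elim: l h1 {h2} => [|[d u] l IH] h; first by exists 0%N.
  have [|K hK] := IH; first by move=> d' r' h'; apply: h; rewrite inE h' orbT.
  have [m hm] := h d u (mem_head _ _); exists (maxn m K) => d' u'.
  rewrite inE => /orP[/eqP[-> ->]|/hK h'].
    by apply: gspan_mono hm; apply: Lmono; exact: leq_maxl.
  by apply: gspan_mono h'; apply: Lmono; exact: leq_maxr.
apply: (xbad K); rewrite /ideal -/(L K).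
have := h2 (deg K) (x K) (ex_intro _ K.+1 _); move=> h3.
have h4 : gspan (M := reg R) l (deg K) (x K).
  apply: h3; apply: gspan_mem; first exact: xZ.
  by apply/mapP; exists K => //; rewrite mem_iota /= add0n.
elim: h4 {h3} => [n b hb|m d r0 u v hu hr _ IH]; first exact: gs0.
apply: gspan_add IH; apply: gspan_act => //; [exact: LZ | exact: hK].
Qed.
End Koenig.

(** [tie] is a relation because the auxiliary object, such as an extension or a periodicity class,
    is extra structure that a group admits without determining it. *)
Lemma fincol_pull (O O' : Type) (P : O -> Prop) (E : O -> O -> Prop) (P' : O' -> Prop)
    (E' : O' -> O' -> Prop) (tie : O -> O' -> Prop) :
  fincol P' E' -> (forall x, P x -> exists2 x', P' x' & tie x x') ->
  (forall x y x' y', P x -> P y -> tie x x' -> tie y y' -> E' x' y' -> E x y) -> fincol P E.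
Proof.
move=> [F [c hc]] ht hE.
exists (option F), (fun x => if pselect (exists x', P' x' /\ tie x x') is left h
  then Some (c (sval (cid h))) else None) => x y px py.
have [x0 p0 t0] := ht _ px; have [y0 q0 u0] := ht _ py.
case: pselect => [h|[]]; last by exists x0.
case: pselect => [h'|[]]; last by exists y0.
have [p1 t1] := svalP (cid h); have [p2 t2] := svalP (cid h').
by move=> [e]; apply: (hE _ _ _ _ px py t1 t2); exact: hc.
Qed.

Lemma aiso_refl (A : grg) : aiso A A.
Proof.
exists (fun n (x y : A) => [/\ gZ A n x, gZ A n y & gB A n (x - y)]); first exact: giso_id.
move=> m n a b a' b' [ha hb h] [ha' hb' h']; split; try exact: rmulZ.
exact: rmulBxx.
Qed.

Lemma theta_ex (k : finFieldType) (R : grg) (Q : finGroupType) :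
  aiso R (Hring k Q) -> exists th : nat -> R -> seq Q -> k, thetaP th.
Proof.
move=> [rho gr mr].
pose th m r : seq Q -> k := if pselect (exists s, rho m r s) is left h then sval (cid h) else 0.
have thr m r : gZ R m r -> rho m r (th m r).
  move=> hr; rewrite /th; case: pselect => [h|[]]; last exact: (gi_tot gr hr).
  exact: (svalP (cid h)).
exists th; split.
- by move=> m r /thr /(gi_Z gr) [].
- by move=> m r /thr /(gi_B gr).
- move=> m r r' hr hr'; apply: (gi_uniq gr (thr _ _ (gZB hr hr'))).
  by apply: (gi_sub gr); exact: thr.
- move=> m s hs; have [r hr] := gi_sur gr (y := s) hs; have [hr' _] := gi_Z gr hr.
  by exists r => //; exact: (gi_uniq gr hr (thr _ _ hr')).
- move=> m n r r' hr hr'; apply: (gi_uniq gr (thr _ _ (rmulZ hr hr'))).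
  by apply: mr; exact: thr.
(* Compatibility with products implies compatibility with units: the product of [rone] with a
   preimage e of 1 is e itself. *)
- have [e he] := gi_sur gr (y := onef k (T := Q)) (@Zc_one k Q).
  have [eZ _] := gi_Z gr he; have hu := thr _ _ (roneZ R).
  have := mr _ _ _ _ _ _ hu he; rewrite addn0 (rmul1 eZ) => h.
  have hth0 : th 0 (rone R) [::] = 0.
    by have [_ h0] := gi_Z gr hu; case: h0 => /coch_nil.
  have := gi_uniq gr h he; rewrite /= cupf1 //.
Qed.

Lemma pairwise_fin (M : gm) : (forall n x, gZ M n x -> x = 0) ->
  forall M' : gm, (forall n x, gZ M' n x -> x = 0) ->
  giso (fun n (x : M) (y : M') => gZ M n x /\ gZ M' n y).
Proof.
move=> h M' h'; split.
- by move=> n x y.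
- by move=> n x hx; exists 0; split=> //; exact: gZ0.
- by move=> n x hx; exists 0; split=> //; exact: gZ0.
- by move=> n x y x' y' [h1 h2] [h3 h4]; split; exact: gZB.
- by move=> n x y [/h -> /h' ->]; split=> _; exact: gB0.
- by move=> n x y hx hy; split; exact: gBZ.
Qed.

(** * Families of extensions with a fixed ring H^*(Q) *)

Section Objects.
Variables (k : finFieldType) (p : nat).
Hypothesis pk : p \in [pchar k].
Variable R : grg.
Hypothesis noethR : noeth (reg R).

(** Q may vary while R stays fixed, so the modules of all members are modules over one ring and can
    be compared. *)
Record obj := Obj {
  oC : finGroupType; oG : finGroupType; oQ : finGroupType;
  oio : oC -> oG; opr : oG -> oQ; oz : oC;
  ocx : cext p oio opr oz;
  oth : nat -> R -> seq oQ -> k;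
  ohth : thetaP oth
}.

Let Mod n (y : obj) : gmd R := Kmod (@opr y) (ohth y) n.

Lemma Mod0 y n (F : Mod 0 y) : gZ (Mod 0 y) n F -> F = 0.
Proof. by move=> [KF EF _]; exact: (E0_eq KF EF). Qed.

Lemma Mod_fincol n : fincol (fun=> True) (fun y z => miso (Mod n y) (Mod n z)).
Proof.
elim: n => [|n IH].
  apply: fincol_triv => y z _ _.
  exists (fun n (x : Mod 0 y) (x' : Mod 0 z) => gZ (Mod 0 y) n x /\ gZ (Mod 0 z) n x').
    by apply: pairwise_fin; [exact: Mod0 | exact: Mod0].
  by move=> m n r x x' hr [hx hx']; split; exact: actZ.
exact: (triangle_fincol (t := fun y => Ktri pk (ocx y) (ohth y) n) noethR).
Qed.

Lemma Mod_noeth n y : noeth (Mod n y).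
Proof.
elim: n => [|n IH].
  move=> U hU; exists [::]; split=> // n x /(subZ hU) /Mod0 ->; apply: gs0; exact: gB0.
exact: (triangle_noeth (t := Ktri pk (ocx y) (ohth y) n) noethR).
Qed.

Record objz (N : nat) := Objz {
  zo : obj; ze : seq (oG zo) -> k;
  zeZ : Zc N.*2 ze;
  zeB : Bc N.*2 (pb (@oio zo) ze - ygen k (ce_gen (ocx zo)) N.*2)
}.

Let sp N (y : objz N) : splitting R N.*2 := Ksplit pk (ohth (zo y)) (zeZ y) (zeB y).

Lemma objz_fincol N : (0 < N)%N ->
  fincol (fun=> True) (fun y z : objz N => aiso (Hring k (oG (zo y))) (Hring k (oG (zo z)))).
Proof.
move=> N0; have N2e : ~~ odd N.*2 by rewrite odd_double.
have N20 : (0 < N.*2)%N by rewrite double_gt0.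
apply: (splitting_fincol N2e N20 (t := @sp N)).
  by move=> y _; exact: Mod_noeth.
apply: (fincol_pull (tie := fun (y : objz N) o => zo y = o) (Mod_fincol N.*2)).
  by move=> y _; exists (zo y).
by move=> y z y' z' _ _ <- <-.
Qed.

Lemma objz_noeth N (y : objz N) : (0 < N)%N -> noeth (reg (Hring k (oG (zo y)))).
Proof.
move=> N0; have N2e : ~~ odd N.*2 by rewrite odd_double.
have N20 : (0 < N.*2)%N by rewrite double_gt0.
by apply: (splitting_noeth N2e N20 (t := sp y)); exact: Mod_noeth.
Qed.

(** [koenig] is applied to the transgressions, of degrees 2p^j + 1; the exponent it yields gives the
    periodicity class through [zeta_ex], and its bound is uniform over the family. *)
Lemma obj_bound : exists A (a : obj -> nat), forall y, (a y < A)%N /\ exists2 u : objz (p ^ a y), zo u = y & True.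
Proof.
have [r hr] : {r : obj -> nat -> R & forall y j, exists f, transg (@oio y) (@opr y) (@oth y) (tdeg p j).+1 (r y j) f /\
    Bc (tdeg p j) (pb (@oio y) f - ygen k (ce_gen (ocx y)) (tdeg p j))}.
  exists (fun y j => sval (cid (tower_ex pk (ocx y) (ohth y) j))) => y j.
  exact: (svalP (cid (tower_ex pk (ocx y) (ohth y) j))).
have rZ y j : True -> gZ R (tdeg p j).+1 (r y j).
  by have [f [[t [_ _ _ _ [h _]]] _]] := hr y j.
have [A hA] := koenig noethR (P := fun=> True) rZ.
have hA' y : exists a, (a < A)%N /\ gspan (M := reg R) [seq ((tdeg p j).+1, r y j) | j <- iota 0 a] (tdeg p a).+1 (r y a).
  by have [a h1 h2] := hA y I; exists a.
exists A, (fun y => sval (cid (hA' y))) => y; have [h1 h2] := svalP (cid (hA' y)); split=> //.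
have [ze [zZ zB]] := zeta_ex pk (cx := ocx y) (ohth y) (fun j _ => hr y j) h2.
by exists (@Objz (p ^ sval (cid (hA' y))) y ze zZ zB).
Qed.

Lemma obj_fincol : fincol (fun=> True) (fun y z => aiso (Hring k (oG y)) (Hring k (oG z))).
Proof.
have p0 : (0 < p)%N := prime_gt0 (pcharf_prime pk).
have [A [a ha]] := obj_bound.
(* Colouring by the exponent leaves finitely many families, each with a common degree of z. *)
pose c y : 'I_A := Ordinal (proj1 (ha y)).
apply: (fincol_sigma (c := c)) => f.
have pf : (0 < p ^ f)%N by rewrite expn_gt0 p0.
apply: (fincol_pull (tie := fun y (u : objz (p ^ f)) => zo u = y) (objz_fincol pf)).
  move=> y [_ <-]; have [_ [u hu _]] := ha y; by exists u.
by move=> y z y' z' _ _ <- <-.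
Qed.

Lemma obj_noeth y : noeth (reg (Hring k (oG y))).
Proof.
have p0 : (0 < p)%N := prime_gt0 (pcharf_prime pk).
have [A [a ha]] := obj_bound; have [_ [u <- _]] := ha y.
by apply: objz_noeth; rewrite expn_gt0 p0.
Qed.
End Objects.

Section Trivial.
Variables (k : finFieldType) (G : finGroupType).
Hypothesis G1 : forall x : G, x = 1%g.

Lemma map_triv (a : G) s : map (mulg a) s = s.
Proof. by rewrite -[RHS]map_id; apply: eq_map => x; rewrite (G1 (a * x)%g) [RHS]G1. Qed.

Lemma triv_B n (f : seq G -> k) : Zc n.+1 f -> Bc n.+1 f.
Proof.
move=> [[fs _] fc]; exists (cone 1%g f); last by rewrite (cob_cone _ fs fc).
by split; [exact: szd_cone | move=> a s; rewrite map_triv].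
Qed.

Lemma triv_B0 (f : seq G -> k) : Bc 0 f <-> f = 0.
Proof.
split; first by move=> [g /coch_size0 -> ->]; rewrite cob0.
by move->; exact: Bc0.
Qed.

Lemma triv_Z0 (f : seq G -> k) : Zc 0 f -> f = fun s => f [:: 1%g] * onef k s.
Proof.
move=> [[[f0 f1] _] _]; apply: funext => -[|a [|b s]]; rewrite /onef /= ?mulr0 //.
  by rewrite mulr1 (G1 a).
by rewrite f1.
Qed.

Lemma Zc_onec (c : k) : Zc 0 (fun s : seq G => c * onef k s).
Proof. by have := Zc_scale c (@Zc_one k G). Qed.

Lemma triv_noeth : noeth (reg (Hring k G)).
Proof.
move=> U hU; case: (pselect (exists f, U 0%N f /\ f <> 0)) => [[f [Uf f0]]|ne]; last first.
  exists [::]; split=> // -[|n] x hx; apply: gs0; last by apply: triv_B; exact: (subZ hU hx).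
  by apply/triv_B0; apply: contrapT => h; apply: ne; exists x.
exists [:: (0%N, f)]; split; first by move=> d u; rewrite inE => /eqP [-> ->].
have fZ : Zc 0 f := subZ hU Uf.
move=> [|n] x hx; last by apply: gs0; apply: triv_B; exact: (subZ hU hx).
have hxZ : Zc 0 x := subZ hU hx.
have fc0 : f [:: 1%g] != 0.
  by apply/eqP => e; apply: f0; rewrite (triv_Z0 fZ) e; apply: funext => s; rewrite mul0r.
pose c := x [:: 1%g] / f [:: 1%g].
apply: (gspan_eqv (x := act (reg (Hring k G)) 0 (fun s => c * onef k s) f + 0)).
  apply/triv_B0; rewrite addr0 /= (triv_Z0 hxZ) (triv_Z0 fZ).
  apply/eqP; rewrite subr_eq0; apply/eqP; apply: funext => s; rewrite /cupf.
  have -> : cut s (fun u v => c * onef k u * (f [:: 1%g] * onef k v)) =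
     x [:: 1%g] * cupf (onef k (T := G)) (onef k (T := G)) s.
    rewrite /cupf -cutZ; apply: eq_cut => u v _ _ _; rewrite /c; field.
    exact: fc0.
  by rewrite cup1f.
by apply: (gsa (m := 0%N)); [rewrite mem_head | exact: Zc_onec | apply: gs0; exact: gB0].
Qed.
End Trivial.

Lemma triv_aiso (k : finFieldType) (G H : finGroupType) :
  (forall x : G, x = 1%g) -> (forall x : H, x = 1%g) -> aiso (Hring k G) (Hring k H).
Proof.
move=> hG hH.
exists (fun n (f : Hring k G) (g : Hring k H) => [/\ Zc n f, Zc n g & n = 0%N -> f [:: 1%g] = g [:: 1%g]]).
  split.
  - by move=> n f g [].
  - move=> [|n] f hf; last by exists 0; split=> //; exact: Zc0.
    exists (fun s => f [:: 1%g] * onef k s); split=> //; first exact: Zc_onec.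
    by rewrite /onef /= mulr1.
  - move=> [|n] f hf; last by exists 0; split=> //; exact: Zc0.
    exists (fun s => f [:: 1%g] * onef k s); split=> //; first exact: Zc_onec.
    by rewrite /onef /= mulr1.
  - move=> n f g f' g' [h1 h2 h3] [h1' h2' h3']; split; try exact: ZcB.
    by move=> n0; rewrite !funE h3 // h3'.
  - move=> [|n] f g [h1 h2 h3] /=; last by split=> _; exact: triv_B.
    rewrite !triv_B0; split=> e; [rewrite (triv_Z0 hH h2) -h3 // | rewrite (triv_Z0 hG h1) h3 //];
      rewrite e; apply: funext => s; by rewrite mul0r.
  - move=> n f g hf hg; split; [exact: Bc_Zc | exact: Bc_Zc |] => n0; subst n.
    by move/triv_B0: hf => ->; move/triv_B0: hg => ->.
move=> m n f g f' g' [h1 h2 h3] [h1' h2' h3']; split; try exact: Zc_cup.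
case: m n h3 h3' {h1 h2 h1' h2'} => [|m] [|n] // h3 h3' _.
by rewrite /= /cupf /= h3 // h3' // !addr0.
Qed.

(** * Central series with cyclic factors *)

Inductive cser (p : nat) : nat -> finGroupType -> Prop :=
| cser0 (G : finGroupType) : (forall x : G, x = 1%g) -> cser p 0 G
| cserS r (C G Q : finGroupType) (io : C -> G) (pr : G -> Q) (z : C) :
    cext p io pr z -> cser p r Q -> cser p r.+1 G.

Record extn p r := Extn {
  eC : finGroupType; eG : finGroupType; eQ : finGroupType;
  eio : eC -> eG; epr : eG -> eQ; ez : eC;
  ecx : cext p eio epr ez; eser : cser p r eQ
}.

Lemma cser_extn p r G : cser p r.+1 G -> exists y : extn p r, eG y = G.
Proof.
move=> h; inversion h as [|r' C G' Q io pr z cx hQ e1 e2]; subst.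
by exists (Extn cx hQ).
Qed.

Theorem cser_finite (k : finFieldType) p (pk : p \in [pchar k]) r :
  fincol (cser p r) (fun G H => aiso (Hring k G) (Hring k H)) /\
  forall G, cser p r G -> noeth (reg (Hring k G)).
Proof.
elim: r => [|r [IH1 IH2]].
  have h G : cser p 0 G -> forall x : G, x = 1%g.
    by move=> h; inversion h.
  split; first by apply: fincol_triv => G H /h hG /h hH; exact: triv_aiso.
  by move=> G /h; exact: triv_noeth.
(* Choosing x0 fixes R as its H^*(Q); an isomorphism of quotient rings turns any other extension of
   the class into an [obj] over the same R. *)
have tie (x0 y : extn p r) : aiso (Hring k (eQ x0)) (Hring k (eQ y)) ->
    exists o : obj k p (Hring k (eQ x0)), oG o = eG y.
  by move=> /theta_ex [th hth]; exists (Obj (ecx y) hth).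
split; last first.
  move=> G /cser_extn [y <-]; have [o <-] := tie y y (aiso_refl _).
  by apply: obj_noeth => //; exact: IH2 (eser y).
have h1 : fincol (fun=> True) (fun y z : extn p r => aiso (Hring k (eQ y)) (Hring k (eQ z))).
  apply: (fincol_pull (tie := fun y Q => eQ y = Q) IH1).
    by move=> y _; exists (eQ y) => //; exact: eser.
  by move=> y z Q Q' _ _ <- <-.
have h2 : fincol (fun=> True) (fun y z : extn p r => aiso (Hring k (eG y)) (Hring k (eG z))).
  apply: (fincol_refine h1) => x0 _.
  apply: (fincol_pull (tie := fun y (o : obj k p (Hring k (eQ x0))) => oG o = eG y)
     (obj_fincol pk (IH2 _ (eser x0)))).
    by move=> y [_ /tie [o ho]]; exists o.
  by move=> y z o o' _ _ <- <-.
apply: (fincol_pull (tie := fun G (y : extn p r) => eG y = G) h2).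
  by move=> G /cser_extn [y hy]; exists y.
by move=> G H y z _ _ <- <-.
Qed.

Section GroupTheory.
Local Open Scope group_scope.

Section HomGen.
Variables (G H : finGroupType) (f : G -> H).
Hypothesis fM : forall x y, f (x * y) = f x * f y.

Lemma hom1 : f 1 = 1.
Proof. by apply: (mulgI (f 1)); rewrite -fM !mulg1. Qed.

Lemma homX x n : f (x ^+ n) = f x ^+ n.
Proof. by elim: n => [|n IH]; rewrite ?hom1 // !expgS fM IH. Qed.

Lemma homV x : f x^-1 = (f x)^-1.
Proof. by apply: (mulgI (f x)); rewrite -fM !mulgV hom1. Qed.

Lemma hom_gen (S : {set G}) (K : {group H}) g :
  (forall x, x \in S -> f x \in K) -> g \in <<S>> -> f g \in K.
Proof.
move=> hS; have gK : group_set [set x | f x \in K].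
  apply/group_setP; split; first by rewrite inE hom1 group1.
  by move=> x y; rewrite !inE fM; exact: groupM.
suff : <<S>> \subset Group gK by move/subsetP=> h /h; rewrite inE.
by rewrite gen_subG; apply/subsetP => x /hS; rewrite inE.
Qed.
End HomGen.

Lemma gen_cons1 (G : finGroupType) (s : seq G) : <<[set x in 1 :: s]>> = <<[set x in s]>>.
Proof.
apply/eqP; rewrite eqEsubset !gen_subG; apply/andP; split; apply/subsetP => x.
  by rewrite inE in_cons => /orP[/eqP->|h]; [exact: group1 | apply: mem_gen; rewrite inE].
by rewrite inE => h; apply: mem_gen; rewrite inE in_cons h orbT.
Qed.

Lemma dvd_order (G : finGroupType) p M (x : G) : prime p -> x ^+ (p ^ M) = 1 -> x != 1 -> (p %| #[x])%N.
Proof.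
move=> pp /eqP; rewrite -order_dvdn => /(dvdn_pfactor _ _ pp) [m _ e] x1.
case: m e => [|m] e; last by rewrite e expnS dvdn_mulr.
by move/eqP: e; rewrite expn0 order_eq1 (negbTE x1).
Qed.

Section CyclicExt.
Variables (p M : nat) (G : finGroupType) (x : G).
Hypotheses (pp : prime p) (xp : x ^+ (p ^ M) = 1) (x1 : x != 1).
Hypothesis xc : forall g, x * g = g * x.

Lemma cycle_cen c g : c \in <[x]> -> c * g = g * c.
Proof. by case/cycleP => i ->; apply: commute_sym; apply: commuteX; apply: commute_sym; exact: xc. Qed.

Lemma cycle_normal g : g \in 'N(<[x]>).
Proof.
rewrite inE; apply/subsetP => y /imsetP [c hc ->]; rewrite conjgE (cycle_cen g hc).
by rewrite mulKg.
Qed.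

Lemma cext_cycle : cext p (@sgval G <[x]>%G) (coset <[x]>) (subg <[x]>%G x).
Proof.
split.
- by [].
- exact: val_inj.
- by move=> a b; apply: coset_morphM; exact: cycle_normal.
- by move=> y; have [g _ ->] := cosetP y; exists g.
- by move=> c; apply: coset_id; exact: subgP.
- move=> g /(coset_idr (cycle_normal g)) hg; exists (subg _ g); exact: subgK.
- by move=> c g; apply: cycle_cen; exact: subgP.
- move=> c; have /cycleP [i hi] := subgP c.
  apply/cycleP; exists i; apply: val_inj.
  have := homX (f := @sgval G <[x]>%G) (fun _ _ => erefl) (subg <[x]>%G x) i.
  by rewrite /= subgK ?cycle_id // => ->.
- have hx : sgval (subg <[x]>%G x) = x by rewrite subgK // cycle_id.
  apply: (dvd_order (M := M)) => //.
    apply: val_inj; have := homX (f := @sgval G <[x]>%G) (fun _ _ => erefl) (subg <[x]>%G x) (p ^ M).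
    by rewrite /= hx xp.
  by apply: contra x1 => /eqP e; rewrite -hx e.
Qed.
End CyclicExt.

Lemma cser_iso p r (G H : finGroupType) (f : G -> H) : (forall x y, f (x * y) = f x * f y) ->
  (forall y, exists x, f x = y) -> (forall x, f x = 1 -> x = 1) -> cser p r H -> cser p r G.
Proof.
move=> fM fs fi hH; have f_inj : injective f.
  move=> x y e; apply: (mulIg y^-1); rewrite mulgV; apply: fi.
  by rewrite fM (homV fM) e mulgV.
have [g fg] : exists g : H -> G, forall y, f (g y) = y.
  have h y : exists x, f x == y by have [x <-] := fs y; exists x.
  by exists (fun y => xchoose (h y)) => y; apply/eqP/(xchooseP (h y)).
inversion hH as [H' h1|r' C H' Q io pr z cx hQ e1 e2]; subst.
  by apply: cser0 => x; apply: fi; exact: h1.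
apply: (@cserS p r' C G Q (g \o io) (pr \o f) z) hQ; split.
- by move=> a b /=; apply: f_inj; rewrite fM !fg (ce_ioM cx).
- by move=> a b /= e; apply: (ce_inj cx); have := congr1 f e; rewrite !fg.
- by move=> a b /=; rewrite fM (ce_prM cx).
- by move=> y; have [x hx] := ce_surj cx y; exists (g x); rewrite /= fg.
- by move=> c; rewrite /= fg (ce_io cx).
- by move=> x /= /(ce_ker cx) [c hc]; exists c; apply: f_inj; rewrite fg.
- by move=> c x /=; apply: f_inj; rewrite !fM fg (ce_cen cx).
- exact: (ce_gen cx).
- exact: (ce_pC cx).
Qed.

(** The central generators in [s] are divided out one at a time, each nontrivial one giving a cyclic
    central step; trivial ones are skipped, hence an inequality for the length. *)
Lemma cser_central_ext p M r (H : finGroupType) : prime p -> cser p r H ->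
  forall m (G : finGroupType) (f : G -> H) (s : seq G), size s = m ->
  (forall x y, f (x * y) = f x * f y) -> (forall y, exists x, f x = y) ->
  (forall x g, x \in s -> x * g = g * x) -> (forall g, f g = 1 <-> g \in <<[set x in s]>>) ->
  (forall x : G, x ^+ (p ^ M) = 1) -> exists2 r', (r' <= r + m)%N & cser p r' G.
Proof.
move=> pp hH; elim=> [|m IH] G f [|x s] //= => [_ fM fs _ fk _|[sz] fM fs sc fk pM].
  exists r; rewrite ?addn0 //; apply: cser_iso fM fs _ hH => x /fk.
  by rewrite (_ : [set x in [::]] = set0) ?gen0 => [/set1P|] //; apply/setP => y; rewrite !inE.
case: (eqVneq x 1) => [x1|x1].
  have [|g|r' hr' h] := IH G f s sz fM fs _ _ pM.
  - by move=> y g hy; apply: sc; rewrite in_cons hy orbT.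
  - by rewrite fk x1 gen_cons1.
  by exists r' => //; rewrite addnS ltnW // ltnS.
have xc g : x * g = g * x by apply: sc; rewrite mem_head.
have fx c : c \in <[x]> -> f c = 1.
  move=> hc; apply/fk; apply: subsetP hc; rewrite cycle_subG; apply: mem_gen.
  by rewrite inE mem_head.
pose f' (y : coset_of <[x]>) := f (repr y).
have f'E g : f' (coset <[x]> g) = f g.
  rewrite /f'; have := mem_repr_coset (coset <[x]> g).
  rewrite val_coset ?cycle_normal // => /rcosetP [c hc ->].
  by rewrite fM fx // mul1g.
have cM a b : coset <[x]> (a * b) = coset <[x]> a * coset <[x]> b.
  by apply: coset_morphM; exact: cycle_normal.
have f'M a b : f' (a * b) = f' a * f' b.
  have [a' _ ->] := cosetP a; have [b' _ ->] := cosetP b.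
  by rewrite -cM !f'E fM.
have [|||||r' hr' h] := IH (coset_of <[x]>) f' (map (coset <[x]>) s) _ f'M.
- by rewrite size_map.
- by move=> y; have [g <-] := fs y; exists (coset <[x]> g); rewrite f'E.
- move=> y g /mapP [a ha ->]; have [b _ ->] := cosetP g; rewrite -!cM; congr coset.
  by apply: sc; rewrite in_cons ha orbT.
- move=> y; split.
    have [g _ ->] := cosetP y; rewrite f'E => /fk.
    apply: (hom_gen (K := <<[set x0 in map (coset <[x]>) s]>>%G) cM) => a; rewrite inE in_cons.
    case/orP => [/eqP->|ha]; first by rewrite coset_id ?cycle_id ?group1.
    by apply: mem_gen; rewrite inE; apply: map_f.
  move=> hy; have := hom_gen (K := 1%G) f'M _ hy; rewrite inE => h; apply/eqP/h.
  move=> a; rewrite 2!inE => /mapP [b hb ->]; rewrite f'E; apply/eqP/fk; apply: mem_gen.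
  by rewrite inE in_cons hb orbT.
- by move=> y; have [g _ ->] := cosetP y; rewrite -(homX cM) pM (hom1 cM).
exists r'.+1; first by rewrite addnS ltnS.
exact: (cserS (cext_cycle (M := M) pp (pM x) x1 xc) h).
Qed.

Section LowerCentral.
Variables (gT : finGroupType) (s : seq gT).
Hypothesis sG : <<[set x in s]>> = [set: gT].
Local Notation G := [set: gT].

Fixpoint lncomm n : seq gT := if n is n'.+1 then [seq [~ w, g] | w <- lncomm n', g <- s] else s.

Lemma size_lncomm n : size (lncomm n) = (size s ^ n.+1)%N.
Proof. by elim: n => [|n IH]; rewrite ?expn1 //= size_allpairs IH -expnSr. Qed.

Lemma lncomm_lcn n w : w \in lncomm n -> w \in 'L_n.+1(G).
Proof.
elim: n w => [|n IH] w; first by rewrite lcn1 inE.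
move=> /= /allpairsP [[a b] /= [ha hb ->]]; rewrite lcnSn; apply: mem_commg; [exact: IH | exact: in_setT].
Qed.

(** Modulo the next term of the lower central series commutators are multiplicative in each
    argument: [h1] extends from generators in the first argument, [h2] in the second. *)
Lemma lcn_gen n : 'L_n.+1(G) \subset <<[set x in lncomm n] :|: 'L_n.+2(G)>>.
Proof.
elim: n => [|n IH].
  rewrite lcn1; apply/subsetP => y _; have : y \in <<[set x in s]>> by rewrite sG inE.
  by apply: subsetP; apply: genS; exact: subsetUl.
set K := <<_>>.
have LK y : y \in 'L_n.+3(G) -> y \in K by move=> h; apply: mem_gen; rewrite inE h orbT.
have comm3 y g : y \in 'L_n.+2(G) -> [~ y, g] \in K.
  by move=> h; apply: LK; rewrite lcnSn mem_commg // inE.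
have comm2 x g : x \in 'L_n.+1(G) -> [~ x, g] \in 'L_n.+2(G).
  by move=> h; rewrite lcnSn mem_commg // inE.
have conjK x g h : x \in 'L_n.+1(G) -> [~ x, g] \in K -> [~ x, g] ^ h \in K.
  move=> hx hK; rewrite conjg_mulR; apply: groupM => //; apply: comm3; exact: comm2.
have h1 x g : x \in 'L_n.+1(G) -> g \in s -> [~ x, g] \in K.
  move=> hx hg.
  have gA : group_set [set y in 'L_n.+1(G) | [~ y, g] \in K].
    apply/group_setP; split; first by rewrite inE group1 comm1g group1.
    move=> y y'; rewrite !inE => /andP[hy hK] /andP[hy' hK']; rewrite groupM //=.
    by rewrite commMgJ groupM // conjK.
  have : <<[set x in lncomm n] :|: 'L_n.+2(G)>> \subset Group gA.
    rewrite gen_subG; apply/subsetP => y; rewrite !inE => /orP[hy|hy].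
      rewrite lncomm_lcn //=; apply: mem_gen; rewrite !inE; apply/orP; left.
      by apply/allpairsP; exists (y, g).
    by rewrite (subsetP (lcn_subS _ _)) //= comm3.
  by move/subsetP => h; have := h _ (subsetP IH _ hx); rewrite inE => /andP [].
have h2 x g : x \in 'L_n.+1(G) -> [~ x, g] \in K.
  move=> hx; have gA : group_set [set y | [~ x, y] \in K].
    apply/group_setP; split; first by rewrite inE commg1 group1.
    move=> y y'; rewrite !inE => hK hK'.
    by rewrite commgMJ groupM // conjK.
  have : <<[set x in s]>> \subset Group gA.
    by rewrite gen_subG; apply/subsetP => y; rewrite !inE => hy; exact: h1.
  by rewrite sG => /subsetP /(_ g (in_setT g)); rewrite inE.
rewrite lcnSn gen_subG; apply/subsetP => y /imset2P [x g hx _ ->]; exact: h2.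
Qed.

Variables (p M : nat).
Hypotheses (pp : prime p) (pM : forall x : gT, x ^+ (p ^ M) = 1).

(** The value is d + d^2 + ... + d^n, the i-th summand bounding the number of left-normed
    commutators of length i. *)
Fixpoint cbound d n : nat := if n is n'.+1 then (cbound d n' + d ^ n)%N else 0.

(** H is any model of the quotient by a term of the lower central series, presented by a surjection,
    which avoids iterated coset types. It is a central extension of the previous quotient by the
    images of [lncomm n]. *)
Lemma cser_lcn d n : (size s <= d)%N -> forall (H : finGroupType) (f : gT -> H),
  (forall x y, f (x * y) = f x * f y) -> (forall y, exists x, f x = y) ->
  (forall g, f g = 1 <-> g \in 'L_n.+1(G)) -> exists2 r, (r <= cbound d n)%N & cser p r H.
Proof.
move=> sd; elim: n => [|n IH] H f fM fs fk.
  exists 0%N => //; apply: cser0 => y; have [x <-] := fs y; apply/fk.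
  by rewrite lcn1 inE.
pose L := 'L_n.+1(G)%G.
have Ln g : g \in 'N(L) by apply: subsetP (lcn_norm n.+1 [group of G]) _ (in_setT g).
have cM a b : coset L (a * b) = coset L a * coset L b by apply: coset_morphM; exact: Ln.
have [||r hr hK] := IH (coset_of L) (coset L) cM.
- by move=> y; have [g _ ->] := cosetP y; exists g.
- by move=> g; split=> [/(coset_idr (Ln g))|]; [|exact: coset_id].
have hf y : exists x, f x == y by have [x <-] := fs y; exists x.
pose g y := xchoose (hf y).
have fg y : f (g y) = y by apply/eqP/(xchooseP (hf y)).
pose u y := coset L (g y).
have f_eq a b : f a = f b -> a * b^-1 \in 'L_n.+2(G).
  by move=> e; apply/fk; rewrite fM (homV fM) e mulgV.
have uE a : u (f a) = coset L a.
  have h := f_eq (g (f a)) a (fg _).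
  rewrite /u -[g (f a)](mulgKV a) cM coset_id ?mul1g //.
  exact: subsetP (lcn_subS n.+1 [group of G]) _ h.
have uM a b : u (a * b) = u a * u b.
  by have [[a' <-] [b' <-]] := (fs a, fs b); rewrite -fM !uE cM.
have [||||r' hr' h] := cser_central_ext (M := M) pp hK (erefl (size (map f (lncomm n)))) uM.
- by move=> y; have [a _ ->] := cosetP y; exists (f a).
- move=> y b /mapP [w hw ->]; have [b' <-] := fs b.
  apply/commgP; have e : f [~ w, b'] = [~ f w, f b'] by rewrite !commgEl conjgE !fM !(homV fM).
  rewrite -e; apply/eqP/fk; rewrite lcnSn mem_commg ?inE //; exact: lncomm_lcn.
- move=> y; have [a <-] := fs y; split.
    rewrite uE => /(coset_idr (Ln a)) /(subsetP (lcn_gen n)).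
    apply: (hom_gen (K := <<[set x in map f (lncomm n)]>>%G) fM) => w; rewrite !inE => /orP[hw|hw].
      by apply: mem_gen; rewrite inE; exact: map_f.
    by rewrite (_ : f w = 1) ?group1 //; apply/fk.
  move=> hy; have := hom_gen (K := 1%G) uM _ hy; rewrite inE => h; apply/eqP/h.
  move=> b; rewrite 2!inE => /mapP [w hw ->]; rewrite uE; apply/eqP; apply: coset_id.
  exact: lncomm_lcn.
- by move=> y; have [a <-] := fs y; rewrite -(homX fM) pM (hom1 fM).
exists r' => //; apply: leq_trans hr' _; rewrite size_map size_lncomm /=.
by apply: leq_add => //; rewrite leq_exp2r.
Qed.
End LowerCentral.
End GroupTheory.

(** * Comparison with inhomogeneous cochains *)

Section SumFormulas.
Variables (k : comNzRingType) (T : Type).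

Lemma bd_sum (s : seq T) (f : seq T -> k) :
  bd s f = \sum_(i < size s) (-1) ^+ i * f (take i s ++ drop i.+1 s).
Proof.
elim: s f => [|a s IH] f /=; first by rewrite big_ord0.
rewrite big_ord_recl /= mul1r drop0 IH -sumrN; congr (_ + _).
by apply: eq_bigr => i _; rewrite /= /bump leq0n add1n exprS mulN1r mulNr.
Qed.

Lemma cut_bigsum (s : seq T) (F : seq T -> seq T -> k) :
  cut s F = \sum_(i < size s) F (take i.+1 s) (drop i s).
Proof.
elim: s F => [|a s IH] F /=; first by rewrite big_ord0.
by rewrite big_ord_recl /= take0 IH.
Qed.
End SumFormulas.

Section Homogeneous.
Variables (p : nat) (gT : finGroupType).
Local Notation k := 'F_p.

Definition inhom n (s : seq gT) : {ffun 'I_n -> gT} :=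
  [ffun i : 'I_n => ((nth 1 s i)^-1 * nth 1 s i.+1)%g].

Definition toH n (f : cochain p gT n) : seq gT -> k :=
  fun s => if size s == n.+1 then f (inhom n s) else 0.

Definition xget n (x : {ffun 'I_n -> gT}) j : gT := if insub j is Some i then x i else 1%g.

(** Partial products: the homogeneous simplex starting at 1 whose successive quotients are given, an
    inverse of [inhom] up to translation. *)
Definition hs n (x : {ffun 'I_n -> gT}) : seq gT :=
  mkseq (fun i => \prod_(0 <= j < i) xget x j)%g n.+1.

Lemma nth_hs n (x : {ffun 'I_n -> gT}) i : (i <= n)%N ->
  nth 1%g (hs x) i = (\prod_(0 <= j < i) xget x j)%g.
Proof. by move=> hi; rewrite nth_mkseq. Qed.

Lemma inhom_hs n (x : {ffun 'I_n -> gT}) : inhom n (hs x) = x.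
Proof.
apply/ffunP => i; have hi := ltn_ord i.
rewrite ffunE (nth_hs x (ltnW hi)) (nth_hs x hi) big_nat_recr //= mulKg.
by rewrite /xget insubT /=; congr (x _); apply: val_inj.
Qed.

Lemma hs_inhom n (s : seq gT) : size s = n.+1 -> hs (inhom n s) = map (mulg (nth 1 s 0)^-1%g) s.
Proof.
move=> sn; apply: (@eq_from_nth _ 1%g); first by rewrite size_mkseq size_map.
move=> i; rewrite size_mkseq ltnS => hi; rewrite nth_hs // (nth_map 1%g) ?sn //.
elim: i hi => [|i IH] hi; first by rewrite big_geq // mulVg.
rewrite big_nat_recr //= IH ?(ltnW hi) // /xget insubT /= ffunE /=.
by rewrite -mulgA mulKVg.
Qed.

Lemma coch_toH n f : coch n.+1 (@toH n f).
Proof.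
split; first split.
- by [].
- by move=> s /negbTE h; rewrite /toH h.
- move=> a s; rewrite /toH size_map; case: eqP => // sn; congr (f _).
  apply/ffunP => i; rewrite !ffunE !(nth_map 1%g) ?sn ?ltnS //; last by rewrite ltnW // ltnS.
  by rewrite invMg -mulgA mulKg.
Qed.

Lemma toH_surj n (f : seq gT -> k) : coch n.+1 f -> exists g : cochain p gT n, toH g = f.
Proof.
move=> [[f0 fn] fi]; exists [ffun x => f (hs x)]; apply: funext => s; rewrite /toH.
case: eqP => [sn|/eqP/fn //]; by rewrite ffunE hs_inhom.
Qed.

Lemma toH_inj n (f g : cochain p gT n) : toH f = toH g -> f = g.
Proof.
move=> e; apply/ffunP => x; have := congr1 (fun h => h (hs x)) e.
by rewrite /toH size_mkseq eqxx inhom_hs.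
Qed.

Lemma toHB n (f g : cochain p gT n) : toH (f - g) = toH f - toH g.
Proof.
by apply: funext => s; rewrite !funE /toH; case: eqP => _; rewrite ?subr0 // !ffunE.
Qed.
Lemma toH0 n : toH (0 : cochain p gT n) = 0.
Proof. by apply: funext => s; rewrite /toH ffunE if_same. Qed.
Lemma toHN n (f : cochain p gT n) : toH (- f) = - toH f.
Proof. by rewrite -sub0r toHB toH0 sub0r. Qed.
Lemma toHD n (f g : cochain p gT n) : toH (f + g) = toH f + toH g.
Proof. by rewrite -[g]opprK toHB toHN !opprK. Qed.

Lemma nth_del (s : seq gT) i j : (i < size s)%N ->
  nth 1%g (take i s ++ drop i.+1 s) j = if (j < i)%N then nth 1%g s j else nth 1%g s j.+1.
Proof.
move=> hi; rewrite nth_cat size_take hi; case: ltnP => h; first by rewrite nth_take.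
by rewrite nth_drop addSn subnKC.
Qed.

Lemma tget_inhom n (s : seq gT) j : (j <= n)%N ->
  tget (inhom n.+1 s) j = ((nth 1 s j)^-1 * nth 1 s j.+1)%g.
Proof. by move=> hj; rewrite /tget ltnS hj ffunE inordK. Qed.

(** Deleting the first, an inner or the last vertex corresponds to the first face, a merging of two
    entries or the last face. *)
Lemma toH_cob n (f : cochain p gT n) : toH (cobound f) = cob (toH f).
Proof.
apply: funext => s; have [_ h] := szd_cob (proj1 (coch_toH f)).
rewrite {1}/toH; case: eqP => [sn|/eqP/h -> //].
rewrite /cob bd_sum sn big_ord_recl big_ord_recr /= ffunE -addrA.
have szd i : (i < n.+2)%N -> size (take i s ++ drop i.+1 s) = n.+1.
  by move=> hi; rewrite size_cat size_take size_drop sn hi; lia.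
have toHd i : (i < n.+2)%N -> toH f (take i s ++ drop i.+1 s) = f (inhom n (take i s ++ drop i.+1 s)).
  by move=> hi; rewrite /toH szd // eqxx.
congr (_ + (_ + _)).
- rewrite mul1r toHd //; congr (f _); apply/ffunP => j.
  by rewrite !ffunE (tget_inhom s (ltn_ord j)) !nth_del ?sn.
- apply: eq_bigr => i _; rewrite /= /bump leq0n add1n toHd; last by rewrite ltnS ltnW // ltnS.
  congr (_ * f _); apply/ffunP => j.
  have [hi hj] := (ltn_ord i, ltn_ord j).
  rewrite !ffunE !nth_del ?sn; try by rewrite ltnS ltnW // ltnS.
  case: (ltngtP j i) => hji.
  + by rewrite tget_inhom ?(ltnW hj) // !ltnS (ltnW hji) hji.
  + have e1 : (j < i.+1)%N = false by rewrite ltnS leqNgt hji.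
    have e2 : (j.+1 < i.+1)%N = false by rewrite ltnS ltnNge (ltnW hji).
    by rewrite (tget_inhom s hj) e1 e2.
  + have e1 : (i < i.+1)%N by [].
    have e2 : (i.+1 < i.+1)%N = false by rewrite ltnn.
    by rewrite (tget_inhom s (ltnW hi)) (tget_inhom s hi) hji e1 e2 -mulgA mulKVg.
- rewrite /bump leq0n add1n toHd //; congr (_ * f _); apply/ffunP => j.
  have hj := ltn_ord j.
  by rewrite !ffunE !nth_del ?sn // (tget_inhom s (ltnW hj)) !ltnS (ltnW hj) hj.
Qed.

Lemma toH_cup m n (f : cochain p gT m) (g : cochain p gT n) :
  toH (cup f g) = cupf (toH f) (toH g).
Proof.
apply: funext => s; have [_ h] := szd_cup (proj1 (coch_toH f)) (proj1 (coch_toH g)).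
rewrite {1}/toH; case: eqP => [sn|/eqP/h -> //].
have hm : (m < size s)%N by rewrite sn ltnS leq_addr.
rewrite /cupf cut_bigsum (bigD1 (Ordinal hm)) //= big1 ?addr0 => [|i ne]; last first.
  rewrite {1}/toH size_take_min (_ : (minn i.+1 (size s) == m.+1) = false) ?mul0r //.
  by apply/negbTE; apply: contra ne => /eqP e; apply/eqP/val_inj => /=; move: (ltn_ord i) e; lia.
rewrite ffunE /toH size_takel ?sn ?ltnS ?leq_addr // eqxx size_drop sn subSn ?leq_addr // addKn eqxx.
congr (f _ * g _); apply/ffunP => j; rewrite !ffunE /=.
  by rewrite !nth_take // ?ltnS // ltnW // ltnS.
by rewrite !nth_drop addnS.
Qed.

Lemma cocycleP n (f : cochain p gT n) : is_cocycle f <-> Zc n (toH f).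
Proof.
split=> [h|[_ h]]; first by split; [exact: coch_toH | rewrite -toH_cob h toH0].
by apply: toH_inj; rewrite toH_cob h toH0.
Qed.

Lemma coboundaryP n (f : cochain p gT n) : is_coboundary f <-> Bc n (toH f).
Proof.
case: n f => [|n] f /=.
  split=> [->|[g /coch_size0 -> e]]; first by rewrite toH0; exact: Bc0.
  by apply: toH_inj; rewrite e cob0 toH0.
split=> [[g ->]|[h /toH_surj [g <-] e]].
  by exists (toH g); [exact: coch_toH | rewrite toH_cob].
by exists g; apply: toH_inj; rewrite e toH_cob.
Qed.

Lemma cobound_linear n : linear (@cobound p gT n).
Proof.
move=> a f g; apply: toH_inj.
have toHZ m (c : 'F_p) (h : cochain p gT m) : toH (c *: h) = (fun s => c * toH h s).
  by apply: funext => s; rewrite /toH; case: eqP => _; rewrite ?mulr0 // ffunE.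
rewrite toHD !toHZ !toH_cob toHD cobD toHZ; congr (_ + _).
by apply: funext => s; rewrite /cob bdZ.
Qed.
End Homogeneous.

(** Linear maps are obtained from the relation by choosing images of a basis of the cocycles and
    composing with the projection onto them; the classes of the values on cocycles are then dictated
    by the relation. *)
Lemma aiso_cohom (p : nat) (gT hT : finGroupType) : prime p ->
  aiso (Hring 'F_p gT) (Hring 'F_p hT) -> cohom_iso p gT hT.
Proof.
move=> pp [rho gr mr].
have lin n : exists phi : {linear cochain p gT n -> cochain p hT n},
    forall f, is_cocycle f -> rho n (toH f) (toH (phi f)).
  pose cb : {linear cochain p gT n -> cochain p gT n.+1} :=
    HB.pack (@cobound p gT n) (GRing.isLinear.Build _ _ _ _ _ (@cobound_linear p gT n)).
  pose Z := lker (linfun cb).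
  have ZP f : reflect (is_cocycle f) (f \in Z).
    by rewrite memv_ker lfunE /=; exact: eqP.
  have ex (b : cochain p gT n) : exists h : cochain p hT n, b \in Z -> rho n (toH b) (toH h).
    case: (boolP (b \in Z)) => [/ZP/cocycleP hb|_]; last by exists 0.
    have [h hh] := gi_tot gr (x := toH b) hb.
    have [_ [hc _]] := gi_Z gr hh.
    by have [g eg] := toH_surj hc; exists g => _; rewrite eg.
  pose hb b := sval (cid (ex b)).
  have hbP b : b \in Z -> rho n (toH b) (toH (hb b)) := svalP (cid (ex b)).
  pose F v : cochain p hT n := \sum_(i < \dim Z) coord (vbasis Z) i (projv Z v) *: hb (vbasis Z)`_i.
  have Fl : linear F.
    move=> a u v; rewrite /F scaler_sumr -big_split /=; apply: eq_bigr => i _.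
    by rewrite !linearP /= scalerDl scalerA.
  pose FL : {linear cochain p gT n -> cochain p hT n} :=
    HB.pack F (GRing.isLinear.Build _ _ _ _ _ Fl).
  exists FL => f /ZP hf /=.
  rewrite /F (projv_id hf) {1}(coord_vbasis hf).
  have radd m (u u' : cochain p gT m) (v v' : cochain p hT m) : rho m (toH u) (toH v) -> rho m (toH u') (toH v') ->
      rho m (toH (u + u')) (toH (v + v')).
    by move=> h h'; rewrite !toHD; exact: (gi_add gr).
  have r0 m : rho m (toH (0 : cochain p gT m)) (toH (0 : cochain p hT m)).
    by rewrite !toH0; exact: (gi_0 gr).
  have rsc m (c : 'F_p) (u : cochain p gT m) (v : cochain p hT m) : rho m (toH u) (toH v) -> rho m (toH (c *: u)) (toH (c *: v)).
    (* Scalars of F_p are multiples of 1, so an additive relation is compatible with scaling. *)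
    move=> h; rewrite -[c]natr_Zp !scaler_nat; elim: (nat_of_ord c) => [|j IH].
      rewrite !mulr0n; exact (r0 m).
    by rewrite !mulrS; exact: radd.
  elim/big_ind2: _ => [|u v u' v'|i _]; [exact: r0 | exact: radd |].
  apply: rsc; apply: hbP; apply: vbasis_mem; by apply: mem_nth; rewrite size_tuple.
pose phi n := sval (cid (lin n)).
have phiP n f : is_cocycle f -> rho n (toH f) (toH (phi n f)) := svalP (cid (lin n)) f.
have bc n f : @is_coboundary p gT n f -> is_cocycle f.
  by move=> /coboundaryP/Bc_Zc/cocycleP.
exists phi; split; [|split; [|split; [|split]]].
- by move=> n f /phiP /(gi_Z gr) [_ /cocycleP].
- move=> n f h; apply/coboundaryP; apply/(gi_B gr (phiP _ _ (bc _ _ h))).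
  by move/coboundaryP: h.
- move=> n f hf /coboundaryP h; apply/coboundaryP; exact/(gi_B gr (phiP _ _ hf)).
- move=> n h /cocycleP hh; have [f0 hf] := gi_sur gr (y := toH h) hh.
  have [hf0 _] := gi_Z gr hf; have [f ef] := toH_surj (proj1 hf0); subst f0.
  have hfc : is_cocycle f by apply/cocycleP.
  exists f => //; apply/coboundaryP; rewrite toHB; exact: (gi_uniq gr hf (phiP _ _ hfc)).
- move=> m n f g hf hg; apply/coboundaryP; rewrite toHB toH_cup.
  have hc : is_cocycle (cup f g).
    by apply/cocycleP; rewrite toH_cup; apply: Zc_cup; exact/cocycleP.
  have := phiP _ _ hc; rewrite toH_cup => h.
  exact: (gi_uniq gr h (mr _ _ _ _ _ _ (phiP _ _ hf) (phiP _ _ hg))).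
Qed.

(** Class smaller than p makes the p-th term of the lower central series trivial, so [cser_lcn]
    applies to the identity map with n = p - 1. *)
Lemma class_cser p d (gT : finGroupType) : prime p ->
  d_generated d gT -> (p.-group [set: gT])%g -> (nil_class [set: gT] < p)%N ->
  exists2 r, (r <= cbound d p.-1)%N & cser p r gT.
Proof.
move=> pp [X [Xd Xg]] pG cG.
have sG : <<[set x in enum X]>>%g = [set: gT].
  by rewrite -Xg; congr (<<_>>%g); apply/setP => x; rewrite inE mem_enum.
have [M eM] : exists M, #|[set: gT]| = (p ^ M)%N by have [M ->] := p_natP pG; exists M.
have pM (x : gT) : (x ^+ (p ^ M) = 1)%g by rewrite -eM; apply: expg_cardG; rewrite inE.
apply: (@cser_lcn _ _ sG _ _ pp pM d p.-1 _ gT id).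
- by rewrite -cardE.
- by [].
- by move=> y; exists y.
move=> g; have -> : ('L_p.-1.+1([set: gT]) = 1)%g.
  by apply/(lcn_nil_classP p.-1 (pgroup_nil pG)); rewrite -ltnS prednK // prime_gt0.
by split=> [->|/set1P //]; exact: set11.
Qed.

(* At most N(p,d) isomorphism classes: among any N+1 such groups, two have
   isomorphic mod p cohomology algebras. *)
Theorem mainTheorem1 (p d : nat) (hp : prime p) :
  exists N : nat,
    forall gT : 'I_N.+1 -> finGroupType,
      (forall i, d_generated d (gT i) /\ (p.-group [set: gT i])%g /\
                 (nil_class [set: gT i] < p)%N) ->
      exists i j : 'I_N.+1, i != j /\ cohom_iso p (gT i) (gT j).
Proof.
have pk : p \in [pchar 'F_p] by exact: pchar_Fp.
pose B := cbound d p.-1.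
have [F [c hc]] : fincol (fun G : finGroupType => exists r : 'I_B.+1, cser p r G)
    (fun G H => aiso (Hring 'F_p G) (Hring 'F_p H)).
  (* A group may have series of several lengths; one is chosen so that the length can serve as a
     colour. *)
  have h (G : finGroupType) : exists r : 'I_B.+1, (exists r' : 'I_B.+1, cser p r' G) -> cser p r G.
    case: (pselect (exists r' : 'I_B.+1, cser p r' G)) => [[r' h]|ne]; first by exists r'.
    by exists ord0.
  apply: (fincol_sigma (c := fun G => sval (cid (h G)))) => r.
  apply: fincol_sub (proj1 (cser_finite pk r)) => // G [hG <-].
  exact: (svalP (cid (h G))) hG.
(* Pigeonhole: two of the #|F| + 1 groups share a colour. *)
exists #|F| => gT hgT.
have hP i : exists r : 'I_B.+1, cser p r (gT i).
  have [h1 [h2 h3]] := hgT i; have [r hr h] := class_cser hp h1 h2 h3.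
  by exists (Ordinal (hr : (r < B.+1)%N)).
have [ij|/existsPn ninj] := boolP [exists ij : 'I_#|F|.+1 * 'I_#|F|.+1, (ij.1 != ij.2) && (c (gT ij.1) == c (gT ij.2))].
  have /existsP [[i j] /= /andP [ne /eqP e]] := ij; exists i, j; split=> //.
  by apply: aiso_cohom => //; exact: hc.
have inj : injective (fun i => c (gT i)).
  move=> i j e; apply/eqP; apply: contraT => ne.
  by have := ninj (i, j); rewrite /= ne e eqxx.
by have := leq_card _ inj; rewrite card_ord ltnn.
Qed.
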